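(* Let $P$ be a set of $m$ points and $\mathcal{C}$ a set of $n$ circles in $\mathbb{R}^3$, such that no plane or sphere contains more than $q$ circles of $\mathcal{C}$. Then the number of incidences between $P$ and $\mathcal{C}$ satisfies $$I(P,\mathcal{C}) = O\left( m^{3/7}n^{6/7} + m^{2/3}n^{1/3}q^{1/3} + m^{6/11}n^{5/11}q^{4/11}\log^{2/11}(m^3/q) + m + n \right),$$ with an absolute constant of proportionality.
   Context: $I(P,\mathcal{C})$ denotes the number of pairs $(p,\gamma)\in P\times\mathcal{C}$ with $p\in\gamma$.
   Formalization: The factor log^{2/11}(m^3/q), undefined when m^3<q (e.g. m=1, q=2), is read as (ln max(2, m^3/q))^{2/11}, so the logarithm never drops below a positive constant; q is taken to be an integer with q ≥ 1. *)

(* Defs.v *)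
From Stdlib Require Import Reals List.
Import ListNotations.
Open Scope R_scope.

Definition R3 : Type := (R * R * R)%type.

Definition sub3 (x y : R3) : R3 :=
  let '(x1, x2, x3) := x in let '(y1, y2, y3) := y in (x1 - y1, x2 - y2, x3 - y3).

Definition dot3 (x y : R3) : R :=
  let '(x1, x2, x3) := x in let '(y1, y2, y3) := y in x1 * y1 + x2 * y2 + x3 * y3.

Record circle := mkCircle { c_center : R3; c_normal : R3; c_radius : R }.

Definition wf_circle (c : circle) : Prop :=
  0 < c_radius c /\ c_normal c <> (0, 0, 0).

Definition on_circle (c : circle) (x : R3) : Prop :=
  dot3 (sub3 x (c_center c)) (sub3 x (c_center c)) = c_radius c ^ 2 /\
  dot3 (sub3 x (c_center c)) (c_normal c) = 0.

Definition on_circle_dec (c : circle) (x : R3) : {on_circle c x} + {~ on_circle c x}.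
Proof.
  unfold on_circle.
  destruct (Req_EM_T (dot3 (sub3 x (c_center c)) (sub3 x (c_center c))) (c_radius c ^ 2));
  destruct (Req_EM_T (dot3 (sub3 x (c_center c)) (c_normal c)) 0); tauto.
Defined.

Definition in_plane (a : R3) (b : R) (x : R3) : Prop := dot3 a x = b.
Definition in_sphere (s : R3) (r : R) (x : R3) : Prop := dot3 (sub3 x s) (sub3 x s) = r ^ 2.

Definition circle_in (c : circle) (S : R3 -> Prop) : Prop :=
  forall x, on_circle c x -> S x.

Definition distinct_circles (C : list circle) : Prop :=
  ForallOrdPairs (fun c d => ~ (forall x, on_circle c x <-> on_circle d x)) C.

Definition at_most_in (q : nat) (C : list circle) (S : R3 -> Prop) : Prop :=
  forall L : list circle, NoDup L -> incl L C ->
    (forall c, In c L -> circle_in c S) -> (length L <= q)%nat.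

Definition incidences (P : list R3) (C : list circle) : nat :=
  fold_right plus 0%nat
    (map (fun p => length (filter (fun c => if on_circle_dec c p then true else false) C)) P).

(* log^{2/11}(m^3/q); the logarithm is taken of max(2, m^3/q) so that it is
   positive. *)
Definition log_term (m q : nat) : R :=
  Rpower (ln (Rmax 2 (INR m ^ 3 / INR q))) (2 / 11).

(* Main.v *)
Require Import Defs.
From Stdlib Require Reals Lra Lia Psatz List.
(* Partition the points by polynomials of total degree O(2^a).  Off the zero
   set, each circle meets O(2^a) cells, and the remaining incidences give triples
   of points in one cell; three points determine a circle.  On the zero set,
   stratify by the first member of a chain of iterated derivatives that does not
   vanish: an incidence is either charged to the degree, or the circle lies in
   {g = 0} and grad g <> 0 at the point.  In the latter case, where the tangent of
   the circle is not a principal direction of {g = 0}, the fourth-order jet of g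
   leaves at most 11 circles through the point.  A circle whose tangent is principal at
   too many points is a line of curvature, and then {g = 0} is tangent along it to
   a sphere or a plane; since distinct principal directions are orthogonal, at
   most two such surfaces pass through a point.  Each of these surfaces carries at most q
   circles and is mapped to the plane, where points and circles are counted by
   partitioning both the points and the space of circles: what remains are lenses,
   which force the neighbour lists of a circle to be cyclically reversed.

   The polynomial partition needs no topology: once the points are in
   isotropic position, a random sign vector splits a positive proportion of the
   pairs in a common cell. *)

(** For a given tangent direction at a smooth point of {g = 0}, the second-order jet fixes the
    normal part of the vector to the centre, the third order its tangential part, and the fourth
    order leaves one equation on the slope of the tangent. The third order degenerates exactly in
    principal directions, which is why lines of curvature form a class of their own. The slope
    equation has degree at most 10 and the infinite slope is treated apart: hence 11. Along a circle
    that is a line of curvature, two components of grad g keep a constant ratio (Joachimsthal), and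
    this ratio names the tangent sphere or plane. The logarithm comes from lenses: n reversed lists
    on n symbols have total size O(n^(3/2) log n), and cells of 4^h circles turn this into O(n 2^h
    h). The sizes of the surfaces are unknown, so their bounds are made linear by the
    arithmetic-geometric mean, with weights common to all surfaces, and then added. All calculus
    along circles is algebraic: rational parametrizations, formal derivatives and root counts. *)

Module IncidenceNumerics.
From Stdlib Require Import Reals Lra Lia Psatz.
Local Open Scope R_scope.

(** * Choice of the free parameters *)

Lemma pow_floor_R (b x : R) : 1 < b -> 1 <= x -> exists a : nat, b ^ a <= x < b * b ^ a.
Proof.
intros hb hx.
destruct (Pow_x_infinity b ltac:(rewrite Rabs_right; lra) (x + 1)) as [N hN].
assert (h : x < b ^ N).
{ specialize (hN N (Nat.le_refl N)). rewrite Rabs_right in hN; [lra|].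
  apply Rle_ge, pow_le; lra. }
clear hN. revert h. induction N as [|N IH]; intros h; [simpl in h; lra|].
destruct (Rlt_le_dec x (b ^ N)) as [h1|h1]; [now apply IH|].
exists N; split; [exact h1|exact h].
Qed.

Lemma exp_pow (x : R) (k : nat) : exp x ^ k = exp (INR k * x).
Proof.
induction k as [|k IH]; [simpl; now rewrite Rmult_0_l, exp_0|].
rewrite S_INR, <- tech_pow_Rmult, IH, <- exp_plus; f_equal; ring.
Qed.

Lemma exp_le (x y : R) : x <= y -> exp x <= exp y.
Proof. intros [h| ->]; [left; now apply exp_increasing|right; reflexivity]. Qed.

Lemma exp_ln2 : exp (ln 2) = 2.
Proof. apply exp_ln; lra. Qed.

Lemma two_pow (k : nat) : 2 ^ k = exp (INR k * ln 2).
Proof. now rewrite <- exp_pow, exp_ln2. Qed.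

Lemma pow_four (h : nat) : 4 ^ h = exp (2 * INR h * ln 2).
Proof. replace 4 with (2 ^ 2) by ring. rewrite <- pow_mult, two_pow, mult_INR; f_equal; simpl; ring. Qed.

Lemma pow_eight (h : nat) : 8 ^ h = exp (3 * INR h * ln 2).
Proof. replace 8 with (2 ^ 3) by ring. rewrite <- pow_mult, two_pow, mult_INR; f_equal; simpl; ring. Qed.

Lemma pow_sixtyfour (h : nat) : 64 ^ h = exp (6 * INR h * ln 2).
Proof. replace 64 with (2 ^ 6) by ring. rewrite <- pow_mult, two_pow, mult_INR; f_equal; simpl; ring. Qed.

Lemma exp_inv (x y : R) : exp x <= exp y -> x <= y.
Proof.
intros h; destruct (Rle_lt_dec x y) as [|h1]; [assumption|].
apply exp_increasing in h1; lra.
Qed.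

Section Choices.
Variables M N Q : R.
Let l := ln 2.
Let l_pos : / 2 < l. Proof. exact ln_lt_2. Qed.
Let l_exp : exp l = 2. Proof. exact exp_ln2. Qed.

(** [M], [N], [Q] stand for the logarithms of m, n, q. The two terms balance at 2^a = (m^3/n)^(1/7),
    and rounding a down costs at most a factor 2^6 in the second one. If m^3 <= n, then a = 0 works
    and n absorbs the cube. *)
Lemma cell_exponent : exists a : nat,
  exp N * 2 ^ a + exp M ^ 3 / 64 ^ a <= 65 * exp (3 / 7 * M + 6 / 7 * N) + 2 * exp N.
Proof.
assert (p1 := exp_pos (3 / 7 * M + 6 / 7 * N)).
assert (p2 := exp_pos N).
destruct (Rle_lt_dec (3 * M) N) as [h|h].
- exists 0%nat. rewrite exp_pow. simpl INR.
  assert (h1 : exp ((1 + 1 + 1) * M) <= exp N) by (apply exp_le; lra).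
  simpl; lra.
- destruct (pow_floor_R 2 (exp ((3 * M - N) / 7))) as [a [a1 a2]]; [lra| |].
  { rewrite <- exp_0; apply exp_le; lra. }
  exists a. rewrite two_pow in a1, a2.
  assert (a2' : (3 * M - N) / 7 < l + INR a * l).
  { apply exp_lt_inv. rewrite exp_plus, l_exp. exact a2. }
  apply exp_inv in a1.
  assert (e1 : exp N * 2 ^ a <= exp (3 / 7 * M + 6 / 7 * N)).
  { rewrite two_pow, <- exp_plus; apply exp_le. fold l in a1 |- *. lra. }
  assert (e2 : exp M ^ 3 / 64 ^ a <= 64 * exp (3 / 7 * M + 6 / 7 * N)).
  { replace 64 with (exp (6 * l)) at 2 by (replace (6 * l) with (INR 6 * l) by (simpl; ring); rewrite <- exp_pow, l_exp; ring).
    unfold Rdiv. rewrite pow_sixtyfour, exp_pow, <- exp_Ropp, <- !exp_plus. apply exp_le. simpl INR. fold l. lra. }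
  lra.
Qed.

(** [om] is sqrt q, [tau] = sqrt (m/n) makes n tau and m / tau equal, and [sg] is then the value at
    which om sg sqrt (m n) equals m 2^k / sg^2. The constant is (1 + 2)/2 + 8. *)
Lemma group_exponent (k : nat) : exists om sg tau : R, 0 < om /\ 0 < sg /\ 0 < tau /\ om ^ 2 = exp Q /\
  om * sg * (exp N * tau + 2 * exp M / tau) / 2 + 8 * exp M * 2 ^ k / sg ^ 2 =
  19 / 2 * (exp (2 / 3 * M + 1 / 3 * N + 1 / 3 * Q) * exp (INR k * l / 3)).
Proof.
set (s := (M + 2 * INR k * l - Q - N) / 6).
exists (exp (Q / 2)), (exp s), (exp ((M - N) / 2)).
repeat split; try apply exp_pos.
- rewrite exp_pow; f_equal; simpl; field.
- set (Z := exp (2 / 3 * M + 1 / 3 * N + 1 / 3 * Q) * exp (INR k * l / 3)).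
  assert (h1 : exp (Q / 2) * exp s * (exp N * exp ((M - N) / 2)) = Z).
  { unfold Z; rewrite <- !exp_plus; f_equal; unfold s; field. }
  assert (h2 : exp (Q / 2) * exp s * (exp M / exp ((M - N) / 2)) = Z).
  { unfold Z, Rdiv; rewrite <- exp_Ropp, <- !exp_plus; f_equal; unfold s; field. }
  assert (h3 : exp M * 2 ^ k / exp s ^ 2 = Z).
  { unfold Z, Rdiv; rewrite two_pow, exp_pow, <- exp_Ropp, <- !exp_plus; f_equal; unfold s; simpl INR; fold l; field. }
  transitivity ((exp (Q / 2) * exp s * (exp N * exp ((M - N) / 2)) +
    2 * (exp (Q / 2) * exp s * (exp M / exp ((M - N) / 2)))) / 2 + 8 * (exp M * 2 ^ k / exp s ^ 2)).
  { unfold Rdiv; ring. }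
  rewrite h1, h2, h3; field.
Qed.

(** k is the first exponent with 8^k above q / 4^h (0 if q <= 4^h), so 2^k exceeds the cube root of
    this ratio by at most a factor 2. The cube root of 2^k is what [group_exponent] pays. *)
Lemma dual_exponent (h : nat) : exists k : nat, exp Q <= 4 ^ h * 8 ^ k /\
  exp (INR k * l / 3) <= 1 + 2 * exp ((Q - 2 * INR h * l) / 9).
Proof.
assert (p := exp_pos ((Q - 2 * INR h * l) / 9)).
destruct (Rle_lt_dec (exp Q) (4 ^ h)) as [h1|h1].
- exists 0%nat; split; [simpl; lra|].
  replace (INR 0 * l / 3) with 0 by (simpl; field). rewrite exp_0; lra.
- rewrite pow_four in h1 |- *. fold l in h1 |- *.
  assert (h2 : 2 * INR h * l < Q) by (now apply exp_lt_inv).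
  destruct (pow_floor_R 8 (exp (Q - 2 * INR h * l))) as [a [a1 a2]]; [lra| |].
  { rewrite <- exp_0; apply exp_le; lra. }
  exists (S a); rewrite pow_eight in *; fold l in a1, a2 |- *.
  apply exp_inv in a1.
  assert (e8 : 8 = exp (3 * l)).
  { replace (3 * l) with (INR 3 * l) by (simpl; ring); rewrite <- exp_pow, l_exp; ring. }
  rewrite e8, <- exp_plus in a2. apply exp_lt_inv in a2.
  rewrite S_INR. split.
  + rewrite <- exp_plus; apply exp_le; lra.
  + assert (exp ((INR a + 1) * l / 3) <= 2 * exp ((Q - 2 * INR h * l) / 9)); [|lra].
    rewrite <- l_exp at 1; rewrite <- exp_plus; apply exp_le; lra.
Qed.

Variable Lq : R.
Hypothesis Lq2 : l <= Lq.
Hypothesis QN : Q <= N.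
Hypothesis LM : 3 * M - Q <= Lq.
Let T := exp (6 / 11 * M + 5 / 11 * N + 4 / 11 * Q + 2 / 11 * ln Lq).

(* [h] is chosen with [4 ^ h] close to [(m^3 q^2 / n^3)^(4/11) Lq^(-18/11)], which equalizes the two terms. *)
Lemma balanced_exponent : exists h : nat,
  exp (2 / 3 * M + 1 / 3 * N + 1 / 3 * Q) * exp ((Q - 2 * INR h * l) / 9) <= 2 * T /\
  exp N * (2 ^ h * (2 * INR h + 1)) <= exp N + 6 * T.
Proof.
assert (pT : 0 < T) by apply exp_pos.
assert (pN := exp_pos N).
assert (L0 : 0 < Lq) by lra.
set (y := 4 / 11 * (3 * M + 2 * Q - 3 * N) - 18 / 11 * ln Lq).
destruct (Rlt_le_dec y 0) as [y0|y0].
- exists 0%nat; simpl INR; split; [|simpl; lra].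
  apply Rle_trans with T; [|lra].
  rewrite <- exp_plus; apply exp_le. unfold y in y0. lra.
- destruct (pow_floor_R 4 (exp y)) as [h [h1 h2]]; [lra| |].
  { rewrite <- exp_0; now apply exp_le. }
  exists h. rewrite pow_four in h1, h2. fold l in h1, h2. apply exp_inv in h1.
  assert (e4 : 4 = exp (2 * l)).
  { replace (2 * l) with (INR 2 * l) by (simpl; ring); rewrite <- exp_pow, l_exp; ring. }
  rewrite e4, <- exp_plus in h2. apply exp_lt_inv in h2.
  split.
  + replace (2 * T) with (exp (l + (6 / 11 * M + 5 / 11 * N + 4 / 11 * Q + 2 / 11 * ln Lq))) by (rewrite exp_plus, l_exp; reflexivity).
    rewrite <- !exp_plus; apply exp_le. unfold y in *; lra.
  + assert (hl : - ln Lq <= Lq).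
    { rewrite <- ln_Rinv by lra. apply Rle_trans with (ln 2); [|exact Lq2].
      destruct (Rle_lt_dec (ln (/ Lq)) (ln 2)) as [|hc]; [assumption|exfalso].
      apply ln_lt_inv in hc; [|lra|now apply Rinv_0_lt_compat].
      assert (/ Lq < 2); [|lra].
      apply Rmult_lt_reg_l with Lq; [lra|]. rewrite Rinv_r by lra. lra. }
    (* From Q <= N, 3M + 2Q - 3N <= 3M - Q <= Lq, and 4/11 + 18/11 = 2. So h is O(Lq), and the
       factor 2h + 1 becomes the logarithm of the theorem. *)
    assert (yL : y <= 2 * Lq) by (unfold y; lra).
    assert (hL : 2 * INR h + 1 <= 6 * Lq).
    { assert (0 <= INR h) by apply pos_INR. nra. }
    assert (e1 : exp N * (2 ^ h * Lq) <= T).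
    { rewrite two_pow, <- (exp_ln Lq) at 1 by lra. unfold T; rewrite <- !exp_plus; apply exp_le.
      fold l. unfold y in *; lra. }
    assert (p2 : 0 < 2 ^ h) by (apply pow_lt; lra).
    assert (exp N * (2 ^ h * (2 * INR h + 1)) <= exp N * (2 ^ h * (6 * Lq))).
    { apply Rmult_le_compat_l; [lra|]; apply Rmult_le_compat_l; lra. }
    lra.
Qed.

Lemma optimized_exponents : exists (a k h : nat) (om sg tau : R), 0 < om /\ 0 < sg /\ 0 < tau /\ om ^ 2 = exp Q /\
  exp Q <= 4 ^ h * 8 ^ k /\
  exp N * 2 ^ a + exp M ^ 3 / 64 ^ a + 3 * exp M + 2 * exp N + om * sg * (exp N * tau + 2 * exp M / tau) / 2 +
    8 * exp M * 2 ^ k / sg ^ 2 + exp N * (2 ^ h * (2 * INR h + 1)) <=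
  65 * (exp (3 / 7 * M + 6 / 7 * N) + exp (2 / 3 * M + 1 / 3 * N + 1 / 3 * Q) + T + exp M + exp N).
Proof.
destruct cell_exponent as [a ha].
destruct balanced_exponent as [h [h1 h2]].
destruct (dual_exponent h) as [k [k1 k2]].
destruct (group_exponent k) as [om [sg [tau [o1 [o2 [o3 [o4 o5]]]]]]].
exists a, k, h, om, sg, tau. repeat split; try assumption.
set (X2 := exp (2 / 3 * M + 1 / 3 * N + 1 / 3 * Q)) in *.
assert (p2 : 0 < X2) by apply exp_pos.
assert (X2 * exp (INR k * l / 3) <= X2 + 4 * T).
{ apply Rle_trans with (X2 * (1 + 2 * exp ((Q - 2 * INR h * l) / 9))).
  - apply Rmult_le_compat_l; lra.
  - lra. }
assert (0 < T) by apply exp_pos.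
assert (p3 := exp_pos (3 / 7 * M + 6 / 7 * N)).
assert (p4 := exp_pos M). assert (p5 := exp_pos N).
lra.
Qed.
End Choices.

(** The combinatorial bound is used with q0 = min(q, n) while the target has q, and the logarithm
    decreases in q. As ln (q/q0) <= q/q0, it loses at most a factor 3 q/q0, which q^2 outweighs. *)
Lemma log_term_min (x : R) (q q0 : R) : 0 < x -> 0 < q0 -> q0 <= q ->
  2 * ln q0 + ln (ln (Rmax 2 (x / q0))) <= 2 * ln q + ln (ln (Rmax 2 (x / q))) + ln 3.
Proof.
intros x0 q00 qq.
set (L0 := ln (Rmax 2 (x / q0))); set (L := ln (Rmax 2 (x / q))).
assert (q1 : 0 < q) by lra.
assert (hd : 0 <= ln q - ln q0).
{ destruct qq as [qq| <-]; [|lra]. apply ln_increasing in qq; lra. }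
assert (m0 := Rmax_l 2 (x / q0)). assert (m1 := Rmax_l 2 (x / q)).
assert (ln2 := ln_lt_2).
assert (mono : forall s t, 0 < s -> s <= t -> ln s <= ln t).
{ intros s t hs [hst| ->]; [left; now apply ln_increasing|lra]. }
assert (L1 : ln 2 <= L) by (apply mono; lra).
assert (L2 : ln 2 <= L0) by (apply mono; lra).
assert (LL : L0 <= L + (ln q - ln q0)).
{ replace (L + (ln q - ln q0)) with (ln (Rmax 2 (x / q) * (q / q0))).
  2: { unfold L, Rdiv; rewrite !ln_mult, ln_Rinv; try lra; try apply Rmult_lt_0_compat; try apply Rinv_0_lt_compat; lra. }
  apply mono; [lra|].
  assert (r1 : 1 <= q / q0).
  { apply Rmult_le_reg_r with q0; [lra|]. unfold Rdiv; rewrite Rmult_assoc, Rinv_l; lra. }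
  apply Rmax_lub; [nra|].
  replace (x / q0) with (x / q * (q / q0)) by (field; lra).
  apply Rmult_le_compat_r; [lra|apply Rmax_r]. }
assert (e := exp_ineq1_le (ln q - ln q0)).
assert (L3 : L0 <= L * exp (ln q - ln q0) * 3) by nra.
assert (ln L0 <= ln L + (ln q - ln q0) + ln 3).
{ assert (pe := exp_pos (ln q - ln q0)).
  replace (ln L + (ln q - ln q0) + ln 3) with (ln (L * exp (ln q - ln q0) * 3)); [apply mono; lra|].
  rewrite ln_mult; [|apply Rmult_lt_0_compat; lra|lra].
  rewrite ln_mult, ln_exp; lra. }
lra.
Qed.

Definition target (m n q : R) : R :=
  Rpower m (3 / 7) * Rpower n (6 / 7) + Rpower m (2 / 3) * Rpower n (1 / 3) * Rpower q (1 / 3)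
  + Rpower m (6 / 11) * Rpower n (5 / 11) * Rpower q (4 / 11) * Rpower (ln (Rmax 2 (m ^ 3 / q))) (2 / 11) + m + n.

(** q0 will be min(q, n), since [balanced_exponent] asks for q0 <= n. 195 = 65 * 3: the constant of
    [optimized_exponents] times the loss in [log_term_min]. *)
Lemma incidence_numerics (C I m n q q0 : R) : 0 <= C -> 1 <= m -> 1 <= n -> 1 <= q0 -> q0 <= q -> q0 <= n ->
  (forall (a k h : nat) (om sg tau : R), 0 < om -> 0 < sg -> 0 < tau -> q0 <= om ^ 2 -> q0 <= 4 ^ h * 8 ^ k ->
    I <= C * (n * 2 ^ a + m ^ 3 / 64 ^ a + 3 * m + 2 * n + om * sg * (n * tau + 2 * m / tau) / 2 +
      8 * m * 2 ^ k / sg ^ 2 + n * (2 ^ h * (2 * INR h + 1)))) ->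
  I <= 195 * C * target m n q.
Proof.
intros C0 m1 n1 q1 qq qn H.
assert (mono : forall s t, 0 < s -> s <= t -> ln s <= ln t).
{ intros s t hs [hst| ->]; [left; now apply ln_increasing|lra]. }
set (L0 := ln (Rmax 2 (m ^ 3 / q0))).
assert (m3 : 0 < m ^ 3) by (apply pow_lt; lra).
assert (hm3 : ln (m ^ 3) = 3 * ln m).
{ rewrite <- (exp_ln m) at 1 by lra. rewrite exp_pow, ln_exp; simpl; ring. }
destruct (optimized_exponents (ln m) (ln n) (ln q0) L0) as [a [k [h [om [sg [tau [o1 [o2 [o3 [o4 [o5 o6]]]]]]]]]]].
- apply mono; [lra|apply Rmax_l].
- apply mono; lra.
- replace (3 * ln m - ln q0) with (ln (m ^ 3 / q0)).
  + apply mono; [apply Rmult_lt_0_compat; [lra|apply Rinv_0_lt_compat; lra]|apply Rmax_r].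
  + unfold Rdiv; rewrite ln_mult, ln_Rinv, hm3; try lra. apply Rinv_0_lt_compat; lra.
- rewrite !(exp_ln m), !(exp_ln n), !(exp_ln q0) in * by lra.
  eapply Rle_trans; [apply (H a k h om sg tau); try assumption; lra|].
  eapply Rle_trans; [apply Rmult_le_compat_l; [exact C0|exact o6]|].
  rewrite (Rmult_comm 195), Rmult_assoc. apply Rmult_le_compat_l; [exact C0|].
  unfold target, Rpower; rewrite <- !exp_plus.
  assert (lq := mono q0 q ltac:(lra) qq).
  assert (e1 : exp (2 / 3 * ln m + 1 / 3 * ln n + 1 / 3 * ln q0) <= exp (2 / 3 * ln m + 1 / 3 * ln n + 1 / 3 * ln q)) by (apply exp_le; lra).
  assert (lt := log_term_min (m ^ 3) q q0 m3 ltac:(lra) qq). fold L0 in lt.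
  assert (e2 : exp (6 / 11 * ln m + 5 / 11 * ln n + 4 / 11 * ln q0 + 2 / 11 * ln L0) <=
     3 * exp (6 / 11 * ln m + 5 / 11 * ln n + 4 / 11 * ln q + 2 / 11 * ln (ln (Rmax 2 (m ^ 3 / q))))).
  { set (E2 := 6 / 11 * ln m + 5 / 11 * ln n + 4 / 11 * ln q + _).
    replace (3 * exp E2) with (exp (ln 3 + E2)) by (rewrite exp_plus, exp_ln; lra).
    apply exp_le; unfold E2.
    assert (0 < ln 3) by (rewrite <- ln_1; apply ln_increasing; lra). lra. }
  set (A1 := exp (3 / 7 * ln m + 6 / 7 * ln n)) in *.
  assert (0 < A1) by apply exp_pos.
  assert (p2 := exp_pos (2 / 3 * ln m + 1 / 3 * ln n + 1 / 3 * ln q)).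
  lra.
Qed.
End IncidenceNumerics.

Module CircleIncidences.
From HB Require Import structures.
From mathcomp Require Import all_boot all_order all_algebra.
From mathcomp Require Import zify ring lra.
From mathcomp Require Import perm reals mpoly.
Set Implicit Arguments.
Unset Strict Implicit.
Unset Printing Implicit Defensive.
Import Order.TTheory GRing.Theory Num.Theory.
Local Open Scope ring_scope.
From mathcomp Require Import Rstruct.

Section BigopFacts.
Variable R : realFieldType.

Lemma sum_sqr_ge0 (I : finType) (P : pred I) (F : I -> R) :
  0 <= \sum_(i | P i) F i ^+ 2.
Proof. by apply: sumr_ge0 => i _; rewrite sqr_ge0. Qed.

(** Cauchy-Schwarz, from the sum of the squares of c F i - s, where c is the cardinal and s the
    sum. *)
Lemma sqr_sum_le_card (I : finType) (P : pred I) (F : I -> R) :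
  (\sum_(i | P i) F i) ^+ 2 <= #|P|%:R * \sum_(i | P i) F i ^+ 2.
Proof.
have [c0|c0] := posnP #|P|.
  rewrite c0 mul0r big_pred0 ?expr0n // => i.
  by have := card0_eq c0 i; rewrite !inE.
set s := \sum_(i | P i) F i; set c := #|P|%:R : R.
have {}c0 : 0 < c by rewrite ltr0n.
have : 0 <= \sum_(i | P i) (c * F i - s) ^+ 2 by apply: sum_sqr_ge0.
have -> : \sum_(i | P i) (c * F i - s) ^+ 2
   = c * (c * (\sum_(i | P i) F i ^+ 2) - s ^+ 2).
  transitivity (\sum_(i | P i) (c ^+ 2 * F i ^+ 2 + - (2 * c * s) * F i + s ^+ 2)).
    by apply: eq_bigr => i _; ring.
  rewrite !big_split /= -!mulr_sumr sumr_const -/s -mulr_natr -/c; ring.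
by rewrite pmulr_rge0 // subr_ge0.
Qed.

Lemma card_sum1 (I : finType) (P : {pred I}) : #|P|%:R = \sum_(i in P) 1 :> R.
Proof. by rewrite sumr_const. Qed.

End BigopFacts.

(** * Lists with reversed cyclic orders *)

(* After Marcus and Tardos: pairs of blocks at dyadic scales are counted with signs. *)
Section ReverseOrders.
Variables (R : realFieldType) (I L : finType).
Variables (A : I -> {set L}) (pos : I -> L -> nat).

Definition cyc3 (a b c : nat) := [|| (a < b < c)%N, (b < c < a)%N | (c < a < b)%N].

(** Only cyclic orders are compared: the lists will be read off closed curves cut at an arbitrary
    parameter. *)
Definition reverse_family :=
  (forall i, {in A i &, injective (pos i)}) /\
  (forall i j x y z, i != j -> x \in A i :&: A j -> y \in A i :&: A j ->
     z \in A i :&: A j -> (pos i x < pos i y < pos i z)%N ->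
     ~~ cyc3 (pos j x) (pos j y) (pos j z)).

Definition blk k i x := (pos i x %/ 2 ^ k)%N.
Definition cls k i j x := (blk k i x, blk k j x).

Definition splitting i j (X : pred L) :=
  forall x y, x \in A i :&: A j -> y \in A i :&: A j -> x != y ->
   (X x == X y -> (pos i x < pos i y)%N = (pos j y < pos j x)%N) /\
   (X x && ~~ X y -> (pos i x < pos i y)%N && (pos j x < pos j y)%N).

(** Cut at the common element [s] that comes first in list j. Reversal of the triples through s puts
    the elements up to s in list i before the remaining ones in list j as well, and reverses the
    linear order inside each of the two classes. *)
Lemma reverse_splitting i j : reverse_family -> i != j ->
  exists X : pred L, splitting i j X.
Proof.
move=> [inj rev] ij.
have [e|[s0 s0C]] := set_0Vmem (A i :&: A j).
  by exists xpredT => x y; rewrite e inE.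
pose s := [arg min_(x < s0 in A i :&: A j) pos j x].
have [sC smin] : s \in A i :&: A j /\ forall x, x \in A i :&: A j -> (pos j s <= pos j x)%N.
  by rewrite /s; case: arg_minnP.
have injC l x y : l \in [:: i; j] -> x \in A i :&: A j -> y \in A i :&: A j ->
    x != y -> pos l x != pos l y.
  rewrite !inE => /orP[]/eqP-> /andP[x1 x2] /andP[y1 y2]; apply: contraNneq => e;
  by [rewrite (inj i x y) | rewrite (inj j x y)].
exists (fun x => pos i x <= pos i s)%N => x y xC yC xy.
have rv a b c := rev i j a b c ij.
have pS z : z \in A i :&: A j -> z != s -> (pos j s < pos j z)%N.
  by move=> zC zs; rewrite ltn_neqAle smin // andbT eq_sym (injC j) // !inE eqxx orbT.
have pI z : z \in A i :&: A j -> z != s -> pos i z != pos i s.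
  by move=> zC zs; rewrite (injC i) // !inE eqxx.
have := injC i x y (mem_head _ _) xC yC xy.
have /(injC j x y)/(_ xC yC xy) : j \in [:: i; j] by rewrite !inE eqxx orbT.
have [exs|xs] := eqVneq x s; have [eys|ys] := eqVneq y s.
- by move: xy; rewrite exs eys eqxx.
- have := pS y yC ys; have := pI y yC ys; rewrite exs leqnn.
  move: (pos i y) (pos i s) (pos j y) (pos j s) => a b c d *; split; lia.
- have := pS x xC xs; have := pI x xC xs; rewrite eys leqnn.
  move: (pos i x) (pos i s) (pos j x) (pos j s) => a b c d *; split; lia.
have := rv x s y xC sC yC; have := rv x y s xC yC sC; have := rv y x s yC xC sC.
have := rv s x y sC xC yC; have := rv s y x sC yC xC.
have := pI x xC xs; have := pI y yC ys; have := pS x xC xs; have := pS y yC ys.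
rewrite /cyc3; move: (pos i x) (pos i s) (pos i y) (pos j x) (pos j s) (pos j y).
move=> a c b e d f df de.
have fd : (f < d)%N = false by rewrite ltnNge ltnW.
have ed : (e < d)%N = false by rewrite ltnNge ltnW.
rewrite df de fd ed /= ?andbF ?andbT ?orbF.
case: (ltngtP a c) => //= ac; case: (ltngtP b c) => //= bc;
case: (ltngtP a b) => //= ab; case: (ltngtP e f) => //= ef; rewrite ?orbT ?orbF /=;
  try (by split => //); try (by move=> *; lia);
  try (by move=> _ _ /(_ isT)); try (by move=> _ _ _ /(_ isT));
  try (by move=> _ _ _ _ /(_ isT)); try (by move=> _ _ _ _ _ /(_ isT));
  try (by move=> _ _ _ _ _ _ /(_ isT)).
Qed.
End ReverseOrders.

(** * Signed pair counts at dyadic scales: upper bound over all pairs of lists *)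

Section EnergyBound.
Variables (R : realFieldType) (I L : finType).
Variables (A : I -> {set L}) (pos : I -> L -> nat).

(** The sign of the order of x and y in list i, restricted to pairs in one block of length 2^k. For
    two lists the product is -1 exactly on pairs that share a block in both and are ordered
    oppositely. *)
Definition w k i x y : R :=
  ([&& x \in A i, y \in A i, x != y & blk pos k i x == blk pos k i y])%:R
   * (-1) ^+ (pos i y < pos i x)%N.
Definition common i j := A i :&: A j.
(** The diagonal plus the excess of oppositely ordered pairs over equally ordered ones. It is a sum
    of squares when the two lists are reversed ([energy_classes]), yet its total over all pairs of
    lists is small ([sum_energy_le]). *)
Definition energy k i j : R :=
  #|common i j|%:R - \sum_x \sum_y w k i x y * w k j x y.
Definition totcard : nat := \sum_i #|A i|.
Definition offdiag : R := \sum_i \sum_(j | j != i) #|common i j|%:R.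

Lemma card_block k i (x : L) : {in A i &, injective (pos i)} ->
  (#|[pred y in A i | blk pos k i x == blk pos k i y]| <= 2 ^ k)%N.
Proof.
move=> inj; set B := [pred y in A i | _].
have p0 : (0 < 2 ^ k)%N by rewrite expn_gt0.
pose f y : 'I_(2 ^ k) := Ordinal (ltn_pmod (pos i y) p0).
rewrite -[X in (_ <= X)%N]card_ord.
have finj : {in B &, injective f}.
  move=> a b /andP[aA /eqP ea] /andP[bA /eqP eb] [em].
  apply: inj => //; rewrite (divn_eq (pos i a) (2 ^ k)) (divn_eq (pos i b) (2 ^ k)) em.
  by move: ea eb; rewrite /blk => <- <-.
by rewrite -(card_in_image finj) max_card.
Qed.

(** For fixed x and y, the sum of w_i w_j over i <> j is the square of the sum of the w_i minus the
    sum of their squares. Only these squares count against the bound, and each x has at most 2^k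
    companions in its block. *)
Lemma sum_energy_le k : (forall i, {in A i &, injective (pos i)}) ->
  \sum_i \sum_(j | j != i) energy k i j <= offdiag + (2 ^ k)%:R * totcard%:R.
Proof.
move=> inj.
have -> : \sum_i \sum_(j | j != i) energy k i j = offdiag
   - \sum_x \sum_y \sum_i \sum_(j | j != i) w k i x y * w k j x y.
  rewrite /energy.
  under eq_bigr => i _ do rewrite sumrB.
  rewrite sumrB; congr (_ - _).
  under eq_bigr => i _ do rewrite exchange_big /=.
  rewrite exchange_big /=; apply: eq_bigr => x _.
  under eq_bigr => i _ do rewrite exchange_big /=.
  by rewrite exchange_big /=.
rewrite lerD2l lerNl.
have step x y : - (\sum_i w k i x y ^+ 2) <= \sum_i \sum_(j | j != i) w k i x y * w k j x y.
  have -> : \sum_i \sum_(j | j != i) w k i x y * w k j x y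
     = (\sum_i w k i x y) ^+ 2 - \sum_i w k i x y ^+ 2.
    rewrite expr2 big_distrl /= -sumrB; apply: eq_bigr => i _.
    by rewrite big_distrr /= [in RHS](bigD1 i) //= -expr2 addrC addrK.
  by rewrite lerBrDr addrC subrr sqr_ge0.
have : \sum_x \sum_y - (\sum_i w k i x y ^+ 2)
  <= \sum_x \sum_y \sum_i \sum_(j | j != i) w k i x y * w k j x y.
  by apply: ler_sum => x _; apply: ler_sum => y _; exact: step.
apply: le_trans.
under eq_bigr => x _ do rewrite sumrN.
rewrite sumrN lerN2.
under eq_bigr => x _ do rewrite exchange_big /=.
rewrite exchange_big /= /totcard natr_sum mulr_sumr; apply: ler_sum => i _.
rewrite -[X in _ <= _ * X%:R]sum1_card natr_sum mulr_sumr.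
rewrite [X in X <= _](bigID (mem (A i))) /=.
rewrite [X in _ + X]big1 ?addr0; last first.
  move=> x xA; apply: big1 => y _; rewrite /w (negbTE xA) /=; ring.
apply: ler_sum => x xA.
rewrite mulr1; apply: (@le_trans _ _ (#|[pred y in A i | blk pos k i x == blk pos k i y]|%:R)); last first.
  by rewrite ler_nat card_block.
rewrite card_sum1 [X in _ <= X]big_mkcond /=; apply: ler_sum => y _.
rewrite /w xA exprMn sqrr_sign mulr1 inE /=.
case: (y \in A i); case: (blk _ _ _ _ == _); case: (x != y) => //=;
  by rewrite ?expr0n ?expr1n ?ler01 ?lexx.
Qed.

(** offdiag + totcard is the sum over the elements of the squared number of lists that contain them;
    then Cauchy-Schwarz. *)
Lemma offdiag_ge : (0 < #|L|)%N ->
  totcard%:R ^+ 2 <= #|L|%:R * (offdiag + totcard%:R).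
Proof.
move=> L0.
pose d x : R := \sum_i (x \in A i)%:R.
have dA : totcard%:R = \sum_x d x.
  rewrite /d exchange_big /totcard natr_sum; apply: eq_bigr => i _.
  by rewrite -sum1_card natr_sum [LHS]big_mkcond; apply: eq_bigr => x _; case: (x \in A i).
have -> : offdiag + totcard%:R = \sum_x d x ^+ 2.
  under [RHS]eq_bigr => x _ do rewrite expr2 /d big_distrl /=.
  rewrite exchange_big /= /offdiag /totcard natr_sum -big_split /=.
  apply: eq_bigr => i _.
  under [RHS]eq_bigr => x _ do rewrite big_distrr /=.
  rewrite exchange_big /= [RHS](bigD1 i) //= addrC; congr (_ + _).
    rewrite card_sum1 big_mkcond /=; apply: eq_bigr => x _.
    by case: (x \in A i) => /=; rewrite ?(mulr0n, mulr1n, mulr1, mul0r, mulr0).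
  apply: eq_bigr => j _.
  rewrite card_sum1 big_mkcond /=; apply: eq_bigr => x _.
  by rewrite /common inE; case: (x \in A i); case: (x \in A j) => /=; rewrite ?(mulr0n, mulr1n, mulr1, mul0r, mulr0).
by rewrite dA; apply: le_trans (sqr_sum_le_card _ _) _; rewrite (@eq_card _ _ L).
Qed.

End EnergyBound.

(** * Signed pair counts: lower bound for one pair of lists *)

Section EnergyLower.
Variables (R : realFieldType) (I L : finType).
Variables (A : I -> {set L}) (pos : I -> L -> nat) (h : nat).
Hypothesis inj : forall i, {in A i &, injective (pos i)}.
Hypothesis small : forall i x, x \in A i -> (pos i x < 2 ^ h)%N.
Variables (i j : I) (X : pred L).
Hypothesis splitX : splitting A pos i j X.

Let C := common A i j.
Let eps x : R := (-1) ^+ (~~ X x).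
(** A finite home for pairs of block indices, so that classes can be summed over. By [small] the
    indices are below 2^h; the successor form is what [inord] asks for. *)
Let T := ('I_(2 ^ h).-1.+1 * 'I_(2 ^ h).-1.+1)%type.
Let code k x : T := (inord (blk pos k i x), inord (blk pos k j x)).

Let CA x : x \in C -> x \in A i /\ x \in A j.
Proof. by rewrite inE => /andP. Qed.

Lemma code_eq k x y : x \in C -> y \in C ->
  (code k x == code k y) = (cls pos k i j x == cls pos k i j y).
Proof.
have blkK l a : (pos l a < 2 ^ h)%N ->
    nat_of_ord (inord (blk pos k l a) : 'I_(2 ^ h).-1.+1) = blk pos k l a.
  by move=> lt; rewrite inordK // prednK ?expn_gt0 //; apply: leq_ltn_trans lt; rewrite leq_div.
move=> /CA[xi xj] /CA[yi yj]; rewrite /code /cls !xpair_eqE -!val_eqE /=.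
by rewrite !blkK ?small.
Qed.

(** By [splitX], two common elements of one class are ordered oppositely if they lie on the same
    side of X and equally otherwise, so the negated product of weights is eps x * eps y; the
    diagonal accounts for the cardinal. *)
Lemma energy_eps k : energy R A pos k i j =
  \sum_(x in C) \sum_(y in C | code k y == code k x) eps x * eps y.
Proof.
have -> : energy R A pos k i j =
   \sum_(x in C) (1 - \sum_y w R A pos k i x y * w R A pos k j x y).
  rewrite /energy sumrB card_sum1; congr (_ - _).
  rewrite [LHS](bigID (mem C)) /= [X in _ + X]big1 ?addr0 // => x xC.
  apply: big1 => y _; move: xC; rewrite /w inE.
  by case: (x \in A i); case: (x \in A j) => //=; rewrite ?mul0r ?mulr0.
apply: eq_bigr => x xC.
rewrite [RHS](bigD1 x) ?xC ?eqxx //= -expr2 sqrr_sign -sumrN; congr (_ + _).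
rewrite [LHS](bigID [pred y | (y \in C) && (code k y == code k x) && (y != x)]) /=.
rewrite [X in _ + X]big1 ?addr0 => [|y]; last first.
  rewrite /w; have [xi xj] := CA xC.
  have [yC|] := boolP (y \in C); last first.
    rewrite inE => + _; case: (y \in A i); case: (y \in A j) => //=;
    by rewrite ?andbF ?mul0r ?mulr0 ?oppr0.
  rewrite code_eq //= /cls xpair_eqE [x == y]eq_sym [blk _ _ i x == _]eq_sym [blk _ _ j x == _]eq_sym.
  case: (y == x); case: (_ == _); case: (_ == _) => //=;
    by rewrite ?andbF ?mul0r ?mulr0 ?oppr0.
apply: eq_big => // y /andP[/andP[yC]]; rewrite code_eq // => /eqP[ei ej] nyx.
have [xi xj] := CA xC; have [yi yj] := CA yC.
rewrite /w xi xj yi yj [x == y]eq_sym nyx ei ej !eqxx /= !mul1r.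
have [s1 s2] := splitX xC yC (contra_neq (fun e => esym e) nyx).
have [_ s3] := splitX yC xC nyx.
have ni : pos i x != pos i y by apply: contraNneq nyx => e; apply/eqP/esym/(inj xi yi e).
have nj : pos j x != pos j y by apply: contraNneq nyx => e; apply/eqP/esym/(inj xj yj e).
move: s1 s2 s3; rewrite /eps.
case: (X x); case: (X y) => /= s1 s2 s3;
 (have {s1 s2 s3} := s1 isT) || (have {s1 s2 s3} /andP[] := s2 isT) || (have {s1 s2 s3} /andP[] := s3 isT);
 case: (ltngtP (pos i x) (pos i y)) ni => //= _ _; case: (ltngtP (pos j x) (pos j y)) nj => //= _ _ _;
 try (move=> _); rewrite ?expr0 ?expr1; try ring; try done.
Qed.

Lemma energy_classes k : energy R A pos k i j =
  \sum_(c : T) (\sum_(x in C | code k x == c) eps x) ^+ 2.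
Proof.
rewrite energy_eps (partition_big (code k) predT) //=; apply: eq_bigr => c _.
rewrite expr2 big_distrl /=; apply: eq_bigr => x /andP[xC /eqP <-].
by rewrite big_distrr.
Qed.

Definition pure k x := [forall y, (y \in C) && (cls pos k i j y == cls pos k i j x) ==> (X y == X x)].

Lemma pureP k x y : pure k x -> y \in C -> cls pos k i j y = cls pos k i j x -> X y = X x.
Proof. by move=> /forallP/(_ y); case: (y \in C) => //= + _ e; rewrite e eqxx => /eqP. Qed.

(** On a pure class all signs agree, so its square in [energy_classes] is at least the squared
    number of elements of V in it; Cauchy-Schwarz over at most four classes costs the factor 4. *)
Lemma energy_ge_pure k (V : {set L}) (S : {set T}) : V \subset C -> (#|S| <= 4)%N ->
  (forall x, x \in V -> pure k x /\ code k x \in S) ->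
  #|V|%:R ^+ 2 <= 4 * energy R A pos k i j.
Proof.
move=> VC S4 VS; rewrite energy_classes.
pose v c : R := #|[set x in V | code k x == c]|%:R.
have vE : #|V|%:R = \sum_(c in S) v c.
  rewrite card_sum1 (partition_big (code k) (mem S)) /=; last by move=> x /VS[].
  by apply: eq_bigr => c _; rewrite /v card_sum1; apply: eq_bigl => x; rewrite inE.
have vle c : v c ^+ 2 <= (\sum_(x in C | code k x == c) eps x) ^+ 2.
  have [e|[x]] := set_0Vmem [set x in V | code k x == c].
    by rewrite /v e cards0 expr0n sqr_ge0.
  rewrite inE => /andP[xV /eqP xc]; have [px _] := VS x xV.
  have xC := subsetP VC x xV.
  have -> : \sum_(y in C | code k y == c) eps y = eps x * #|[set y in C | code k y == c]|%:R.
    rewrite card_sum1 mulr_sumr; apply: eq_big => [y|y /andP[yC]]; first by rewrite !inE.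
    by rewrite -xc code_eq // => /eqP e; rewrite /eps (pureP px yC e) mulr1.
  rewrite exprMn sqrr_sign mul1r ler_pXn2r ?nnegrE ?ler0n // ler_nat.
  by apply/subset_leq_card/subsetP => y; rewrite !inE => /andP[/(subsetP VC) yC ->]; move: yC; rewrite inE => ->.
rewrite vE; apply: le_trans (sqr_sum_le_card _ _) _.
apply: ler_pM; rewrite ?ler0n ?sum_sqr_ge0 ?ler_nat //.
apply: le_trans (ler_sum _ (fun c _ => vle c)) _.
by rewrite [X in _ <= X](bigID (mem S)) /= lerDl sum_sqr_ge0.
Qed.

(** The elements that lose their purity between scales k and k + 1; the last scale h takes those
    still pure there. *)
Definition stage k : {set L} :=
  [set x in C | pure k x && ((k == h) || ~~ pure k.+1 x)].

(** A class that is impure at scale k + 1 has elements on both sides of X, and those in X precede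
    the others in both lists. Comparing two impure classes both ways bounds the block indices of
    each by those of the other, so there is only one. At k = h all block indices are 0. *)
Lemma cls_stage k x y : x \in stage k -> y \in stage k -> (k <= h)%N ->
  cls pos k.+1 i j x = cls pos k.+1 i j y.
Proof.
have mono l a b m : (pos l a < pos l b)%N -> (blk pos m l a <= blk pos m l b)%N.
  by move=> lt; apply: leq_div2r; apply: ltnW.
rewrite inE => /andP[xC /andP[_ px]]; rewrite inE => /andP[yC /andP[_ py]].
have [xi xj] := CA xC; have [yi yj] := CA yC.
have [->|kh] := eqVneq k h.
  have z l a : a \in A l -> blk pos h.+1 l a = 0%N.
    by move=> aA; apply: divn_small; apply: leq_trans (small aA) _; rewrite leq_exp2l.
  by rewrite /cls !z.
move: px py; rewrite (negbTE kh) /= => px py _.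
have mixed z : z \in C -> ~~ pure k.+1 z -> exists a b, [/\ a \in C, b \in C, X a, ~~ X b
   & cls pos k.+1 i j a = cls pos k.+1 i j z /\ cls pos k.+1 i j b = cls pos k.+1 i j z].
  move=> zC; rewrite negb_forall => /existsP[u]; rewrite negb_imply => /andP[/andP[uC /eqP e] n].
  case Xz : (X z); move: n; rewrite Xz; case Xu : (X u) => // _.
    by exists z, u; split; rewrite ?Xu.
  by exists u, z; split; rewrite ?Xz.
have [a [b [aC bC Xa Xb [ea eb]]]] := mixed x xC px.
have [a' [b' [aC' bC' Xa' Xb' [ea' eb']]]] := mixed y yC py.
have ord u v : u \in C -> v \in C -> X u -> ~~ X v ->
   (blk pos k.+1 i u <= blk pos k.+1 i v)%N /\ (blk pos k.+1 j u <= blk pos k.+1 j v)%N.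
  move=> uC vC Xu Xv; have uv : u != v by apply: contraNneq Xv => <-.
  have [_] := splitX uC vC uv; rewrite Xu Xv => /(_ isT)/andP[l1 l2].
  by split; apply: mono.
have [l1 l2] := ord a b' aC bC' Xa Xb'; have [l3 l4] := ord a' b aC' bC Xa' Xb.
move: ea eb ea' eb'; rewrite /cls => -[<- <-] [e1 e2] [<- <-] [e3 e4].
rewrite e3 e4 in l1 l2; rewrite e1 e2 in l3 l4.
by congr (_, _); apply/eqP; rewrite eqn_leq ?l1 ?l2 ?l3 ?l4.
Qed.

(** The single class at scale k + 1 breaks into at most four classes at scale k. *)
Lemma stage_energy k : (k <= h)%N ->
  #|stage k|%:R ^+ 2 <= 4 * energy R A pos k i j.
Proof.
move=> kh; have [->|[x0 x0V]] := set_0Vmem (stage k).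
  rewrite cards0 expr0n /= mulr_ge0 // energy_classes sum_sqr_ge0 //.
pose b := blk pos k.+1 i x0; pose b' := blk pos k.+1 j x0.
pose S : {set T} := [set (inord (2 * b), inord (2 * b')); (inord (2 * b + 1), inord (2 * b'));
  (inord (2 * b), inord (2 * b' + 1)); (inord (2 * b + 1), inord (2 * b' + 1))].
apply: (@energy_ge_pure k _ S).
- by apply/subsetP => x; rewrite inE => /andP[].
- by rewrite /S -!setUA !cardsU1 cards1; do 3!case: (_ \notin _).
- move=> x xV; split; first by move: xV; rewrite inE => /and3P[].
  have := cls_stage xV x0V kh; rewrite /cls -/b -/b' => -[ex ey].
  have half l : exists r, blk pos k l x = (2 * blk pos k.+1 l x + r)%N /\ (r < 2)%N.
    exists (blk pos k l x %% 2)%N; rewrite ltn_mod; split => //.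
    by rewrite {1}(divn_eq (blk pos k l x) 2) mulnC /blk -divnMA expnSr.
  have [r [er r2]] := half i; have [r' [er' r2']] := half j.
  rewrite /code er er' ex ey !inE.
  by case: r r2 {er} => [|[]] // _; case: r' r2' {er'} => [|[]] // _; rewrite ?addn0 eqxx ?orbT.
Qed.

(** Every element is pure at scale 0, so the stages cover the common elements; Cauchy-Schwarz over
    the h + 1 stages. *)
Lemma sum_energy_ge :
  #|C|%:R ^+ 2 <= 4 * h.+1%:R * \sum_(k < h.+1) energy R A pos k i j.
Proof.
have cov : C \subset \bigcup_(k < h.+1) stage k.
  apply/subsetP => x xC.
  have p0 : pure 0 x.
    apply/forallP => y; apply/implyP => /andP[yC].
    rewrite /cls /blk !expn0 !divn1 xpair_eqE => /andP[/eqP e _].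
    by have [xi _] := CA xC; have [yi _] := CA yC; rewrite (inj yi xi e).
  have exP : exists k, (k <= h)%N && pure k x by exists 0%N.
  have [k /andP[kh pk] kmax] := ex_maxnP exP (fun k => fun H => proj1 (andP H)).
  apply/bigcupP; exists (inord k) => //; rewrite inE xC inordK // pk /=.
  have [//|kh'] := eqVneq k h; apply/negP => pk1.
  have := kmax k.+1; rewrite pk1 ltn_neqAle kh' kh ltnn => /(_ isT) //.
have le1 : #|C|%:R <= \sum_(k < h.+1) #|stage k|%:R :> R.
  rewrite -natr_sum ler_nat; apply: leq_trans (subset_leq_card cov) _.
  elim/big_ind2: _ => [|a b c d ab cd|//]; first by rewrite cards0.
  by apply: leq_trans (leq_card_setU _ _).1 _; apply: leq_add.
have : #|C|%:R ^+ 2 <= (\sum_(k < h.+1) #|stage k|%:R) ^+ 2 :> R.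
  by rewrite ler_pXn2r ?nnegrE ?ler0n // sumr_ge0.
move/le_trans; apply; apply: le_trans (sqr_sum_le_card _ _) _.
rewrite (@eq_card _ _ 'I_h.+1) // card_ord [4 * _]mulrC -mulrA ler_wpM2l ?ler0n //.
rewrite mulr_sumr; apply: ler_sum => k _; apply: stage_energy; rewrite -ltnS //.
Qed.
End EnergyLower.

(** Cauchy-Schwarz over the at most N^2 pairs of nonempty lists reduces to the sum of the squared
    numbers of common elements, which the energies at all scales dominate. *)
Lemma reverse_offdiag (R : realFieldType) (I L : finType) (A : I -> {set L})
    (pos : I -> L -> nat) (h N : nat) :
  reverse_family A pos ->
  (forall i x, x \in A i -> (pos i x < 2 ^ h)%N) ->
  (#|[set i | A i != set0]| <= N)%N ->
  offdiag R A ^+ 2 <= N%:R ^+ 2 * (4 * h.+1%:R *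
     (h.+1%:R * offdiag R A + (2 ^ h.+1)%:R * (totcard A)%:R)).
Proof.
move=> rev small NA; have inj := rev.1.
pose P (p : I * I) := [&& p.2 != p.1, A p.1 != set0 & A p.2 != set0].
pose t (p : I * I) : R := #|common A p.1 p.2|%:R.
have offE : offdiag R A = \sum_(p | P p) t p.
  rewrite /offdiag pair_big_dep /= (bigID P) /= [X in _ + X]big1 ?addr0 => [|[i j]].
    by apply: eq_bigl => -[i j]; rewrite /P /=; case: (j != i).
  rewrite /P /t /= => /andP[-> /=]; rewrite negb_and !negbK.
  by case/orP => /eqP e; rewrite /common e ?set0I ?setI0 cards0.
have t2 : \sum_(p | P p) t p ^+ 2 <= 4 * h.+1%:R *
     (h.+1%:R * offdiag R A + (2 ^ h.+1)%:R * (totcard A)%:R).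
  apply: (@le_trans _ _ (\sum_i \sum_(j | j != i) #|common A i j|%:R ^+ 2)).
    rewrite [X in _ <= X]pair_big_dep /= [X in _ <= X](bigID P) /=.
    rewrite [X in _ <= X + _](eq_bigl P) => [|[i j]]; first by rewrite lerDl sumr_ge0 // => p _; rewrite sqr_ge0.
    by rewrite /P /=; case: (j != i).
  apply: (@le_trans _ _ (\sum_i \sum_(j | j != i) (4 * h.+1%:R * \sum_(k < h.+1) energy R A pos k i j))).
    apply: ler_sum => i _; apply: ler_sum => j ji.
    have [X sX] := reverse_splitting rev (contra_neq (fun e => esym e) ji).
    exact: (@sum_energy_ge R I L A pos h inj small i j X sX).
  under eq_bigr => i _ do rewrite -mulr_sumr.
  rewrite -mulr_sumr ler_wpM2l ?mulr_ge0 ?ler0n //.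
  under eq_bigr => i _ do rewrite exchange_big /=.
  rewrite exchange_big /=.
  apply: (@le_trans _ _ (\sum_(k < h.+1) (offdiag R A + (2 ^ k)%:R * (totcard A)%:R))).
    by apply: ler_sum => k _; apply: sum_energy_le.
  rewrite big_split /= sumr_const card_ord -[offdiag R A *+ h.+1]mulr_natl lerD2l -mulr_suml ler_wpM2r ?ler0n //.
  by rewrite -natr_sum ler_nat -[X in (X <= _)%N]mul1n -(predn_exp 2) leq_pred.
rewrite offE; apply: le_trans (sqr_sum_le_card _ _) _; rewrite -offE.
apply: ler_pM; rewrite ?ler0n ?sum_sqr_ge0 // -natrX ler_nat.
apply: leq_trans (_ : (#|setX [set i | A i != set0] [set i | A i != set0]| <= _)%N).
  by apply/subset_leq_card/subsetP => -[i j]; rewrite !inE => /and3P[_ /= -> ->].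
by rewrite cardsX -mulnn leq_mul.
Qed.

(** * Cutting lists into pieces of bounded length *)

Section Rank.
Variables (I L : finType) (A : I -> {set L}) (pos : I -> L -> nat).
Hypothesis rev : reverse_family A pos.

Definition rank i x := #|[set y in A i | (pos i y < pos i x)%N]|.

Lemma rank_lt i x : x \in A i -> (rank i x < #|A i|)%N.
Proof.
move=> xA; apply: proper_card; apply/properP; split.
  by apply/subsetP => y; rewrite inE => /andP[].
by exists x => //; rewrite inE ltnn andbF.
Qed.

Lemma rank_mono i x y : x \in A i -> y \in A i ->
  (rank i x < rank i y)%N = (pos i x < pos i y)%N.
Proof.
move=> xA yA; have [lt|ge] := ltnP (pos i x) (pos i y).
  apply: proper_card; apply/properP; split.
    by apply/subsetP => z; rewrite !inE => /andP[->] /= /ltn_trans; apply.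
  by exists x; rewrite ?inE ?ltnn ?andbF // xA.
rewrite ltnNge; apply/negbF/subset_leq_card/subsetP => z; rewrite !inE.
by move=> /andP[->] /= /leq_trans; apply.
Qed.

Variable h n : nat.
Definition piece (p : I * 'I_n) : {set L} := [set x in A p.1 | (rank p.1 x %/ 2 ^ h == p.2)%N].
Definition piece_pos (p : I * 'I_n) x := (rank p.1 x %% 2 ^ h)%N.

Lemma piece_pos_mono p x y : x \in piece p -> y \in piece p ->
  (piece_pos p x < piece_pos p y)%N = (pos p.1 x < pos p.1 y)%N.
Proof.
rewrite !inE => /andP[xA /eqP ex] /andP[yA /eqP ey]; rewrite -rank_mono //.
by rewrite (divn_eq (rank p.1 x) (2 ^ h)) (divn_eq (rank p.1 y) (2 ^ h)) ex ey ltn_add2l.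
Qed.

(** Distinct pieces of one list are disjoint, so the condition on common elements is vacuous for
    them; pieces of different lists inherit their orders. *)
Lemma reverse_pieces : reverse_family piece piece_pos.
Proof.
split=> [p x y xp yp e|p p' x y z pp'].
  have := piece_pos_mono xp yp; have := piece_pos_mono yp xp; rewrite e ltnn.
  move: xp yp; rewrite !inE => /andP[xA _] /andP[yA _] h1 h2.
  by apply: (rev.1 p.1) => //; apply/eqP; move: h1 h2; case: ltngtP.
move=> /setIP[xp xp'] /setIP[yp yp'] /setIP[zp zp'].
rewrite /cyc3 !piece_pos_mono //.
have [e|ne] := eqVneq p.1 p'.1.
  case/eqP: pp'; case: p p' e xp xp' {yp yp' zp zp'} => [i a] [j b] /= <-.
  rewrite !inE /= => /andP[_ /eqP ea] /andP[_ /eqP eb].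
  by congr (_, _); apply: val_inj; rewrite /= -ea -eb.
have sub q u : u \in piece q -> u \in A q.1 by rewrite inE => /andP[].
by apply: rev.2 => //; apply/setIP; split; apply: sub.
Qed.

Lemma totcard_pieces : (forall i, #|A i| <= n)%N -> totcard piece = totcard A.
Proof.
move=> An; rewrite /totcard -(pair_bigA _ (fun i b => #|piece (i, b)|)) /=.
apply: eq_bigr => i _.
have lt x : x \in A i -> (rank i x %/ 2 ^ h < n)%N.
  by move=> xA; apply: leq_ltn_trans (leq_div _ _) _; apply: leq_trans (rank_lt xA) (An i).
transitivity (\sum_(b < n) \sum_(x in A i) nat_of_bool (rank i x %/ 2 ^ h == b)%N).
  apply: eq_bigr => b _; rewrite -sum1_card big_mkcond [RHS]big_mkcond.
  by apply: eq_bigr => x _; rewrite inE /=; case: (x \in A i); case: eqP.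
rewrite exchange_big /= -sum1_card; apply: eq_bigr => x xA.
rewrite (bigD1 (Ordinal (lt x xA))) //= eqxx big1 ?addn0 // => b nb.
by apply: contraNeq nb; rewrite eqb0 negbK -val_eqE /= eq_sym.
Qed.

Lemma card_nonempty_pieces :
  (#|[set p | piece p != set0]| <= #|I| + totcard A %/ 2 ^ h)%N.
Proof.
have H : (0 < 2 ^ h)%N by rewrite expn_gt0.
apply: (@leq_trans (\sum_(i : I) (#|A i| %/ 2 ^ h).+1)).
  rewrite -sum1_card (eq_bigl (fun p => true && (piece (p.1, p.2) != set0))) => [|[i b]]; last by rewrite inE.
  rewrite -(pair_big_dep xpredT (fun i b => piece (i, b) != set0) (fun _ _ => 1%N)) /=.
  apply: leq_sum => i _; rewrite sum1_card -[X in (_ <= X)%N]card_ord.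
  have bnd b : piece (i, b) != set0 -> (b <= #|A i| %/ 2 ^ h)%N.
    case/set0Pn => x; rewrite inE => /andP[/= xA /eqP <-].
    by apply: leq_div2r; apply: ltnW; apply: rank_lt.
  have finj : {in [pred b | piece (i, b) != set0] &, injective (fun b : 'I_n => inord b : 'I_(#|A i| %/ 2 ^ h).+1)}.
    move=> b c; rewrite !inE => /bnd bb /bnd cc /(congr1 (@nat_of_ord _)).
    by rewrite !inordK // => /val_inj.
  by rewrite -(card_in_image finj) max_card.
under eq_bigr => i _ do rewrite -addn1.
rewrite big_split /= sum1_card addnC leq_add2l leq_divRL // big_distrl /=.
by apply: leq_sum => i _; apply: leq_divM.
Qed.
End Rank.

(** Pieces of about the average length T/n are few, at most 3n, and short enough that the term 2^h T
    of [reverse_offdiag] is dominated by D. *)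
Lemma reverse_orders_bound (I L : finType) (A : I -> {set L}) (pos : I -> L -> nat) (n h0 : nat) :
  reverse_family A pos -> (0 < n)%N -> (#|I| <= n)%N -> (#|L| <= n)%N -> (n <= 2 ^ h0)%N ->
  (totcard A ^ 2 <= 360 * n ^ 3 * h0.+1 ^ 2)%N.
Proof.
move=> rev n0 In Ln nh.
have An i : (#|A i| <= n)%N by apply: leq_trans Ln; apply: max_card.
set T := totcard A.
have Tn2 : (T <= n ^ 2)%N.
  rewrite -mulnn; apply: leq_trans (_ : (\sum_(i : I) n <= _)%N); first by apply: leq_sum.
  by rewrite sum_nat_const leq_mul2r In orbT.
have [small|big] := leqP T (2 * n).
  apply: (@leq_trans ((2 * n) ^ 2)); first by rewrite leq_exp2r.
  have : (1 <= h0.+1 ^ 2)%N by rewrite expn_gt0.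
  by move: (_ ^ 2)%N n0 => u; nia.
(* 2^h lies between T/(2n) and T/n up to rounding: at most 2n additional pieces, and 2^h T <= 2 D
   below. *)
pose h := trunc_log 2 (T %/ n).
have q1 : (2 <= T %/ n)%N by rewrite leq_divRL // ltnW.
have /andP[h1 h2] : (2 ^ h <= T %/ n < 2 ^ h.+1)%N by apply: trunc_log_bounds => //; lia.
have H0 : (0 < 2 ^ h)%N by rewrite expn_gt0.
have hh0 : (h <= h0)%N.
  rewrite -(leq_exp2l (m := 2)) //; apply: leq_trans h1 (leq_trans _ nh).
  by apply: leq_trans (leq_div2r n Tn2) _; rewrite -mulnn mulnK.
have TH : (T %/ 2 ^ h <= 2 * n)%N.
  apply: ltnW; rewrite ltn_divLR // -mulnA [(n * _)%N]mulnC mulnA -expnS -ltn_divLR //.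
have hT : (2 ^ h * n <= T)%N by rewrite -leq_divRL.
(* The energies need an ordered field; the rationals do for an inequality between integers. *)
pose R := rat.
have tE := totcard_pieces pos h An.
have main := @reverse_offdiag R _ L (piece A pos h (n := n)) (piece_pos A pos h (n := n)) h (3 * n)
  (reverse_pieces rev h n).

have L0 : (0 < #|L|)%N.
  rewrite lt0n; apply: contraL big => /eqP e; rewrite -leqNgt.
  suff -> : T = 0%N by [].
  by rewrite /T /totcard big1 // => i _; apply/eqP; rewrite -leqn0 -e max_card.
have := @offdiag_ge R _ L (piece A pos h (n := n)) L0.
rewrite tE -/T in main *.
set D := offdiag _ _ in main *.
move=> D1.
have {}D1 : T%:R ^+ 2 <= n%:R * (D + T%:R).
  apply: le_trans D1 _; rewrite ler_wpM2r ?ler_nat // addr_ge0 ?ler0n //.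
  by rewrite sumr_ge0 // => i _; rewrite sumr_ge0.
have {}main : D ^+ 2 <= (3 * n)%:R ^+ 2 * (4 * h.+1%:R * (h.+1%:R * D + (2 ^ h.+1)%:R * T%:R)).
  apply: main => [p x|].
    by rewrite inE => _; rewrite ltn_mod.
  apply: leq_trans (card_nonempty_pieces _ _ _ _) _; rewrite -/T; lia.
suff : T%:R ^+ 2 <= (360 * n ^ 3 * h.+1 ^ 2)%:R :> R.
  rewrite -natrX ler_nat => /leq_trans; apply; by rewrite leq_mul2l leq_exp2r ?ltnS ?hh0 ?orbT.
have bigR : (2 * n)%:R <= T%:R :> R by rewrite ler_nat ltnW.
have hTR : (2 ^ h * n)%:R <= T%:R :> R by rewrite ler_nat.
have n0R : 0 < n%:R :> R by rewrite ltr0n.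
have c1 : 1 <= h.+1%:R :> R by rewrite ler1n.
rewrite natrM in bigR; rewrite natrM natrX in hTR.
rewrite (natrM _ (360 * n ^ 3)) (natrM _ 360) !natrX; rewrite natrM natrX (exprS _ h) in main.
move: (T%:R) (n%:R) (h.+1%:R) (2 ^+ h) D n0R c1 bigR hTR D1 main => t m c e D' m0 c1 bigR hTR D1 main.
have D2 : t ^+ 2 <= 2 * m * D' by nra.
have e1 : m * (e * t) <= 2 * m * D'.
  apply: le_trans D2; nra.
have e2 : e * t <= 2 * D' by rewrite -(ler_pM2l m0); lra.
have D0 : 0 <= D' by nra.
(* With 2^h T absorbed this reads D^2 <= 180 n^2 (h + 1)^2 D. Dividing by D and using T^2 <= 2 n D
   gives the constant 360. *)
have m2 : D' ^+ 2 <= (3 * m) ^+ 2 * (4 * c * (5 * c * D')).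
  apply: le_trans main _; rewrite ler_wpM2l ?sqr_ge0 // ler_wpM2l ?mulr_ge0 //; try lra.
  by have := ler_peMl D0 c1; lra.
have m3 : D' <= 180 * m ^+ 2 * c ^+ 2.
  have [->|Dn] := eqVneq D' 0; first by have := sqr_ge0 (m * c); lra.
  have Dp : 0 < D' by rewrite lt0r Dn.
  rewrite -(ler_pM2l Dp); move: m2; lra.
apply: le_trans D2 _.
have : m * D' <= m * (180 * m ^+ 2 * c ^+ 2) by rewrite ler_wpM2l // ltW.
lra.
Qed.

(** * Polynomial partitioning *)

Section SignAverage.
Variable R : realFieldType.
Implicit Types (F G : (nat -> R) -> R) (s u v : nat -> R).

Definition upd s N e : nat -> R := fun k => if k == N then e else s k.

(** Expectation over independent uniform signs in the first N coordinates, as an iterated mean of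
    two values; the later coordinates are fixed to 1. *)
Fixpoint avg N F : R :=
  if N is N'.+1 then avg N' (fun s => (F (upd s N' 1) + F (upd s N' (-1))) / 2)
  else F (fun=> 1).

Lemma avg_le N F G : (forall s, F s <= G s) -> avg N F <= avg N G.
Proof.
elim: N F G => [|N IH] F G FG; first exact: FG.
by apply: IH => s; rewrite ler_pM2r ?invr_gt0 ?ltr0n // lerD.
Qed.

Lemma eq_avg N F G : F =1 G -> avg N F = avg N G.
Proof. by move=> FG; apply/le_anti; rewrite !avg_le // => s; rewrite FG. Qed.

Lemma avgD N F G : avg N (fun s => F s + G s) = avg N F + avg N G.
Proof.
elim: N F G => [//|N IH] F G /=.
by rewrite -IH; apply: eq_avg => s; field.
Qed.

Lemma avgZ N a F : avg N (fun s => a * F s) = a * avg N F.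
Proof.
elim: N F => [//|N IH] F /=.
by rewrite -IH; apply: eq_avg => s; field.
Qed.

Lemma avg_cst N a : avg N (fun=> a) = a.
Proof. by elim: N => [//|N IH] /=; rewrite -[RHS]IH; apply: eq_avg => s; field. Qed.

Lemma avg_sum N (I : finType) (P : pred I) (F : I -> (nat -> R) -> R) :
  avg N (fun s => \sum_(i | P i) F i s) = \sum_(i | P i) avg N (F i).
Proof.
elim: N F => [//|N IH] F /=.
by rewrite -IH; apply: eq_avg => s; rewrite -big_split mulr_suml.
Qed.

Lemma avg_attained N F : exists2 s, (forall k, s k ^+ 2 = 1) & F s <= avg N F.
Proof.
elim: N F => [|N IH] F; first by exists (fun=> 1) => // k; rewrite expr1n.
have [s s1 /= le] := IH (fun s => (F (upd s N 1) + F (upd s N (-1))) / 2).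
have ok e : e ^+ 2 = 1 -> forall k, upd s N e k ^+ 2 = 1.
  by move=> e1 k; rewrite /upd; case: eqP.
have [l|l] := leP (F (upd s N 1)) (F (upd s N (-1))).
  exists (upd s N 1); first by apply: ok; rewrite expr1n.
  by apply: le_trans le; lra.
exists (upd s N (-1)); first by apply: ok; rewrite sqrrN expr1n.
by apply: le_trans le; lra.
Qed.

Definition sdot N s u : R := \sum_(k < N) s k * u k.

Lemma sdot_upd N s e u : sdot N.+1 (upd s N e) u = sdot N s u + e * u N.
Proof.
rewrite /sdot big_ord_recr /= /upd eqxx; congr (_ + _).
by apply: eq_bigr => k _; rewrite ltn_eqF.
Qed.

Lemma avg_dot N u v : avg N (fun s => sdot N s u * sdot N s v) = sdot N u v.
Proof.
elim: N => [|N IH] /=; first by rewrite /sdot !big_ord0 mulr0.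
rewrite [RHS]big_ord_recr /= -/(sdot N u v) -IH -[u N * v N in RHS](avg_cst N) -avgD.
by apply: eq_avg => s; rewrite !sdot_upd; field.
Qed.

(** Signs have at most Gaussian fourth moments: each step of the recursion drops a term -2 u_k^2
    v_k^2. *)
Lemma avg_dot2 N u v : avg N (fun s => sdot N s u ^+ 2 * sdot N s v ^+ 2)
  <= sdot N u u * sdot N v v + 2 * sdot N u v ^+ 2.
Proof.
elim: N => [|N IH] /=; first by rewrite /sdot !big_ord0 expr0n /= !mul0r mulr0 addr0.
have -> : avg N (fun s => (sdot N.+1 (upd s N 1) u ^+ 2 * sdot N.+1 (upd s N 1) v ^+ 2 +
      sdot N.+1 (upd s N (-1)) u ^+ 2 * sdot N.+1 (upd s N (-1)) v ^+ 2) / 2)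
  = avg N (fun s => sdot N s u ^+ 2 * sdot N s v ^+ 2)
    + v N ^+ 2 * avg N (fun s => sdot N s u * sdot N s u)
    + u N ^+ 2 * avg N (fun s => sdot N s v * sdot N s v)
    + 4 * u N * v N * avg N (fun s => sdot N s u * sdot N s v) + u N ^+ 2 * v N ^+ 2.
  rewrite -!avgZ -[X in _ = _ + X](avg_cst N) -!avgD.
  by apply: eq_avg => s; rewrite !sdot_upd; field.
rewrite !avg_dot.
have rec a b : sdot N.+1 a b = sdot N a b + a N * b N by rewrite /sdot big_ord_recr.
rewrite !rec.
move: IH; move: (avg _ _) (sdot N u u) (sdot N v v) (sdot N u v) (u N) (v N) => a b c d x y. nra.
Qed.

(** The quartic touches |x| at |x| = 3/2. It turns moments into a Khintchine inequality: second
    moment 1 and fourth moment at most 3 give 1 - 3 * 4/27 = 5/9. *)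
Lemma norm_ge_quartic (x : R) : x ^+ 2 - 4 / 27 * x ^+ 4 <= `|x|.
Proof.
have <- : `|x| ^+ 2 = x ^+ 2 by rewrite real_normK ?num_real.
have -> : x ^+ 4 = `|x| ^+ 4 by rewrite -[4%N]/(2 * 2)%N !exprM real_normK ?num_real.
have : 0 <= `|x| by []. move: `|x| => y y0.
have : 0 <= y * ((1 - 2 / 3 * y) ^+ 2 * (1 + y / 3)).
  by rewrite mulr_ge0 // mulr_ge0 ?sqr_ge0 //; lra.
have -> : y * ((1 - 2 / 3 * y) ^+ 2 * (1 + y / 3)) = y - y ^+ 2 + 4 / 27 * y ^+ 4 by field.
lra.
Qed.

Lemma avg_norm_ge N u : sdot N u u = 1 -> 5 / 9 <= avg N (fun s => `|sdot N s u|).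
Proof.
move=> u1; have := avg_le N (fun s => norm_ge_quartic (sdot N s u)).
have -> : avg N (fun s => sdot N s u ^+ 2 - 4 / 27 * sdot N s u ^+ 4) =
   avg N (fun s => sdot N s u * sdot N s u) +
   (- (4 / 27)) * avg N (fun s => sdot N s u ^+ 2 * sdot N s u ^+ 2).
  by rewrite -avgZ -avgD; apply: eq_avg => s; field.
have := avg_dot2 N u u; rewrite avg_dot u1; lra.
Qed.

(** With z = x y, the right-hand side is (1 + z/10)^2 for negative z. The scale 1/10 lets the linear
    gain beat the quadratic error after averaging. *)
Lemma same_sign_le (x y : R) : (0 < x * y)%R%:R <= 1 - (`|x| * `|y| - x * y) / 10
   + (x ^+ 2 * y ^+ 2) / 100 :> R.
Proof.
rewrite -normrM -exprMn; move: (x * y) => z {x y}.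
have [z0|z0|<-] := ltgtP 0 z => /=.
- by rewrite gtr0_norm //; have := sqr_ge0 z; lra.
- by rewrite ltr0_norm //; have := sqr_ge0 (1 + z / 10); nra.
- by rewrite normr0; lra.
Qed.

Section Splitting.
Variables (X Q : finType) (c : X -> Q) (N : nat) (u : X -> nat -> R).
Hypothesis u1 : forall x, sdot N (u x) (u x) = 1.
Let T : R := \sum_x \sum_(y | c y == c x) 1.
Let W : R := \sum_x \sum_y sdot N (u x) (u y) ^+ 2.
Hypothesis WT : 10000 * W <= T.

(** A substitute for independence: with f x = |<s, u_x>| - 5/9, this positivity bounds the sum of
    the products |<s, u_x>| |<s, u_y>| over common cells from below by an expression linear in each
    absolute value, whose mean [avg_norm_ge] controls. *)
Lemma class_psd (f : X -> R) : 0 <= \sum_x \sum_(y | c y == c x) f x * f y.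
Proof.
rewrite (partition_big c predT) //=; apply: sumr_ge0 => q _.
have -> : \sum_(x | c x == q) \sum_(y | c y == c x) f x * f y = (\sum_(x | c x == q) f x) ^+ 2.
  rewrite expr2 big_distrl /=; apply: eq_bigr => x /eqP <-; by rewrite big_distrr.
exact: sqr_ge0.
Qed.

(** On average a pair of a common cell contributes at most 1 - 25/810 + 1/2000 + 1/100 plus about
    five times its squared inner product; by [WT] these squares sum to at most T/10000. *)
Lemma exists_splitting_signs : exists2 s, (forall k, s k ^+ 2 = 1) &
  \sum_x \sum_(y | c y == c x) (0 < sdot N s (u x) * sdot N s (u y))%R%:R <= 99 / 100 * T.
Proof.
pose F s : R := \sum_x \sum_(y | c y == c x) (0 < sdot N s (u x) * sdot N s (u y))%R%:R.
have [s s1 le] := avg_attained N F; exists s => //; apply: le_trans le _.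
pose G s x y : R := 1 + (sdot N s (u x) * sdot N s (u y)) / 10
   + (sdot N s (u x) ^+ 2 * sdot N s (u y) ^+ 2) / 100
   - (5 / 9 * `|sdot N s (u x)| + 5 / 9 * `|sdot N s (u y)| - 25 / 81) / 10.
apply: (@le_trans _ _ (avg N (fun s => \sum_x \sum_(y | c y == c x) G s x y))).
  apply: avg_le => t; have := class_psd (fun x => `|sdot N t (u x)| - 5 / 9).
  rewrite -subr_ge0 => psd; rewrite -subr_ge0.
  have : 0 <= \sum_x \sum_(y | c y == c x) (1 - (`|sdot N t (u x)| * `|sdot N t (u y)| - sdot N t (u x) * sdot N t (u y)) / 10
   + (sdot N t (u x) ^+ 2 * sdot N t (u y) ^+ 2) / 100 - (0 < sdot N t (u x) * sdot N t (u y))%R%:R).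
    by apply: sumr_ge0 => x _; apply: sumr_ge0 => y _; rewrite subr_ge0 same_sign_le.
  move=> h; have := addr_ge0 h (mulr_ge0 (_ : 0 <= 10^-1) psd); rewrite subr0 invr_ge0 ler0n => /(_ isT).
  rewrite mulr_sumr -big_split /= /F -sumrB; congr (_ <= _).
  apply: eq_bigr => x _; rewrite mulr_sumr -big_split /= -sumrB.
  by apply: eq_bigr => y _; rewrite /G; field.
rewrite avg_sum.
under eq_bigr => x _ do rewrite avg_sum.
have Gle x y : avg N (fun s => G s x y) <= 1 - 25 / 810 + (1 / 200 + sdot N (u x) (u y) ^+ 2 * 50) / 10
     + (1 + 2 * sdot N (u x) (u y) ^+ 2) / 100.
  have -> : avg N (fun s => G s x y) = 1 + 25 / 810 + 10^-1 * avg N (fun s => sdot N s (u x) * sdot N s (u y))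
     + 100^-1 * avg N (fun s => sdot N s (u x) ^+ 2 * sdot N s (u y) ^+ 2)
     + (- (5 / 90)) * avg N (fun s => `|sdot N s (u x)|) + (- (5 / 90)) * avg N (fun s => `|sdot N s (u y)|).
    by rewrite -[1 + 25 / 810](avg_cst N) -!avgZ -!avgD; apply: eq_avg => t; rewrite /G; field.
  have := avg_norm_ge (u1 x); have := avg_norm_ge (u1 y).
  have := avg_dot2 N (u x) (u y); rewrite !u1 avg_dot.
  have := sqr_ge0 (sdot N (u x) (u y) * 100 - 1).
  lra.
apply: (@le_trans _ _ (\sum_x \sum_(y | c y == c x) (1 - 25 / 810 + 1 / 2000 + 1 / 100 + (5 + 1 / 50) * sdot N (u x) (u y) ^+ 2))).
  by apply: ler_sum => x _; apply: ler_sum => y _; apply: le_trans (Gle x y) _; lra.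
have -> : \sum_x \sum_(y | c y == c x) (1 - 25 / 810 + 1 / 2000 + 1 / 100 + (5 + 1 / 50) * sdot N (u x) (u y) ^+ 2)
   = (1 - 25 / 810 + 1 / 2000 + 1 / 100) * T + (5 + 1 / 50) * \sum_x \sum_(y | c y == c x) sdot N (u x) (u y) ^+ 2.
  rewrite /T !mulr_sumr -big_split /=; apply: eq_bigr => x _.
  by rewrite !mulr_sumr -big_split /=; apply: eq_bigr => y _; rewrite mulr1.
have : \sum_x \sum_(y | c y == c x) sdot N (u x) (u y) ^+ 2 <= W.
  apply: ler_sum => x _; rewrite [X in _ <= X](bigID (fun y => c y == c x)) /= lerDl.
  by apply: sumr_ge0 => y _; rewrite sqr_ge0.
have : 0 <= T by apply: sumr_ge0 => x _; apply: sumr_ge0.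
move: WT; lra.
Qed.
End Splitting.
End SignAverage.

Lemma prod_ord_const (R : pzSemiRingType) n (x : R) : \prod_(i < n) x = x ^+ n.
Proof. by rewrite prodr_const card_ord. Qed.

(** * Isotropic position *)

Section Isotropic.
Variable (R : realType).

Definition dotv N (v w : 'rV[R]_N) : R := \sum_k v 0 k * w 0 k.
Local Notation nv v := (dotv v v).

Lemma nv_ge0 N (v : 'rV_N) : 0 <= nv v.
Proof. by apply: sumr_ge0 => k _; rewrite -expr2 sqr_ge0. Qed.

Lemma dotvDl N (u v w : 'rV_N) : dotv (u + v) w = dotv u w + dotv v w.
Proof. by rewrite /dotv -big_split; apply: eq_bigr => k _; rewrite mxE mulrDl. Qed.

Lemma dotvZl N a (u w : 'rV_N) : dotv (a *: u) w = a * dotv u w.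
Proof. by rewrite /dotv mulr_sumr; apply: eq_bigr => k _; rewrite mxE mulrA. Qed.

Lemma dotvC N (u v : 'rV_N) : dotv u v = dotv v u.
Proof. by apply: eq_bigr => k _; rewrite mulrC. Qed.

Lemma dotvE N (u v : 'rV_N) : dotv u v = (u *m v^T) 0 0.
Proof. by rewrite mxE; apply: eq_bigr => k _; rewrite mxE. Qed.

(** Hadamard's inequality up to a factor (N!)^2, from Cauchy-Schwarz on the Leibniz formula; it only
    serves to bound a potential. *)
Lemma det_sqr_le N (B : 'M[R]_N) :
  \det B ^+ 2 <= #|[set: {perm 'I_N}]|%:R ^+ 2 * \prod_j nv (row j B).
Proof.
rewrite /determinant; apply: le_trans (sqr_sum_le_card _ _) _.
rewrite (@eq_card _ _ [set: {perm 'I_N}]) => [|s]; last by rewrite inE.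
rewrite [X in _ <= X * _]expr2 -mulrA ler_wpM2l ?ler0n //.
set P := \prod_j _; have -> : #|[set: {perm 'I_N}]|%:R * P = \sum_(s : {perm 'I_N}) P.
  by rewrite sumr_const cardsT mulr_natl.
apply: ler_sum => s _.
rewrite exprMn sqrr_sign mul1r -prodrXl; apply: ler_prod => j _.
rewrite sqr_ge0 /= /dotv (bigD1 (s j)) //= mxE -expr2 lerDl.
by apply: sumr_ge0 => k _; rewrite -expr2 sqr_ge0.
Qed.

(** Two block factorizations of one bordered matrix. *)
Lemma det_rank1 N (a : R) (v : 'rV[R]_N) : \det (1%:M - a *: (v^T *m v)) = 1 - a * nv v.
Proof.
pose X := block_mx 1%:M v (a *: v^T) 1%:M : 'M_(1 + N).
have e1 : \det X = \det (1%:M - a *: (v^T *m v)).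
  have -> : X = block_mx 1%:M 0 (a *: v^T) 1%:M *m block_mx 1%:M v 0 (1%:M - a *: (v^T *m v)).
    by rewrite mulmx_block !mul1mx !mulmx1 !mul0mx ?mulmx0 !addr0 -scalemxAl addrC subrK.
  by rewrite det_mulmx det_lblock det_ublock !det1 !mul1r.
have e2 : \det X = 1 - a * nv v.
  have -> : X = block_mx (1 - a * nv v)%:M v 0 1%:M *m block_mx 1%:M 0 (a *: v^T) 1%:M.
    rewrite mulmx_block !mul1mx !mulmx1 !mul0mx ?mulmx0 !add0r -scalemxAr; congr block_mx.
    by apply/matrixP => i j; rewrite !ord1 !mxE /= dotvE mxE mulr1n subrK.
  by rewrite det_mulmx det_lblock det_ublock !det1 !mulr1 det_scalar1.
by rewrite -e1 e2.
Qed.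

Variables (N' m : nat).
Let N := N'.+1.
Let M := m.+1.
Variable phi : 'I_M -> 'rV[R]_N.
(** N cyclically consecutive vectors. Over all windows every vector occurs exactly N times, which
    matches the exponent N in [iso_potential]. *)
Definition window (i : 'I_M) : 'M[R]_N := \matrix_(j < N) phi (inZp (i + j)).
Hypothesis generic : forall i : 'I_M, \det (window i) != 0.

Lemma nv_generic A x : \det A != 0 -> 0 < nv (phi x *m A).
Proof.
move=> A0; rewrite lt0r nv_ge0 andbT; apply/negP => /eqP e.
have : 0 < \det (window x *m A) ^+ 2.
  by rewrite det_mulmx lt0r sqr_ge0 sqrf_eq0 mulf_neq0.
rewrite ltNge => /negP[]; apply: le_trans (det_sqr_le _) _; rewrite (bigD1 ord0) //=.
by rewrite row_mul rowK addn0 valZpK e mul0r mulr0.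
Qed.

(** Invariant under scaling of A. Near its supremum, the vectors [phi x *m A] are close to radially
    isotropic position, as in Barthe and Forster. *)
Definition iso_potential A := \det A ^+ (2 * M) / \prod_x nv (phi x *m A) ^+ N.

Lemma iso_potential_gt0 A : \det A != 0 -> 0 < iso_potential A.
Proof.
move=> A0; rewrite divr_gt0 ?prodr_gt0 // => [|x _]; last by rewrite exprn_gt0 ?nv_generic.
by rewrite exprM exprn_gt0 // lt0r sqr_ge0 sqrf_eq0 A0.
Qed.

(** Hadamard's inequality for all windows at once: multiplied together they contain each squared
    norm N times and \det A ^ (2M). *)
Lemma iso_potential_bounded : exists B, forall A, \det A != 0 -> iso_potential A <= B.
Proof.
pose c : R := #|[set: {perm 'I_N}]|%:R ^+ 2.
exists (c ^+ M / \prod_i \det (window i) ^+ 2) => A A0.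
have wp : 0 < \prod_i \det (window i) ^+ 2.
  by apply: prodr_gt0 => i _; rewrite lt0r sqr_ge0 sqrf_eq0 generic.
rewrite ler_pdivlMr // mulrAC ler_pdivrMr; last first.
  by apply: prodr_gt0 => x _; rewrite exprn_gt0 ?nv_generic.
have -> : \det A ^+ (2 * M) * \prod_i \det (window i) ^+ 2 = \prod_i \det (window i *m A) ^+ 2.
  under [RHS]eq_bigr => i _ do rewrite det_mulmx exprMn.
  by rewrite [RHS]big_split /= prod_ord_const -exprM mulrC.
have -> : c ^+ M * \prod_x nv (phi x *m A) ^+ N = \prod_(i : 'I_M) (c * \prod_j nv (row j (window i *m A))).
  rewrite big_split /= prod_ord_const; congr (_ * _).
  rewrite exchange_big /=.
  transitivity (\prod_(j < N) \prod_x nv (phi x *m A)).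
    by rewrite prod_ord_const prodrXl.
  apply: eq_bigr => j _; rewrite (reindex_inj (addIr (inZp j : 'I_M))) /=.
  apply: eq_bigr => i _; rewrite row_mul rowK.
  by have -> : i + inZp j = inZp (i + j) by apply: val_inj; rewrite /= modnDmr.
by apply: ler_prod => i _; rewrite sqr_ge0 det_sqr_le.
Qed.

Definition cos2 (v w : 'rV[R]_N) := dotv v w ^+ 2 / (nv v * nv w).

Lemma prod_1B_le (I : finType) (a : I -> R) : (forall i, 0 <= a i <= 1) ->
  \prod_i (1 - a i) * (1 + \sum_i a i) <= 1.
Proof.
move=> a01; apply: (@le_trans _ _ (\prod_i (1 - a i) * \prod_i (1 + a i))).
  rewrite ler_wpM2l ?prodr_ge0 // => [i _|]; first by have := a01 i; lra.
  have : 0 <= \sum_i a i /\ 1 + \sum_i a i <= \prod_i (1 + a i); last by case.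
  elim/big_ind2: _ => [|x y z t [x0 xy] [z0 zt]|i _]; first by rewrite addr0.
    split; first exact: addr_ge0.
    apply: (@le_trans _ _ ((1 + x) * (1 + z))); first by have := mulr_ge0 x0 z0; lra.
    by apply: ler_pM => //; rewrite addr_ge0.
  by have := a01 i; case/andP.
rewrite -big_split /=; apply: prodr_ile1 => i _; have := a01 i; nra.
Qed.

(** Shrink the direction of [w] by 1 - d. The numerator keeps at least 1 - M k, about 3/4, while the
    denominator falls by at least 1 + 2 M k, about 3/2, because w is correlated with too many
    vectors; 9/8 exceeds 11/10. *)
Lemma iso_improve A x : \det A != 0 ->
  2 * M%:R < N%:R * \sum_y cos2 (phi x *m A) (phi y *m A) ->
  exists2 A', \det A' != 0 & 11 / 10 * iso_potential A <= iso_potential A'.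
Proof.
move=> A0 big; have nv0 y := nv_generic y A0.
pose w := phi x *m A; pose d : R := (8 * M%:R)^-1; pose k := 2 * d - d ^+ 2.
have M0 : 0 < M%:R :> R by rewrite ltr0n.
have M1 : 1 <= M%:R :> R by rewrite ler1n.
have dM : d * M%:R = 1 / 8 by rewrite /d; field; apply: lt0r_neq0.
have d0 : 0 < d by rewrite invr_gt0; lra.
have d1 : d <= 1 / 8 by nra.
pose A' := A *m (1%:M - (d / nv w) *: (w^T *m w)).
have dA' : \det A' = \det A * (1 - d).
  by rewrite det_mulmx det_rank1 -mulrA mulVf ?mulr1 // lt0r_neq0 ?nv0.
have dA'0 : \det A' != 0 by rewrite dA' mulf_neq0 //; apply: lt0r_neq0; lra.
exists A' => //.
pose c y := cos2 w (phi y *m A).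
have nA' y : nv (phi y *m A') = nv (phi y *m A) * (1 - k * c y).
  set z := phi y *m A.
  have -> : phi y *m A' = z + (- (d * dotv w z / nv w)) *: w.
    rewrite mulmxA mulmxBr mulmx1 -/z -scalemxAr scaleNr; congr (_ - _).
    rewrite mulmxA (mx11_scalar (z *m w^T)) -dotvE mul_scalar_mx scalerA dotvC.
    by congr (_ *: _); field; apply: lt0r_neq0; apply: nv0.
  rewrite dotvDl dotvZl ![dotv _ (_ + _)]dotvC !dotvDl !dotvZl /c /cos2 -/z /k.
  rewrite [dotv z w]dotvC.
  have := lt0r_neq0 (nv0 y); have := lt0r_neq0 (nv0 x); rewrite -/z -/w => h1 h2.
  by field; rewrite h1 h2.
have c0 y : 0 <= c y by rewrite divr_ge0 ?sqr_ge0 // mulr_ge0 ?nv_ge0.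
have k0 : 0 < k by rewrite /k; nra.
have kc y : 0 <= k * c y <= 1.
  rewrite mulr_ge0 ?(ltW k0) //=; have := nv_ge0 (phi y *m A').
  by rewrite nA' pmulr_rge0 ?nv0 // subr_ge0.
have PE : iso_potential A' = iso_potential A * ((1 - k) ^+ M / (\prod_y (1 - k * c y)) ^+ N).
  rewrite /iso_potential dA' exprMn [(1 - d) ^+ _]exprM.
  have -> : (1 - d) ^+ 2 = 1 - k by rewrite /k; ring.
  under eq_bigr => y _ do rewrite nA' exprMn.
  rewrite big_split /= prodrXl.
  have p1 : \prod_y nv (phi y *m A) ^+ N != 0.
    by apply: lt0r_neq0; apply: prodr_gt0 => y _; rewrite exprn_gt0.
  have p2 : \prod_y (1 - k * c y) ^+ N != 0.
    apply: lt0r_neq0; apply: prodr_gt0 => y _; rewrite exprn_gt0 //.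
    by rewrite -(pmulr_rgt0 _ (nv0 y)) -nA' nv_generic.
  rewrite -prodrXl; move: p1 p2; rewrite -!prodrXl.
  by move=> p1 p2; field; rewrite p1 p2.
rewrite PE mulrC ler_pM2l ?iso_potential_gt0 //.
pose Pr := \prod_y (1 - k * c y).
have Pr0 : 0 < Pr.
  apply: prodr_gt0 => y _; by rewrite -(pmulr_rgt0 _ (nv0 y)) -nA' nv_generic.
rewrite ler_pdivlMr ?exprn_gt0 //.
set s := \sum_y c y; have s0 : 0 <= s by apply: sumr_ge0.
have Prs : Pr * (1 + k * s) <= 1 by rewrite /s mulr_sumr; apply: prod_1B_le.
have ks0 : 0 <= k * s by rewrite mulr_ge0 // ltW.
have bern (a : R) j : 0 <= a -> 1 + j%:R * a <= (1 + a) ^+ j.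
  move=> a0; elim: j => [|j IH]; first by rewrite mul0r addr0 expr0.
  rewrite exprS -natr1; have := mulr_ge0 (ler0n R j) (sqr_ge0 a).
  have : (1 + a) * (1 + j%:R * a) <= (1 + a) * (1 + a) ^+ j by rewrite ler_wpM2l //; lra.
  lra.
have bern' (a : R) j : 0 <= a <= 1 -> 1 - j%:R * a <= (1 - a) ^+ j.
  move=> /andP[a0 a1]; elim: j => [|j IH]; first by rewrite mul0r subr0 expr0.
  rewrite exprS -natr1; have := mulr_ge0 (ler0n R j) (sqr_ge0 a).
  have : (1 - a) * (1 - j%:R * a) <= (1 - a) * (1 - a) ^+ j by rewrite ler_wpM2l //; lra.
  lra.
have b1 : Pr ^+ N * (1 + 2 * M%:R * k) <= 1.
  apply: (@le_trans _ _ (Pr ^+ N * (1 + k * s) ^+ N)).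
    rewrite ler_wpM2l ?exprn_ge0 ?(ltW Pr0) //; apply: le_trans (bern _ N ks0).
    have bigs : 2 * M%:R < N%:R * s := big.
    by have := ler_wpM2l (ltW k0) (ltW bigs); lra.
  by rewrite -exprMn exprn_ile1 // mulr_ge0 ?(ltW Pr0) //; lra.
have b2 : 1 - M%:R * k <= (1 - k) ^+ M by apply: bern'; rewrite (ltW k0) /=; rewrite /k; nra.
have Mk : M%:R * k = 1 / 4 - d / 8 by rewrite /k; nra.
apply: le_trans b2; rewrite Mk; move: b1.
have -> : 2 * M%:R * k = 1 / 2 - d / 4 by rewrite -mulrA Mk; field.
have : 0 <= Pr ^+ N by rewrite exprn_ge0 ?(ltW Pr0).
by move: (Pr ^+ N) => p p0 b1; nra.
Qed.

(** Each failure allows an increase of the bounded potential by a factor 11/10, so finitely many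
    improvements suffice and no maximizer has to exist. *)
Lemma isotropic_position : exists2 A, \det A != 0 &
  forall x, N%:R * \sum_y cos2 (phi x *m A) (phi y *m A) <= 2 * M%:R.
Proof.
pose good A := [forall x, N%:R * \sum_y cos2 (phi x *m A) (phi y *m A) <= 2 * M%:R].
have [B BA] := iso_potential_bounded.
suff : exists2 A, \det A != 0 & good A by case=> A A0 /forallP gA; exists A.
have [A A0 [//|gA]] : exists2 A, \det A != 0 & good A \/ B < iso_potential A; last first.
- by have := BA A A0; rewrite leNgt gA.
- by exists A.
have p1 : 0 < iso_potential 1%:M by rewrite iso_potential_gt0 ?det1 ?oner_neq0.
have step j : exists2 A, \det A != 0 &
    good A \/ (1 + j%:R / 10) * iso_potential 1%:M <= iso_potential A.
  elim: j => [|j [A A0 [gA|le]]].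
  - by exists 1%:M; rewrite ?det1 ?oner_neq0 //; right; rewrite mul0r addr0 mul1r.
  - by exists A => //; left.
  have [gA|/forallPn[x]] := boolP (good A); first by exists A => //; left.
  rewrite -ltNge => /(iso_improve A0)[A' A'0 le']; exists A' => //; right.
  apply: le_trans le'; rewrite -natr1.
  have := mulr_ge0 (ler0n R j) (ltW p1); lra.
have [A A0 h] := step (Num.bound (10 * `|B| / iso_potential 1%:M)).
exists A => //; case: h => [gA|le]; [by left|right; apply: lt_le_trans le].
have b0 : 0 <= 10 * `|B| / iso_potential 1%:M.
  by apply: divr_ge0; [apply: mulr_ge0|exact: ltW].
have := archi_boundP b0; rewrite ltr_pdivrMr //.
have := ler_norm B; lra.
Qed.

(** Isotropy gives W <= 2 M^2 / N, which the hypothesis turns into [WT]; the sign vector found for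
    the normalized images is pulled back by the transpose of A. *)
Lemma generic_splitting (Q : finType) (c : 'I_M -> Q) :
  20000 * M%:R ^+ 2 <= N%:R * \sum_x \sum_(y | c y == c x) 1 :> R ->
  exists2 v : 'rV[R]_N, v != 0 & \sum_x \sum_(y | c y == c x)
     (0 < dotv (phi x) v * dotv (phi y) v)%R%:R <= 99 / 100 * \sum_x \sum_(y | c y == c x) 1 :> R.
Proof.
set T := \sum_x _ => bigT; have [A A0 iso] := isotropic_position.
pose w x := phi x *m A.
have w0 x : 0 < nv (w x) by apply: nv_generic.
have q0 x : 0 < Num.sqrt (nv (w x)) by rewrite sqrtr_gt0.
pose u x k : R := w x 0 (inord k) / Num.sqrt (nv (w x)).
have uE x y : sdot N (u x) (u y) = dotv (w x) (w y) / (Num.sqrt (nv (w x)) * Num.sqrt (nv (w y))).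
  rewrite /sdot /dotv mulr_suml; apply: eq_bigr => k _; rewrite /u inord_val.
  have := lt0r_neq0 (q0 x); have := lt0r_neq0 (q0 y) => h1 h2.
  by field; rewrite h1 h2.
have u1 x : sdot N (u x) (u x) = 1.
  by rewrite uE -expr2 sqr_sqrtr ?nv_ge0 // divff // lt0r_neq0.
have u2 x y : sdot N (u x) (u y) ^+ 2 = cos2 (w x) (w y).
  by rewrite uE expr_div_n exprMn !sqr_sqrtr ?nv_ge0.
have N0 : 0 < N%:R :> R by rewrite ltr0n.
have WT : 10000 * (\sum_x \sum_y sdot N (u x) (u y) ^+ 2) <= T.
  rewrite -(ler_pM2l N0); apply: le_trans bigT.
  have : \sum_x N%:R * \sum_y sdot N (u x) (u y) ^+ 2 <= \sum_(x : 'I_M) 2 * M%:R.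
    by apply: ler_sum => x _; apply: le_trans (iso x); under eq_bigr => y _ do rewrite u2.
  rewrite -mulr_sumr sumr_const card_ord -[_ *+ M]mulr_natr; lra.
have [s s1 le] := exists_splitting_signs u1 WT.
pose sv : 'rV[R]_N := \row_k s k.
have sv0 : sv != 0.
  apply/eqP => /rowP/(_ ord0); rewrite !mxE => e.
  by have /eqP := s1 0%N; rewrite e expr0n eq_sym oner_eq0.
exists (sv *m A^T).
  apply: contraNneq sv0 => e; apply/eqP.
  have AU : A^T \in unitmx by rewrite unitmx_tr unitmxE unitfE.
  by rewrite -[sv](mulmxK AU) e mul0mx.
have dE x : dotv (phi x) (sv *m A^T) = Num.sqrt (nv (w x)) * sdot N s (u x).
  rewrite dotvE trmx_mul trmxK mulmxA -/(w x) -dotvE /dotv /sdot mulr_sumr.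
  apply: eq_bigr => k _; rewrite [sv 0 k]mxE /u inord_val.
  by field; rewrite lt0r_neq0 ?q0.
apply: le_trans le; apply: ler_sum => x _; apply: ler_sum => y _.
by rewrite !dE mulrACA pmulr_rgt0 // mulr_gt0.
Qed.
End Isotropic.

From mathcomp Require boolp classical_sets topology normedtype.

Module BolzanoWeierstrass.
Import boolp classical_sets topology normedtype numFieldNormedType.Exports.
Local Open Scope classical_set_scope.

(** Lets a vanishing perturbation pass to the limit in [sign_splitting]. *)
Lemma box_cluster (R : realType) N (u : nat -> 'rV[R]_N.+1) :
  (forall k j, `|u k 0 j| <= 1) ->
  exists v : 'rV[R]_N.+1, forall (d : R) K, 0 < d ->
    exists2 k, (K <= k)%N & forall j, `|v 0 j - u k 0 j| < d.
Proof.
move=> u1; pose A := [set v : 'rV[R]_N.+1 | forall j, `[-1, 1]%classic (v 0 j)].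
have cA : compact A by apply: (@rV_compact R N.+1 (fun=> `[-1, 1]%classic)) => j; apply: segment_compact.
have FA : (u @ \oo) A.
  by exists 0%N => // k _ j /=; rewrite in_itv /= -ler_norml.
have [v [_ cl]] := cA (u @ \oo) _ FA; exists v => d K d0.
have B1 : (u @ \oo) [set w | exists2 k, (K <= k)%N & w = u k].
  by exists K => // k /= Kk; exists k.
have B2 : nbhs v (ball v d) by apply: nbhsx_ballx.
have [w [[k Kk ->] /= bw]] := cl _ _ B1 B2.
exists k => // j; have [_ /(_ 0 j)] := bw.
by rewrite -ball_normE.
Qed.
End BolzanoWeierstrass.

(** * Removing the genericity assumption *)

Section SignSplitting.
Variable R : realType.

Lemma exists_nonroot (q : {poly R}) (e : R) : q != 0 -> 0 < e ->
  exists2 x, 0 < x < e & ~~ root q x.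
Proof.
move=> q0 e0; pose rs := [seq e / k.+2%:R | k <- iota 0 (size q)].
have urs : uniq rs.
  rewrite map_inj_uniq ?iota_uniq // => a b.
  move/(mulfI (lt0r_neq0 e0))/invr_inj/eqP; rewrite eqr_nat => /eqP[] //.
have : ~~ all (root q) rs.
  by apply: contraTN isT => ars; have := max_poly_roots q0 ars urs; rewrite size_map size_iota ltnn.
move/allPn => [x /mapP[k _ ->] nx]; exists (e / k.+2%:R) => //.
rewrite divr_gt0 ?ltr0n //= ltr_pdivrMr ?ltr0n //.
by rewrite -[X in X < _]mulr1 ltr_pM2l // ltr1n.
Qed.

Section Perturb.
Variables (N' m : nat).
Let N := N'.+1.
Let M := m.+1.
Hypothesis NM : (N <= M)%N.
Variable phi : 'I_M -> 'rV[R]_N.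
(** Points of the moment curve: their windows are Vandermonde matrices, so adding a small multiple
    can make any family generic. *)
Definition moment (x : 'I_M) : 'rV[R]_N := \row_k (x%:R ^+ k).

Lemma window_moment i : \det (window moment i) != 0.
Proof.
rewrite -det_tr.
have -> : (window moment i)^T = Vandermonde N (\row_(j < N) (inZp (i + j) : 'I_M)%:R).
  by apply/matrixP => k j; rewrite !mxE.
rewrite det_Vandermonde; apply/prodf_neq0 => a _; apply/prodf_neq0 => b ab.
rewrite !mxE subr_eq0 eqr_nat /=; apply: contraTN ab => /eqP e.
have : (i + b == i + a %[mod M])%N by rewrite e.
rewrite eqn_modDl !modn_small; [|exact: leq_trans (ltn_ord a) NM|exact: leq_trans (ltn_ord b) NM].
by move=> /eqP ->; rewrite ltnn.
Qed.

(** As a function of t, the determinant of window i vanishes only at eigenvalues of [C i]; a product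
    of characteristic polynomials has nonroots arbitrarily close to 0. *)
Lemma exists_generic_perturbation (e : R) : 0 < e -> exists2 t, 0 < t < e &
  forall i, \det (window (fun x => phi x + t *: moment x) i) != 0.
Proof.
move=> e0; pose C i := - (window phi i *m invmx (window moment i)).
have qn0 : \prod_i char_poly (C i) != 0.
  by apply/prodf_neq0 => i _; apply: monic_neq0; apply: char_poly_monic.
have [t te nr] := exists_nonroot qn0 e0; exists t => // i.
apply: contraNneq nr => /eqP/det0P[v v0 ve].
suff /rootP ht : root (char_poly (C i)) t by rewrite rootE horner_prod (bigD1 i) //= ht mul0r.
rewrite -eigenvalue_root_char; apply/eigenvalueP; exists v => //.
have U : window moment i \in unitmx by rewrite unitmxE unitfE window_moment.
have {}ve : v *m window phi i + t *: (v *m window moment i) = 0.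
  rewrite -ve scalemxAr -mulmxDr; congr (_ *m _); apply/matrixP => a b; by rewrite !mxE.
rewrite /C mulmxN mulmxA; move/eqP: ve; rewrite addr_eq0 => /eqP ->.
by rewrite mulNmx opprK -scalemxAl mulmxK.
Qed.
End Perturb.

(** If N > M, a vector orthogonal to all phi x makes every product 0. Otherwise perturb, split,
    normalize in the sup norm and pass to a limit: a positive product at the limit stays positive
    for a small perturbation, so the limit has no more such pairs. *)
Lemma sign_splitting N M (Q : finType) (phi : 'I_M -> 'rV[R]_N) (c : 'I_M -> Q) :
  (0 < N)%N ->
  20000 * M%:R ^+ 2 <= N%:R * \sum_x \sum_(y | c y == c x) 1 :> R ->
  exists2 v : 'rV[R]_N, v != 0 & \sum_x \sum_(y | c y == c x)
     (0 < dotv (phi x) v * dotv (phi y) v)%R%:R <= 99 / 100 * \sum_x \sum_(y | c y == c x) 1 :> R.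
Proof.
move=> N0; have [MN|NM] := ltnP M N => big.
  pose A : 'M[R]_(N, M) := \matrix_(k, x) phi x 0 k.
  have : kermx A != 0.
    by rewrite -mxrank_eq0 mxrank_ker -lt0n subn_gt0; apply: leq_ltn_trans (rank_leq_col _) MN.
  move/rowV0Pn => [v /sub_kermxP vA v0]; exists v => //.
  have z x : dotv (phi x) v = 0.
    have /rowP/(_ x) := vA; rewrite !mxE => <-.
    by apply: eq_bigr => k _; rewrite mxE mulrC.
  have -> : \sum_x \sum_(y | c y == c x) (0 < dotv (phi x) v * dotv (phi y) v)%R%:R = 0 :> R.
    by apply: big1 => x _; apply: big1 => y _; rewrite z mul0r ltxx.
  rewrite mulr_ge0 //; first by lra.
  by apply: sumr_ge0 => x _; apply: sumr_ge0.
case: N N0 NM phi big => // N' _; case: M c => // m c NM phi.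
set T := \sum_x _ => big.
pose M := m.+1; pose N := N'.+1.
have ex k : exists v : 'rV[R]_N, exists2 t, 0 < t < k.+1%:R^-1 &
   [/\ forall j, `|v 0 j| <= 1, exists j, `|v 0 j| = 1 &
    \sum_x \sum_(y | c y == c x)
     (0 < dotv (phi x + t *: moment N' x) v * dotv (phi y + t *: moment N' y) v)%R%:R <= 99 / 100 * T].
  have k0 : 0 < k.+1%:R^-1 :> R by rewrite invr_gt0 ltr0n.
  have [t tk gen] := exists_generic_perturbation NM phi k0.
  have [v v0 vT] := generic_splitting gen big.
  have [j0 _ jmax] : exists2 j0, true & forall j, `|v 0 j| <= `|v 0 j0|.
    have [j0 _ h] := @arg_maxP _ _ _ (ord0 : 'I_N) xpredT (fun j => `|v 0 j|) isT.
    by exists j0 => // j; apply: h.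
  have a0 : 0 < `|v 0 j0|.
    rewrite normr_gt0; apply: contraNneq v0 => e; apply/eqP/rowP => j.
    by have := jmax j; rewrite e normr0 normr_le0 mxE => /eqP.
  exists (`|v 0 j0|^-1 *: v); exists t => //; split.
  - by move=> j; rewrite mxE normrM normfV normr_id mulrC ler_pdivrMr // mul1r.
  - by exists j0; rewrite mxE normrM normfV normr_id mulVf // lt0r_neq0.
  apply: le_trans vT; apply: ler_sum => x _; apply: ler_sum => y _.
  rewrite ![dotv _ (_ *: _)]dotvC !dotvZl mulrACA pmulr_rgt0; last by rewrite mulr_gt0 ?invr_gt0.
  by rewrite ![dotv v _]dotvC.
have [u uP] : exists u : nat -> 'rV[R]_N, forall k, exists2 t, 0 < t < k.+1%:R^-1 &
   [/\ forall j, `|u k 0 j| <= 1, exists j, `|u k 0 j| = 1 &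
    \sum_x \sum_(y | c y == c x)
     (0 < dotv (phi x + t *: moment N' x) (u k) * dotv (phi y + t *: moment N' y) (u k))%R%:R <= 99 / 100 * T].
  by exists (fun k => proj1_sig (boolp.cid (ex k))) => k; case: (boolp.cid _).
have u1 k j : `|u k 0 j| <= 1 by case: (uP k) => t _ [].
have [v vcl] := BolzanoWeierstrass.box_cluster u1.
exists v.
  have h0 : 0 < 1 / 2 :> R by lra.
  have [k _ kv] := vcl (1 / 2) 0%N h0; have [t _ [_ [j uj] _]] := uP k.
  apply/eqP => e; have := kv j; rewrite e mxE sub0r normrN uj; lra.
pose B : R := 1 + \sum_x \sum_j `|phi x 0 j| + \sum_(x : 'I_M) \sum_j `|moment N' x 0 j|.
have sB0 (f : 'I_M -> 'rV[R]_N) : 0 <= \sum_x \sum_j `|f x 0 j|.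
  by apply: sumr_ge0 => x _; apply: sumr_ge0.
have lB (f : 'I_M -> 'rV[R]_N) x : \sum_j `|f x 0 j| <= \sum_x \sum_j `|f x 0 j|.
  by rewrite [X in _ <= X](bigD1 x) //= lerDl sumr_ge0 // => y _; apply: sumr_ge0.
have B0 : 0 < B by have := sB0 phi; have := sB0 (@moment N' m); rewrite /B; lra.
(* below [d] the perturbation cannot change a nonzero sign *)
have [d d0 dP] : exists2 d, 0 < d & forall x, dotv (phi x) v != 0 -> d <= `|dotv (phi x) v|.
  pose f x := if dotv (phi x) v != 0 then `|dotv (phi x) v| else 1.
  have [x0 _ h] := @arg_minP _ _ _ (ord0 : 'I_M) xpredT f isT.
  exists (f x0) => [|x nx]; last by have := h x isT; rewrite {2}/f nx.
  by rewrite /f; case: ifP => // nz; rewrite normr_gt0.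
(* k is so large that the distance to the limit and the perturbation each change an inner product by
   at most d/4. *)
have [k kK kv] := vcl (d / (4 * B)) (Num.bound (4 * B / d)) (divr_gt0 d0 (mulr_gt0 (ltr0Sn _ _) B0)).
have [t /andP[t0 tk] [_ _ le]] := uP k.
have tB : t * B < d / 4.
  have b0 : 0 <= 4 * B / d by rewrite divr_ge0 ?mulr_ge0 ?ltW.
  have h := archi_boundP b0.
  have : 4 * B / d < k.+1%:R by apply: lt_le_trans h _; rewrite ler_nat leqW.
  rewrite ltr_pdivrMr // => h2.
  have : t * (4 * B) < k.+1%:R^-1 * (k.+1%:R * d).
    apply: (@lt_trans _ _ (k.+1%:R^-1 * (4 * B))); first by rewrite ltr_pM2r // mulr_gt0.
    by rewrite ltr_pM2l // invr_gt0 ltr0n.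
  by rewrite mulKf ?pnatr_eq0 //; lra.
have close x : `|dotv (phi x) v - dotv (phi x + t *: moment N' x) (u k)| < d.
  have -> : dotv (phi x) v - dotv (phi x + t *: moment N' x) (u k) =
     \sum_j (phi x 0 j * (v 0 j - u k 0 j) - t * (moment N' x 0 j * u k 0 j)).
    by rewrite /dotv -sumrB; apply: eq_bigr => j _; rewrite !mxE; ring.
  apply: le_lt_trans (ler_norm_sum _ _ _) _.
  apply: (@le_lt_trans _ _ (\sum_j (`|phi x 0 j| * (d / (4 * B)) + t * `|moment N' x 0 j|))).
    apply: ler_sum => j _; apply: le_trans (ler_normB _ _) _; rewrite !normrM (gtr0_norm t0).
    apply: lerD; first by rewrite ler_wpM2l // ltW.
    by rewrite ler_wpM2l ?(ltW t0) // ler_piMr.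
  rewrite big_split /= -mulr_suml -mulr_sumr.
  have h1 : \sum_j `|phi x 0 j| <= B.
    by have := lB phi x; have := sB0 (@moment N' m); rewrite /B; lra.
  have h2 : \sum_j `|moment N' x 0 j| <= B.
    by have := lB (@moment N' m) x; have := sB0 phi; rewrite /B; lra.
  have e1 : (\sum_j `|phi x 0 j|) * (d / (4 * B)) <= d / 4.
    apply: (@le_trans _ _ (B * (d / (4 * B)))).
      by rewrite ler_wpM2r // ltW // divr_gt0 // mulr_gt0.
    by rewrite le_eqVlt; apply/orP; left; apply/eqP; field; apply: lt0r_neq0.
  have e2 : t * (\sum_j `|moment N' x 0 j|) <= t * B by rewrite ler_wpM2l // ltW.
  lra.
have sgn x : dotv (phi x) v != 0 -> 0 < dotv (phi x) v * dotv (phi x + t *: moment N' x) (u k).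
  move=> nz; have := dP x nz; have := close x; move: nz (dotv _ (u k)) => + b.
  move: (dotv _ v) => a a0; rewrite ltr_norml => /andP[l1 l2].
  by rewrite neq_lt in a0; case/orP: a0 => a0; [rewrite ltr0_norm // => l3; nra|rewrite gtr0_norm // => l3; nra].
apply: le_trans le; apply: ler_sum => x _; apply: ler_sum => y _.
have [p|//] := boolP (0 < dotv (phi x) v * dotv (phi y) v).
have x0 : dotv (phi x) v != 0 by apply: contraTneq p => ->; rewrite mul0r ltxx.
have y0 : dotv (phi y) v != 0 by apply: contraTneq p => ->; rewrite mulr0 ltxx.
by have := mulr_gt0 (sgn x x0) (sgn y y0); rewrite mulrACA pmulr_rgt0 // => ->.
Qed.
End SignSplitting.

(** * Partition by iterated splitting *)

Lemma degs_step1 (K N e : nat) : (99 * N * (N * (K * (2 * e))) + 400 * K * N ^ 2 * e <= 400 * K * N ^ 2 * (2 * e))%N.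
Proof. by rewrite -mulnn; lia. Qed.
Lemma degs_step2 (K N e : nat) :
  (400 * K * N ^ 2 * (2 * (2 * e)) + 1600 * K * N ^ 2 * e <= 1600 * K * N ^ 2 * (2 * e))%N.
Proof. by rewrite -mulnn; lia. Qed.

(** Bernoulli's inequality: (1 + 1/K)^K >= 2. With K = 99, [99 * n] splittings that keep 99/100 of
    the pairs divide their number by 2^n. *)
Lemma expn_bernoulli K n : (0 < K -> K ^ (K * n) * 2 ^ n <= K.+1 ^ (K * n))%N.
Proof.
move=> K0; rewrite !expnM -expnMn; case: n => // n; rewrite leq_exp2r //.
suff b i : (i <= K -> K ^ i * (K + i) <= K.+1 ^ i * K)%N.
  by rewrite -(leq_pmul2r K0) -mulnA (_ : (2 * K = K + K)%N) ?b //; lia.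
elim: i => [|i IH] iK; first by rewrite addn0.
have {IH} := IH (ltnW iK); rewrite !expnS.
by move: (K ^ i)%N (K.+1 ^ i)%N => a b; nia.
Qed.

Section Partition.
Variables (R : realType) (n' : nat).
Let n := n'.+1.
Implicit Types (F : {mpoly R[n]}) (Fs : seq {mpoly R[n]}).

(** Signs are strict: a point is related to itself only off all the zero sets, so cells contain no
    point of them. *)
Definition same_sign Fs (p q : 'I_n -> R) := all (fun F => 0 < F.@[p] * F.@[q]) Fs.
Definition degs Fs : nat := \sum_(F <- Fs) (msize F).-1.

Lemma same_sign_sym Fs p q : same_sign Fs p q = same_sign Fs q p.
Proof. by apply: eq_all => F; rewrite mulrC. Qed.

Lemma same_sign_trans Fs p q r : same_sign Fs p q -> same_sign Fs q r -> same_sign Fs p r.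
Proof.
move=> /allP pq /allP qr; apply/allP => F FFs; have := mulr_gt0 (pq F FFs) (qr F FFs).
rewrite mulrACA [F.@[q] * _]mulrC mulrACA -expr2 mulrC pmulr_rgt0 //.
by rewrite lt0r sqr_ge0 sqrf_eq0 andbT; apply: contraTneq (pq F FFs) => ->; rewrite mulr0 ltxx.
Qed.

Lemma same_sign_refl Fs p q : same_sign Fs p q -> same_sign Fs p p.
Proof. by move=> h; apply: (same_sign_trans h); rewrite same_sign_sym. Qed.

Lemma same_sign_cat Fs Gs p q : same_sign (Fs ++ Gs) p q = same_sign Fs p q && same_sign Gs p q.
Proof. exact: all_cat. Qed.

Section Box.
Variable d : nat.
(** Monomials with every exponent at most d: exactly (d + 1)^n of them, of total degree at most n d.
    They turn signs of polynomials into signs of linear forms. *)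
Let B := {ffun 'I_n -> 'I_d.+1}.
Let N := #|{: B}|.
Definition boxmon (f : B) : 'X_{1..n} := [multinom (f i : nat) | i < n].
Definition boxrow (p : 'I_n -> R) : 'rV[R]_N := \row_k ('X_[boxmon (enum_val k)] : {mpoly R[n]}).@[p].
Definition boxpoly (v : 'rV[R]_N) : {mpoly R[n]} := \sum_k v 0 k *: 'X_[boxmon (enum_val k)].

Lemma boxpolyE v p : (boxpoly v).@[p] = dotv (boxrow p) v.
Proof. by rewrite raddf_sum /=; apply: eq_bigr => k _; rewrite mevalZ mxE mulrC. Qed.

Lemma boxmon_inj : injective boxmon.
Proof.
move=> f g e; apply/ffunP => i; apply: val_inj.
by have /mnmP/(_ i) := e; rewrite !mnmE.
Qed.

Lemma boxpoly_neq0 v : v != 0 -> boxpoly v != 0.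
Proof.
apply: contraNneq => e; apply/eqP/rowP => k; rewrite mxE.
have : (boxpoly v)@_(boxmon (enum_val k)) = 0 by rewrite e mcoeff0.
rewrite /boxpoly raddf_sum /= (bigD1 k) //= mcoeffZ mcoeffX eqxx mulr1 big1 ?addr0 // => j jk.
rewrite mcoeffZ mcoeffX (inj_eq boxmon_inj) (inj_eq enum_val_inj) (negbTE jk) mulr0 //.
Qed.

Lemma msize_boxpoly v : ((msize (boxpoly v)).-1 <= n * d)%N.
Proof.
rewrite -subn1 leq_subLR add1n; apply: leq_trans (msize_sum _ _ _) _.
apply/bigmax_leqP_seq => k _ _; apply: leq_trans (msizeZ_le _ _) _.
rewrite msizeX ltnS mdegE; apply: leq_trans (_ : (\sum_(i < n) d <= _)%N).
  by apply: leq_sum => i _; rewrite mnmE -ltnS.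
by rewrite sum_nat_const card_ord.
Qed.
End Box.

Section Energy.
Variables (M : nat) (X : 'I_M -> 'I_n -> R).

Definition cell Fs x : {set 'I_M} := [set y | same_sign Fs (X x) (X y)].
Definition pairs Fs : nat := \sum_x #|cell Fs x|.

(** [sign_splitting] for the monomial vectors of the points off the zero sets ([S]), with their
    cells as classes. *)
Lemma pairs_step Fs d : (20000 * M ^ 2 <= d.+1 ^ n * pairs Fs)%N ->
  exists2 F, F != 0 /\ ((msize F).-1 <= n * d)%N & (100 * pairs (F :: Fs) <= 99 * pairs Fs)%N.
Proof.
move=> big; pose S := [set x | same_sign Fs (X x) (X x)].
pose phi (i : 'I_#|S|) := boxrow d (X (enum_val i)).
pose c (i : 'I_#|S|) := cell Fs (enum_val i).
have cE i j : (c j == c i) = same_sign Fs (X (enum_val i)) (X (enum_val j)).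
  have := enum_valP i; have := enum_valP j; rewrite !inE => sj si.
  apply/eqP/idP => [e|ij].
    have h : enum_val j \in c j by rewrite inE.
    by rewrite e inE in h.
  apply/setP => y; rewrite !inE; apply/idP/idP; apply: same_sign_trans => //.
  by rewrite same_sign_sym.
have conv (P : rel 'I_M) : (forall x y, P x y -> x \in S /\ y \in S) ->
   (\sum_x #|[set y | P x y]|)%:R = \sum_(i < #|S|) \sum_(j < #|S|) (P (enum_val i) (enum_val j))%:R :> R.
  move=> PS; rewrite natr_sum; under [RHS]eq_bigr => i _ do rewrite -(big_enum_val (fun y => (P (enum_val i) y)%:R)).
  rewrite -(big_enum_val (fun x => \sum_(y in S) (P x y)%:R)) /=.
  rewrite [LHS](bigID (mem S)) /= [X in _ + X]big1 ?addr0 => [|x xS]; last first.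
    by apply/eqP; rewrite pnatr_eq0 cards_eq0; apply/set0Pn => -[y]; rewrite inE => /PS[]; rewrite (negbTE xS).
  apply: eq_bigr => x xS; rewrite card_sum1 [RHS]big_mkcond [LHS]big_mkcond; apply: eq_bigr => y _.
  rewrite inE; case: ifP => [/PS[_ ->]//|_]; by case: ifP.
have N0 : (0 < #|{: {ffun 'I_n -> 'I_d.+1}}|)%N by rewrite card_ffun !card_ord expn_gt0.
have sS x y : same_sign Fs (X x) (X y) -> x \in S /\ y \in S.
  by move=> h; rewrite !inE (same_sign_refl h); split=> //; apply: (@same_sign_refl _ _ (X x)); rewrite same_sign_sym.
have TE : \sum_i \sum_(j | c j == c i) 1 = (pairs Fs)%:R :> R.
  rewrite /pairs (conv (fun x y => same_sign Fs (X x) (X y))) //.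
  by apply: eq_bigr => i _; rewrite big_mkcond; apply: eq_bigr => j _; rewrite cE; case: (same_sign _ _ _).
have bigR : 20000 * #|S|%:R ^+ 2 <= #|{: {ffun 'I_n -> 'I_d.+1}}|%:R * \sum_i \sum_(j | c j == c i) 1 :> R.
  rewrite TE -natrX -!natrM ler_nat card_ffun !card_ord; apply: leq_trans big.
  by rewrite leq_mul2l leq_exp2r // -[X in (_ <= X)%N]card_ord max_card.
have [v v0 le] := @sign_splitting R _ _ _ phi c N0 bigR.
exists (boxpoly v); first by rewrite boxpoly_neq0 // msize_boxpoly.
rewrite -(ler_nat R) [X in _ <= X]natrM -TE.
suff -> : (100 * pairs (boxpoly v :: Fs))%:R = 100 * \sum_i \sum_(j | c j == c i) (0 < dotv (phi i) v * dotv (phi j) v)%R%:R :> R by lra.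
rewrite natrM; congr (_ * _).
rewrite /pairs (conv (fun x y => same_sign (boxpoly v :: Fs) (X x) (X y))); last by move=> x y /andP[_ /sS].
apply: eq_bigr => i _; rewrite [RHS]big_mkcond; apply: eq_bigr => j _.
by rewrite cE /= !boxpolyE; case: (same_sign _ _ _); rewrite ?andbT ?andbF.
Qed.

(** Split until s splittings are done or the pairs fall below the threshold of [pairs_step]; either
    outcome serves [pairs_le]. *)
Lemma pairs_steps Fs d s : exists2 Gs, all (fun F => F != 0) Gs /\ (degs Gs <= s * (n * d))%N &
  (100 ^ s * pairs (Gs ++ Fs) <= 99 ^ s * pairs Fs)%N \/ (d.+1 ^ n * pairs (Gs ++ Fs) <= 20000 * M ^ 2)%N.
Proof.
elim: s => [|s [Gs [Gs0 dGs] h]]; first by exists [::]; [rewrite /degs big_nil|left; rewrite !mul1n].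
have [big|small] := leqP (20000 * M ^ 2) (d.+1 ^ n * pairs (Gs ++ Fs)); last first.
  exists Gs; [split=> //; apply: leq_trans dGs _; by rewrite mulSn leq_addl|right; exact: ltnW].
have [F [F0 dF] le] := pairs_step big; case: h => h; last first.
  by exists Gs; [split=> //; apply: leq_trans dGs _; by rewrite mulSn leq_addl|right].
exists (F :: Gs); first by rewrite /= F0 Gs0 /degs big_cons mulSn leq_add.
left; rewrite cat_cons !expnS; move: le h; move: (100 ^ s)%N (99 ^ s)%N => a b.
move: (pairs _) (pairs _) (pairs _) => x y z l1 l2.
nia.
Qed.

(** A round of [99 * n] splittings divides the pairs by 2^n, and its degree doubles from round to
    round, so the degrees form a geometric series. The choice of [d] makes the threshold outcome as
    good as the target. *)
Lemma pairs_le j : exists2 Fs, all (fun F => F != 0) Fs /\ (degs Fs <= 400 * 20000 * n ^ 2 * 2 ^ j)%N &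
  (2 ^ (n * j) * pairs Fs <= M ^ 2)%N.
Proof.
elim: j => [|j [Fs [Fs0 dFs] le]].
  exists [::]; first by rewrite /degs big_nil.
  rewrite muln0 mul1n /pairs -mulnn -[X in (_ <= X * _)%N]card_ord -sum_nat_const.
  by apply: leq_sum => x _; apply: leq_trans (max_card _) _; rewrite card_ord.
pose d := (20000 * 2 ^ j.+1)%N.
have [Gs [Gs0 dGs] h] := pairs_steps Fs d (99 * n).
exists (Gs ++ Fs).
  rewrite all_cat Gs0 Fs0; split=> //; rewrite /degs big_cat /= -/(degs _) -/(degs _).
  apply: leq_trans (leq_add dGs dFs) _; by rewrite /d expnS degs_step1.
have bern : (99 ^ (99 * n) * 2 ^ n <= 100 ^ (99 * n))%N.
  exact: expn_bernoulli.
have nj : (2 ^ (n * j.+1) = 2 ^ n * 2 ^ (n * j))%N by rewrite mulnS expnD.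
case: h => h.
  have p : (0 < 99 ^ (99 * n))%N by rewrite expn_gt0.
  rewrite -(leq_pmul2l p); apply: leq_trans (_ : 99 ^ (99 * n) * (2 ^ (n * j) * pairs Fs) <= _)%N; last by rewrite leq_mul2l le orbT.
  rewrite nj; move: bern h; move: (99 ^ _)%N (100 ^ _)%N (2 ^ n)%N (2 ^ (n * j))%N (pairs _) (pairs _) => a b e f x y h1 h2.
  have -> : (a * (f * x) = f * (a * x))%N by lia.
  apply: (@leq_trans (f * (b * y))); last by rewrite leq_mul2l h2 orbT.
  have -> : (a * (e * f * y) = f * (a * e * y))%N by lia.
  by rewrite leq_mul2l leq_mul2r h1 !orbT.
rewrite -(leq_pmul2l (m := 20000)) //; apply: leq_trans h; rewrite mulnA leq_mul2r.
apply/orP; right; apply: (@leq_trans (d ^ n)); last by rewrite leq_exp2r.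
rewrite /d expnMn -expnM [(j.+1 * n)%N]mulnC leq_mul2r; apply/orP; right.
by rewrite -[X in (X <= _)%N]expn1 leq_pexp2l.
Qed.
End Energy.

(** Pair counts control only the average cell. Once the pairs are below M^2 / 2^(n(k+2)), at most t
    2^(nk) points lie in cells larger than t; these are partitioned again with k in place of k + 1,
    and the degrees again sum geometrically. *)
Lemma polynomial_partition k t M (X : 'I_M -> 'I_n -> R) : (M <= t * 2 ^ (n * k))%N ->
  exists2 Fs, all (fun F => F != 0) Fs /\ (degs Fs <= 1600 * 20000 * n ^ 2 * 2 ^ k)%N &
    forall x, (#|cell X Fs x| <= t)%N.
Proof.
elim: k M X => [|k IH] M X Mt.
  exists [::]; first by rewrite /degs big_nil.
  by move=> x; apply: leq_trans (max_card _) _; rewrite card_ord; rewrite muln0 muln1 in Mt.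
case: (posnP t) => [t0|t0].
  exists [::]; first by rewrite /degs big_nil.
  by rewrite t0 mul0n leqn0 in Mt; move: X; rewrite (eqP Mt) => X [].
have [Fs [Fs0 dFs] le] := pairs_le X k.+2.
pose big := [set x | (t < #|cell X Fs x|)%N].
have bigM : (#|big| <= t * 2 ^ (n * k))%N.
  have h : (#|big| * t <= pairs X Fs)%N.
    rewrite /pairs [X in (_ <= X)%N](bigID (mem big)) /=; apply: leq_trans (leq_addr _ _).
    rewrite -sum_nat_const; apply: leq_sum => x; rewrite inE; exact: ltnW.
  have e1 : (2 ^ (n * k.+2) = 2 ^ n * (2 ^ n * 2 ^ (n * k)))%N by rewrite !mulnS !expnD.
  have e2 : (2 ^ (n * k.+1) = 2 ^ n * 2 ^ (n * k))%N by rewrite !mulnS !expnD.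
  rewrite e1 in le; rewrite e2 in Mt.
  have n2 : (1 < 2 ^ n)%N by rewrite -{1}(expn0 2) ltn_exp2l.
  have c0 : (0 < 2 ^ (n * k))%N by rewrite expn_gt0.
  move: (2 ^ n)%N (2 ^ (n * k))%N (pairs _ _) #|big| n2 c0 le Mt h => a c p b n2 c0 le Mt h.
  have le2 : (M ^ 2 <= (t * (a * c)) ^ 2)%N by rewrite leq_exp2r.
  have h3 : (a * (a * c) * (b * t) <= (t * (a * c)) ^ 2)%N.
    by apply: leq_trans le2; apply: leq_trans le; rewrite leq_mul2l h orbT.
  have q0 : (0 < t * (a * (a * c)))%N by rewrite !muln_gt0 t0 c0 !(ltnW n2).
  rewrite -(leq_pmul2l q0); move: h3; rewrite -mulnn.
  have -> : (a * (a * c) * (b * t) = t * (a * (a * c)) * b)%N by lia.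
  by have -> : (t * (a * c) * (t * (a * c)) = t * (a * (a * c)) * (t * c))%N by lia.
have [Gs [Gs0 dGs] hG] := IH _ (fun i => X (enum_val i : 'I_M)) bigM.
exists (Fs ++ Gs).
  rewrite all_cat Gs0 Fs0; split=> //; rewrite /degs big_cat /= -/(degs _) -/(degs _).
  apply: leq_trans (leq_add dFs dGs) _; by rewrite !(expnS 2) degs_step2.
move=> x; have [xb|] := boolP (x \in big); last first.
  rewrite inE -leqNgt; apply: leq_trans; apply/subset_leq_card/subsetP => y.
  by rewrite !inE same_sign_cat => /andP[].
have sub : cell X (Fs ++ Gs) x \subset [set enum_val j | j in cell (fun i => X (enum_val i)) Gs (enum_rank_in xb x)].
  apply/subsetP => y; rewrite !inE same_sign_cat => /andP[xy xy'].
  have yb : y \in big.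
    move: xb; rewrite !inE; congr (_ < #|pred_of_set _|)%N; apply/setP => z; rewrite !inE.
    by apply/idP/idP; apply: same_sign_trans => //; rewrite same_sign_sym.
  apply/imsetP; exists (enum_rank_in xb y); last by rewrite enum_rankK_in.
  by rewrite inE !enum_rankK_in.
by apply: leq_trans (subset_leq_card sub) _; apply: leq_trans (leq_imset_card _ _) (hG _).
Qed.
End Partition.

(** * Consecutive points and root counts *)

Section Consecutive.
Variables (R : rcfType) (T : finType) (S : {set T}) (t : T -> R).
Hypothesis tinj : {in S &, injective t}.

Definition cons x y := [&& x \in S, y \in S, t x < t y &
  [forall z in S, ~~ ((t x < t z) && (t z < t y))]].

Lemma cons_next x y : x \in S -> y \in S -> t x < t y -> exists2 z, cons x z & t z <= t y.
Proof.
move=> xS yS xy.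
have Py : (y \in S) && (t x < t y) by rewrite yS.
have [z /andP[zS xz] zmin] := @arg_minP _ _ _ y (fun z => (z \in S) && (t x < t z)) t Py.
exists z; last by apply: zmin.
rewrite /cons xS zS xz; apply/forall_inP => u uS; apply/negP => /andP[xu uz].
by have := zmin u; rewrite uS xu leNgt uz => /(_ isT).
Qed.

Lemma cons_prev x y : x \in S -> y \in S -> t x < t y -> exists2 z, cons z y & t x <= t z.
Proof.
move=> xS yS xy.
have Px : (x \in S) && (t x < t y) by rewrite xS.
have [z /andP[zS zy] zmax] := @arg_maxP _ _ _ x (fun z => (z \in S) && (t z < t y)) t Px.
exists z; last by apply: zmax.
rewrite /cons yS zS zy; apply/forall_inP => u uS; apply/negP => /andP[zu uy].
have lu : t u <= t z by apply: zmax; rewrite uS uy.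
by move: lu; rewrite leNgt zu.
Qed.

Lemma cons_le x y z : cons x y -> z \in S -> t x < t z -> t y <= t z.
Proof. by case/and4P => _ _ _ /forall_inP h zS xz; have := h z zS; rewrite xz /= -leNgt. Qed.

Lemma cons_fun x y z : cons x y -> cons x z -> y = z.
Proof.
move=> xy xz; case/and4P: (xy) => _ yS lt1 _; case/and4P: (xz) => _ zS lt2 _.
by apply: tinj => //; apply/le_anti; rewrite (cons_le xy) // (cons_le xz).
Qed.

Lemma card_cons : (#|S| <= #|[set p | cons p.1 p.2]|.+1)%N.
Proof.
have [->|[x0 x0S]] := set_0Vmem S; first by rewrite cards0.
have [m mS mmax] := @arg_maxP _ _ _ x0 (mem S) t x0S; have {}mS : m \in S by [].
have sub : S :\ m \subset [set p.1 | p in [set p | cons p.1 p.2]].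
  apply/subsetP => x; rewrite !inE => /andP[xm xS].
  have lt : t x < t m.
    have xm' : t x <= t m by apply: mmax.
    by rewrite lt_neqAle xm' andbT; apply: contra_neq xm => /(tinj xS mS).
  have [z cz _] := cons_next xS mS lt.
  by apply/imsetP; exists (x, z); rewrite ?inE.
rewrite (cardsD1 m S) mS add1n ltnS; apply: leq_trans (subset_leq_card sub) _.
exact: leq_imset_card.
Qed.

(** The open intervals between consecutive parameters are disjoint, so bad pairs have distinct
    roots. *)
Lemma card_cons_roots (p : {poly R}) (bad : pred (T * T)) : p != 0 ->
  (forall x y, cons x y -> bad (x, y) -> exists2 r, t x < r < t y & root p r) ->
  (#|[set e | cons e.1 e.2 && bad e]| <= (size p).-1)%N.
Proof.
move=> p0 badr; set E := [set e | _].
have /fin_all_exists[r rP] : forall e : T * T, exists r, e \in E -> t e.1 < r < t e.2 /\ root p r.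
  move=> e; have [|] := boolP (e \in E); last by exists 0.
  by rewrite inE => /andP[ce]; rewrite [e]surjective_pairing => /(badr _ _ ce)[r r1 r2]; exists r.
have rinj : {in E &, injective r}.
  have main a b : a \in E -> b \in E -> t a.1 < t b.1 -> r a < r b.
    move=> aE bE ab; have [/andP[_ ra] _] := rP a aE; have [/andP[rb _] _] := rP b bE.
    move: aE bE; rewrite !inE => /andP[ca _] /andP[cb _].
    by apply: lt_trans ra (le_lt_trans _ rb); apply: (cons_le ca) => //; case/and4P: cb.
  move=> a b aE bE rab; have [ca cb] : cons a.1 a.2 /\ cons b.1 b.2.
    by move: aE bE; rewrite !inE => /andP[? _] /andP[? _].
  case/and4P: (ca) => a1 _ _ _; case/and4P: (cb) => b1 _ _ _.
  have [lt|lt|e] := ltgtP (t a.1) (t b.1).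
  - by have := main a b aE bE lt; rewrite rab ltxx.
  - by have := main b a bE aE lt; rewrite rab ltxx.
  have e1 := tinj a1 b1 e; move: ca cb; rewrite e1 => ca cb.
  by rewrite [a]surjective_pairing [b]surjective_pairing e1 (cons_fun ca cb).
rewrite -ltnS prednK ?size_poly_gt0 // cardE -(size_map r); apply: max_poly_roots => //.
  by apply/allP => y /mapP[e]; rewrite mem_enum => /rP[_ re] ->.
by rewrite map_inj_in_uniq ?enum_uniq // => a b; rewrite !mem_enum; apply: rinj.
Qed.

(** A first element other than the lowest forms a separated pair with its predecessor; the lowest
    one accounts for [size p] in place of its predecessor. *)
Lemma card_firsts (p : {poly R}) (eqv : rel T) : p != 0 ->
  (forall x y, x \in S -> y \in S -> t x < t y -> ~~ eqv x y -> exists2 r, t x < r < t y & root p r) ->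
  (#|[set x in S | [forall y in S, (t y < t x)%R ==> ~~ eqv y x]]| <= size p)%N.
Proof.
move=> p0 sep; set F := [set x in S | _].
have [S0|[x0 x0S]] := set_0Vmem S.
  by rewrite (_ : F = set0) ?cards0 //; apply/setP => x; rewrite !inE S0 inE.
have [m mS mmin] := @arg_minP _ _ _ x0 (mem S) t x0S; have {}mS : m \in S by [].
pose bad (e : T * T) := ~~ eqv e.1 e.2.
have h : (#|[set e | cons e.1 e.2 && bad e]| <= (size p).-1)%N.
  by apply: card_cons_roots => // x y /and4P[xS yS xy _]; apply: sep.
have sub : F :\ m \subset [set e.2 | e in [set e | cons e.1 e.2 && bad e]].
  apply/subsetP => x; rewrite !inE => /andP[xm /andP[xS /forall_inP xF]].
  have lt : t m < t x.
    have mx : t m <= t x by apply: mmin.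
    by rewrite lt_neqAle mx andbT; apply: contra_neq xm => /(tinj mS xS).
  have [z cz _] := cons_prev mS xS lt.
  apply/imsetP; exists (z, x); rewrite ?inE //= cz /bad /=.
  by case/and4P: cz => zS _ zx _; have := xF z zS; rewrite zx.
have e : size p = (size p).-1.+1 by rewrite prednK ?size_poly_gt0.
rewrite e; apply: leq_trans (_ : (#|F :\ m|.+1 <= _)%N); first by rewrite (cardsD1 m F) -add1n leq_add2r; case: (m \in F).
rewrite ltnS; apply: leq_trans h; apply: leq_trans (subset_leq_card sub) _; exact: leq_imset_card.
Qed.
End Consecutive.

(** * Polynomials along rational curves *)

Section Curve.
Variables (R : rcfType) (n : nat) (w : {poly R}) (c : 'I_n -> {poly R}) (dl : nat).
Hypothesis w0 : forall s, 0 < w.[s].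
Hypothesis sw : (size w <= dl.+1)%N.
Hypothesis sc : forall i, (size (c i) <= dl.+1)%N.

Definition curve s (i : 'I_n) : R := (c i).[s] / w.[s].
Definition velocity s (i : 'I_n) : R := (w.[s] * (c i)^`().[s] - w^`().[s] * (c i).[s]) / w.[s] ^+ 2.

(** A rational function along the curve with denominator w^D and numerator of degree at most dl D:
    what is needed to count its zeros, and closed under the ring operations. *)
Definition good D (f : R -> R) :=
  exists2 p : {poly R}, (size p <= (dl * D).+1)%N & forall s, p.[s] = w.[s] ^+ D * f s.

Lemma size_mul_deg (p q : {poly R}) a b : (size p <= a.+1)%N -> (size q <= b.+1)%N ->
  (size (p * q)%R <= (a + b).+1)%N.
Proof.
move=> pa qb; apply: leq_trans (size_polyMleq _ _) _; rewrite -subn1 leq_subLR.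
by apply: leq_trans (leq_add pa qb) _; rewrite addSn addnS add1n.
Qed.

Lemma size_exp_deg (p : {poly R}) a k : (size p <= a.+1)%N -> (size (p ^+ k) <= (a * k).+1)%N.
Proof.
move=> pa; elim: k => [|k IH]; first by rewrite expr0 size_poly1.
by rewrite exprS mulnS; apply: size_mul_deg.
Qed.

Lemma good_add D f g : good D f -> good D g -> good D (fun s => f s + g s).
Proof.
move=> [p sp pf] [q sq qg]; exists (p + q); last by move=> s; rewrite hornerD pf qg mulrDr.
by apply: leq_trans (size_polyD _ _) _; rewrite geq_max sp.
Qed.

Lemma good_mul D E f g : good D f -> good E g -> good (D + E) (fun s => f s * g s).
Proof.
move=> [p sp pf] [q sq qg]; exists (p * q); last by move=> s; rewrite hornerM pf qg exprD mulrACA.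
by rewrite mulnDr; apply: size_mul_deg.
Qed.

Lemma good_const D a : good D (fun=> a).
Proof.
exists (a *: w ^+ D); last by move=> s; rewrite hornerZ horner_exp mulrC.
by apply: leq_trans (size_scale_leq _ _) _; apply: size_exp_deg.
Qed.

Lemma good_sum D (I : Type) (r : seq I) (f : I -> R -> R) :
  (forall i, good D (f i)) -> good D (fun s => \sum_(i <- r) f i s).
Proof.
move=> gf; elim: r => [|i r IH].
  by have [p sp pf] := good_const D 0; exists p => // s; rewrite big_nil pf.
by have [p sp pf] := good_add (gf i) IH; exists p => // s; rewrite big_cons pf.
Qed.

Lemma good_ext D f g : f =1 g -> good D f -> good D g.
Proof. by move=> fg [p sp pf]; exists p => // s; rewrite pf fg. Qed.

Lemma good_mpoly (F : {mpoly R[n]}) D : (msize F <= D.+1)%N -> good D (fun s => F.@[curve s]).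
Proof.
move=> FD.
exists (\sum_(m <- msupp F) F@_m *: (\prod_i c i ^+ m i * w ^+ (D - mdeg m))).
  apply: leq_trans (size_sum _ _ _) _; apply/bigmax_leqP_seq => m mF _.
  apply: leq_trans (size_scale_leq _ _) _.
  have mD : (mdeg m <= D)%N by rewrite -ltnS; apply: leq_trans (msize_mdeg_lt mF) FD.
  rewrite (_ : dl * D = dl * mdeg m + dl * (D - mdeg m))%N; last by rewrite -mulnDr subnKC.
  apply: size_mul_deg; last exact: size_exp_deg.
  rewrite mdegE big_distrr /=; elim/big_ind2: _ => [|p a q b pa qb|i _].
  - by rewrite size_poly1.
  - exact: size_mul_deg.
  - exact: size_exp_deg.
move=> s; rewrite horner_sum mevalE big_distrr /=; apply: eq_big_seq => m mF.
have mD : (mdeg m <= D)%N by rewrite -ltnS; apply: leq_trans (msize_mdeg_lt mF) FD.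
rewrite hornerZ hornerM horner_prod horner_exp [RHS]mulrCA; congr (_ * _).
rewrite (_ : w.[s] ^+ D = w.[s] ^+ mdeg m * w.[s] ^+ (D - mdeg m)); last by rewrite -exprD subnKC.
rewrite [RHS]mulrAC; congr (_ * _).
rewrite mdegE expr_sum -big_split /=; apply: eq_bigr => i _.
by rewrite horner_exp /curve expr_div_n mulrCA divff ?mulr1 // expf_neq0 // lt0r_neq0.
Qed.

Lemma good_neq0 D f p s : (forall s, p.[s] = w.[s] ^+ D * f s) -> f s != 0 -> p != 0.
Proof. by move=> pf; apply: contraNneq => p0; have /eqP := pf s; rewrite p0 horner0 eq_sym mulf_eq0 expf_eq0 (gt_eqF (w0 s)) andbF. Qed.

Lemma good_zeros (T : finType) (S : {set T}) (t : T -> R) D f s0 :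
  {in S &, injective t} -> good D f -> f s0 != 0 -> (forall x, x \in S -> f (t x) = 0) ->
  (#|S| <= dl * D)%N.
Proof.
move=> tinj [p sp pf] fs0 fS; have p0 := good_neq0 pf fs0.
rewrite -ltnS; apply: leq_trans sp; rewrite cardE -(size_map t); apply: max_poly_roots => //.
  by apply/allP => y /mapP[x]; rewrite mem_enum => xS ->; rewrite rootE pf fS ?mulr0.
by rewrite map_inj_in_uniq ?enum_uniq // => a b; rewrite !mem_enum; apply: tinj.
Qed.
End Curve.

(** * Formal differentiation along a rational curve *)

Section CurveDerivative.
Variables (R : rcfType) (n : nat) (w : {poly R}) (c : 'I_n -> {poly R}).
Hypothesis w0 : forall s, 0 < w.[s].

(** The quotient rule for f = p / w^D with derivative g, multiplied out by w^(D+1), so that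
    differentiation stays within polynomials. *)
Definition isder D (f g : R -> R) (p : {poly R}) :=
  (forall s, p.[s] = w.[s] ^+ D * f s) /\
  (forall s, w.[s] * p^`().[s] - D%:R * w^`().[s] * p.[s] = w.[s] ^+ D.+1 * g s).

Definition hasder f g := exists D, exists p, isder D f g p.

Lemma isder_mul D E f g f' g' p q : isder D f g p -> isder E f' g' q ->
  isder (D + E) (fun s => f s * f' s) (fun s => g s * f' s + f s * g' s) (p * q).
Proof.
move=> [pf pg] [qf qg]; split=> s; first by rewrite hornerM pf qf exprD mulrACA.
rewrite derivM hornerD !hornerM natrD; have := pg s; have := qg s.
have -> : w.[s] ^+ (D + E).+1 * (g s * f' s + f s * g' s) =
   (w.[s] ^+ D.+1 * g s) * q.[s] + p.[s] * (w.[s] ^+ E.+1 * g' s).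
  by rewrite pf qf !exprS exprD; ring.
by move=> <- <-; ring.
Qed.

Lemma isder_const D a : isder D (fun=> a) (fun=> 0) (a *: w ^+ D).
Proof.
split=> s; first by rewrite hornerZ horner_exp mulrC.
rewrite derivZ !hornerZ mulr0; case: D => [|D].
  by rewrite expr0 derivC horner0; ring.
by rewrite deriv_exp /= hornerMn hornerM !horner_exp exprS -mulr_natr; ring.
Qed.

Lemma isder_weaken D E f g p : isder D f g p -> exists q, isder (D + E) f g q.
Proof.
move=> h; have [h1 h2] := isder_mul h (isder_const E 1); exists (p * (1 *: w ^+ E)).
by split=> s; [rewrite h1 mulr1|rewrite h2 mulr1 mulr0 addr0].
Qed.

Lemma hasder_mul f g f' g' : hasder f g -> hasder f' g' ->
  hasder (fun s => f s * f' s) (fun s => g s * f' s + f s * g' s).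
Proof. by move=> [D [p h]] [E [q h']]; exists (D + E)%N, (p * q); apply: isder_mul. Qed.

Lemma hasder_add f g f' g' : hasder f g -> hasder f' g' ->
  hasder (fun s => f s + f' s) (fun s => g s + g' s).
Proof.
move=> [D [p h]] [E [q h']].
have [p1 [p1f p1g]] := isder_weaken E h; have [q1 [q1f q1g]] := isder_weaken D h'.
rewrite addnC in q1f q1g; exists (D + E)%N, (p1 + q1); split=> s.
  by rewrite hornerD p1f q1f mulrDr.
by rewrite derivD !hornerD [in RHS]mulrDr -p1g -q1g; ring.
Qed.

Lemma hasder_const a : hasder (fun=> a) (fun=> 0).
Proof. by exists 0%N, (a *: w ^+ 0); apply: isder_const. Qed.

Lemma hasder_ext f g f' g' : f =1 f' -> g =1 g' -> hasder f g -> hasder f' g'.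
Proof. by move=> e1 e2 [D [p [h1 h2]]]; exists D, p; split=> s; rewrite -?e1 -?e2. Qed.

Lemma mpoly_ring_ind (P : {mpoly R[n]} -> Prop) :
  (forall a, P a%:MP) -> (forall i, P 'X_i) ->
  (forall p q, P p -> P q -> P (p + q)) -> (forall p q, P p -> P q -> P (p * q)) ->
  forall p, P p.
Proof.
move=> Pc PX PD PM p; rewrite [p]mpolyE; elim/big_ind: _ => [||m _].
- by rewrite -mpolyC0.
- exact: PD.
rewrite -mul_mpolyC; apply: (PM) => //; rewrite mpolyXE_id; elim/big_ind: _ => [||i _].
- by rewrite -mpolyC1.
- exact: PM.
by elim: (m i) => [|k IH]; [rewrite expr0 -mpolyC1|rewrite exprS; apply: (PM)].
Qed.

Lemma hasder_mpoly (F : {mpoly R[n]}) : hasder (fun s => F.@[curve w c s])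
  (fun s => \sum_i (F^`M(i)).@[curve w c s] * velocity w c s i).
Proof.
elim/mpoly_ring_ind: F => [a|i|p q hp hq|p q hp hq].
- apply: hasder_ext (hasder_const a) => s; first by rewrite mevalC.
  by rewrite big1 // => j _; rewrite mderivC meval0 mul0r.
- apply: (@hasder_ext (fun s => curve w c s i) (fun s => velocity w c s i)) => [s|s|].
  + by rewrite mevalXU.
  + rewrite (bigD1 i) //= mderivX mnm1E eqxx scale1r.
    have -> : (U_(i) - U_(i))%MM = 0%MM :> 'X_{1..n} by apply/mnmP => k; rewrite !mnmE subnn.
    rewrite mpolyX0 meval1 mul1r big1 ?addr0 // => j ji.
    by rewrite mderivX mnm1E eq_sym (negbTE ji) scale0r meval0 mul0r.
  exists 1%N, (c i); split=> s.
    by rewrite expr1 /curve mulrCA divff ?mulr1 // lt0r_neq0.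
  by rewrite /velocity mulrCA divff ?mulr1 ?mul1r // expf_neq0 // lt0r_neq0.
- apply: hasder_ext (hasder_add hp hq) => s; first by rewrite mevalD.
  by rewrite -big_split; apply: eq_bigr => i _; rewrite mderivD mevalD mulrDl.
- apply: hasder_ext (hasder_mul hp hq) => s; first by rewrite mevalM.
  rewrite mulr_suml mulr_sumr -big_split; apply: eq_bigr => i _.
  by rewrite mderivM mevalD !mevalM /=; ring.
Qed.

Lemma poly_all0 (p : {poly R}) : (forall s, p.[s] = 0) -> p = 0.
Proof.
move=> p0; apply/eqP; apply: contraT => pn.
have := max_poly_roots pn (rs := [seq k%:R | k <- iota 0 (size p)]).
rewrite size_map size_iota ltnn => -> //.
  by apply/allP => x _; rewrite rootE p0.
by rewrite map_inj_uniq ?iota_uniq // => a b /eqP; rewrite eqr_nat => /eqP.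
Qed.

Lemma hasder0 f g : hasder f g -> (forall s, f s = 0) -> forall s, g s = 0.
Proof.
move=> [D [p [pf pg]]] f0 s; have p0 : p = 0 by apply: poly_all0 => x; rewrite pf f0 mulr0.
have := pg s; rewrite p0 derivC !horner0 !mulr0 subr0 => /esym/eqP.
by rewrite mulf_eq0 expf_eq0 (gt_eqF (w0 s)) andbF => /eqP.
Qed.

(* two solutions [P], [Q] of [P' Q = P Q'] have the same degree, so the
   combination killing the leading terms vanishes *)
Lemma wronskian0 (p q : {poly R}) : p^`() * q = p * q^`() ->
  exists ab : R * R, ab != 0 /\ ab.1 *: p + ab.2 *: q = 0.
Proof.
have deg (a b : {poly R}) : a != 0 -> b != 0 -> a^`() * b = a * b^`() -> size a = size b.
  move=> a0 b0 e; have sa : (0 < size a)%N by rewrite size_poly_gt0.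
  have sb : (0 < size b)%N by rewrite size_poly_gt0.
  case: (posnP ((size a).-1 + (size b).-1)%N) => [z|nz].
    by move: z sa sb; case: (size a) => [|[]]; case: (size b) => [|[]].
  have /(congr1 (fun u : {poly R} => u`_((size a).-1 + (size b).-1).-1)) := e.
  have lead (u v : {poly R}) : (0 < size u)%N -> (0 < size v)%N -> (0 < (size u).-1 + (size v).-1)%N ->
     (u^`() * v)`_((size u).-1 + (size v).-1).-1 = (size u).-1%:R * (lead_coef u * lead_coef v).
    move=> su sv suv; case eu: (size u).-1 => [|k].
      have -> : u^`() = 0.
        by apply/polyP => k; rewrite coef_deriv coef0 nth_default ?mul0rn //; move: eu su; case: (size u) => [|[]].
      by rewrite mul0r coef0 mul0r.
    rewrite addSn /= coefM (bigD1 (inord k)) //= inordK ?ltnS ?leq_addr //.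
    rewrite addKn coef_deriv -eu -mulr_natr -/(lead_coef u) big1 ?addr0; first by rewrite /lead_coef; ring.
    move=> i ik; have [lt|ge] := ltnP i k.
      rewrite [v`_ _]nth_default ?mulr0 //; move: lt sv; move: (nat_of_ord i) => x; move: (size v) => m; lia.
    rewrite coef_deriv nth_default ?mul0rn ?mul0r //.
    have : i != k :> nat by apply: contraNneq ik => ik; apply/eqP/val_inj; rewrite /= inordK ?ltnS ?leq_addr.
    move=> ik'; have : (k < i)%N by rewrite ltn_neqAle eq_sym ik' ge.
    by move: eu su; move: (nat_of_ord i) => x; move: (size u) => m; lia.
  rewrite lead // [a * _]mulrC addnC lead // 1?addnC // [lead_coef b * _]mulrC => /mulIf.
  rewrite mulf_neq0 ?lead_coef_eq0 // => /(_ isT)/eqP; rewrite eqr_nat => /eqP.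
  by move: sa sb; case: (size a) => // x _; case: (size b) => //= y _ ->.
move=> e; have [q0|qn] := eqVneq q 0.
  by exists (0, 1); rewrite q0 /= scale0r scaler0 addr0 xpair_eqE oner_eq0 andbF.
have [p0|pn] := eqVneq p 0.
  by exists (1, 0); rewrite p0 /= scale0r scaler0 addr0 xpair_eqE oner_eq0.
have spq := deg p q pn qn e.
exists (lead_coef q, - lead_coef p); split.
  by rewrite xpair_eqE lead_coef_eq0 (negbTE qn).
rewrite /=; set r := _ + _; apply/eqP; apply: contraT => rn.
have er : r^`() * q = r * q^`().
  rewrite /r derivD !derivZ !mulrDl -!scalerAl e; congr (_ + _ *: _); exact: mulrC.
have := deg r q rn qn er => srq.
have : (size r < size q)%N.
  rewrite -[X in (_ < X)%N](prednK (_ : 0 < size q)%N) ?size_poly_gt0 // ltnS; apply/leq_sizeP => k.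
  rewrite /r coefD !coefZ leq_eqVlt => /orP[/eqP <-|lt].
    by rewrite {2}/lead_coef -{1}spq -/(lead_coef p) -/(lead_coef q); ring.
  have h : (size q <= k)%N by move: lt; case: (size q).
  by rewrite !nth_default ?spq // !mulr0 addr0.
by rewrite srq ltnn.
Qed.
End CurveDerivative.

Section SignOnCurve.
Variables (R : realType) (n' : nat).
Let n := n'.+1.
Variables (w : {poly R}) (c : 'I_n -> {poly R}) (dl : nat).
Hypothesis w0 : forall s, 0 < w.[s].
Hypothesis sw : (size w <= dl.+1)%N.
Hypothesis sc : forall i, (size (c i) <= dl.+1)%N.
Local Notation gam := (curve w c).

(** The product of the compositions of the F with the curve, denominators cleared. A sign change of
    one factor gives a root strictly between by the intermediate value theorem. *)
Lemma curve_partition_poly (Fs : seq {mpoly R[n]}) s0 : all (fun F => F.@[gam s0] != 0) Fs ->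
  exists p : {poly R}, [/\ p != 0, (size p <= (dl * degs Fs).+1)%N &
   forall s t, s < t -> all (fun F => F.@[gam s] != 0) Fs -> all (fun F => F.@[gam t] != 0) Fs ->
    ~~ same_sign Fs (gam s) (gam t) -> exists2 r, s < r < t & root p r].
Proof.
elim: Fs => [_|F Fs IH /= /andP[F0 /IH[p [p0 sp hp]]]].
  by exists 1; rewrite oner_neq0 size_poly1 /degs big_nil.
have [q sq qF] := good_mpoly w0 sw sc (leqSpred (msize F)).
have q0 : q != 0 by apply: (good_neq0 w0 qF F0).
exists (q * p); split; first by rewrite mulf_neq0.
  by rewrite /degs big_cons mulnDr; apply: size_mul_deg.
move=> s t st /andP[Fs0 a1] /andP[Ft0 a2]; rewrite /= negb_and => /orP[|h]; last first.
  by have [r str rp] := hp s t st a1 a2 h; exists r => //; rewrite rootM rp orbT.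
rewrite -leNgt => le; have neg : q.[s] * q.[t] < 0.
  rewrite !qF mulrACA pmulr_rlt0 ?mulr_gt0 ?exprn_gt0 // lt_neqAle le andbT.
  by rewrite mulf_neq0.
have ivt (u : {poly R}) : u.[s] < 0 -> 0 < u.[t] -> exists2 r, s < r < t & root u r.
  move=> us ut; have [|r /andP[sr rt] ru] := poly_ivt (p := u) (ltW st); first by rewrite (ltW us) (ltW ut).
  exists r => //; rewrite !lt_neqAle sr rt !andbT; apply/andP; split.
    by apply: contraTneq us => ->; rewrite (rootP ru) ltxx.
  by apply: contraTneq ut => <-; rewrite (rootP ru) ltxx.
have [r rst rq] : exists2 r, s < r < t & root q r.
  have [qs|qs|qs] := ltgtP q.[s] 0; last by rewrite qs mul0r ltxx in neg.
    by apply: ivt => //; rewrite nmulr_rlt0 in neg.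
  rewrite pmulr_rlt0 // in neg; have [||r rst rq] := ivt (- q); rewrite ?hornerN ?oppr_lt0 ?oppr_gt0 //.
  by exists r => //; rewrite rootN in rq.
by exists r => //; rewrite rootM rq.
Qed.

Lemma card_curve_firsts (T : finType) (S : {set T}) (t : T -> R) (Fs : seq {mpoly R[n]}) :
  {in S &, injective t} -> (forall x, x \in S -> all (fun F => F.@[gam (t x)] != 0) Fs) ->
  (#|[set x in S | [forall y in S, (t y < t x)%R ==> ~~ same_sign Fs (gam (t y)) (gam (t x))]]|
    <= (dl * degs Fs).+1)%N.
Proof.
move=> tinj S0; have [e|[x0 x0S]] := set_0Vmem S.
  by rewrite (_ : [set x in S | _] = set0) ?cards0 //; apply/setP => x; rewrite !inE e inE.
have [p [p0 sp hp]] := curve_partition_poly (S0 x0 x0S).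
apply: leq_trans sp; apply: (card_firsts tinj (eqv := fun y x => same_sign Fs (gam (t y)) (gam (t x)))) => //.
by move=> x y xS yS xy ns; apply: hp => //; apply: S0.
Qed.

Lemma card_curve_breaks (T : finType) (S : {set T}) (t : T -> R) (Fs : seq {mpoly R[n]}) :
  {in S &, injective t} -> (forall x, x \in S -> all (fun F => F.@[gam (t x)] != 0) Fs) ->
  (#|[set e | cons S t e.1 e.2 && ~~ same_sign Fs (gam (t e.1)) (gam (t e.2))]| <= dl * degs Fs)%N.
Proof.
move=> tinj S0; have [e|[x0 x0S]] := set_0Vmem S.
  by rewrite (_ : [set x | _] = set0) ?cards0 //; apply/setP => x; rewrite !inE /cons e inE.
have [p [p0 sp hp]] := curve_partition_poly (S0 x0 x0S).
apply: (@leq_trans (size p).-1); last by rewrite -ltnS prednK ?size_poly_gt0.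
apply: (card_cons_roots tinj (bad := fun e => ~~ same_sign Fs (gam (t e.1)) (gam (t e.2)))) => //.
move=> x y /and4P[xS yS xy _] ns; by apply: hp => //; apply: S0.
Qed.
End SignOnCurve.

(** * Chains of derivatives *)

Section Stratification.
Variables (R : realFieldType) (n : nat).
Implicit Types (p : {mpoly R[n]}).

Lemma msize_mderiv_lt p i : p^`M(i) != 0 -> (msize p^`M(i) < msize p)%N.
Proof.
move=> d0; have h m : m \in msupp p^`M(i) -> ((mdeg m).+2 <= msize p)%N.
  rewrite mcoeff_msupp mcoeff_deriv mulrn_eq0 /= -mcoeff_msupp => /msize_mdeg_lt.
  by rewrite mdegD mdeg1 addn1.
rewrite msizeE big_seq; elim/big_ind: _ => [|a b|m /h //].
  by rewrite lt0n msize_poly_eq0; apply: contraNneq d0 => ->; rewrite mderiv0.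
by rewrite gtn_max => -> ->.
Qed.

Lemma mderiv_all0 p : (forall i, p^`M(i) = 0) -> exists a, p = a%:MP.
Proof.
move=> d0; exists p@_0; apply/mpolyP => m; rewrite mcoeffC.
have [->|m0] := eqVneq m 0%MM; first by rewrite ?eqxx ?mulr1n ?mulr1.
rewrite mulr0.
have [i mi] : exists i, (m i != 0)%N.
  apply/existsP; apply: contraNT m0 => /existsPn z; apply/eqP/mnmP => i.
  by rewrite mnm0E; apply/eqP; have := z i; rewrite negbK.
have := congr1 (fun q => q@_(m - U_(i))) (d0 i); rewrite /= mcoeff0 mcoeff_deriv => /eqP.
rewrite mulrn_eq0 /= submK ?lep1mP // => /eqP //.
Qed.

(** If g k with k > 0 is the first member nonzero at a point, it is a partial derivative of g (k-1),
    which vanishes there: so {g (k-1) = 0} is smooth at that point, and singular points of {p = 0}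
    need no separate treatment. *)
Lemma derivative_chain p : p != 0 -> exists L (g : nat -> {mpoly R[n]}),
  [/\ g 0%N = p, forall k, (k <= L)%N -> (g k != 0) && (msize (g k) <= msize p)%N,
      forall k, (k < L)%N -> exists i, g k.+1 = (g k)^`M(i) &
      exists2 a, a != 0 & g L = a%:MP].
Proof.
have [s] := ubnP (msize p); elim: s p => // s IH p ps p0.
have [/existsP[i di]|] := boolP [exists i, p^`M(i) != 0].
  have [L [g [g0 gn gd gL]]] := IH _ (leq_trans (msize_mderiv_lt di) ps) di.
  exists L.+1, (fun k => if k is k'.+1 then g k' else p); split => //.
  - move=> [_|k kL]; first by rewrite p0 leqnn.
    by have /andP[-> h] := gn k kL; rewrite (leq_trans h) // ltnW ?msize_mderiv_lt.
  - by move=> [_|k kL]; [exists i|exact: gd].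
move=> /existsPn d0; have [a e] : exists a, p = a%:MP.
  by apply: mderiv_all0 => i; apply/eqP; have := d0 i; rewrite negbK.
exists 0%N, (fun=> p); split => //; first by move=> k _; rewrite p0 leqnn.
by exists a => //; apply: contraNneq p0 => a0; rewrite e a0 mpolyC0.
Qed.
End Stratification.

(** * Incidences of points and circles in the plane *)

Section PlaneCircles.
Variable R : realFieldType.
Implicit Types (a b w r u v x y z t : R).

(* power of the point [(u,v)] with respect to the circle of center [(a,b)]
   and squared radius [a^2 + b^2 - w]; it is affine in [(a,b,w)] *)
Definition power u v a b w := u ^+ 2 + v ^+ 2 - 2 * a * u - 2 * b * v + w.
Definition cross u1 v1 u2 v2 u3 v3 := (u2 - u1) * (v3 - v1) - (v2 - v1) * (u3 - u1).
Definition circu a r t := a + r * (1 - t ^+ 2) / (1 + t ^+ 2).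
Definition circv b r t := b + r * (2 * t) / (1 + t ^+ 2).

Lemma den_gt0 t : 0 < 1 + t ^+ 2.
Proof. by rewrite ltr_pwDl ?sqr_ge0. Qed.
Lemma den_neq0 t : 1 + t ^+ 2 != 0.
Proof. by rewrite lt0r_neq0 ?den_gt0. Qed.

Lemma circ_param u v a b w r : power u v a b w = 0 -> r ^+ 2 = a ^+ 2 + b ^+ 2 - w ->
  u - a + r != 0 -> let t := (v - b) / (u - a + r) in circu a r t = u /\ circv b r t = v.
Proof.
move=> p0 rr n0 /=; set t := _ / _.
have vt : v = b + t * (u - a + r) by rewrite /t; field.
have e : (u - a + r) * ((u - a) * (1 + t ^+ 2) - r * (1 - t ^+ 2)) = 0.
  have -> : (u - a + r) * ((u - a) * (1 + t ^+ 2) - r * (1 - t ^+ 2)) =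
     (u - a) ^+ 2 - r ^+ 2 + (t * (u - a + r)) ^+ 2 by ring.
  have -> : t * (u - a + r) = v - b by rewrite vt; ring.
  by move: p0; rewrite /power rr => <-; ring.
have {}e : (u - a) * (1 + t ^+ 2) = r * (1 - t ^+ 2).
  by apply/eqP; rewrite -subr_eq0; move/eqP: e; rewrite mulf_eq0 (negbTE n0).
have d := den_neq0 t; split.
  by rewrite /circu -e mulfK //; ring.
rewrite /circv; apply: (mulIf d); rewrite mulrDl mulfVK // vt.
have -> : (b + t * (u - a + r)) * (1 + t ^+ 2) = b * (1 + t ^+ 2) + t * ((u - a) * (1 + t ^+ 2) + r * (1 + t ^+ 2)) by ring.
by rewrite e; ring.
Qed.

Lemma cross_circ a b r x y z :
  cross (circu a r x) (circv b r x) (circu a r y) (circv b r y) (circu a r z) (circv b r z)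
  = 4 * r ^+ 2 * ((y - x) * (z - x) * (z - y)) / ((1 + x ^+ 2) * (1 + y ^+ 2) * (1 + z ^+ 2)).
Proof.
rewrite /cross /circu /circv; have := den_neq0 x; have := den_neq0 y; have := den_neq0 z.
by move=> h1 h2 h3; field; rewrite h1 h2 h3.
Qed.

(** The shift is along the line of circles through both points in the space of triples (a, b, w); it
    changes the power by a multiple of the equation of the chord. *)
Lemma power_shift u v u1 v1 u2 v2 a b w l :
  power u v (a + l * (v2 - v1)) (b + l * (u1 - u2)) (w + l * (2 * (u1 * v2 - u2 * v1)))
  = power u v a b w + 2 * l * cross u1 v1 u2 v2 u v.
Proof. by rewrite /power /cross; ring. Qed.

(** The position of a circle in the pencil through two points, measured by its centre along the
    perpendicular bisector. *)
Definition pen u1 v1 u2 v2 a b :=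
  (a * (v2 - v1) + b * (u1 - u2)) / ((v2 - v1) ^+ 2 + (u1 - u2) ^+ 2).

Lemma dist_neq0 u1 v1 u2 v2 : (u1 != u2) || (v1 != v2) -> (v2 - v1) ^+ 2 + (u1 - u2) ^+ 2 != 0.
Proof.
move=> h; apply/negP; rewrite paddr_eq0 ?sqr_ge0 // !sqrf_eq0 !subr_eq0 => /andP[/eqP e /eqP e'].
by move: h; rewrite e e' !eqxx.
Qed.

Lemma pencil u1 v1 u2 v2 a b w a' b' w' : (u1 != u2) || (v1 != v2) ->
  power u1 v1 a b w = 0 -> power u2 v2 a b w = 0 ->
  power u1 v1 a' b' w' = 0 -> power u2 v2 a' b' w' = 0 ->
  let l := pen u1 v1 u2 v2 a' b' - pen u1 v1 u2 v2 a b in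
  [/\ a' = a + l * (v2 - v1), b' = b + l * (u1 - u2) & w' = w + l * (2 * (u1 * v2 - u2 * v1))].
Proof.
move=> h e1 e2 e3 e4 /=; have d := dist_neq0 h; rewrite /pen.
have k : (a' - a) * (u1 - u2) = (b' - b) * (v2 - v1).
  have : power u1 v1 a b w - power u2 v2 a b w - (power u1 v1 a' b' w' - power u2 v2 a' b' w') = 0.
    by rewrite e1 e2 e3 e4; ring.
  by rewrite /power => h0; lra.
set l := _ - _; have lE : l * ((v2 - v1) ^+ 2 + (u1 - u2) ^+ 2) = (a' - a) * (v2 - v1) + (b' - b) * (u1 - u2).
  by rewrite /l; field.
have ea : a' - a = l * (v2 - v1).
  apply: (mulIf d); rewrite mulrAC lE.
  have -> : (a' - a) * ((v2 - v1) ^+ 2 + (u1 - u2) ^+ 2) = (a' - a) * (v2 - v1) ^+ 2 + ((a' - a) * (u1 - u2)) * (u1 - u2) by ring.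
  by rewrite k; ring.
have eb : b' - b = l * (u1 - u2).
  apply: (mulIf d); rewrite mulrAC lE.
  have -> : (b' - b) * ((v2 - v1) ^+ 2 + (u1 - u2) ^+ 2) = ((b' - b) * (v2 - v1)) * (v2 - v1) + (b' - b) * (u1 - u2) ^+ 2 by ring.
  by rewrite -k; ring.
split; [by rewrite -ea; ring|by rewrite -eb; ring|].
have : power u1 v1 a' b' w' - power u1 v1 a b w = 0 by rewrite e1 e3 subr0.
have -> : power u1 v1 a' b' w' - power u1 v1 a b w = w' - w - 2 * (a' - a) * u1 - 2 * (b' - b) * v1.
  by rewrite /power; ring.
by rewrite ea eb => e; lra.
Qed.

Lemma circle_through3 u1 v1 u2 v2 u3 v3 a b w a' b' w' :
  cross u1 v1 u2 v2 u3 v3 != 0 ->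
  power u1 v1 a b w = 0 -> power u2 v2 a b w = 0 -> power u3 v3 a b w = 0 ->
  power u1 v1 a' b' w' = 0 -> power u2 v2 a' b' w' = 0 -> power u3 v3 a' b' w' = 0 ->
  [/\ a' = a, b' = b & w' = w].
Proof.
move=> cr e1 e2 e3 f1 f2 f3.
have h : (u1 != u2) || (v1 != v2).
  by apply: contraNT cr; rewrite negb_or !negbK => /andP[/eqP -> /eqP ->]; rewrite /cross !subrr !mul0r subr0.
have [] := pencil h e1 e2 f1 f2; set l := _ - _ => ea eb ew.
have := power_shift u3 v3 u1 v1 u2 v2 a b w l; rewrite -ea -eb -ew e3 f3 add0r => /esym/eqP.
rewrite !mulf_eq0 (negbTE cr) pnatr_eq0 /= orbF => /eqP l0.
by rewrite ea eb ew l0 !mul0r !addr0.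
Qed.

Definition det3 (a1 a2 a3 b1 b2 b3 c1 c2 c3 : R) :=
  a1 * (b2 * c3 - b3 * c2) - a2 * (b1 * c3 - b3 * c1) + a3 * (b1 * c2 - b2 * c1).

(** The determinant with rows (1, x + y, x y), rewritten as products of nonnegative differences. *)
Lemma interlaced_det_gt0 x1 y1 x2 y2 x3 y3 :
  x1 < y1 -> y1 <= x2 -> x2 < y2 -> y2 <= x3 -> x3 < y3 ->
  0 < (x2 + y2 - (x1 + y1)) * (x3 * y3 - x1 * y1) - (x3 + y3 - (x1 + y1)) * (x2 * y2 - x1 * y1).
Proof.
move=> h1 h2 h3 h4 h5.
have -> : (x2 + y2 - (x1 + y1)) * (x3 * y3 - x1 * y1) - (x3 + y3 - (x1 + y1)) * (x2 * y2 - x1 * y1)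
  = ((y2 - x2) + ((x2 - x1) + (x2 - y1))) * ((x3 - x2) * (y3 - x2))
    + ((x3 - x2) + (y3 - x2) - (y2 - x2)) * ((x2 - x1) * (x2 - y1)) by ring.
apply: ltr_pwDl; first by apply: mulr_gt0; [lra|apply: mulr_gt0; lra].
by apply: mulr_ge0; [lra|apply: mulr_ge0; lra].
Qed.

Lemma chord_circ a b r x y : let k := 2 * r * (y - x) / ((1 + x ^+ 2) * (1 + y ^+ 2)) in
  [/\ circv b r y - circv b r x = k * (1 - x * y),
   circu a r x - circu a r y = k * (x + y) &
   2 * (circu a r x * circv b r y - circu a r y * circv b r x) =
     2 * r * (k * (1 + x * y)) + 2 * a * (k * (1 - x * y)) + 2 * b * (k * (x + y))].
Proof.
have := den_neq0 x; have := den_neq0 y => h1 h2.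
by rewrite /circu /circv; split; field; rewrite h1 h2.
Qed.

(** Up to a positive factor and column operations, the pencil direction of a chord is (1 - x y, x +
    y, 1 + x y) by [chord_circ], so the sign is that of [interlaced_det_gt0]. Three disjoint arcs in
    order thus have independent, positively oriented pencils. *)
Lemma chord_det_gt0 a b r x1 y1 x2 y2 x3 y3 : 0 < r ->
  x1 < y1 -> y1 <= x2 -> x2 < y2 -> y2 <= x3 -> x3 < y3 ->
  let U := circu a r in let V := circv b r in
  0 < det3 (V y1 - V x1) (U x1 - U y1) (2 * (U x1 * V y1 - U y1 * V x1))
           (V y2 - V x2) (U x2 - U y2) (2 * (U x2 * V y2 - U y2 * V x2))
           (V y3 - V x3) (U x3 - U y3) (2 * (U x3 * V y3 - U y3 * V x3)).
Proof.
move=> r0 h1 h2 h3 h4 h5 /=; have id := interlaced_det_gt0 h1 h2 h3 h4 h5.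
have kp x y : x < y -> 0 < 2 * r * (y - x) / ((1 + x ^+ 2) * (1 + y ^+ 2)).
  move=> xy; apply: divr_gt0; last by rewrite mulr_gt0 ?den_gt0.
  by rewrite mulr_gt0 ?subr_gt0 // mulr_gt0.
have [-> -> ->] := chord_circ a b r x1 y1.
have [-> -> ->] := chord_circ a b r x2 y2.
have [-> -> ->] := chord_circ a b r x3 y3.
move: (kp _ _ h1) (kp _ _ h3) (kp _ _ h5).
move: (_ / _) (_ / _) (_ / _) => k1 k2 k3 p1 p2 p3.
rewrite /det3; set W := _ - _ in id.
have q : 0 < 4 * r * (k1 * k2 * k3) * W by rewrite !mulr_gt0.
apply: lt_le_trans q _; rewrite le_eqVlt; apply/orP; left; apply/eqP; rewrite /W; ring.
Qed.

(* the 4x4 determinant of the lifts [(1, a, b, w)], expanded along the column of ones *)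
Definition det4 (a b c d : R * R * R) :=
  let: (a1, a2, a3) := a in let: (b1, b2, b3) := b in
  let: (c1, c2, c3) := c in let: (d1, d2, d3) := d in
  det3 (b1 - a1) (b2 - a2) (b3 - a3) (c1 - a1) (c2 - a2) (c3 - a3) (d1 - a1) (d2 - a2) (d3 - a3).

Definition powr u v (c : R * R * R) := power u v c.1.1 c.1.2 c.2.

(** Cramer's relation among five vectors (1, a, b, w) of a four-dimensional space, evaluated by the
    linear form [powr u v]. *)
Lemma det4_syzygy u v (a a' b c d : R * R * R) :
  det4 a' b c d * powr u v a - det4 a b c d * powr u v a' + det4 a a' c d * powr u v b
  - det4 a a' b d * powr u v c + det4 a a' b c * powr u v d = 0.
Proof.
case: a => [[a1 a2] a3]; case: a' => [[a1' a2'] a3']; case: b => [[b1 b2] b3].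
case: c => [[c1 c2] c3]; case: d => [[d1 d2] d3].
rewrite /det4 /powr /power /det3 /=; ring.
Qed.

Lemma det4_cyc (a b c d : R * R * R) : det4 a b c d = det4 a c d b.
Proof.
case: a => [[a1 a2] a3]; case: b => [[b1 b2] b3]; case: c => [[c1 c2] c3]; case: d => [[d1 d2] d3].
by rewrite /det4 /det3; ring.
Qed.

(* the relation between the five lifts would need three reals any two of
   which have opposite signs *)
Lemma lens_configuration_impossible (a a' b1 b2 b3 : R * R * R) (e1 e2 e3 f1 f2 f3 : R * R) :
  let P e c := powr e.1 e.2 c in
  0 < det4 a b1 b2 b3 -> 0 < det4 a' b1 b2 b3 ->
  (forall e, e \in [:: e1; e2; e3] -> [/\ P e a = 0, P e a' < 0, 0 <= P e b1, 0 <= P e b2 & 0 <= P e b3]) ->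
  (forall e, e \in [:: f1; f2; f3] -> [/\ P e a' = 0, P e a < 0, 0 <= P e b1, 0 <= P e b2 & 0 <= P e b3]) ->
  P e1 b1 = 0 -> P e2 b2 = 0 -> P e3 b3 = 0 -> P f1 b1 = 0 -> P f2 b2 = 0 -> P f3 b3 = 0 -> False.
Proof.
move=> P X0 X0' he hf z1 z2 z3 y1 y2 y3.
have syz e := det4_syzygy e.1 e.2 a a' b1 b2 b3.
move: (syz e1) (syz e2) (syz e3) (syz f1) (syz f2) (syz f3).
rewrite -!/(P _ _) z1 z2 z3 y1 y2 y3 {syz}.
have ie1 : e1 \in [:: e1; e2; e3] by rewrite !inE eqxx.
have ie2 : e2 \in [:: e1; e2; e3] by rewrite !inE eqxx orbT.
have ie3 : e3 \in [:: e1; e2; e3] by rewrite !inE eqxx !orbT.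
have if1 : f1 \in [:: f1; f2; f3] by rewrite !inE eqxx.
have if2 : f2 \in [:: f1; f2; f3] by rewrite !inE eqxx orbT.
have if3 : f3 \in [:: f1; f2; f3] by rewrite !inE eqxx !orbT.
have [-> n1 _ p12 p13] := he _ ie1; have [-> n2 p21 _ p23] := he _ ie2; have [-> n3 p31 p32 _] := he _ ie3.
have [-> m1 _ q12 q13] := hf _ if1; have [-> m2 q21 _ q23] := hf _ if2; have [-> m3 q31 q32 _] := hf _ if3.
move: (det4 a a' b2 b3) (det4 a a' b1 b3) (det4 a a' b1 b2) => t1 t2 t3.
move: (det4 a b1 b2 b3) (det4 a' b1 b2 b3) X0 X0' => X X' X0 X0'.
have neg (x y p q : R) : 0 <= p -> 0 <= q -> x * p + y * q < 0 -> (x < 0) || (y < 0).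
  move=> p0 q0 h; have [//|x0] := ltP x 0; have [//|y0] := ltP y 0.
  by have := mulr_ge0 x0 p0; have := mulr_ge0 y0 q0; lra.
have pos (x y p q : R) : 0 <= p -> 0 <= q -> 0 < x * p + y * q -> (0 < x) || (0 < y).
  move=> p0 q0; have := neg (- x) (- y) p q p0 q0; rewrite !oppr_lt0 !mulNr => h h2; apply: h; lra.
move=> s1 s2 s3 r1 r2 r3.
have g (Y p : R) : 0 < Y -> p < 0 -> Y * p < 0 by move=> ? ?; rewrite pmulr_rlt0.
have := neg (- t2) t3 _ _ p12 p13; have := neg t1 t3 _ _ p21 p23; have := neg t1 (- t2) _ _ p31 p32.
have := pos (- t2) t3 _ _ q12 q13; have := pos t1 t3 _ _ q21 q23; have := pos t1 (- t2) _ _ q31 q32.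
have := g _ _ X0 n1; have := g _ _ X0 n2; have := g _ _ X0 n3.
have := g _ _ X0' m1; have := g _ _ X0' m2; have := g _ _ X0' m3.
move=> a1 a2 a3 a4 a5 a6 c1 c2 c3 c4 c5 c6.
have := c1 ltac:(move: r3 a1; clear; lra); have := c2 ltac:(move: r2 a2; clear; lra).
have := c3 ltac:(move: r1 a3; clear; lra); have := c4 ltac:(move: s3 a4; clear; lra).
have := c5 ltac:(move: s2 a5; clear; lra); have := c6 ltac:(move: s1 a6; clear; lra).
clear; rewrite oppr_gt0 oppr_lt0.
by case: (ltgtP t1 0); case: (ltgtP t2 0); case: (ltgtP t3 0).
Qed.
End PlaneCircles.

(** [reverse_orders_bound] on each label class K, where |K|^(3/2) <= |K| 2^g because |K| <= 4^g.
    19^2 exceeds 360. *)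
Lemma reverse_orders_classes (n g : nat) (A : 'I_n -> {set 'I_n}) (pos : 'I_n -> 'I_n -> nat)
    (D : {set 'I_n}) (T : finType) (lab : 'I_n -> T) :
  reverse_family A pos ->
  (forall i j, j \in A i -> [/\ i \in D, j \in D & lab j = lab i]) ->
  (forall i, i \in D -> #|[set j in D | lab j == lab i]| <= 4 ^ g)%N ->
  (totcard A <= 19 * n * (2 ^ g * (2 * g).+1))%N.
Proof.
move=> rev labA small.
have main l : (\sum_(i in D | lab i == l) #|A i| <= 19 * #|[set i in D | lab i == l]| * (2 ^ g * (2 * g).+1))%N.
  set K := [set i in D | lab i == l].
  have [K0|[k0 k0K]] := set_0Vmem K.
    rewrite big_pred0 // => i; have : i \in K = false by rewrite K0 inE.
    by rewrite inE.
  have Kg : (#|K| <= 4 ^ g)%N.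
    by move: k0K; rewrite inE => /andP[kD /eqP e]; rewrite /K -e; apply: small.
  pose I := {x | x \in K}.
  pose B (i : I) : {set I} := [set j : I | val j \in A (val i)].
  pose ps (i j : I) := pos (val i) (val j).
  have cI : #|{: I}| = #|K| by rewrite card_sig; apply: eq_card => x; rewrite inE.
  have revB : reverse_family B ps.
    split=> [i x y|i j x y z ij]; rewrite !inE.
      by move=> xA yA e; apply/val_inj/(rev.1 (val i)).
    by move=> /andP[? ?] /andP[? ?] /andP[? ?]; apply: rev.2; rewrite ?inE //; apply/andP.
  have tB : totcard B = (\sum_(i in D | lab i == l) #|A i|)%N.
    rewrite (eq_bigl (fun i => i \in K)) => [|i]; last by rewrite inE.
    rewrite (big_sub (mem K)) /totcard; apply: eq_bigr => i _.
    rewrite -sum1_card -[RHS]sum1_card.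
    rewrite [RHS](eq_bigl (fun j => (j \in K) && (j \in A (val i)))) => [|j].
      by rewrite big_mkcondr (big_sub (mem K)) -big_mkcond; apply: eq_bigl => j; rewrite inE.
    apply/idP/andP => [jA|[]//]; split=> //; have [_ jD lj] := labA _ _ jA.
    by have := valP i; rewrite !inE jD lj => /andP[_ ->].
  have K1 : (0 < #|K|)%N by apply/card_gt0P; exists k0.
  have := @reverse_orders_bound I I B ps #|K| (2 * g) revB K1.
  rewrite cI leqnn expnM => /(_ isT isT Kg); rewrite tB => h.
  rewrite -leq_sqr; apply: leq_trans h _.
  have -> : ((19 * #|K| * (2 ^ g * (2 * g).+1)) ^ 2 = 361 * #|K| ^ 2 * (2 ^ g) ^ 2 * (2 * g).+1 ^ 2)%N.
    by rewrite -!mulnn; ring.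
  rewrite leq_mul2r; apply/orP; right.
  have -> : (360 * #|K| ^ 3 = 360 * #|K| ^ 2 * #|K|)%N by rewrite !expnS; ring.
  rewrite leq_mul // ?leq_mul2r ?orbT //; apply: leq_trans Kg _.
  by rewrite -expnM mulnC expnM.
rewrite /totcard (bigID (mem D)) /= [X in (_ + X)%N]big1 ?addn0 => [|i iD]; last first.
  apply/eqP; rewrite cards_eq0; apply/set0Pn => -[j /labA[iD' _ _]].
  by rewrite iD' in iD.
rewrite (partition_big lab predT) //=.
apply: leq_trans (leq_sum _ (fun l _ => main l)) _.
rewrite -big_distrl /= -big_distrr /= leq_mul2r; apply/orP; right.
rewrite leq_mul2l /=; apply: leq_trans (_ : \sum_l \sum_(i | (i \in D) && (lab i == l)) 1 <= _)%N.
  by apply: leq_sum => l _; rewrite -sum1_card; apply: eq_leq; apply: eq_bigl => i; rewrite inE.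
apply: leq_trans (_ : \sum_(i in D) 1 <= _)%N; first by rewrite [X in (_ <= X)%N](partition_big lab predT).
by rewrite sum1_card -[X in (_ <= X)%N]card_ord max_card.
Qed.

Lemma cons_inj (R : rcfType) (T : finType) (S : {set T}) (t : T -> R) x y z :
  {in S &, injective t} -> cons S t x z -> cons S t y z -> x = y.
Proof.
move=> tinj /and4P[xS zS xz /forall_inP hx] /and4P[yS _ yz /forall_inP hy].
apply: tinj => //; have := hx y yS; have := hy x xS; rewrite xz yz !andbT.
by case: ltgtP.
Qed.

Lemma card_below_lt (R : rcfType) (T : finType) (S : {set T}) (t : T -> R) x y :
  x \in S -> y \in S ->
  (#|[set z in S | (t z < t x)%R]| < #|[set z in S | (t z < t y)%R]|)%N = (t x < t y).
Proof.
move=> xS yS; have [lt|le] := ltP (t x) (t y).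
  apply: proper_card; apply/properP; split.
    by apply/subsetP => z; rewrite !inE => /andP[->] /= /lt_trans; apply.
  by exists x; rewrite ?inE ?ltxx ?andbF // xS.
rewrite ltnNge; apply/negbF/subset_leq_card/subsetP => z; rewrite !inE.
by move=> /andP[->] /= /lt_le_trans; apply.
Qed.

(** * Lenses *)

Section Lenses.
Variables (R : realType) (m n : nat).
Variables (U V : 'I_m -> R) (a b w : 'I_n -> R) (Q : {set 'I_m}).
Hypothesis pts_inj : forall i j, U i = U j -> V i = V j -> i = j.
Hypothesis circ_inj : forall i j, a i = a j -> b i = b j -> w i = w j -> i = j.
Hypothesis sqr_rad_gt0 : forall i, 0 < a i ^+ 2 + b i ^+ 2 - w i.

Definition rho A := Num.sqrt (a A ^+ 2 + b A ^+ 2 - w A).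
Definition pw A p := power (U p) (V p) (a A) (b A) (w A).
(* the point with parameter at infinity is left out *)
Definition onc A := [set p in Q | (pw A p == 0) && (U p - a A + rho A != 0)].
Definition par A p := (V p - b A) / (U p - a A + rho A).
Definition edge A p q := cons (onc A) (par A) p q.
Definition crs p q e := cross (U p) (V p) (U q) (V q) (U e) (V e).

Lemma rho_gt0 A : 0 < rho A. Proof. by rewrite sqrtr_gt0. Qed.

Lemma oncP A p : p \in onc A ->
  [/\ circu (a A) (rho A) (par A p) = U p, circv (b A) (rho A) (par A p) = V p & pw A p = 0].
Proof.
rewrite inE => /and3P[_ /eqP p0 nz]; have r2 : rho A ^+ 2 = a A ^+ 2 + b A ^+ 2 - w A.
  by rewrite sqr_sqrtr // ltW.
by have [-> ->] := circ_param p0 r2 nz.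
Qed.

Lemma par_inj A : {in onc A &, injective (par A)}.
Proof.
move=> p q /oncP[pu pv _] /oncP[qu qv _] e.
by apply: pts_inj; [rewrite -pu -qu e|rewrite -pv -qv e].
Qed.

Lemma crsE A p q e : p \in onc A -> q \in onc A -> e \in onc A ->
  crs p q e = 4 * rho A ^+ 2 * ((par A q - par A p) * (par A e - par A p) * (par A e - par A q))
    / ((1 + par A p ^+ 2) * (1 + par A q ^+ 2) * (1 + par A e ^+ 2)).
Proof.
move=> /oncP[pu pv _] /oncP[qu qv _] /oncP[eu ev _].
by have := cross_circ (a A) (b A) (rho A) (par A p) (par A q) (par A e); rewrite pu pv qu qv eu ev.
Qed.

Lemma edge_mem A p q : edge A p q -> [/\ p \in onc A, q \in onc A & par A p < par A q].
Proof. by case/and4P. Qed.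

(** No point of [onc A] lies between p and q, so all of them are on one side of the chord. *)
Lemma edge_crs_ge0 A p q e : edge A p q -> e \in onc A -> 0 <= crs p q e.
Proof.
move=> E eA; have [pA qA pq] := edge_mem E; rewrite (crsE pA qA eA).
apply: divr_ge0; last by rewrite !mulr_ge0 // ltW ?den_gt0.
rewrite -mulrA mulr_ge0 // mulr_ge0 ?sqr_ge0 // -mulrA mulr_ge0 ?subr_ge0 ?(ltW pq) //.
have [le|lt] := leP (par A e) (par A p).
  by apply: mulr_le0; rewrite subr_le0 // (le_trans le) // ltW.
by apply: mulr_ge0; rewrite subr_ge0; [exact: ltW|exact: (cons_le E)].
Qed.

Lemma crs_neq0 A p q e : p \in onc A -> q \in onc A -> e \in onc A ->
  p != q -> p != e -> q != e -> crs p q e != 0.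
Proof.
move=> pA qA eA pq pe qe; rewrite (crsE pA qA eA).
have nz x y : x \in onc A -> y \in onc A -> x != y -> par A y - par A x != 0.
  by move=> xA yA xy; rewrite subr_eq0 eq_sym; apply: contra_neq xy; apply: par_inj.
apply: mulf_neq0; last by rewrite invr_eq0 !mulf_neq0 ?den_neq0.
apply: mulf_neq0; last by rewrite !mulf_neq0 ?nz.
by rewrite mulf_neq0 ?pnatr_eq0 // expf_neq0 // lt0r_neq0 // rho_gt0.
Qed.

Lemma pts_neq p q : p != q -> (U p != U q) || (V p != V q).
Proof. by apply: contraNT; rewrite negb_or !negbK => /andP[/eqP e1 /eqP e2]; apply/eqP/pts_inj. Qed.

Lemma edge_neq A p q : edge A p q -> p != q.
Proof. by case/edge_mem => _ _; apply: contraTneq => ->; rewrite ltxx. Qed.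

Variables (D : {set 'I_n}) (T : finType) (lab : 'I_n -> T).

Definition penp p q A := pen (U p) (V p) (U q) (V q) (a A) (b A).
Definition pencil_class p q l := [set A in D | edge A p q && (lab A == l)].
(** A and B are neighbours in the pencil of the edge (p, q) within one label class, and so bound a
    lens. With neighbours only, an edge of B has at most one predecessor. *)
Definition nxt p q A B := (lab A == lab B) && cons (pencil_class p q (lab B)) (penp p q) A B.

Lemma edges_pencil p q A B : edge A p q -> edge B p q ->
  let l := penp p q B - penp p q A in
  [/\ a B = a A + l * (V q - V p), b B = b A + l * (U p - U q) &
      w B = w A + l * (2 * (U p * V q - U q * V p))].
Proof.
move=> EA EB; have [pA qA _] := edge_mem EA; have [pB qB _] := edge_mem EB.
have [_ _ z1] := oncP pA; have [_ _ z2] := oncP qA; have [_ _ z3] := oncP pB; have [_ _ z4] := oncP qB.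
exact: (pencil (pts_neq (edge_neq EA)) z1 z2 z3 z4).
Qed.

Lemma pen_inj p q l : {in pencil_class p q l &, injective (penp p q)}.
Proof.
move=> A B; rewrite !inE => /and3P[_ EA _] /and3P[_ EB _] e.
have [] := edges_pencil EA EB; rewrite e subrr !mul0r !addr0 => ea eb ew; by apply: circ_inj.
Qed.

Lemma nxtP p q A B : nxt p q A B -> [/\ A \in D, B \in D, lab A = lab B, edge A p q & edge B p q] /\
  exists2 l, 0 < l & [/\ a B = a A + l * (V q - V p), b B = b A + l * (U p - U q),
     w B = w A + l * (2 * (U p * V q - U q * V p)) & forall e, pw B e = pw A e + 2 * l * crs p q e].
Proof.
move=> /andP[/eqP lAB /and4P[]]; rewrite !inE => /and3P[AD EA _] /and3P[BD EB _] lt _.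
split; first by split.
exists (penp p q B - penp p q A); first by rewrite subr_gt0.
have [ea eb ew] := edges_pencil EA EB; split=> // e.
by rewrite /pw ea eb ew power_shift.
Qed.

Lemma share_two A B p q p' q' : A != B ->
  p \in onc A -> q \in onc A -> p' \in onc A -> q' \in onc A ->
  pw B p = 0 -> pw B q = 0 -> pw B p' = 0 -> pw B q' = 0 ->
  par A p < par A q -> par A p' < par A q' -> p = p' /\ q = q'.
Proof.
move=> AB pA qA pA' qA' p0 q0 p0' q0' pq pq'.
have [_ _ zp] := oncP pA; have [_ _ zq] := oncP qA.
have mem2 e : e \in onc A -> pw B e = 0 -> e = p \/ e = q.
  move=> eA e0; have [_ _ ze] := oncP eA.
  have [->|pe] := eqVneq e p; first by left.
  have [->|qe] := eqVneq e q; first by right.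
  have npq : p != q by apply: contraTneq pq => ->; rewrite ltxx.
  have := crs_neq0 pA qA eA npq; rewrite eq_sym pe eq_sym qe => /(_ isT isT) nz.
  have [] := circle_through3 nz zp zq ze p0 q0 e0 => e1 e2 e3.
  by case/eqP: AB; apply: circ_inj.
case: (mem2 p' pA' p0') => ep; case: (mem2 q' qA' q0') => eq; rewrite ep eq // in pq' *.
- by rewrite ltxx in pq'.
- by rewrite ltNge ltW in pq'.
- by rewrite ltxx in pq'.
Qed.

Lemma nxt_neq p q A B : nxt p q A B -> A != B.
Proof. by case/andP => _ /and4P[_ _ lt _]; apply: contraTneq lt => ->; rewrite ltxx. Qed.

Lemma nxt_edge_uniq p q p' q' A B : nxt p q A B -> nxt p' q' A B -> p = p' /\ q = q'.
Proof.
move=> N N'; have AB := nxt_neq N; have [[_ _ _ EA EB] _] := nxtP N; have [[_ _ _ EA' EB'] _] := nxtP N'.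
have [? ? ?] := edge_mem EA; have [? ? ?] := edge_mem EA'.
have [/oncP[_ _ ?] /oncP[_ _ ?] _] := edge_mem EB; have [/oncP[_ _ ?] /oncP[_ _ ?] _] := edge_mem EB'.
exact: (share_two AB).
Qed.

(** B is A moved by a positive amount along the pencil, so on A its power is a positive multiple of
    [crs]: the points on A are outside B or on it. [nxt_onc'] is the mirror image. *)
Lemma nxt_onc p q A B e : nxt p q A B -> e \in onc A -> 0 <= pw B e.
Proof.
move=> N eA; have [[_ _ _ EA _] [l l0 [_ _ _ ->]]] := nxtP N; have [_ _ ->] := oncP eA.
by rewrite add0r; apply: mulr_ge0; [rewrite mulr_ge0 // ltW|exact: edge_crs_ge0 EA eA].
Qed.

Lemma nxt_onc' p q A B e : nxt p q A B -> e \in onc B -> pw A e <= 0.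
Proof.
move=> N eB; have [[_ _ _ _ EB] [l l0 [_ _ _ h]]] := nxtP N; have [_ _ e0] := oncP eB.
have := h e; rewrite e0; have := edge_crs_ge0 EB eB => c0.
have : 0 <= 2 * l * crs p q e by apply: mulr_ge0; rewrite ?mulr_ge0 // ltW.
lra.
Qed.

Definition trip A : R * R * R := (a A, b A, w A).

(** Each B_i - A is a positive multiple of the pencil direction of its edge, and the edges of A are
    in order. *)
Lemma det4_gt0 A B1 B2 B3 p1 q1 p2 q2 p3 q3 :
  nxt p1 q1 A B1 -> nxt p2 q2 A B2 -> nxt p3 q3 A B3 ->
  par A p1 < par A p2 -> par A p2 < par A p3 ->
  0 < det4 (trip A) (trip B1) (trip B2) (trip B3).
Proof.
move=> N1 N2 N3 l12 l23.
have [[_ _ _ E1 _] [l1 p_1 [ea1 eb1 ew1 _]]] := nxtP N1.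
have [[_ _ _ E2 _] [l2 p_2 [ea2 eb2 ew2 _]]] := nxtP N2.
have [[_ _ _ E3 _] [l3 p_3 [ea3 eb3 ew3 _]]] := nxtP N3.
have [P1 Q1 lt1] := edge_mem E1; have [P2 Q2 lt2] := edge_mem E2; have [P3 Q3 lt3] := edge_mem E3.
have := chord_det_gt0 (a A) (b A) (rho_gt0 A) lt1 (cons_le E1 P2 l12) lt2 (cons_le E2 P3 l23) lt3.
rewrite /=; have [-> -> _] := oncP P1; have [-> -> _] := oncP Q1; have [-> -> _] := oncP P2.
have [-> -> _] := oncP Q2; have [-> -> _] := oncP P3; have [-> -> _] := oncP Q3 => d.
have {}d := mulr_gt0 (mulr_gt0 (mulr_gt0 p_1 p_2) p_3) d.
apply: lt_le_trans d _; rewrite le_eqVlt; apply/orP; left; apply/eqP.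
rewrite /trip /det4 ea1 eb1 ew1 ea2 eb2 ew2 ea3 eb3 ew3 /det3; ring.
Qed.

(* an endpoint of the [A]-edge shared with [B] lies strictly inside [A'] *)
Lemma exists_inner_endpoint p q p' q' A A' B : A != A' -> nxt p q A B -> nxt p' q' A' B ->
  exists e, [/\ e \in onc A, pw B e = 0 & pw A' e < 0].
Proof.
move=> AA N N'; have [[_ _ _ EA EB] _] := nxtP N; have [[_ _ _ EA' EB'] _] := nxtP N'.
have [pB qB ltB] := edge_mem EB; have [pB' qB' ltB'] := edge_mem EB'.
have [pA qA _] := edge_mem EA; have [pA' qA' _] := edge_mem EA'.
have [_ _ zp] := oncP pB; have [_ _ zq] := oncP qB.
have [_ _ zp'] := oncP pA'; have [_ _ zq'] := oncP qA'.
have [p0|p0] := eqVneq (pw A' p) 0; last first.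
  by exists p; rewrite pA zp lt_neqAle p0 (nxt_onc' N' pB).
have [q0|q0] := eqVneq (pw A' q) 0; last first.
  by exists q; rewrite qA zq lt_neqAle q0 (nxt_onc' N' qB).
have BA' : B != A' by rewrite eq_sym (nxt_neq N').
have [e1 e2] := share_two BA' pB qB pB' qB' p0 q0 zp' zq' ltB ltB'.
case/eqP: AA; move: N N' => /andP[_ N] /andP[_]; rewrite -e1 -e2 => N'.
exact: (cons_inj (@pen_inj _ _ _) N N').
Qed.

Definition succs A := [set B | [exists e : 'I_m * 'I_m, nxt e.1 e.2 A B]].
Definition succ_pos A B : nat :=
  if [pick e : 'I_m * 'I_m | nxt e.1 e.2 A B] is Some e
  then #|[set z in onc A | (par A z < par A e.1)%R]| else 0%N.

Lemma succsP A B : B \in succs A -> exists p q, nxt p q A B /\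
   succ_pos A B = #|[set z in onc A | (par A z < par A p)%R]|.
Proof.
rewrite inE => /existsP[e N]; rewrite /succ_pos; case: pickP => [f Nf|/(_ e)]; last by rewrite N.
by exists f.1, f.2.
Qed.

(** If A and A' met B1, B2, B3 in the same cyclic order, both determinants would be positive; with
    the inner endpoints of both circles this is the configuration excluded by
    [lens_configuration_impossible]. *)
Lemma reverse_lenses : reverse_family succs succ_pos.
Proof.
split=> [A B B' /succsP[p [q [N ->]]] /succsP[p' [q' [N' ->]]] e|A A' B1 B2 B3 AA].
  have [[_ _ l1 EA _] _] := nxtP N; have [[_ _ l2 EA' _] _] := nxtP N'.
  have [pA qA _] := edge_mem EA; have [pA' qA' _] := edge_mem EA'.
  have ep : p = p'.
    apply: (@par_inj A) => //; have := card_below_lt (par A) pA pA'; have := card_below_lt (par A) pA' pA.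
    by rewrite e ltnn; case: ltgtP.
  rewrite -ep in N' EA'; have eq := cons_fun (@par_inj A) EA EA'; rewrite -eq in N'.
  case/andP: N => _ N; case/andP: N' => _; rewrite -l2 l1 => N'.
  exact: (cons_fun (@pen_inj _ _ _) N N').
move=> /setIP[b1 b1'] /setIP[b2 b2'] /setIP[b3 b3'].
have [p1 [q1 [N1 ->]]] := succsP b1; have [p2 [q2 [N2 ->]]] := succsP b2; have [p3 [q3 [N3 ->]]] := succsP b3.
have [r1 [s1 [M1 ->]]] := succsP b1'; have [r2 [s2 [M2 ->]]] := succsP b2'; have [r3 [s3 [M3 ->]]] := succsP b3'.
have on p q X Y (N : nxt p q X Y) : p \in onc X.
  by have [[_ _ _ EX _] _] := nxtP N; have [] := edge_mem EX.
rewrite /cyc3 !card_below_lt ?(on _ _ _ _ N1) ?(on _ _ _ _ N2) ?(on _ _ _ _ N3)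
  ?(on _ _ _ _ M1) ?(on _ _ _ _ M2) ?(on _ _ _ _ M3) // => /andP[l12 l23].
apply/negP => cyc.
have d1 := det4_gt0 N1 N2 N3 l12 l23.
have d2 : 0 < det4 (trip A') (trip B1) (trip B2) (trip B3).
  case/or3P: cyc => /andP[h h'].
  - exact: det4_gt0 M1 M2 M3 h h'.
  - by rewrite det4_cyc; exact: det4_gt0 M2 M3 M1 h h'.
  - by rewrite -det4_cyc; exact: det4_gt0 M3 M1 M2 h h'.
have AA' : A' != A by rewrite eq_sym.
have [e1 [e1A e1B e1n]] := exists_inner_endpoint AA N1 M1.
have [e2 [e2A e2B e2n]] := exists_inner_endpoint AA N2 M2.
have [e3 [e3A e3B e3n]] := exists_inner_endpoint AA N3 M3.
have [f1 [f1A f1B f1n]] := exists_inner_endpoint AA' M1 N1.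
have [f2 [f2A f2B f2n]] := exists_inner_endpoint AA' M2 N2.
have [f3 [f3A f3B f3n]] := exists_inner_endpoint AA' M3 N3.
have side X Y p q e : e \in onc X -> nxt p q X Y -> 0 <= powr (U e) (V e) (trip Y).
  by move=> eX N; exact: (nxt_onc N eX).
have zer X e : e \in onc X -> powr (U e) (V e) (trip X) = 0 by case/oncP.
apply: (@lens_configuration_impossible R (trip A) (trip A') (trip B1) (trip B2) (trip B3)
   (U e1, V e1) (U e2, V e2) (U e3, V e3) (U f1, V f1) (U f2, V f2) (U f3, V f3)) => //.
- move=> e; rewrite !inE => /or3P[] /eqP ->; split=> //;
    by [exact: zer | exact: (side _ _ _ _ _ _ N1) | exact: (side _ _ _ _ _ _ N2) | exact: (side _ _ _ _ _ _ N3)].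
- move=> e; rewrite !inE => /or3P[] /eqP ->; split=> //;
    by [exact: zer | exact: (side _ _ _ _ _ _ M1) | exact: (side _ _ _ _ _ _ M2) | exact: (side _ _ _ _ _ _ M3)].
Qed.

(** Two circles form at most one lens ([nxt_edge_uniq]), so lenses inject into the successor
    lists. *)
Lemma card_lenses g :
  (forall A, A \in D -> #|[set B in D | lab B == lab A]| <= 4 ^ g)%N ->
  (#|[set x : 'I_n * ('I_m * 'I_m) | [exists A, nxt x.2.1 x.2.2 A x.1]]| <= 19 * n * (2 ^ g * (2 * g).+1))%N.
Proof.
move=> small; apply: leq_trans (reverse_orders_classes reverse_lenses _ small); last first.
  by move=> A B /succsP[p [q [N _]]]; have [[AD BD l _ _] _] := nxtP N.
set L := [set x | _].
pose f (x : 'I_n * ('I_m * 'I_m)) := (odflt x.1 [pick A | nxt x.2.1 x.2.2 A x.1], x.1).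
have fP x : x \in L -> nxt x.2.1 x.2.2 (f x).1 x.1.
  rewrite inE => /existsP[A N]; rewrite /f; case: pickP => [//|/(_ A)]; by rewrite N.
have finj : {in L &, injective f}.
  move=> x y xL yL e; have := fP x xL; have := fP y yL; rewrite -e.
  have e1 : x.1 = y.1 by case: e.
  rewrite -e1 => h1 h2; have [ep eq] := nxt_edge_uniq h2 h1.
  by case: x y ep eq e1 {xL yL e h1 h2} => [x [x1 x2]] [y [y1 y2]] /= -> -> ->.
rewrite -(card_in_imset finj) /totcard.
apply: (@leq_trans #|[set z : 'I_n * 'I_n | z.2 \in succs z.1]|).
  apply/subset_leq_card/subsetP => _ /imsetP[x xL ->]; rewrite !inE.
  by apply/existsP; exists x.2; exact: fP.
rewrite -sum1_card (eq_bigl (fun z => true && (z.2 \in succs z.1))) => [|z]; last by rewrite inE.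
rewrite -(pair_big_dep xpredT (fun i j => j \in succs i) (fun _ _ => 1%N)) /=.
by apply: leq_sum => A _; rewrite sum1_card.
Qed.
End Lenses.

Lemma msize_prod_degs (R : realType) n' (Fs : seq {mpoly R[n'.+1]}) : all (fun F => F != 0) Fs ->
  \prod_(F <- Fs) F != 0 /\ ((msize (\prod_(F <- Fs) F)).-1 <= degs Fs)%N.
Proof.
elim: Fs => [_|F Fs IH /= /andP[F0 /IH[P0 sP]]].
  by rewrite big_nil oner_neq0 msize1.
rewrite big_cons mulf_neq0 // msizeM // /degs big_cons; split=> //.
have : (0 < msize F)%N by rewrite lt0n msize_poly_eq0.
have : (0 < msize (\prod_(F <- Fs) F))%N by rewrite lt0n msize_poly_eq0.
move: sP; rewrite /degs; move: (msize _) (msize F) (\sum_(_ <- _) _)%N => x y z; lia.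
Qed.

Lemma meval_prod_neq0 (R : idomainType) n (Fs : seq {mpoly R[n]}) x :
  ((\prod_(F <- Fs) F).@[x] != 0) = all (fun F => F.@[x] != 0) Fs.
Proof.
elim: Fs => [|F Fs IH]; first by rewrite big_nil meval1 oner_neq0.
by rewrite big_cons mevalM mulf_eq0 negb_or IH.
Qed.

(** * Points of a curve on the strata of a chain *)

Section Strata.
Variables (R : rcfType) (n : nat).
Variables (L : nat) (g : nat -> {mpoly R[n]}) (d : nat).
Hypothesis gL : exists2 a, a != 0 & g L = a%:MP.
Hypothesis gd : forall k, (k <= L)%N -> ((msize (g k)).-1 <= d)%N.

Lemma stratum_subproof x : exists k, (g k).@[x] != 0.
Proof. by have [a a0 e] := gL; exists L; rewrite e mevalC. Qed.

Definition stratum x := ex_minn (stratum_subproof x).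

Lemma stratumP x : (g (stratum x)).@[x] != 0.
Proof. by rewrite /stratum; case: ex_minnP. Qed.

Lemma stratum_lt x k : (k < stratum x)%N -> (g k).@[x] = 0.
Proof.
rewrite /stratum; case: ex_minnP => j _ jmin kj; apply/eqP; apply: contraTT kj => k0.
by rewrite -leqNgt jmin.
Qed.

Lemma stratum_le x : (stratum x <= L)%N.
Proof. by rewrite leqNgt; apply/negP => /stratum_lt; have [a /negbTE a0 ->] := gL; rewrite mevalC => /eqP; rewrite a0. Qed.

Variables (w : {poly R}) (c : 'I_n -> {poly R}) (dl : nat).
Hypothesis w0 : forall s, 0 < w.[s].
Hypothesis sw : (size w <= dl.+1)%N.
Hypothesis sc : forall i, (size (c i) <= dl.+1)%N.

(** Different points may come with different witnesses, but the least member that is not identically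
    zero on the curve vanishes at all of them, so one root count suffices. *)
Lemma card_low_points (T : finType) (S : {set T}) (t : T -> R) (X : T -> 'I_n -> R) :
  {in S &, injective t} -> (forall x, x \in S -> X x =1 curve w c (t x)) ->
  (forall x, x \in S -> exists2 j, (j < stratum (X x))%N & exists s, (g j).@[curve w c s] != 0) ->
  (#|S| <= dl * d)%N.
Proof.
move=> tinj XE XS; have [->|[x0 x0S]] := set_0Vmem S; first by rewrite cards0.
pose P k := boolp.asbool (exists s, (g k).@[curve w c s] != 0).
have exP : exists k, P k by have [j _ jP] := XS _ x0S; exists j; apply/boolp.asboolP.
have [j /boolp.asboolP[s js] jmin] := ex_minnP exP.
have jlt x : x \in S -> (j < stratum (X x))%N.
  by move=> xS; have [k kx ex] := XS x xS; apply: leq_ltn_trans kx; apply: jmin; apply/boolp.asboolP.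
have jL : (j <= L)%N by apply: leq_trans (stratum_le (X x0)); apply: ltnW; apply: jlt.
have gj := good_mpoly w0 sw sc (leqSpred (msize (g j))).
apply: leq_trans (_ : (dl * (msize (g j)).-1 <= _)%N); last by rewrite leq_mul2l gd ?orbT.
apply: (good_zeros w0 tinj gj js) => x xS.
by rewrite -(stratum_lt (jlt x xS)); apply: meval_eq => i; rewrite XE.
Qed.

Lemma card_deep_points (T : finType) (S : {set T}) (t : T -> R) (X : T -> 'I_n -> R) :
  {in S &, injective t} -> (forall x, x \in S -> X x =1 curve w c (t x)) ->
  (forall x, x \in S -> (0 < stratum (X x))%N /\ exists s, (g (stratum (X x)).-1).@[curve w c s] != 0) ->
  (#|S| <= dl * d)%N.
Proof.
move=> tinj XE XS; apply: card_low_points tinj XE _ => x xS.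
by have [k0 ex] := XS x xS; exists (stratum (X x)).-1; rewrite ?prednK.
Qed.
End Strata.

Section Flow.
Variables (R : rcfType) (n : nat) (w : {poly R}) (c : 'I_n -> {poly R}).
Hypothesis w0 : forall s, 0 < w.[s].
Variables (T : 'I_n -> {mpoly R[n]}) (tau : R -> R).
Hypothesis tau0 : forall s, tau s != 0.
Hypothesis vel : forall s i, velocity w c s i = tau s * (T i).@[curve w c s].

Definition lie F : {mpoly R[n]} := \sum_i F^`M(i) * T i.

Lemma lie_flow F : hasder w (fun s => F.@[curve w c s]) (fun s => tau s * (lie F).@[curve w c s]).
Proof.
apply: hasder_ext (hasder_mpoly c w0 F) => s //.
rewrite /lie raddf_sum mulr_sumr; apply: eq_bigr => i _.
by rewrite /= mevalM vel mulrCA.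
Qed.

Lemma lie_vanish F : (forall s, F.@[curve w c s] = 0) -> forall s, (lie F).@[curve w c s] = 0.
Proof.
move=> F0 s; have := hasder0 w0 (lie_flow F) F0 s => /eqP.
by rewrite mulf_eq0 (negbTE (tau0 s)) => /eqP.
Qed.
End Flow.

Section Quadratics.
Variable R : rcfType.

Definition quad (x y z : R) : {poly R} := x%:P + y *: 'X + z *: 'X^2.

Lemma horner_quad x y z s : (quad x y z).[s] = x + y * s + z * s ^+ 2.
Proof. by rewrite !hornerE. Qed.

Lemma size_quad x y z : (size (quad x y z) <= 3)%N.
Proof.
apply/leq_sizeP => j j3; rewrite !coefD coefC !coefZ coefX coefXn.
by case: j j3 => [|[|[|j]]] //= _; rewrite !mulr0 !addr0.
Qed.

Lemma deriv_quad x y z s : (quad x y z)^`().[s] = y + 2 * z * s.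
Proof. by rewrite /quad !derivE !hornerE; ring. Qed.

Definition line_poly n (o v : 'I_n -> R) i : {poly R} := quad (o i) (v i) 0.

Lemma size_line n (o v : 'I_n -> R) i : (size (line_poly o v i) <= 2)%N.
Proof.
apply/leq_sizeP => j j3; rewrite !coefD coefC !coefZ coefX coefXn.
by case: j j3 => [|[|j]] //= _; rewrite ?mulr0 ?mul0r ?addr0.
Qed.

Lemma curve_line n (o v : 'I_n -> R) s i : curve 1 (line_poly o v) s i = o i + s * v i.
Proof. by rewrite /curve horner_quad hornerC divr1 mul0r addr0 [v i * s]mulrC. Qed.

Lemma velocity_line n (o v : 'I_n -> R) s i : velocity 1 (line_poly o v) s i = v i.
Proof. by rewrite /velocity deriv_quad derivC !hornerC mul0r subr0 mul1r expr1n divr1 mulr0 mul0r addr0. Qed.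

Lemma line_w0 s : 0 < (1 : {poly R}).[s].
Proof. by rewrite hornerC ltr01. Qed.

Lemma line_sw : (size (1%R : {poly R}) <= 2)%N.
Proof. by rewrite size_poly1. Qed.

Lemma line_vanish n (o v : 'I_n -> R) (F : {mpoly R[n]}) :
  (forall s, F.@[fun i => o i + s * v i] = 0) -> \sum_i (F^`M(i)).@[o] * v i = 0.
Proof.
move=> F0; have h := hasder0 line_w0 (hasder_mpoly (line_poly o v) line_w0 F) _ 0.
rewrite -[RHS]h => [|s]; last by rewrite -(F0 s); apply: meval_eq => i; rewrite curve_line.
apply: eq_bigr => i _; rewrite velocity_line; congr (_ * _).
by apply: meval_eq => j; rewrite curve_line mul0r addr0.
Qed.

Lemma mderivXU n i j : ('X_j : {mpoly R[n]})^`M(i) = (i == j)%:R%:MP.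
Proof.
rewrite mderivX mnm1E eq_sym; case: eqP => [->|_]; last by rewrite scale0r mpolyC0.
have -> : (U_(j) - U_(j))%MM = 0%MM :> 'X_{1..n} by apply/mnmP => k; rewrite !mnmE subnn.
by rewrite mpolyX0 scale1r mpolyC1.
Qed.

End Quadratics.

(** * Circles contained in a plane curve *)

Section PlaneTangency.
Variable R : realType.
Definition vec2 (u v : R) : 'I_2 -> R := fun i => nth 0 [:: u; v] i.
Definition vec3 (a b w : R) : 'I_3 -> R := fun i => nth 0 [:: a; b; w] i.

Definition circ_poly (a b r : R) : 'I_2 -> {poly R} :=
  fun i => nth 0 [:: quad (a + r) 0 (a - r); quad b (2 * r) b] i.
Definition circ_den : {poly R} := quad 1 0 1.

Lemma circ_den_gt0 s : 0 < circ_den.[s].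
Proof. by rewrite horner_quad mul0r addr0 mul1r den_gt0. Qed.

Lemma circ_curve a b r s : curve circ_den (circ_poly a b r) s =1 vec2 (circu a r s) (circv b r s).
Proof.
have d := den_neq0 s.
by case=> [[|[|]]] // i; rewrite /curve /circ_poly /vec2 /= !horner_quad /circu /circv;
  rewrite mul0r addr0 mul1r; field.
Qed.

Lemma size_circ_poly a b r i : (size (circ_poly a b r i) <= 3)%N.
Proof. by case: i => [[|[|]]] // i; apply: size_quad. Qed.

(** The rotation field about the centre. Unlike the velocity it is polynomial in the point, so [lie]
    can be iterated. *)
Definition circ_field (a b : R) : 'I_2 -> {mpoly R[2]} :=
  fun i => nth 0 [:: b%:MP - 'X_(lift ord0 ord0); 'X_ord0 - a%:MP] i.

Lemma circ_velocity a b r s i : velocity circ_den (circ_poly a b r) s i =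
  2 / (1 + s ^+ 2) * (circ_field a b i).@[curve circ_den (circ_poly a b r) s].
Proof.
have d := den_neq0 s.
have -> : (circ_field a b i).@[curve circ_den (circ_poly a b r) s] =
   (circ_field a b i).@[vec2 (circu a r s) (circv b r s)] by apply: meval_eq; apply: circ_curve.
by case: i => [[|[|]]] // i; rewrite /velocity /circ_poly /circ_field /= !deriv_quad !horner_quad;
  rewrite mevalB mevalC mevalXU /vec2 /= /circu /circv; field; rewrite ?mul0r ?addr0 ?mul1r d.
Qed.

Let i0 : 'I_2 := ord0.
Let i1 : 'I_2 := lift ord0 ord0.

Lemma circle_in_zero_set a b r s (F : {mpoly R[2]}) :
  (forall t, F.@[curve circ_den (circ_poly a b r) t] = 0) ->
  let z := vec2 (circu a r s) (circv b r s) in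
  let x := circu a r s - a in let y := circv b r s - b in
  let D i := (F^`M(i)).@[z] in let DD i j := (F^`M(i)^`M(j)).@[z] in
  x * D i1 = y * D i0 /\
  y ^+ 2 * DD i0 i0 - 2 * x * y * DD i0 i1 + x ^+ 2 * DD i1 i1 = y * D i1 + x * D i0.
Proof.
move=> F0 z x y D DD.
have tau0 t : 2 / (1 + t ^+ 2) != 0 :> R by rewrite mulf_neq0 ?pnatr_eq0 // invr_eq0 den_neq0.
have l1 := lie_vanish circ_den_gt0 tau0 (circ_velocity a b r) F0.
have l2 := lie_vanish circ_den_gt0 tau0 (circ_velocity a b r) l1.
have ev G : G.@[curve circ_den (circ_poly a b r) s] = G.@[z] by apply: meval_eq; apply: circ_curve.
have := l1 s; have := l2 s; rewrite !ev /lie.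
rewrite !big_ord_recl !big_ord0 !addr0 !mderivD !mderivM /circ_field /=.
rewrite !mderivB !mderivC !mderivXU -/i0 -/i1 [F^`M(i1)^`M(i0)]mderiv_comm.
rewrite !(mevalD, mevalM, mevalB, mevalN, mevalC, mevalXU) -!/(DD _ _) -!/(D _).
have -> : z i0 = circu a r s by []. have -> : z i1 = circv b r s by [].
rewrite /= => h2 h1; split.
  by apply/eqP; rewrite -subr_eq0; apply/eqP; rewrite -[RHS]h1 /x /y; ring.
by apply/eqP; rewrite -subr_eq0; apply/eqP; rewrite -[RHS]h2 /x /y; ring.
Qed.

(* the curvature, hence the circle, is determined by the 2-jet of [F] *)
Lemma tangent_circle_unique a b r s a' b' r' s' (F : {mpoly R[2]}) u v :
  0 < r -> 0 < r' -> circu a r s = u -> circv b r s = v -> circu a' r' s' = u -> circv b' r' s' = v ->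
  (forall t, F.@[curve circ_den (circ_poly a b r) t] = 0) ->
  (forall t, F.@[curve circ_den (circ_poly a' b' r') t] = 0) ->
  (exists i, (F^`M(i)).@[vec2 u v] != 0) -> a = a' /\ b = b'.
Proof.
move=> r0 r0' eu ev eu' ev' F0 F0' [i nz].
have [g1 h1] := circle_in_zero_set s F0; have [g2 h2] := circle_in_zero_set s' F0'.
rewrite eu ev in g1 h1; rewrite eu' ev' in g2 h2.
have nz' : ((F^`M(i0)).@[vec2 u v] != 0) || ((F^`M(i1)).@[vec2 u v] != 0).
  case: i nz => [[|[|]]] // ii; first by rewrite (_ : Ordinal ii = i0) => [->|]; last exact: val_inj.
  by rewrite (_ : Ordinal ii = i1) => [->|]; [rewrite orbT|exact: val_inj].
have rad (aa bb rr ss : R) : circu aa rr ss = u -> circv bb rr ss = v -> 0 < rr -> (u - aa) ^+ 2 + (v - bb) ^+ 2 = rr ^+ 2.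
  by move=> <- <- _; have := den_neq0 ss => d; rewrite /circu /circv; field.
have q1 := rad _ _ _ _ eu ev r0; have q2 := rad _ _ _ _ eu' ev' r0'.
have p1 : 0 < r ^+ 2 by rewrite exprn_gt0. have p2 : 0 < r' ^+ 2 by rewrite exprn_gt0.
move: nz' g1 h1 g2 h2; move: ((F^`M(i0)).@[_]) ((F^`M(i1)).@[_]) ((F^`M(i0)^`M(i0)).@[_]) ((F^`M(i0)^`M(i1)).@[_]) ((F^`M(i1)^`M(i1)).@[_]).
move=> f0 f1 f00 f01 f11 nz' g1 h1 g2 h2.
(* Numerator and squared gradient in the curvature formula for a level curve; the centre turns out
   to be the point minus (G/N) grad F. *)
pose N := f1 ^+ 2 * f00 - 2 * f0 * f1 * f01 + f0 ^+ 2 * f11; pose G := f0 ^+ 2 + f1 ^+ 2.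
have G0 : 0 < G.
  by rewrite /G lt0r paddr_eq0 ?sqr_ge0 // !sqrf_eq0 negb_and nz' addr_ge0 ?sqr_ge0.
have key (x y rr : R) : 0 < rr -> x ^+ 2 + y ^+ 2 = rr -> x * f1 = y * f0 ->
    y ^+ 2 * f00 - 2 * x * y * f01 + x ^+ 2 * f11 = y * f1 + x * f0 -> N * x = G * f0 /\ N * y = G * f1.
  move=> rr0 xy e1 e2; pose k := (x * f0 + y * f1) / rr.
  have k0 : f0 = k * x.
    rewrite /k mulrAC; apply: (mulIf (lt0r_neq0 rr0)); rewrite mulfVK ?lt0r_neq0 // -xy.
    by transitivity (x * f0 * x + y * (y * f0)); [ring|rewrite -e1; ring].
  have k1 : f1 = k * y.
    rewrite /k mulrAC; apply: (mulIf (lt0r_neq0 rr0)); rewrite mulfVK ?lt0r_neq0 // -xy.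
    by transitivity (x * (x * f1) + y * f1 * y); [ring|rewrite e1; ring].
  have NE : N = k ^+ 2 * (k * (x ^+ 2 + y ^+ 2)).
    have -> : k * (x ^+ 2 + y ^+ 2) = y * f1 + x * f0 by rewrite k0 k1; ring.
    by rewrite -e2 /N k0 k1; ring.
  by rewrite NE /G k0 k1; split; ring.
have [x1 y1] := key _ _ _ p1 q1 g1 h1; have [x2 y2] := key _ _ _ p2 q2 g2 h2.
have N0 : N != 0.
  apply: contraTneq nz' => N0; move: x1 y1; rewrite N0 !mul0r => /esym/eqP + /esym/eqP.
  by rewrite !mulf_eq0 (gt_eqF G0) /= => /eqP -> /eqP ->; rewrite eqxx.
have e1 := mulfI N0 (etrans x1 (esym x2)); have e2 := mulfI N0 (etrans y1 (esym y2)).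
by split; lra.
Qed.
End PlaneTangency.

Lemma sum_nat_pred (T : finType) (P : pred T) : (\sum_e nat_of_bool (P e) = #|[set e | P e]|)%N.
Proof.
rewrite -sum1_card [RHS]big_mkcond; apply: eq_bigr => e _; rewrite inE; by case: (P e).
Qed.

(** * Counting edges in the plane *)

Section PlanarCount.
Variables (R : realType) (m n : nat).
Variables (U V : 'I_m -> R) (a b w : 'I_n -> R).
Hypothesis pts_inj : forall i j, U i = U j -> V i = V j -> i = j.
Hypothesis circ_inj : forall i j, a i = a j -> b i = b j -> w i = w j -> i = j.
Hypothesis sqr_rad_gt0 : forall i, 0 < a i ^+ 2 + b i ^+ 2 - w i.

Let pt p := vec2 (U p) (V p).
Let gam A := curve (circ_den R) (circ_poly (a A) (b A) (rho a b w A)).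

Lemma pt_gam Q A p : p \in onc U V a b w Q A -> pt p =1 gam A (par U V a b w A p).
Proof.
by move=> /(oncP sqr_rad_gt0)[e1 e2 _] i; rewrite /gam circ_curve e1 e2.
Qed.

(** Consider the last member of the chain that vanishes before the first nonzero one at p. If it is
    not zero on all of the circle, [card_deep_points] counts p; otherwise the circle lies in a curve
    smooth at p, and [tangent_circle_unique] allows one such circle per point. *)
Lemma card_inc_zero_set (P1 : {mpoly R[2]}) d : P1 != 0 -> ((msize P1).-1 <= d)%N ->
  (\sum_A #|onc U V a b w [set p | P1.@[pt p] == 0%R] A| <= n * (2 * d) + m)%N.
Proof.
move=> P0 Pd; have [L [g [g0 gn gdv gL]]] := derivative_chain P0.
have gd k : (k <= L)%N -> ((msize (g k)).-1 <= d)%N.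
  by move=> /gn/andP[_ h]; apply: leq_trans Pd; rewrite -!subn1 leq_sub2r.
set Z := [set p | _]; pose S A := onc U V a b w Z A.
pose ns A p := boolp.asbool (exists s, (g (stratum gL (pt p)).-1).@[gam A s] != 0).
have SZ A p : p \in S A -> (0 < stratum gL (pt p))%N.
  rewrite inE inE => /andP[/eqP z _]; rewrite lt0n; apply/eqP => e.
  by have := stratumP gL (pt p); rewrite e g0 z eqxx.
have part A : (#|S A| <= 2 * d + #|[set p in S A | ~~ ns A p]|)%N.
  rewrite -(cardsID [set p | ns A p] (S A)); apply: leq_add; last first.
    by apply/subset_leq_card/subsetP => p; rewrite !inE andbC.
  apply: (@card_deep_points R 2 L g d gL gd (circ_den R) (circ_poly (a A) (b A) (rho a b w A)) 2
    (@circ_den_gt0 R) (size_quad _ _ _) (size_circ_poly _ _ _) _ _ (par U V a b w A) pt).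
  - move=> p q /setIP[pS _] /setIP[qS _]; exact: (par_inj pts_inj sqr_rad_gt0 pS qS).
  - by move=> p /setIP[pS _]; apply: (pt_gam pS).
  - move=> p /setIP[pS]; rewrite inE => /boolp.asboolP ex; split; [exact: (SZ A)|exact: ex].
apply: (@leq_trans (\sum_A (2 * d + #|[set p in S A | ~~ ns A p]|))); first exact: leq_sum.
rewrite big_split /= sum_nat_const card_ord leq_add2l.
under eq_bigr => A _ do rewrite -sum_nat_pred.
rewrite exchange_big /= -[X in (_ <= X)%N]card_ord -sum1_card; apply: leq_sum => p _.
rewrite sum_nat_pred; apply/card_le1_eqP => A B; rewrite !inE.
move=> /andP[Ap /boolp.asboolPn Az] /andP[Bp /boolp.asboolPn Bz].
have ApS : p \in S A by rewrite !inE. have BpS : p \in S B by rewrite !inE.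
have [e1 e2 pA] := oncP sqr_rad_gt0 ApS; have [e1' e2' pB] := oncP sqr_rad_gt0 BpS.
have k0 := SZ A p ApS; set k := (stratum gL (pt p)).-1 in Az Bz.
have kk : k.+1 = stratum gL (pt p) by rewrite prednK.
have vanish C : ~ (exists s, (g k).@[gam C s] != 0) -> forall s, (g k).@[gam C s] = 0.
  by move=> Cz s; apply/eqP; apply: boolp.contrapT => nz; apply: Cz; exists s; apply/negP.
have kL : (k < L)%N by rewrite kk stratum_le.
have [i gi] := gdv k kL.
have nz : exists i, ((g k)^`M(i)).@[vec2 (U p) (V p)] != 0.
  by exists i; rewrite -gi kk; exact: stratumP.
have [ea eb] := tangent_circle_unique (rho_gt0 sqr_rad_gt0 A) (rho_gt0 sqr_rad_gt0 B) e1 e2 e1' e2' (vanish A Az) (vanish B Bz) nz.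
apply: circ_inj => //; move: pA pB; rewrite /pw /power ea eb => h1 h2.
by apply: (addrI (U p ^+ 2 + V p ^+ 2 - 2 * a B * U p - 2 * b B * V p)); rewrite h1 h2.
Qed.

Variables (Q : {set 'I_m}) (Fs : seq {mpoly R[2]}) (Gs : seq {mpoly R[3]}).
Hypothesis FsQ : forall p, p \in Q -> all (fun F => F.@[pt p] != 0) Fs.
Hypothesis Gs0 : all (fun G => G != 0) Gs.

Let dual A := vec3 (a A) (b A) (w A).
Let dir p q := vec3 (V q - V p) (U p - U q) (2 * (U p * V q - U q * V p)).
Let D := [set A | all (fun G => G.@[dual A] != 0) Gs].
Let lab A := cell dual Gs A.
Let edg A (e : 'I_m * 'I_m) := edge U V a b w Q A e.1 e.2.
Let ss (e : 'I_m * 'I_m) := same_sign Fs (pt e.1) (pt e.2).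

Lemma card_breaks A : (#|[set e | edg A e && ~~ ss e]| <= 2 * degs Fs)%N.
Proof.
have := @card_curve_breaks R 1 (circ_den R) (circ_poly (a A) (b A) (rho a b w A)) 2
  (@circ_den_gt0 R) (size_quad _ _ _) (size_circ_poly _ _ _) _ (onc U V a b w Q A) (par U V a b w A) Fs.
have ev F p : p \in onc U V a b w Q A -> F.@[gam A (par U V a b w A p)] = F.@[pt p].
  by move=> pA; apply: meval_eq => i; rewrite -(pt_gam pA).
move=> /(_ (par_inj pts_inj sqr_rad_gt0 (A := A))) h; apply: leq_trans (h _).
  apply/subset_leq_card/subsetP => e; rewrite !inE => /andP[E nss]; apply/andP; split=> //.
  have [pA qA _] := edge_mem E; apply: contra nss => /allP sg; apply/allP => F FFs.
  by have := sg F FFs; rewrite -!/(gam A _) !ev.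
move=> p pA; have pQ : p \in Q by move: pA; rewrite inE => /andP[].
by apply/allP => F FFs; rewrite -/(gam A _) ev // (allP (FsQ pQ)).
Qed.

Lemma dual_line A B e : edg A e -> edg B e ->
  dual B =1 (fun i => dual A i + (penp U V a b e.1 e.2 B - penp U V a b e.1 e.2 A) * dir e.1 e.2 i).
Proof.
move=> EA EB; have [e1 e2 e3] := edges_pencil pts_inj sqr_rad_gt0 EA EB.
by case=> [[|[|[|]]]] // i; rewrite /dual /dir /vec3 /= ?e1 ?e2 ?e3.
Qed.

Section OnePencil.
Variable e : 'I_m * 'I_m.
Let pn := penp U V a b e.1 e.2.

Lemma pn_inj (S : {set 'I_n}) : (forall A, A \in S -> edg A e) -> {in S &, injective pn}.
Proof.
move=> SE A B /SE EA /SE EB eq; have [e1 e2 e3] := edges_pencil pts_inj sqr_rad_gt0 EA EB.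
move: e1 e2 e3; rewrite -/(pn A) -/(pn B) eq subrr !mul0r !addr0 => e1 e2 e3.
by apply: circ_inj.
Qed.

Definition first A := [&& A \in D, edg A e &
  [forall B in [set B in D | edg B e], (pn B < pn A)%R ==> ~~ same_sign Gs (dual B) (dual A)]].

(** Circles through two points form a line in the dual space, which meets at most degs Gs + 1
    cells. *)
Lemma card_pencil_firsts : (#|[set A | first A]| <= (degs Gs).+1)%N.
Proof.
pose S := [set B in D | edg B e].
have [S0|[A0 A0S]] := set_0Vmem S.
  rewrite (_ : [set A | first A] = set0) ?cards0 //; apply/setP => A; rewrite !inE.
  apply/negP => /and3P[AD EA _]; have : A \in S by rewrite inE AD.
  by rewrite S0 inE.
have E0 : edg A0 e by move: A0S; rewrite inE => /andP[].
pose o : 'I_3 -> R := fun i => dual A0 i - pn A0 * dir e.1 e.2 i.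
have SE A : A \in S -> edg A e by rewrite inE => /andP[].
have on A : A \in S -> dual A =1 curve 1 (line_poly o (dir e.1 e.2)) (pn A).
  move=> /SE EA i; rewrite (dual_line E0 EA) curve_line /o -/(pn A) -/(pn A0); ring.
have ev A G : A \in S -> G.@[curve 1 (line_poly o (dir e.1 e.2)) (pn A)] = G.@[dual A].
  by move=> AS; apply: meval_eq => i; rewrite -on.
have := @card_curve_firsts R 2 1 (line_poly o (dir e.1 e.2)) 1 (@line_w0 R) (@line_sw R)
  (size_line _ _) _ S pn Gs (pn_inj SE).
rewrite mul1n => h; apply: leq_trans (h _); last first.
  move=> A AS; have AD : A \in D by move: AS; rewrite inE => /andP[].
  by move: AD; rewrite inE => /allP AD; apply/allP => G GGs; rewrite ev // AD.
apply/subset_leq_card/subsetP => A; rewrite !inE => /and3P[AD EA /forall_inP fA].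
have AS : A \in S by rewrite !inE EA andbT; move: AD; rewrite inE.
move: AD; rewrite inE => ->; rewrite EA /=; apply/forall_inP => B BS; apply/implyP => lt.
have := fA B BS; rewrite lt /=; apply: contra => /allP sg; apply/allP => G GGs.
by have := sg G GGs; rewrite !ev.
Qed.

Lemma nonfirst_lens A : A \in D -> edg A e -> ~~ first A ->
  [exists B, nxt U V a b w Q D lab e.1 e.2 B A].
Proof.
move=> AD EA; rewrite /first AD EA /= negb_forall_in => /exists_inP[B BS].
rewrite negb_imply negbK => /andP[lt sg].
move: BS; rewrite inE => /andP[BD EB].
have lAB : lab B = lab A.
  apply/setP => C; rewrite !inE; apply/idP/idP; apply: same_sign_trans => //.
  by rewrite same_sign_sym.
have AP : A \in pencil_class U V a b w Q D lab e.1 e.2 (lab A) by rewrite inE AD eqxx andbT; exact: EA.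
have BP : B \in pencil_class U V a b w Q D lab e.1 e.2 (lab A) by rewrite inE BD lAB eqxx andbT; exact: EB.
have [C cC _] := cons_prev BP AP lt.
apply/existsP; exists C; rewrite /nxt cC andbT.
by case/and4P: cC; rewrite inE => /and3P[].
Qed.

Variables (L : nat) (g : nat -> {mpoly R[3]}).
Hypothesis g0 : g 0%N = \prod_(G <- Gs) G.
Hypothesis gd : forall k, (k <= L)%N -> ((msize (g k)).-1 <= degs Gs)%N.
Hypothesis gdv : forall k, (k < L)%N -> exists i, g k.+1 = (g k)^`M(i).
Hypothesis gL : exists2 x, x != 0 & g L = x%:MP.

(** The line is tested against the member just before the first one nonzero at the dual point,
    because its gradient there is nonzero; [card_flat] relies on this. *)
Definition transversal A := boolp.asbool
  (exists s, (g (stratum gL (dual A)).-1).@[fun i => dual A i + s * dir e.1 e.2 i] != 0).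

Lemma dual_stratum_gt0 A : A \notin D -> (0 < stratum gL (dual A))%N.
Proof.
rewrite inE -meval_prod_neq0 negbK => /eqP z; rewrite lt0n; apply/eqP => st.
by have := stratumP gL (dual A); rewrite st g0 z eqxx.
Qed.

Lemma card_transversal : (#|[set A | [&& A \notin D, edg A e & transversal A]]| <= degs Gs)%N.
Proof.
set S := [set A | _]; have [->|[A0 A0S]] := set_0Vmem S; first by rewrite cards0.
have SE A : A \in S -> edg A e by rewrite inE => /and3P[].
have E0 := SE _ A0S.
pose o : 'I_3 -> R := fun i => dual A0 i - pn A0 * dir e.1 e.2 i.
have on A : A \in S -> dual A =1 curve 1 (line_poly o (dir e.1 e.2)) (pn A).
  move=> /SE EA i; rewrite (dual_line E0 EA) curve_line /o -/(pn A) -/(pn A0); ring.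
rewrite -[X in (_ <= X)%N]mul1n.
apply: (@card_deep_points R 3 L g (degs Gs) gL gd 1 (line_poly o (dir e.1 e.2)) 1
   (@line_w0 R) (@line_sw R) (size_line _ _) _ S pn dual (pn_inj SE) on).
move=> A AS; have EA := SE A AS; move: (AS); rewrite inE => /and3P[AD _ /boolp.asboolP[s hs]].
split; first exact: dual_stratum_gt0.
exists (pn A + s); move: hs; congr (_ != 0); apply: meval_eq => i.
by rewrite curve_line (dual_line E0 EA) /o -/(pn A) -/(pn A0); ring.
Qed.
End OnePencil.

Section AllEdges.
Variables (L : nat) (g : nat -> {mpoly R[3]}).
Hypothesis g0 : g 0%N = \prod_(G <- Gs) G.
Hypothesis gd : forall k, (k <= L)%N -> ((msize (g k)).-1 <= degs Gs)%N.
Hypothesis gdv : forall k, (k < L)%N -> exists i, g k.+1 = (g k)^`M(i).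
Hypothesis gL : exists2 x, x != 0 & g L = x%:MP.

Let pr := par U V a b w.

Lemma sorted_edges_kernel A e1 e2 e3 (v : 'I_3 -> R) : edg A e1 -> edg A e2 -> edg A e3 ->
  pr A e1.1 < pr A e2.1 -> pr A e2.1 < pr A e3.1 ->
  (forall e, e \in [:: e1; e2; e3] -> \sum_i v i * dir e.1 e.2 i = 0) -> forall i, v i = 0.
Proof.
move=> E1 E2 E3 l12 l23 ker.
have [P1 Q1 lt1] := edge_mem E1; have [P2 Q2 lt2] := edge_mem E2; have [P3 Q3 lt3] := edge_mem E3.
have := chord_det_gt0 (a A) (b A) (rho_gt0 sqr_rad_gt0 A) lt1 (cons_le E1 P2 l12) lt2 (cons_le E2 P3 l23) lt3.
have on := oncP sqr_rad_gt0.
rewrite /=; have [-> -> _] := on _ _ _ _ _ _ P1; have [-> -> _] := on _ _ _ _ _ _ Q1; have [-> -> _] := on _ _ _ _ _ _ P2.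
have [-> -> _] := on _ _ _ _ _ _ Q2; have [-> -> _] := on _ _ _ _ _ _ P3; have [-> -> _] := on _ _ _ _ _ _ Q3.
have k1 := ker e1; have k2 := ker e2; have k3 := ker e3.
move: k1 k2 k3; rewrite !inE !eqxx ?orbT => /(_ isT) + /(_ isT) + /(_ isT).
rewrite !big_ord_recl !big_ord0 /dir /vec3 /= !addr0.
move: (V e1.2 - _) (U e1.1 - _) (2 * _) => x1 x2 x3.
move: (V e2.2 - _) (U e2.1 - _) (2 * _) => y1 y2 y3.
move: (V e3.2 - _) (U e3.1 - _) (2 * _) => z1 z2 z3.
set v0 := v ord0; set v1 := v (lift _ _); set v2 := v (lift _ (lift _ _)) => k1 k2 k3 d0.
have d := lt0r_neq0 d0.
have h (t : R) : t * det3 x1 x2 x3 y1 y2 y3 z1 z2 z3 = 0 -> t = 0.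
  by move=> /eqP; rewrite mulf_eq0 (negbTE d) orbF => /eqP.
have vz0 : v0 = 0.
  apply: h; transitivity ((v0 * x1 + (v1 * x2 + v2 * x3)) * (y2 * z3 - y3 * z2)
    - (v0 * y1 + (v1 * y2 + v2 * y3)) * (x2 * z3 - x3 * z2)
    + (v0 * z1 + (v1 * z2 + v2 * z3)) * (x2 * y3 - x3 * y2)); first by rewrite /det3; ring.
  by rewrite k1 k2 k3; ring.
have vz1 : v1 = 0.
  apply: h; transitivity (- (v0 * x1 + (v1 * x2 + v2 * x3)) * (y1 * z3 - y3 * z1)
    + (v0 * y1 + (v1 * y2 + v2 * y3)) * (x1 * z3 - x3 * z1)
    - (v0 * z1 + (v1 * z2 + v2 * z3)) * (x1 * y3 - x3 * y1)); first by rewrite /det3; ring.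
  by rewrite k1 k2 k3; ring.
have vz2 : v2 = 0.
  apply: h; transitivity ((v0 * x1 + (v1 * x2 + v2 * x3)) * (y1 * z2 - y2 * z1)
    - (v0 * y1 + (v1 * y2 + v2 * y3)) * (x1 * z2 - x2 * z1)
    + (v0 * z1 + (v1 * z2 + v2 * z3)) * (x1 * y2 - x2 * y1)); first by rewrite /det3; ring.
  by rewrite k1 k2 k3; ring.
case=> [[|[|[|]]]] // i; [rewrite -[RHS]vz0|rewrite -[RHS]vz1|rewrite -[RHS]vz2]; congr v; exact: val_inj.
Qed.

Definition flat A e := [&& A \notin D, edg A e & ~~ transversal e gL A].

(** The nonzero gradient at the dual point annihilates the direction of every flat edge, while three
    edges of one circle have independent directions ([sorted_edges_kernel]). *)
Lemma card_flat A : (#|[set e | flat A e]| <= 2)%N.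
Proof.
rewrite leqNgt; apply/negP => /card_gt2P[e1 [e2 [e3 [[f1 f2 f3] [n12 n23 n31]]]]].
move: f1 f2 f3; rewrite !inE => f1 f2 f3.
have AD : A \notin D by case/and3P: f1.
have st0 := dual_stratum_gt0 g0 gL AD.
set k := (stratum gL (dual A)).-1; have kk : k.+1 = stratum gL (dual A) by rewrite prednK.
have [i gi] : exists i, g k.+1 = (g k)^`M(i) by apply: gdv; rewrite kk stratum_le.
have nz : ((g k)^`M(i)).@[dual A] != 0 by rewrite -gi kk; exact: stratumP.
pose v j := ((g k)^`M(j)).@[dual A].
have ker e : flat A e -> \sum_j v j * dir e.1 e.2 j = 0.
  move=> /and3P[_ _ /boolp.asboolPn nt]; apply: line_vanish => s; apply/eqP; apply: boolp.contrapT => h.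
  by apply: nt; exists s; apply/negP.
have lt_cases e f : flat A e -> flat A f -> e != f -> pr A e.1 < pr A f.1 \/ pr A f.1 < pr A e.1.
  move=> /and3P[_ E _] /and3P[_ F _] ef; have [eA _ _] := edge_mem E; have [fA _ _] := edge_mem F.
  have [lt|lt|eq] := ltgtP (pr A e.1) (pr A f.1); [by left|by right|].
  have e1f : e.1 = f.1 := par_inj pts_inj sqr_rad_gt0 eA fA eq.
  case/eqP: ef; move: E F; rewrite /edg e1f => E F.
  have := cons_fun (par_inj pts_inj sqr_rad_gt0 (A := A)) E F.
  by case: e f e1f {E F eA fA eq} => [x y] [z t] /= -> ->.
have fin (x y z : 'I_m * 'I_m) : flat A x -> flat A y -> flat A z -> pr A x.1 < pr A y.1 -> pr A y.1 < pr A z.1 -> False.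
  move=> fx fy fz l1 l2; case/eqP: nz; apply: (@sorted_edges_kernel A x y z v) => //.
  - by case/and3P: fx. - by case/and3P: fy. - by case/and3P: fz.
  by move=> e; rewrite !inE => /or3P[] /eqP ->; apply: ker.
have [l|l] := lt_cases _ _ f1 f2 n12; have [l'|l'] := lt_cases _ _ f2 f3 n23; have [l''|l''] := lt_cases _ _ f3 f1 n31.
- by have := lt_trans l (lt_trans l' l''); rewrite ltxx.
- exact: (fin e1 e2 e3).
- exact: (fin e3 e1 e2).
- exact: (fin e1 e3 e2).
- exact: (fin e2 e3 e1).
- exact: (fin e2 e1 e3).
- exact: (fin e3 e2 e1).
- by have := lt_trans l (lt_trans l'' l'); rewrite ltxx.
Qed.

(** A circle has at most one more point than edges. An edge is cut by Fs, or joins points of one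
    cell; in the latter case the circle is first of its class in the pencil, closes a lens, or has
    its dual point on the zero set of Gs, with a transversal or a flat edge. *)
Lemma card_onc_le h N :
  (forall A, A \in D -> #|[set B in D | lab B == lab A]| <= 4 ^ h)%N ->
  (#|[set e : 'I_m * 'I_m | (e.1 != e.2) && ss e]| <= N)%N ->
  (\sum_A #|onc U V a b w Q A| <= n + n * (2 * degs Fs) + N * (2 * degs Gs + 1)
      + 19 * n * (2 ^ h * (2 * h).+1) + n * 2)%N.
Proof.
move=> small pairs.
pose brk A e := edg A e && ~~ ss e.
pose len A e := [exists B, nxt U V a b w Q D lab e.1 e.2 B A].
pose near (e : 'I_m * 'I_m) := (e.1 != e.2) && ss e.
have pointwise A e : (edg A e <= brk A e + (near e && first e A) + len A e
    + (near e && [&& A \notin D, edg A e & transversal e gL A]) + flat A e)%N.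
  rewrite /brk /flat /near; case E: (edg A e) => //=; rewrite (edge_neq E) /=.
  case: (ss e); rewrite ?addn0 //=; case AD: (A \in D) => /=; last first.
    by case: (transversal _ _ _); rewrite ?addn1 ?addn0 // addnC.
  case F: (first e A) => //=; rewrite /len (nonfirst_lens AD E) ?F //.
apply: (@leq_trans (\sum_A (1 + \sum_e (brk A e + (near e && first e A) + len A e
    + (near e && [&& A \notin D, edg A e & transversal e gL A]) + flat A e)))).
  apply: leq_sum => A _; apply: leq_trans (card_cons (par_inj pts_inj sqr_rad_gt0 (A := A))) _.
  by rewrite -add1n leq_add2l -sum_nat_pred; apply: leq_sum => e _; exact: pointwise.
rewrite big_split /= sum_nat_const card_ord muln1 -!addnA leq_add2l.
under eq_bigr => A _ do rewrite !big_split /=.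
rewrite !big_split /= -!addnA.
have nearE (P : 'I_m * 'I_m -> pred 'I_n) K : (forall e, #|[set A | P e A]| <= K)%N ->
    (\sum_A \sum_e (near e && P e A) <= N * K)%N.
  move=> PK; rewrite exchange_big /=; apply: (@leq_trans (\sum_(e | near e) K)).
    rewrite [X in (_ <= X)%N]big_mkcond; apply: leq_sum => e _.
    case: (near e) => /=; last by rewrite big1.
    by rewrite sum_nat_pred.
  rewrite sum_nat_const leq_mul2r; apply/orP; right; apply: leq_trans pairs.
  by apply/eq_leq/eq_card => e; rewrite inE.
have b1 : (\sum_A \sum_e brk A e <= n * (2 * degs Fs))%N.
  rewrite -[X in (_ <= X * _)%N]card_ord -sum_nat_const; apply: leq_sum => A _.
  by rewrite sum_nat_pred card_breaks.
have b2 := nearE first _ card_pencil_firsts.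
have b3 : (\sum_A \sum_e len A e <= 19 * n * (2 ^ h * (2 * h).+1))%N.
  apply: leq_trans (@card_lenses R m n U V a b w Q pts_inj circ_inj sqr_rad_gt0 D _ lab h small).
  by rewrite pair_big /= sum_nat_pred; apply/subset_leq_card/subsetP => x; rewrite !inE.
have b4 := nearE (fun e A => [&& A \notin D, edg A e & transversal e gL A]) _ (fun e => card_transversal e g0 gd gL).
have b5 : (\sum_A \sum_e flat A e <= n * 2)%N.
  rewrite -[X in (_ <= X * _)%N]card_ord -sum_nat_const; apply: leq_sum => A _.
  by rewrite sum_nat_pred card_flat.
move: b1 b2 b3 b4 b5.
move: (\sum_A _)%N (\sum_A _)%N (\sum_A _)%N (\sum_A _)%N (\sum_A _)%N => s1 s2 s3 s4 s5.
move: (n * 2)%N (19 * n * _)%N (n * (2 * _))%N (degs Gs) => k1 k2 k3 d; nia.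
Qed.
End AllEdges.
End PlanarCount.

Lemma exists_polynomial_partition (R : realType) n' : exists C : nat, forall k t M (X : 'I_M -> 'I_n'.+1 -> R),
  (M <= t * 2 ^ (n'.+1 * k))%N ->
  exists2 Fs, all (fun F => F != 0) Fs /\ (degs Fs <= C * 2 ^ k)%N & forall x, (#|cell X Fs x| <= t)%N.
Proof. by eexists => k t M X; apply: polynomial_partition. Qed.

(** [e] and [k] are the scales of the partitions of points and circles; n <= 4^h 8^k allows cells of
    at most 4^h circles. *)
Lemma planar_bound (R : realType) : exists C : nat, forall m n (U V : 'I_m -> R) (a b w : 'I_n -> R),
  (forall i j, U i = U j -> V i = V j -> i = j) ->
  (forall i j, a i = a j -> b i = b j -> w i = w j -> i = j) ->
  (forall i, 0 < a i ^+ 2 + b i ^+ 2 - w i) ->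
  forall e k h, (n <= 4 ^ h * 8 ^ k)%N ->
  (\sum_A #|[set p | pw U V a b w A p == 0%R]| <=
     C * (n * 2 ^ e + m * (m %/ 4 ^ e) * 2 ^ k + m + n * (2 ^ h * (2 * h).+1)))%N.
Proof.
have [C1 part1] := exists_polynomial_partition R 1.
have [C2 part2] := exists_polynomial_partition R 2.
exists (4 * C1 + 2 * C2 + 26)%N => m n U V a b w pts_inj circ_inj rad0 e k h nhk.
pose pt p := vec2 (U p) (V p); pose dual A := vec3 (a A) (b A) (w A).
have [Fs [Fs0 dFs] cF] : exists2 Fs, all (fun F => F != 0) Fs /\ (degs Fs <= C1 * 2 ^ e)%N &
    forall x, (#|cell pt Fs x| <= (m %/ 4 ^ e).+1)%N.
  by apply: part1; rewrite expnM ltnW // ltn_ceil // expn_gt0.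
have [Gs [Gs0 dGs] cG] : exists2 Fs, all (fun F => F != 0) Fs /\ (degs Fs <= C2 * 2 ^ k)%N &
    forall x, (#|cell dual Fs x| <= 4 ^ h)%N.
  by apply: part2; rewrite expnM.
have [P0 dP] := msize_prod_degs Fs0; have [Q0 dQ] := msize_prod_degs Gs0.
set P1 := \prod_(F <- Fs) F in P0 dP.
pose Z := [set p | P1.@[pt p] == 0%R].
(* The 1 is for the point with infinite parameter, which [onc] leaves out. *)
have inc A : (#|[set p | pw U V a b w A p == 0%R]| <= #|onc U V a b w Z A| + #|onc U V a b w (~: Z) A| + 1)%N.
  pose X := [set p | (pw U V a b w A p == 0%R) && (U p - a A + rho a b w A == 0%R)].
  apply: (@leq_trans #|onc U V a b w Z A :|: onc U V a b w (~: Z) A :|: X|).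
    apply/subset_leq_card/subsetP => p; rewrite !inE => ->.
    by case: (_ == 0%R) => //=; case: (_ == 0%R).
  apply: leq_trans (leq_card_setU _ _).1 _; apply: leq_add; first exact: (leq_card_setU _ _).1.
  apply/card_le1_eqP => p q; rewrite !inE => /andP[/eqP p0 /eqP pr] /andP[/eqP q0 /eqP qr].
  have r2 : rho a b w A ^+ 2 = a A ^+ 2 + b A ^+ 2 - w A by rewrite sqr_sqrtr // ltW.
  have vb x : pw U V a b w A x = 0 -> U x - a A + rho a b w A = 0 -> V x = b A.
    move=> x0 xr; have e1 : U x - a A = - rho a b w A by apply/eqP; rewrite -addr_eq0; apply/eqP.
    apply/eqP; rewrite -subr_eq0 -sqrf_eq0; apply/eqP.
    transitivity (pw U V a b w A x + rho a b w A ^+ 2 - (U x - a A) ^+ 2); first by rewrite r2 /pw /power; ring.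
    by rewrite x0 e1; ring.
  apply: pts_inj; last by rewrite (vb p) // (vb q).
  by apply: (addIr (- a A)); apply: (addIr (rho a b w A)); rewrite pr qr.
apply: leq_trans (leq_sum _ (fun A _ => inc A)) _.
rewrite !big_split /= sum_nat_const card_ord muln1.
have b1 := card_inc_zero_set pts_inj circ_inj rad0 P0 (leq_trans dP dFs).
have [L [g [g0 gn gdv gL]]] := derivative_chain Q0.
have gd j : (j <= L)%N -> ((msize (g j)).-1 <= degs Gs)%N.
  by move=> /gn/andP[_ hh]; apply: leq_trans dQ; rewrite -!subn1 leq_sub2r.
have FsQ p : p \in ~: Z -> all (fun F => F.@[pt p] != 0) Fs.
  by rewrite !inE -meval_prod_neq0.
(* A cell has at most [(m %/ 4 ^ e).+1] points, hence [m %/ 4 ^ e] partners for each of its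
   points. *)
have pairs : (#|[set f : 'I_m * 'I_m | (f.1 != f.2) && same_sign Fs (pt f.1) (pt f.2)]| <= m * (m %/ 4 ^ e))%N.
  rewrite -sum1_card (eq_bigl (fun f => true && ((f.1 != f.2) && same_sign Fs (pt f.1) (pt f.2)))) => [|f]; last by rewrite inE.
  rewrite -(pair_big_dep xpredT (fun p q => (p != q) && same_sign Fs (pt p) (pt q)) (fun _ _ => 1%N)) /=.
  rewrite -[X in (_ <= X * _)%N]card_ord -sum_nat_const; apply: leq_sum => p _; rewrite sum1_card.
  have [pp|npp] := boolP (same_sign Fs (pt p) (pt p)).
    have := cF p; rewrite (cardsD1 p) inE pp add1n ltnS; apply: leq_trans.
    by apply/subset_leq_card/subsetP => q /andP[pq sg]; rewrite !inE eq_sym pq sg.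
  rewrite eq_card0 // => q; apply/negbTE/negP => /andP[_ sg].
  by case/negP: npp; exact: same_sign_refl sg.
pose DD := [set A | all (fun G => G.@[dual A] != 0) Gs].
have small A : A \in DD -> (#|[set B in DD | cell dual Gs B == cell dual Gs A]| <= 4 ^ h)%N.
  move=> _; apply: leq_trans (cG A); apply/subset_leq_card/subsetP => B.
  rewrite inE => /andP[]; rewrite inE => /allP BG /eqP <-; rewrite inE.
  by apply/allP => G GGs; rewrite -expr2 lt0r sqr_ge0 sqrf_eq0 BG.
have b2 := card_onc_le pts_inj circ_inj rad0 FsQ Gs0 g0 gd gdv gL small pairs.
apply: leq_trans (leq_add (leq_add b1 b2) (leqnn n)) _.
have p1 : (0 < 2 ^ e)%N by rewrite expn_gt0.
have p2 : (0 < 2 ^ k)%N by rewrite expn_gt0.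
have a1 : (n * (2 * degs Fs) <= 2 * C1 * (n * 2 ^ e))%N.
  by rewrite [X in (_ <= X)%N]mulnCA leq_mul2l -mulnA leq_mul2l dFs !orbT.
have a2 : (n * (2 * (C1 * 2 ^ e)) = 2 * C1 * (n * 2 ^ e))%N by ring.
have a3 : (m * (m %/ 4 ^ e) * (2 * degs Gs + 1) <= (2 * C2 + 1) * (m * (m %/ 4 ^ e) * 2 ^ k))%N.
  rewrite [X in (_ <= X)%N]mulnCA leq_mul2l; apply/orP; right.
  by move: dGs p2; move: (2 ^ k)%N => x; nia.
have a4 : (n <= n * 2 ^ e)%N by rewrite leq_pmulr.
move: a1 a2 a3 a4; move: (n * 2 ^ e)%N (m * (m %/ 4 ^ e) * 2 ^ k)%N (m * (m %/ 4 ^ e) * (2 * degs Gs + 1))%N.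
rewrite -!mulnA; move: (n * (2 ^ h * (2 * h).+1))%N (n * (2 * (C1 * 2 ^ e)))%N (n * (2 * degs Fs))%N.
move=> s t u x y z h1 h2 h3 h4.
apply: (@leq_trans ((4 * C1) * x + m + 4 * x + (2 * C2 + 1) * y + 19 * s)); first by lia.
rewrite !mulnDr !mulnDl; lia.
Qed.

(** * Circles in space *)

Section SpaceCircles.
Variable R : realType.
Notation V := ('I_3 -> R).
Definition j0 : 'I_3 := ord0.
Definition j1 : 'I_3 := lift ord0 ord0.
Definition j2 : 'I_3 := lift ord0 (lift ord0 ord0).

Lemma sum3 (W : nmodType) (F : 'I_3 -> W) : \sum_i F i = F j0 + (F j1 + F j2).
Proof. by rewrite !big_ord_recl big_ord0 addr0. Qed.

Lemma ord3 (i : 'I_3) : [\/ i = j0, i = j1 | i = j2].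
Proof.
by case: i => [[|[|[|]]]] // ii; [apply: Or31|apply: Or32|apply: Or33]; apply: val_inj.
Qed.

Definition dt (x y : V) : R := x j0 * y j0 + x j1 * y j1 + x j2 * y j2.
Definition cr (x y : V) : V := vec3 (x j1 * y j2 - x j2 * y j1) (x j2 * y j0 - x j0 * y j2) (x j0 * y j1 - x j1 * y j0).

Lemma dtC x y : dt x y = dt y x. Proof. by rewrite /dt; ring. Qed.

Lemma cr0 x y : cr x y j0 = x j1 * y j2 - x j2 * y j1. Proof. by []. Qed.
Lemma cr1 x y : cr x y j1 = x j2 * y j0 - x j0 * y j2. Proof. by []. Qed.
Lemma cr2 x y : cr x y j2 = x j0 * y j1 - x j1 * y j0. Proof. by []. Qed.

Lemma dt_gt0 x : (exists i, x i != 0) -> 0 < dt x x.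
Proof.
move=> [i xi]; rewrite /dt -!expr2.
have h : forall k, 0 <= x k ^+ 2 by move=> k; exact: sqr_ge0.
have : 0 < x i ^+ 2 by rewrite lt0r h sqrf_eq0 xi.
by have := h j0; have := h j1; have := h j2; case: (ord3 i) => ->; lra.
Qed.

Lemma dt_eq0 x : dt x x = 0 -> forall i, x i = 0.
Proof.
move=> x0 i; apply/eqP; apply: contraT => xi; have := dt_gt0 (ex_intro _ i xi).
by rewrite x0 ltxx.
Qed.

Definition onpair (u v : V) := [/\ dt u u = 1, dt v v = 1 & dt u v = 0].

Lemma exists_frame (x : V) : dt x x = 1 -> exists u v, onpair u v /\ cr u v =1 x.
Proof.
move=> x1; pose q := x j0 ^+ 2 + x j1 ^+ 2.
have [q0|qn] := eqVneq q 0.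
  have /andP[/eqP a0 /eqP b0] : (x j0 == 0) && (x j1 == 0).
    by rewrite -![x _ == 0]sqrf_eq0 -paddr_eq0 ?sqr_ge0 //; apply/eqP.
  have c1 : x j2 * x j2 = 1 by move: x1; rewrite /dt a0 b0; lra.
  exists (vec3 1 0 0), (vec3 0 (x j2) 0); split.
    by split; rewrite /dt /vec3 /= ?c1; ring.
  by move=> i; case: (ord3 i) => ->; rewrite ?cr0 ?cr1 ?cr2 /vec3 /= ?a0 ?b0; ring.
have qp : 0 < q by rewrite lt0r qn addr_ge0 ?sqr_ge0.
pose s := Num.sqrt q; have ss : s * s = q by rewrite -expr2 sqr_sqrtr // ltW.
have sn : s != 0 by rewrite lt0r_neq0 ?sqrtr_gt0.
have qE : x j0 * x j0 + x j1 * x j1 = s * s by rewrite ss /q; ring.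
have q2 : x j2 * x j2 = 1 - s * s by rewrite -qE -x1 /dt; ring.
exists (vec3 (- x j1 / s) (x j0 / s) 0), (vec3 (- x j0 * x j2 / s) (- x j1 * x j2 / s) s); split.
  split; rewrite /dt /vec3 /=.
  - transitivity ((x j0 * x j0 + x j1 * x j1) / (s * s)); first by field.
    by rewrite qE divff // mulf_neq0.
  - transitivity ((x j0 * x j0 + x j1 * x j1) * (x j2 * x j2) / (s * s) + s * s); first by field.
    by rewrite qE q2; field.
  - by field.
move=> i; case: (ord3 i) => ->; rewrite ?cr0 ?cr1 ?cr2 /vec3 /=; [by field|by field|].
transitivity ((x j0 * x j0 + x j1 * x j1) * x j2 / (s * s)); first by field.
by rewrite qE; field.
Qed.

Definition sc_poly (o u v : V) (r : R) : 'I_3 -> {poly R} :=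
  fun i => quad (o i + r * u i) (2 * r * v i) (o i - r * u i).
Definition sc_pt (o u v : V) (r s : R) : V :=
  fun i => o i + r * ((1 - s ^+ 2) * u i + 2 * s * v i) / (1 + s ^+ 2).

Lemma sc_curve o u v r s : curve (circ_den R) (sc_poly o u v r) s =1 sc_pt o u v r s.
Proof.
move=> i; have d := den_neq0 s; rewrite /curve /sc_poly /sc_pt !horner_quad mul0r addr0 mul1r; by field.
Qed.

Lemma size_sc_poly o u v r i : (size (sc_poly o u v r i) <= 3)%N.
Proof. exact: size_quad. Qed.

Definition lin (o u : V) : {mpoly R[3]} := \sum_i (u i)%:MP * ('X_i - (o i)%:MP).
(** Quarter turn in the plane of the circle; [radv] is the projection to that plane. Both are
    polynomial, and differentiation along the circle exchanges them up to sign ([lie_rot],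
    [lie_rad]), so higher derivatives stay explicit. *)
Definition rotv (o u v : V) : 'I_3 -> {mpoly R[3]} :=
  fun i => (v i)%:MP * lin o u - (u i)%:MP * lin o v.
Definition radv (o u v : V) : 'I_3 -> {mpoly R[3]} :=
  fun i => (u i)%:MP * lin o u + (v i)%:MP * lin o v.

Lemma meval_lin o u x : (lin o u).@[x] = dt u (fun i => x i - o i).
Proof. by rewrite /lin sum3 !(mevalD, mevalM, mevalB, mevalN, mevalC, mevalXU) /dt addrA. Qed.

Lemma meval_rotv o u v x i : (rotv o u v i).@[x] = v i * dt u (fun i => x i - o i) - u i * dt v (fun i => x i - o i).
Proof. by rewrite /rotv !(mevalB, mevalM, mevalC, meval_lin). Qed.

Lemma meval_radv o u v x i : (radv o u v i).@[x] = u i * dt u (fun i => x i - o i) + v i * dt v (fun i => x i - o i).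
Proof. by rewrite /radv !(mevalD, mevalM, mevalC, meval_lin). Qed.

Lemma dt_sc_pt o u v r s z : dt z (fun i => sc_pt o u v r s i - o i) =
  r * ((1 - s ^+ 2) * dt z u + 2 * s * dt z v) / (1 + s ^+ 2).
Proof. by have d := den_neq0 s; rewrite /dt /sc_pt; field. Qed.

Lemma sc_velocity o u v r s i : onpair u v ->
  velocity (circ_den R) (sc_poly o u v r) s i =
  2 / (1 + s ^+ 2) * (rotv o u v i).@[curve (circ_den R) (sc_poly o u v r) s].
Proof.
move=> [uu vv uv]; have d := den_neq0 s.
rewrite (meval_eq (v2 := sc_pt o u v r s)); last exact: sc_curve.
rewrite meval_rotv !dt_sc_pt uu vv uv (dtC v u) uv /velocity /sc_poly !deriv_quad !horner_quad.
by rewrite mul0r addr0 mul1r; field.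
Qed.

Lemma mderiv_lin o u i : (lin o u)^`M(i) = (u i)%:MP.
Proof.
rewrite /lin raddf_sum /= (bigD1 i) //= mderivM mderivC mul0r add0r mderivB mderivXU mderivC subr0 eqxx mulr1.
by rewrite big1 ?addr0 // => j ji; rewrite mderivM mderivC mul0r add0r mderivB mderivXU mderivC subr0 eq_sym (negbTE ji) mpolyC0 mulr0.
Qed.
End SpaceCircles.

(** * Iterated derivatives along a circular motion *)

Section LieCalculus.
Variables (R : rcfType) (n : nat) (T : 'I_n -> {mpoly R[n]}).
Implicit Types (F : {mpoly R[n]}) (Y Z W : 'I_n -> {mpoly R[n]}).
Notation LT := (lie T).

Lemma lieD F H : LT (F + H) = LT F + LT H.
Proof. by rewrite /lie -big_split; apply: eq_bigr => i _; rewrite mderivD mulrDl. Qed.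

Lemma lieM F H : LT (F * H) = LT F * H + F * LT H.
Proof.
rewrite /lie mulr_suml mulr_sumr -big_split; apply: eq_bigr => i _ /=.
by rewrite mderivM; ring.
Qed.

Lemma lieC a : LT a%:MP = 0.
Proof. by rewrite /lie big1 // => i _; rewrite mderivC mul0r. Qed.

Lemma lieN F : LT (- F) = - LT F.
Proof. by rewrite /lie -sumrN; apply: eq_bigr => i _; rewrite mderivN mulNr. Qed.

Lemma lie_sum (I : Type) (r : seq I) (F : I -> {mpoly R[n]}) : LT (\sum_(i <- r) F i) = \sum_(i <- r) LT (F i).
Proof.
elim: r => [|i r IH]; first by rewrite !big_nil -mpolyC0 lieC.
by rewrite !big_cons lieD IH.
Qed.

Variable G : {mpoly R[n]}.
(** [C1] to [C4] contract the differentials of G of orders one to four with vector fields; [lie_C1]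
    to [lie_C3] are the product rule for them. *)
Definition C1 Y := \sum_i G^`M(i) * Y i.
Definition C2 Y Z := \sum_i \sum_j G^`M(i)^`M(j) * (Y i * Z j).
Definition C3 Y Z W := \sum_i \sum_j \sum_k G^`M(i)^`M(j)^`M(k) * (Y i * Z j * W k).
Definition C4 Y Z W X := \sum_i \sum_j \sum_k \sum_l G^`M(i)^`M(j)^`M(k)^`M(l) * (Y i * Z j * W k * X l).

Lemma lie_C1 Y : LT (C1 Y) = C2 Y T + C1 (fun i => LT (Y i)).
Proof.
rewrite /C1 /C2 lie_sum -big_split; apply: eq_bigr => i _ /=.
rewrite lieM; congr (_ + _); rewrite /lie mulr_suml; apply: eq_bigr => j _; ring.
Qed.

Lemma lie_C2 Y Z : LT (C2 Y Z) = C3 Y Z T + C2 (fun i => LT (Y i)) Z + C2 Y (fun i => LT (Z i)).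
Proof.
rewrite /C2 /C3 lie_sum -!big_split; apply: eq_bigr => i _ /=.
rewrite lie_sum -!big_split; apply: eq_bigr => j _ /=.
rewrite !lieM mulrDr addrA; congr (_ + _ + _).
by rewrite /lie mulr_suml; apply: eq_bigr => k _; ring.
Qed.

Lemma lie_C3 Y Z W : LT (C3 Y Z W) = C4 Y Z W T + C3 (fun i => LT (Y i)) Z W
   + C3 Y (fun i => LT (Z i)) W + C3 Y Z (fun i => LT (W i)).
Proof.
rewrite /C3 /C4 lie_sum -!big_split; apply: eq_bigr => i _ /=.
rewrite lie_sum -!big_split; apply: eq_bigr => j _ /=.
rewrite lie_sum -!big_split; apply: eq_bigr => k _ /=.
rewrite !lieM; transitivity ((\sum_l G^`M(i)^`M(j)^`M(k)^`M(l) * T l) * (Y i * Z j * W k)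
  + G^`M(i)^`M(j)^`M(k) * (LT (Y i) * Z j * W k) + G^`M(i)^`M(j)^`M(k) * (Y i * LT (Z j) * W k)
  + G^`M(i)^`M(j)^`M(k) * (Y i * Z j * LT (W k))); first by rewrite -/(lie T _); ring.
by congr (_ + _ + _ + _); rewrite mulr_suml; apply: eq_bigr => l _; ring.
Qed.

Lemma C1N Y : C1 (fun i => - Y i) = - C1 Y.
Proof. by rewrite /C1 -sumrN; apply: eq_bigr => i _; rewrite mulrN. Qed.

Lemma C2C Y Z : C2 Y Z = C2 Z Y.
Proof.
rewrite /C2 exchange_big; apply: eq_bigr => i _; apply: eq_bigr => j _ /=.
by rewrite mderiv_comm; ring.
Qed.

Lemma C2N Y Z : C2 (fun i => - Y i) Z = - C2 Y Z.
Proof. by rewrite /C2 -sumrN; apply: eq_bigr => i _; rewrite -sumrN; apply: eq_bigr => j _; ring. Qed.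

Lemma C3C12 Y Z W : C3 Y Z W = C3 Z Y W.
Proof.
rewrite /C3 exchange_big; apply: eq_bigr => i _; apply: eq_bigr => j _; apply: eq_bigr => k _.
by rewrite (mderiv_comm j i); ring.
Qed.

Lemma C3C23 Y Z W : C3 Y Z W = C3 Y W Z.
Proof.
rewrite /C3; apply: eq_bigr => i _; rewrite exchange_big; apply: eq_bigr => j _; apply: eq_bigr => k _.
by rewrite mderiv_comm; ring.
Qed.

Lemma C3N Y Z W : C3 (fun i => - Y i) Z W = - C3 Y Z W.
Proof.
by rewrite /C3 -sumrN; apply: eq_bigr => i _; rewrite -sumrN; apply: eq_bigr => j _;
 rewrite -sumrN; apply: eq_bigr => k _; ring.
Qed.

Lemma eq_C1 Y Y' : Y =1 Y' -> C1 Y = C1 Y'.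
Proof. by move=> e; apply: eq_bigr => i _; rewrite e. Qed.
Lemma eq_C2 Y Y' Z Z' : Y =1 Y' -> Z =1 Z' -> C2 Y Z = C2 Y' Z'.
Proof. by move=> e f; apply: eq_bigr => i _; apply: eq_bigr => j _; rewrite e f. Qed.
Lemma eq_C3 Y Y' Z W : Y =1 Y' -> C3 Y Z W = C3 Y' Z W.
Proof. by move=> e; do 3!(apply: eq_bigr => ? _); rewrite e. Qed.

Variable P : 'I_n -> {mpoly R[n]}.
Hypothesis TP : forall i, LT (T i) = - P i.
Hypothesis PT : forall i, LT (P i) = T i.

Lemma lie2E : LT (LT G) = C2 T T - C1 P.
Proof. by rewrite -[LT G]/(C1 T) lie_C1 (eq_C1 TP) C1N. Qed.

Lemma lie3E : LT (LT (LT G)) = C3 T T T - C2 P T *+ 3 - C1 T.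
Proof.
rewrite lie2E lieD lieN lie_C2 lie_C1 (eq_C2 TP (frefl _)) (eq_C2 (frefl T) TP) C2N.
rewrite (C2C T (fun i => - P i)) C2N (eq_C1 PT); ring.
Qed.

Lemma lie4E : LT (LT (LT (LT G))) = C4 T T T T - C3 P T T *+ 6 - C2 T T *+ 4 + C2 P P *+ 3 + C1 P.
Proof.
rewrite lie3E !(lieD, lieN, mulrS) addr0 !lie_C2 lie_C3 lie_C1.
rewrite (eq_C3 _ _ TP) C3N (C3C12 T (fun i => LT (T i))) (eq_C3 _ _ TP) C3N.
rewrite (C3C23 T T (fun i => LT (T i))) (C3C12 T (fun i => LT (T i))) (eq_C3 _ _ TP) C3N.
rewrite (eq_C2 PT (frefl T)) (eq_C2 (frefl P) TP) (C2C P (fun i => - P i)) C2N (eq_C1 TP) C1N; ring.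
Qed.
End LieCalculus.

Section JetForms.
Variables (R : realType) (G : {mpoly R[3]}) (p : 'I_3 -> R).
Notation V := ('I_3 -> R).
Definition jet1 (x : V) := \sum_i (G^`M(i)).@[p] * x i.
Definition jet2 (x y : V) := \sum_i \sum_j (G^`M(i)^`M(j)).@[p] * (x i * y j).
Definition jet3 (x y z : V) := \sum_i \sum_j \sum_k (G^`M(i)^`M(j)^`M(k)).@[p] * (x i * y j * z k).
Definition jet4 (x y z t : V) := \sum_i \sum_j \sum_k \sum_l
  (G^`M(i)^`M(j)^`M(k)^`M(l)).@[p] * (x i * y j * z k * t l).

Lemma f1D x y a : jet1 (fun i => x i + a * y i) = jet1 x + a * jet1 y.
Proof. by rewrite /jet1 mulr_sumr -big_split; apply: eq_bigr => i _ /=; ring. Qed.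

Lemma f2C x y : jet2 x y = jet2 y x.
Proof.
rewrite /jet2 exchange_big; apply: eq_bigr => i _; apply: eq_bigr => j _ /=.
by rewrite mderiv_comm; ring.
Qed.

Lemma f2D x x' a y : jet2 (fun i => x i + a * x' i) y = jet2 x y + a * jet2 x' y.
Proof.
rewrite /jet2 mulr_sumr -big_split; apply: eq_bigr => i _ /=.
by rewrite mulr_sumr -big_split; apply: eq_bigr => j _ /=; ring.
Qed.

Lemma f3D x x' a y z : jet3 (fun i => x i + a * x' i) y z = jet3 x y z + a * jet3 x' y z.
Proof.
rewrite /jet3 mulr_sumr -big_split; apply: eq_bigr => i _ /=.
rewrite mulr_sumr -big_split; apply: eq_bigr => j _ /=.
by rewrite mulr_sumr -big_split; apply: eq_bigr => k _ /=; ring.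
Qed.

Lemma f1Z x a : jet1 (fun i => a * x i) = a * jet1 x.
Proof. by rewrite /jet1 mulr_sumr; apply: eq_bigr => i _; ring. Qed.
Lemma f2Z x y a b : jet2 (fun i => a * x i) (fun i => b * y i) = a * b * jet2 x y.
Proof. by rewrite /jet2 !mulr_sumr; apply: eq_bigr => i _; rewrite mulr_sumr; apply: eq_bigr => j _; ring. Qed.
Lemma f3Z x y z a b c : jet3 (fun i => a * x i) (fun i => b * y i) (fun i => c * z i) = a * b * c * jet3 x y z.
Proof.
rewrite /jet3 !mulr_sumr; apply: eq_bigr => i _; rewrite mulr_sumr; apply: eq_bigr => j _ /=.
by rewrite mulr_sumr; apply: eq_bigr => k _; ring.
Qed.

Lemma eq_f1 x x' : x =1 x' -> jet1 x = jet1 x'.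
Proof. by move=> e; apply: eq_bigr => i _; rewrite e. Qed.
Lemma eq_f2 x x' y y' : x =1 x' -> y =1 y' -> jet2 x y = jet2 x' y'.
Proof. by move=> e f; apply: eq_bigr => i _; apply: eq_bigr => j _; rewrite e f. Qed.
Lemma eq_f3 x x' y y' z z' : x =1 x' -> y =1 y' -> z =1 z' -> jet3 x y z = jet3 x' y' z'.
Proof. by move=> e f g; do 3!(apply: eq_bigr => ? _); rewrite e f g. Qed.
Lemma eq_f4 x x' : x =1 x' -> jet4 x x x x = jet4 x' x' x' x'.
Proof. by move=> e; do 4!(apply: eq_bigr => ? _); rewrite !e. Qed.

Lemma meval_C1 Y : (C1 G Y).@[p] = jet1 (fun i => (Y i).@[p]).
Proof. by rewrite /C1 raddf_sum; apply: eq_bigr => i _; rewrite /= mevalM. Qed.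
Lemma meval_C2 Y Z : (C2 G Y Z).@[p] = jet2 (fun i => (Y i).@[p]) (fun i => (Z i).@[p]).
Proof.
rewrite /C2 raddf_sum; apply: eq_bigr => i _; rewrite /= raddf_sum; apply: eq_bigr => j _ /=.
by rewrite /= !mevalM.
Qed.
Lemma meval_C3 Y Z W : (C3 G Y Z W).@[p] = jet3 (fun i => (Y i).@[p]) (fun i => (Z i).@[p]) (fun i => (W i).@[p]).
Proof.
rewrite /C3 raddf_sum; apply: eq_bigr => i _; rewrite /= raddf_sum; apply: eq_bigr => j _ /=.
by rewrite /= raddf_sum; apply: eq_bigr => k _; rewrite /= !mevalM.
Qed.
Lemma meval_C4 Y Z W X : (C4 G Y Z W X).@[p] =
  jet4 (fun i => (Y i).@[p]) (fun i => (Z i).@[p]) (fun i => (W i).@[p]) (fun i => (X i).@[p]).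
Proof.
rewrite /C4 raddf_sum; apply: eq_bigr => i _; rewrite /= raddf_sum; apply: eq_bigr => j _ /=.
rewrite /= raddf_sum; apply: eq_bigr => k _; rewrite /= raddf_sum; apply: eq_bigr => l _.
by rewrite /= !mevalM.
Qed.
End JetForms.

Section CircleJets.
Variables (R : realType) (o u v : 'I_3 -> R) (r s : R) (G : {mpoly R[3]}).
Hypothesis uv : onpair u v.
Hypothesis G0 : forall t, G.@[curve (circ_den R) (sc_poly o u v r) t] = 0.
Let p := sc_pt o u v r s.
Let T i := (rotv o u v i).@[p].
Let N i := p i - o i.

Lemma lie_lin F w (a b : 'I_3 -> R) : lie F (lin w a) = \sum_i (a i)%:MP * F i.
Proof. by rewrite /lie; apply: eq_bigr => i _; rewrite mderiv_lin. Qed.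

Lemma sum_rot (a : 'I_3 -> R) : \sum_i (a i)%:MP * rotv o u v i = (dt a v)%:MP * lin o u - (dt a u)%:MP * lin o v.
Proof. by rewrite sum3 /rotv /dt !(mpolyCD, mpolyCM); ring. Qed.

Lemma lie_rot i : lie (rotv o u v) (rotv o u v i) = - radv o u v i.
Proof.
have [uu vv uv0] := uv; rewrite /rotv /radv lieD lieN !lieM !lieC !mul0r !add0r !(lie_lin _ _ _ u).
by rewrite -!/(rotv o u v) !sum_rot uu vv uv0 dtC uv0 mpolyC0 mpolyC1; ring.
Qed.

Lemma lie_rad i : lie (rotv o u v) (radv o u v i) = rotv o u v i.
Proof.
have [uu vv uv0] := uv; rewrite /radv lieD !lieM !lieC !mul0r !add0r !(lie_lin _ _ _ u).
by rewrite !sum_rot uu vv uv0 dtC uv0 mpolyC0 mpolyC1 /rotv; ring.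
Qed.

Lemma rad_on i : (radv o u v i).@[p] = N i.
Proof.
have [uu vv uv0] := uv; have d := den_neq0 s.
by rewrite meval_radv !dt_sc_pt uu vv uv0 dtC uv0 /N /p /sc_pt; field.
Qed.

(** The first four derivatives of G along the circle vanish, and [lie2E] to [lie4E] evaluate them;
    at a point of the circle the field [radv] is the radius vector N. *)
Lemma circle_jets : [/\ jet1 G p T = 0, jet2 G p T T = jet1 G p N, jet3 G p T T T = 3 * jet2 G p N T &
  jet4 G p T T T T - 6 * jet3 G p N T T + 3 * jet2 G p N N - 3 * jet2 G p T T = 0].
Proof.
have tau0 t : 2 / (1 + t ^+ 2) != 0 :> R by rewrite mulf_neq0 ?pnatr_eq0 // invr_eq0 den_neq0.
have vel t i := sc_velocity o r t i uv.
have l1 := lie_vanish (@circ_den_gt0 R) tau0 vel G0.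
have l2 := lie_vanish (@circ_den_gt0 R) tau0 vel l1.
have l3 := lie_vanish (@circ_den_gt0 R) tau0 vel l2.
have l4 := lie_vanish (@circ_den_gt0 R) tau0 vel l3.
have ev F : F.@[curve (circ_den R) (sc_poly o u v r) s] = F.@[p] by apply: meval_eq; apply: sc_curve.
move: (etrans (esym (ev _)) (l1 s)) (etrans (esym (ev _)) (l2 s)) (etrans (esym (ev _)) (l3 s)) (etrans (esym (ev _)) (l4 s)).
rewrite (lie4E G lie_rot lie_rad) (lie3E G lie_rot lie_rad) (lie2E G lie_rot) -[lie _ G]/(C1 G (rotv o u v)).
rewrite !(mevalD, mevalN, mevalMn, meval_C1, meval_C2, meval_C3, meval_C4) -!/T.
rewrite (eq_f1 _ _ rad_on) (eq_f2 _ _ rad_on (frefl T)) (eq_f2 _ _ rad_on rad_on) (eq_f3 _ _ rad_on (frefl T) (frefl T)).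
move=> e1 e2 e3 e4; split; [exact: e1|by move: e2; lra|by move: e3 e1; lra|by move: e4 e2; lra].
Qed.
End CircleJets.

(** * Circles with prescribed contact to a surface *)

Section Osculation.
Variables (R : realType) (G : {mpoly R[3]}) (p : 'I_3 -> R) (l : R) (e f : 'I_3 -> R).
Notation V := ('I_3 -> R).
Hypotheses (l0 : 0 < l) (ef : onpair e f) (grad : forall i, (G^`M(i)).@[p] = l * cr e f i).
Let g : V := cr e f.
Local Notation f1 := (jet1 G p).
Local Notation f2 := (jet2 G p).
Local Notation f3 := (jet3 G p).
Local Notation f4 := (jet4 G p).

(* The jet of order four of a circle tangent to [T] at [p] and centred at [p - N] on which [G] vanishes. *)
Definition osculates (T N : V) :=
  [/\ f1 T = 0, f2 T T = f1 N, f3 T T T = 3 * f2 N T &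
      f4 T T T T - 6 * f3 N T T + 3 * f2 N N - 3 * f2 T T = 0] /\
  [/\ dt T T = dt N N, dt T N = 0 & 0 < dt T T].

Lemma eq_dt (x x' y y' : V) : x =1 x' -> y =1 y' -> dt x y = dt x' y'.
Proof. by move=> ex ey; rewrite /dt !ex !ey. Qed.

Lemma f1_frame x : f1 x = l * dt g x.
Proof. by rewrite /jet1 sum3 !grad -/g /dt; ring. Qed.

Lemma parseval (x : V) i : x i = dt x e * e i + dt x f * f i + dt x g * g i.
Proof.
have [ee ff eo] := ef.
have gg : dt g g = 1.
  transitivity (dt e e * dt f f - dt e f * dt e f); last by rewrite ee ff eo; ring.
  by rewrite /g /dt cr0 cr1 cr2; ring.
have h1 k : cr g e k = f k.
  transitivity (f k * dt e e - e k * dt e f); last by rewrite ee eo; ring.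
  by case: (ord3 k) => ->; rewrite ?cr0 ?cr1 ?cr2 /g ?cr0 ?cr1 ?cr2 /dt; ring.
have h2 k : cr g f k = - e k.
  transitivity (f k * dt e f - e k * dt f f); last by rewrite ff eo; ring.
  by case: (ord3 k) => ->; rewrite ?cr0 ?cr1 ?cr2 /g ?cr0 ?cr1 ?cr2 /dt; ring.
have h3 k : cr x g k = dt x f * e k - dt x e * f k.
  by case: (ord3 k) => ->; rewrite ?cr0 ?cr1 ?cr2 /g ?cr0 ?cr1 ?cr2 /dt; ring.
have h4 k : cr g (cr x g) k = dt x f * cr g e k - dt x e * cr g f k.
  by case: (ord3 k) => ->; [rewrite !(cr0 g)|rewrite !(cr1 g)|rewrite !(cr2 g)]; rewrite !h3; ring.
have h5 k : cr g (cr x g) k = x k * dt g g - dt x g * g k.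
  by case: (ord3 k) => ->; rewrite !(cr0, cr1, cr2) /dt; ring.
by move: (h5 i); rewrite h4 h1 h2 gg => h; move: h; lra.
Qed.

Lemma frame_dt : [/\ dt g g = 1, dt e g = 0 & dt f g = 0].
Proof.
have [ee ff eo] := ef; split.
- transitivity (dt e e * dt f f - dt e f * dt e f); last by rewrite ee ff eo; ring.
  by rewrite /g /dt !(cr0, cr1, cr2); ring.
- by rewrite /g /dt !(cr0, cr1, cr2); ring.
- by rewrite /g /dt !(cr0, cr1, cr2); ring.
Qed.

(** [T0 s] is the tangent direction of slope s and [m s] its perpendicular in the tangent plane. Up
    to scale, q and Q are the second fundamental form at (T0, T0) and (m, T0); Q vanishes exactly in
    principal directions. *)
Let T0 s : V := fun i => e i + s * f i.
Let m s : V := fun i => f i + - s * e i.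
Let q s := f2 (T0 s) (T0 s).
Let Q s := f2 (m s) (T0 s).

(** N is orthogonal to T = c T0, so it is a combination of g and m. The second order determines a,
    the third order b when Q <> 0, equality of the norms c^2; the fourth order remains as a
    condition on s. *)
Lemma osculates_solve s c T N : c != 0 -> (forall i, T i = c * T0 s i) -> osculates T N ->
  exists a b, [/\ forall i, N i = - c ^+ 2 * (a * g i + b * m s i), l * a = - q s,
    f3 (T0 s) (T0 s) (T0 s) + 3 * (a * f2 g (T0 s) + b * Q s) = 0,
    c ^+ 2 * (a ^+ 2 + b ^+ 2 * (1 + s ^+ 2)) = 1 + s ^+ 2 &
    c ^+ 2 * (f4 (T0 s) (T0 s) (T0 s) (T0 s) + 6 * (a * f3 g (T0 s) (T0 s) + b * f3 (m s) (T0 s) (T0 s))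
      + 3 * (a ^+ 2 * f2 g g + 2 * a * b * f2 g (m s) + b ^+ 2 * f2 (m s) (m s))) = 3 * q s].
Proof.
move=> c0 Tc [[t1 t2 t3 t4] [TN TpN T0p]]; have [ee ff eo] := ef; have [gg eg fg] := frame_dt.
have c20 : c ^+ 2 != 0 by rewrite sqrf_eq0.
have Nt : dt N e + s * dt N f = 0.
  apply: (mulfI c0); rewrite mulr0 -TpN (eq_dt Tc (frefl N)) /dt /T0; ring.
pose a := - dt N g / c ^+ 2; pose b := - dt N f / c ^+ 2.
have ca : c ^+ 2 * a = - dt N g by rewrite /a mulrC divfK.
have cb : c ^+ 2 * b = - dt N f by rewrite /b mulrC divfK.
have NE i : N i = - c ^+ 2 * (1 * (a * g i + b * m s i)).
  transitivity (- (c ^+ 2 * a) * g i - (c ^+ 2 * b) * m s i); last by ring.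
  rewrite [LHS](parseval N i) ca cb /m (_ : dt N e = - s * dt N f); last by move: Nt; lra.
  by rewrite -/g; ring.
pose N' i := a * g i + b * m s i.
have N'E : N' =1 (fun i => (fun i => a * g i) i + b * m s i) by [].
have c3f : f2 T T = c ^+ 2 * q s by rewrite (eq_f2 _ _ Tc Tc) f2Z expr2.
have NE' i : N i = - c ^+ 2 * N' i by rewrite NE mul1r.
have f2N y : f2 N' y = a * f2 g y + b * f2 (m s) y.
  rewrite (eq_f2 _ _ N'E (frefl y)) f2D; congr (_ + _).
  by rewrite -[X in f2 _ X]/(fun i => y i) -(eq_f2 G p (frefl _) (fun i => mul1r (y i))) f2Z mulr1.
have f3N y z : f3 N' y z = a * f3 g y z + b * f3 (m s) y z.
  rewrite (eq_f3 _ _ N'E (frefl y) (frefl z)) f3D; congr (_ + _).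
  by rewrite -(eq_f3 G p (frefl _) (fun i => mul1r (y i)) (fun i => mul1r (z i))) f3Z !mulr1.
exists a, b; split.
- by move=> i; rewrite NE mul1r.
- apply: (mulfI c20); rewrite mulrCA ca [RHS]mulrN -c3f t2 f1_frame (dtC g); ring.
- have := t3; rewrite (eq_f3 _ _ Tc Tc Tc) (eq_f2 _ _ NE' Tc) f3Z f2Z f2N => h.
  apply: (mulfI (mulf_neq0 c0 c20)); rewrite mulr0 -/(Q s) in h *.
  by move/eqP: h; rewrite -subr_eq0 => /eqP <-; ring.
- have h1 : dt T T = c ^+ 2 * (1 + s ^+ 2).
    rewrite (eq_dt Tc Tc); transitivity (c ^+ 2 * (dt e e + 2 * s * dt e f + s ^+ 2 * dt f f)).
      by rewrite /dt /T0; ring.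
    by rewrite ee ff eo; ring.
  have h2 : dt N N = c ^+ 4 * (a ^+ 2 + b ^+ 2 * (1 + s ^+ 2)).
    rewrite (eq_dt NE' NE'); transitivity (c ^+ 4 * (a ^+ 2 * dt g g + 2 * a * b * (dt f g - s * dt e g) +
      b ^+ 2 * (dt f f - 2 * s * dt e f + s ^+ 2 * dt e e))).
      by rewrite /dt /N' /m; ring.
    by rewrite ee ff eo gg eg fg; ring.
  apply: (mulfI c20); rewrite -h1 TN h2; ring.
- have := t4; rewrite c3f (eq_f4 _ _ Tc) (eq_f3 _ _ NE' Tc Tc) (eq_f2 _ _ NE' NE') f3Z f2Z.
  rewrite f3N f2N (f2C G p g N') (f2C G p (m s) N') !f2N (f2C G p (m s) g).
  have -> : f4 (fun i => c * T0 s i) (fun i => c * T0 s i) (fun i => c * T0 s i) (fun i => c * T0 s i) =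
     c ^+ 4 * f4 (T0 s) (T0 s) (T0 s) (T0 s).
    rewrite /jet4 mulr_sumr; apply: eq_bigr => i _; rewrite mulr_sumr; apply: eq_bigr => j _.
    by rewrite mulr_sumr; apply: eq_bigr => k _; rewrite mulr_sumr; apply: eq_bigr => h _; ring.
  move=> h; apply: (mulfI c20); apply/eqP; rewrite -subr_eq0 -h; apply/eqP; ring.
Qed.

Lemma osculates_unique s c c' T T' N N' : c != 0 -> c' != 0 -> (forall i, T i = c * T0 s i) ->
  (forall i, T' i = c' * T0 s i) -> osculates T N -> osculates T' N' -> Q s != 0 ->
  N =1 N' /\ (T =1 T' \/ forall i, T i = - T' i).
Proof.
move=> c0 c'0 Tc Tc' o o' Q0.
have [a [b [NE la ab cc _]]] := osculates_solve c0 Tc o.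
have [a' [b' [NE' la' ab' cc' _]]] := osculates_solve c'0 Tc' o'.
have aa : a = a' by apply: (mulfI (lt0r_neq0 l0)); rewrite la la'.
have bb : b = b'.
  apply: (mulIf Q0); have := etrans ab (esym ab'); rewrite aa; lra.
have S0 : 1 + s ^+ 2 != 0 by rewrite gt_eqF // ltr_pwDl ?ltr01 // sqr_ge0.
have k0 : a ^+ 2 + b ^+ 2 * (1 + s ^+ 2) != 0.
  by apply: contraNneq S0 => k0; rewrite -cc k0 mulr0.
have ce : c ^+ 2 = c' ^+ 2 by apply: (mulIf k0); rewrite cc aa bb cc'.
split=> [i|]; first by rewrite NE NE' aa bb ce.
have /orP[/eqP cE|/eqP cE] : (c == c') || (c == - c') by rewrite -eqf_sqr ce.
  by left=> i; rewrite Tc Tc' cE.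
by right=> i; rewrite Tc Tc' cE mulNr.
Qed.

(** [good] with denominator 1: polynomial dependence on the slope, of degree at most D. *)
Let pol := @good R 1 1.
Let one1 : (size (1%R : {poly R}) <= 2)%N. Proof. by rewrite size_poly1. Qed.
Let pol_mul := @good_mul R 1 1.
Let pol_add := @good_add R 1 1.
Let pol_const : forall D a, pol D (fun=> a) := @good_const R 1 1 one1.
Let pol_sum D (I : Type) (r : seq I) := @good_sum R 1 1 one1 D I r.
Let polE D h : pol D h -> exists2 P : {poly R}, (size P <= D.+1)%N & forall s, P.[s] = h s.
Proof. by move=> [P sP PE]; exists P => [|s]; [rewrite mul1n in sP|rewrite PE hornerC expr1n mul1r]. Qed.

Let pol_lin a b : pol 1 (fun s => a + s * b).
Proof.
exists (a%:P + b *: 'X); last by move=> s; rewrite hornerD hornerC hornerZ hornerX hornerC expr1n mul1r mulrC.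
apply/leq_sizeP => j j2; rewrite coefD coefC coefZ coefX.
by case: j j2 => [|[|j]] // _; rewrite mulr0 addr0.
Qed.
Let pol_T0 i : pol 1 (fun s => T0 s i). Proof. exact: pol_lin. Qed.
Let pol_m i : pol 1 (fun s => m s i).
Proof. by apply: good_ext (pol_lin (f i) (- e i)) => s; rewrite /m mulrN mulNr. Qed.
Let pol_scale D a h : pol D h -> pol D (fun s => a * h s).
Proof. by move=> hD; have := pol_mul (pol_const 0 a) hD. Qed.
Let pol_f2 D E (Y Z : R -> V) : (forall i, pol D (fun s => Y s i)) -> (forall i, pol E (fun s => Z s i)) ->
  pol (D + E) (fun s => f2 (Y s) (Z s)).
Proof.
move=> hY hZ; apply: pol_sum => i; apply: pol_sum => j; apply: pol_scale; exact: (pol_mul (hY i) (hZ j)).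
Qed.
Let pol_f3 D E F (Y Z W : R -> V) : (forall i, pol D (fun s => Y s i)) -> (forall i, pol E (fun s => Z s i)) ->
  (forall i, pol F (fun s => W s i)) -> pol (D + E + F) (fun s => f3 (Y s) (Z s) (W s)).
Proof.
move=> hY hZ hW; apply: pol_sum => i; apply: pol_sum => j; apply: pol_sum => k.
apply: pol_scale; exact: (pol_mul (pol_mul (hY i) (hZ j)) (hW k)).
Qed.

Let B s := l * f3 (T0 s) (T0 s) (T0 s) - 3 * q s * f2 g (T0 s).
(** 9 l^2 Q^2 times the left-hand factor of the fourth-order equation after the elimination a = - q
    / l, b = - B / (3 l Q), minus the term 3 B^2 q that the norm equation contributes. *)
Let Psi s := 9 * l ^+ 2 * (Q s * Q s * f4 (T0 s) (T0 s) (T0 s) (T0 s)) - 54 * l * (Q s * Q s * q s * f3 g (T0 s) (T0 s))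
  - 18 * l * (Q s * B s * f3 (m s) (T0 s) (T0 s)) + 27 * f2 g g * (Q s * Q s * (q s * q s))
  + 18 * (q s * Q s * (B s * f2 g (m s))) + 3 * (B s * B s * f2 (m s) (m s)) - 3 * (B s * B s * q s).

Lemma osculates_slope s c T N : c != 0 -> (forall i, T i = c * T0 s i) -> osculates T N -> Q s != 0 ->
  (1 + s ^+ 2) * Psi s - 27 * (Q s ^+ 2 * q s ^+ 3) = 0.
Proof.
move=> c0 Tc o Q0; have [a [b [_ la ab cc E4]]] := osculates_solve c0 Tc o.
have c20 : c ^+ 2 != 0 by rewrite sqrf_eq0.
set k := a ^+ 2 + _ in cc; set F := f4 _ _ _ _ + _ + _ in E4.
have e1 : (1 + s ^+ 2) * F = 3 * k * q s.
  by apply: (mulfI c20); rewrite mulrCA E4 -cc; ring.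
have hb : 3 * l * Q s * b = - B s.
  rewrite /B; have -> : 3 * q s * f2 g (T0 s) = - (3 * (l * a) * f2 g (T0 s)) by rewrite la; ring.
  apply/eqP; rewrite -subr_eq0; apply/eqP.
  transitivity (l * (f3 (T0 s) (T0 s) (T0 s) + 3 * (a * f2 g (T0 s) + b * Q s))); first by ring.
  by rewrite ab mulr0.
have e2 : 9 * l ^+ 2 * Q s ^+ 2 * ((1 + s ^+ 2) * F - 3 * k * q s) =
  (1 + s ^+ 2) * Psi s - 27 * (Q s ^+ 2 * q s ^+ 3).
  rewrite /F /k /Psi (_ : q s = - (l * a)); last by rewrite la opprK.
  by rewrite (_ : B s = - (3 * l * Q s * b)); [ring|rewrite hb opprK].
by rewrite -e2 e1 subrr mulr0.
Qed.

(* Modulo [1 + s^2], [Q] and [q / s] reduce to one linear form [Z], so that [Phi] reduces to [- 27 s^3 Z^5]. *)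
Lemma slope_poly s0 : Q s0 != 0 -> exists Phi : {poly R}, [/\ Phi != 0, (size Phi <= 11)%N &
  forall s c T N, c != 0 -> (forall i, T i = c * T0 s i) -> osculates T N -> Q s != 0 -> root Phi s].
Proof.
move=> Q0; set a11 := f2 e e; set a12 := f2 e f; set a22 := f2 f f.
have f2l x y a z : f2 x (fun i => y i + a * z i) = f2 x y + a * f2 x z by rewrite f2C f2D !(f2C G p x).
have qE s : q s = a11 + 2 * a12 * s + a22 * s ^+ 2.
  by rewrite /q /T0 f2D !f2l (f2C G p f e) -/a11 -/a12 -/a22; ring.
have QE s : Q s = a12 + (a22 - a11) * s + (- a12) * s ^+ 2.
  by rewrite /Q /m /T0 f2D !f2l (f2C G p f e) -/a11 -/a12 -/a22; ring.
pose S : {poly R} := 1 + 'X^2.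
pose qp := a11%:P + (2 * a12) *: 'X + a22 *: 'X^2.
pose Qp := a12%:P + (a22 - a11) *: 'X + (- a12) *: 'X^2.
have [P sP PE] : exists2 P : {poly R}, (size P <= 9)%N & forall s, P.[s] = Psi s.
  apply: polE; have pq : pol 2 q := pol_f2 pol_T0 pol_T0.
  have pQ : pol 2 Q := pol_f2 pol_m pol_T0.
  have pg D i : pol D (fun _ => g i) := pol_const D (g i).
  have pF : pol 4 (fun s => f4 (T0 s) (T0 s) (T0 s) (T0 s)).
    apply: pol_sum => i; apply: pol_sum => j; apply: pol_sum => k; apply: pol_sum => h; apply: pol_scale.
    exact: (pol_mul (pol_mul (pol_mul (pol_T0 i) (pol_T0 j)) (pol_T0 k)) (pol_T0 h)).
  have pB : pol 3 B.
    have h := pol_add (pol_scale l (pol_f3 pol_T0 pol_T0 pol_T0)) (pol_scale (- 3) (pol_mul pq (pol_f2 (pg 0%N) pol_T0))).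
    by apply: good_ext h => s; rewrite /B; ring.
  have pQQ := pol_mul pQ pQ; have pBB := pol_mul pB pB.
  have t1 := pol_scale (9 * l ^+ 2) (pol_mul pQQ pF).
  have t2 := pol_scale (- 54 * l) (pol_mul (pol_mul pQQ pq) (pol_f3 (pg 0%N) pol_T0 pol_T0)).
  have t3 := pol_scale (- 18 * l) (pol_mul (pol_mul pQ pB) (pol_f3 pol_m pol_T0 pol_T0)).
  have t4 := pol_scale (27 * f2 g g) (pol_mul pQQ (pol_mul pq pq)).
  have t5 := pol_scale 18 (pol_mul (pol_mul pq pQ) (pol_mul pB (pol_f2 (pg 0%N) pol_m))).
  have t6 := pol_scale 3 (pol_mul pBB (pol_f2 pol_m pol_m)).
  have t7 := pol_scale (- 3) (pol_mul pBB pq).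
  have h := pol_add (pol_add (pol_add (pol_add (pol_add (pol_add t1 t2) t3) t4) t5) t6) t7.
  by apply: good_ext h => s; rewrite /Psi; ring.
have qpE s : qp.[s] = q s by rewrite qE /qp !hornerE.
have QpE s : Qp.[s] = Q s by rewrite QE /Qp !hornerE.
have sS : (size S <= 3)%N.
  by apply/leq_sizeP => -[|[|[|j]]] //= _; rewrite coefD coefXn coef1 addr0.
have sq : (size qp <= 3)%N.
  by apply/leq_sizeP => -[|[|[|j]]] //= _; rewrite !coefD coefC !coefZ coefX coefXn !mulr0 !addr0.
have sQ : (size Qp <= 3)%N.
  by apply/leq_sizeP => -[|[|[|j]]] //= _; rewrite !coefD coefC !coefZ coefX coefXn !mulr0 !addr0.
exists (S * P - 27 *: (Qp ^+ 2 * qp ^+ 3)); split.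
- apply: contraNneq Q0 => /eqP; rewrite subr_eq0 => /eqP h.
  have [A AE] : exists A, A = 2 * a12 by exists (2 * a12).
  have [Bc BE] : exists x, x = a22 - a11 by exists (a22 - a11).
  pose Z := A%:P + Bc *: 'X; pose Zb := A%:P - Bc *: 'X.
  pose k := A ^+ 2 + Bc ^+ 2.
  have eX : ('X : {poly R}) * - 'X = 1 - S by rewrite /S; ring.
  have eZ : Z * Zb = k%:P - (Bc ^+ 2)%:P * S.
    by rewrite /Z /Zb /S /k -!mul_polyC !polyCD !polyC_exp; ring.
  have eQ : Qp = Z - a12%:P * S by rewrite /Qp /Z /S AE BE -!mul_polyC; rewrite !(polyCD, polyCN, polyCM); ring.
  have eq_ : qp = 'X * Z + a11%:P * S.
    by rewrite /qp /Z /S AE BE -!mul_polyC !(polyCD, polyCN, polyCM); ring.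
  have Sdv : S %| (k%:P) ^+ 5.
    have d0 : S %| Qp ^+ 2 * qp ^+ 3.
      rewrite -(@dvdpZr _ 27) ?pnatr_eq0 // -h; exact: dvdp_mulr.
    have d1 : S %| 'X ^+ 3 * Z ^+ 5.
      have e5 : exists W, Qp ^+ 2 * qp ^+ 3 = 'X ^+ 3 * Z ^+ 5 + W * S.
        rewrite eQ eq_; set x := a12%:P; set y := a11%:P.
        exists ((- 2 * Z * x + x ^+ 2 * S) * ('X * Z + y * S) ^+ 3 +
          Z ^+ 2 * (3 * ('X * Z) ^+ 2 * y + 3 * ('X * Z) * y ^+ 2 * S + y ^+ 3 * S ^+ 2)); ring.
      have [W WE] := e5; move: d0; rewrite WE dvdp_addl //; exact: dvdp_mull.
    (* Multiplying by the conjugates -X and Zb: modulo S = 1 + X^2 the products X * -X and Z Zb are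
       1 and k, so S divides the constant k^5. *)
    have d2 : S %| ('X * - 'X) ^+ 3 * (Z * Zb) ^+ 5.
      have -> : ('X * - 'X) ^+ 3 * (Z * Zb) ^+ 5 = ('X ^+ 3 * Z ^+ 5) * ((- 'X) ^+ 3 * Zb ^+ 5) by ring.
      exact: dvdp_mulr.
    move: d2; rewrite eX eZ; set y := (Bc ^+ 2)%:P; set K := k%:P.
    have -> : (1 - S) ^+ 3 * (K - y * S) ^+ 5 = K ^+ 5 + S * ((- 3 + 3 * S - S ^+ 2) * (K - y * S) ^+ 5 +
      (- y) * (5 * K ^+ 4 - 10 * K ^+ 3 * (y * S) + 10 * K ^+ 2 * (y * S) ^+ 2 - 5 * K * (y * S) ^+ 3 + (y * S) ^+ 4)) by ring.
    by rewrite dvdp_addl // dvdp_mulr.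
  have k0 : k = 0.
    apply/eqP; apply: contraT => k0.
    have := dvdp_leq _ Sdv; rewrite -polyC_exp polyC_eq0 expf_eq0 (negbTE k0) andbF => /(_ isT).
    rewrite size_polyC expf_eq0 (negbTE k0) andbF /= => s1.
    have : S`_2 = 0 by apply: nth_default; apply: leq_trans s1 _.
    by rewrite /S coefD coefXn coef1 add0r => /eqP; rewrite oner_eq0.
  (* k = 0 means a12 = 0 and a11 = a22, an umbilic point, where Q vanishes for all slopes, against
     [Q0]. *)
  have /andP[/eqP A0 /eqP B0] : (A == 0) && (Bc == 0).
    by rewrite -(sqrf_eq0 A) -(sqrf_eq0 Bc) -paddr_eq0 ?sqr_ge0 //; apply/eqP.
  have a120 : a12 = 0 by move: A0; rewrite AE; lra.
  by rewrite QE a120 -BE B0; apply/eqP; ring.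
- apply: leq_trans (size_polyD _ _) _; rewrite geq_max size_polyN; apply/andP; split.
    exact: (size_mul_deg (a := 2) (b := 8)).
  apply: leq_trans (size_scale_leq _ _) _.
  by apply: (size_mul_deg (a := 4) (b := 6)); [exact: (size_exp_deg (a := 2) 2)|exact: (size_exp_deg (a := 2) 3)].
move=> s c T N c0 Tc o Qs; have SE : S.[s] = 1 + s ^+ 2 by rewrite /S !hornerE.
rewrite rootE hornerD hornerN hornerZ (hornerM S) (hornerM (Qp ^+ 2)) !horner_exp SE PE QpE qpE.
by apply/eqP; exact: (osculates_slope c0 Tc o Qs).
Qed.
End Osculation.

Section OsculatingCircles.
Variables (R : realType) (G : {mpoly R[3]}) (p : 'I_3 -> R).
Notation V := ('I_3 -> R).

Section OneCircle.
Variables (o u v : V) (r s : R).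
Hypotheses (uv : onpair u v) (r0 : 0 < r) (ps : sc_pt o u v r s = p).
Hypothesis G0 : forall t, G.@[curve (circ_den R) (sc_poly o u v r) t] = 0.
Let T i := (rotv o u v i).@[p].
Let N i := p i - o i.
Let al := dt u N.
Let be := dt v N.

Lemma rotv_at i : T i = v i * al - u i * be.
Proof. by rewrite /T meval_rotv. Qed.

Lemma radius_at i : N i = u i * al + v i * be.
Proof. by have h := rad_on o r s uv i; rewrite ps meval_radv in h; exact: (esym h). Qed.

Lemma radius_norm : al ^+ 2 + be ^+ 2 = r ^+ 2.
Proof.
have [uu vv uv0] := uv; have d := den_neq0 s.
have e : N =1 (fun i => sc_pt o u v r s i - o i) by move=> i; rewrite ps.
by rewrite /al /be (eq_dt (frefl u) e) (eq_dt (frefl v) e) !dt_sc_pt uu vv uv0 dtC uv0; field.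
Qed.

Lemma circle_osculates : osculates G p T N.
Proof.
have jets := circle_jets s uv G0; rewrite ps in jets.
have [uu vv uv0] := uv.
have TT : dt T T = al ^+ 2 + be ^+ 2.
  rewrite (eq_dt rotv_at rotv_at).
  transitivity (dt v v * al ^+ 2 + dt u u * be ^+ 2 - 2 * al * be * dt u v); last by rewrite uu vv uv0; ring.
  by rewrite /dt; ring.
have NN : dt N N = al ^+ 2 + be ^+ 2.
  rewrite (eq_dt radius_at radius_at).
  transitivity (dt v v * be ^+ 2 + dt u u * al ^+ 2 + 2 * al * be * dt u v); last by rewrite uu vv uv0; ring.
  by rewrite /dt; ring.
split=> //; split; first by rewrite TT NN.
  rewrite (eq_dt rotv_at radius_at).
  transitivity (al * be * (dt v v - dt u u) + (al ^+ 2 - be ^+ 2) * dt u v); last by rewrite uu vv uv0; ring.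
  by rewrite /dt; ring.
by rewrite TT radius_norm exprn_gt0.
Qed.

(** Binet-Cauchy: with h the contraction of the second differential with T, both sides are l times
    the inner product of g x h and N x nu. So [tang] is nonzero exactly when Q is, off the principal
    directions. *)
Lemma transversal_slope l e f c t : onpair e f -> (forall i, (G^`M(i)).@[p] = l * cr e f i) ->
  (forall i, T i = c * (e i + t * f i)) ->
  jet1 G p N * jet2 G p (cr u v) T - jet1 G p (cr u v) * jet2 G p N T =
  l * c ^+ 2 * jet2 G p (fun i => f i + - t * e i) (fun i => e i + t * f i).
Proof.
move=> [ee ff eo] grad Tc; have [uu vv uv0] := uv.
pose h i := \sum_j (G^`M(i)^`M(j)).@[p] * T j.
have f2h x : jet2 G p x T = dt x h.
  transitivity (\sum_i x i * h i); last by rewrite sum3 /dt addrA.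
  by apply: eq_bigr => i _; rewrite /h mulr_sumr; apply: eq_bigr => j _ /=; ring.
have -> : l * c ^+ 2 * jet2 G p (fun i => f i + - t * e i) (fun i => e i + t * f i) =
   l * c * jet2 G p (fun i => f i + - t * e i) T.
  rewrite (eq_f2 _ _ (fun i => esym (mul1r (f i + - t * e i))) Tc) f2Z; ring.
rewrite !f2h !(f1_frame grad).
have gT i : cr (cr e f) T i = c * (f i + - t * e i).
  transitivity (c * (f i * (dt e e + t * dt e f) - e i * (dt e f + t * dt f f))); last by rewrite ee ff eo; ring.
  by case: (ord3 i) => ->; rewrite !(cr0, cr1, cr2) !Tc /dt; ring.
have NT i : cr N (cr u v) i = - T i.
  transitivity (u i * dt v N - v i * dt u N); last by rewrite rotv_at -/al -/be; ring.
  by case: (ord3 i) => ->; rewrite !(cr0, cr1, cr2) /dt; ring.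
transitivity (l * dt (cr (cr e f) h) (cr N (cr u v))).
  by rewrite /dt !(cr0 _ h) !(cr1 _ h) !(cr2 _ h) !(cr0 N) !(cr1 N) !(cr2 N); ring.
transitivity (l * dt h (cr (cr e f) T)).
  rewrite (eq_dt (frefl _) NT) /dt !(cr0 _ h) !(cr1 _ h) !(cr2 _ h) !(cr0 _ T) !(cr1 _ T) !(cr2 _ T); ring.
by rewrite (eq_dt (frefl h) gT) /dt; ring.
Qed.
End OneCircle.

Variables (I : finType) (S : {set I}) (o u v : I -> V) (r s : I -> R).
Let T A i := (rotv (o A) (u A) (v A) i).@[p].
Let N A i := p i - o A i.
Hypothesis Gp : exists i, (G^`M(i)).@[p] != 0.
Hypothesis uv : forall A, onpair (u A) (v A).
Hypothesis r0 : forall A, 0 < r A.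
Hypothesis inj : forall A B, o A =1 o B -> r A = r B ->
  (cr (u A) (v A) =1 cr (u B) (v B) \/ forall i, cr (u A) (v A) i = - cr (u B) (v B) i) -> A = B.
Hypothesis ps : forall A, A \in S -> sc_pt (o A) (u A) (v A) (r A) (s A) = p.
Hypothesis G0 : forall A, A \in S -> forall t, G.@[curve (circ_den R) (sc_poly (o A) (u A) (v A) (r A)) t] = 0.
Hypothesis trans : forall A, A \in S ->
  jet1 G p (N A) * jet2 G p (cr (u A) (v A)) (T A) - jet1 G p (cr (u A) (v A)) * jet2 G p (N A) (T A) != 0.

(** The centre is p - N, the radius is |N|, and N x T is r^2 times the unit normal. *)
Lemma same_jet_same_circle A B : A \in S -> B \in S -> N A =1 N B -> T A =1 T B \/ (forall i, T A i = - T B i) -> A = B.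
Proof.
move=> AS BS eN eT.
have nrm C : C \in S -> dt (N C) (N C) = r C ^+ 2.
  move=> CS; have [uu vv uv0] := uv C; rewrite -(radius_norm (uv C) (ps CS)).
  rewrite (eq_dt (radius_at (uv C) (ps CS)) (radius_at (uv C) (ps CS))) -/(N C).
  set a := dt (u C) (N C); set b := dt (v C) (N C).
  transitivity (dt (v C) (v C) * b ^+ 2 + dt (u C) (u C) * a ^+ 2 + 2 * a * b * dt (u C) (v C)); last by rewrite uu vv uv0; ring.
  by rewrite /dt; ring.
have rr : r A = r B.
  by apply/eqP; rewrite -(eqrXn2 (isT : (0 < 2)%N)) ?ltW // -!nrm // (eq_dt eN eN).
have nu C i : C \in S -> cr (N C) (T C) i = r C ^+ 2 * cr (u C) (v C) i.
  move=> CS; rewrite -(radius_norm (uv C) (ps CS)) -/(N C); set a := dt (u C) (N C); set b := dt (v C) (N C).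
  have hT := rotv_at (o C) (u C) (v C); have hN := radius_at (uv C) (ps CS).
  by case: (ord3 i) => ->; rewrite !(cr0, cr1, cr2) /T !hT /N !hN -/(N C) -/a -/b; ring.
have r2 : r B ^+ 2 != 0 by rewrite expf_eq0 /= gt_eqF.
apply: inj => //; first by move=> i; have := eN i; rewrite /N => /addrI /oppr_inj.
case: eT => eT; [left|right] => i; apply: (mulfI r2).
  rewrite -{1}rr -!nu //; case: (ord3 i) => ->; rewrite !(cr0, cr1, cr2) !eN !eT //.
by rewrite -{1}rr mulrN -!nu //; case: (ord3 i) => ->; rewrite !(cr0, cr1, cr2) !eN !eT; ring.
Qed.

(** At most one circle is tangent to f, the infinite slope. The other slopes are roots of the
    polynomial of [slope_poly], of degree at most 10, and a slope determines its circle by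
    [osculates_unique]. *)
Lemma card_osculating : (#|S| <= 11)%N.
Proof.
pose n : V := fun i => (G^`M(i)).@[p].
have nn : 0 < dt n n := dt_gt0 Gp.
pose l := Num.sqrt (dt n n); have l0 : 0 < l by rewrite sqrtr_gt0.
have ll : l ^+ 2 = dt n n by rewrite sqr_sqrtr // ltW.
have l1 : l != 0 by rewrite lt0r_neq0.
have [e [f [ef gE]]] : exists e f, onpair e f /\ cr e f =1 (fun i => n i / l).
  apply: exists_frame; transitivity (dt n n / l ^+ 2); first by rewrite /dt; field.
  by rewrite ll divff // gt_eqF.
have grad i : (G^`M(i)).@[p] = l * cr e f i by rewrite gE mulrC divfK.
(* In the rotated frame (f, -e) the infinite slope becomes slope 0. *)
have ef' : onpair f (fun i => - e i).
  have [ee ff eo] := ef; split=> //; rewrite -?ee -1?(oppr0) -?eo /dt; ring.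
have grad' i : (G^`M(i)).@[p] = l * cr f (fun i => - e i) i.
  rewrite grad; congr (l * _); case: (ord3 i) => ->; rewrite !(cr0, cr1, cr2); ring.
have osc A : A \in S -> osculates G p (T A) (N A).
  by move=> AS; exact: (circle_osculates (uv A) (r0 A) (ps AS) (G0 AS)).
have TE A : A \in S -> forall i, T A i = dt (T A) e * e i + dt (T A) f * f i.
  move=> AS i; rewrite {1}(parseval ef (T A) i); have [[t1 _ _ _] _] := osc A AS.
  have : dt (cr e f) (T A) = 0 by apply: (mulfI l1); rewrite mulr0 -(f1_frame grad).
  by rewrite dtC => ->; rewrite mul0r addr0.
pose x A := dt (T A) e; pose y A := dt (T A) f.
have T1 A : A \in S -> x A != 0 -> forall i, T A i = x A * (e i + (y A / x A) * f i).
  by move=> AS xA i; rewrite {1}(TE A AS) -/(x A) -/(y A); field.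
have T2 A : A \in S -> x A = 0 -> y A != 0 /\ forall i, T A i = y A * (f i + 0 * (fun i => - e i) i).
  move=> AS xA; have h i : T A i = y A * f i by rewrite (TE A AS) -/(x A) -/(y A) xA mul0r add0r.
  split; last by move=> i; rewrite h; ring.
  have [_ [_ _ TT]] := osc A AS; apply: contraTneq TT => yA.
  by rewrite /dt !h yA !mul0r !addr0 ltxx.
pose S1 := [set A in S | x A == 0]; pose S2 := [set A in S | x A != 0].
have -> : S = S1 :|: S2 by apply/setP => A; rewrite !inE -andb_orr orbN andbT.
apply: leq_trans (leq_card_setU _ _) _; rewrite -[11%N]/(1 + 10)%N; apply: leq_add.
  apply/card_le1_eqP => A B; rewrite !inE => /andP[AS /eqP xA] /andP[BS /eqP xB].
  have [yA hA] := T2 A AS xA; have [yB hB] := T2 B BS xB.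
  have Q0 : jet2 G p (fun i => (fun i => - e i) i + - 0 * f i) (fun i => f i + 0 * (fun i => - e i) i) != 0.
    have := trans AS; rewrite (transversal_slope (uv A) ef' grad' hA).
    by apply: contraNneq => ->; rewrite mulr0.
  have [eN eT] := osculates_unique l0 ef' grad' yA yB hA hB (osc A AS) (osc B BS) Q0.
  exact: esym (same_jet_same_circle AS BS eN eT).
have Q0 A : A \in S2 -> jet2 G p (fun i => f i + - (y A / x A) * e i) (fun i => e i + (y A / x A) * f i) != 0.
  rewrite inE => /andP[AS xA]; have := trans AS.
  rewrite (transversal_slope (uv A) ef grad (T1 A AS xA)).
  by apply: contraNneq => ->; rewrite mulr0.
have [e0|[A0 A0S]] := set_0Vmem S2; first by rewrite e0 cards0.
have [Phi [P0 sP PR]] := slope_poly ef grad (Q0 A0 A0S).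
rewrite -ltnS; apply: leq_trans sP; rewrite cardE -(size_map (fun A => y A / x A)).
apply: max_poly_roots => //.
  apply/allP => z /mapP[A]; rewrite mem_enum => AS2 ->; have := AS2; rewrite inE => /andP[AS xA].
  exact: (PR _ (x A) (T A) (N A) xA (T1 A AS xA) (osc A AS) (Q0 A AS2)).
rewrite map_inj_in_uniq ?enum_uniq // => A B; rewrite !mem_enum => AS2 BS2 eAB.
have := AS2; rewrite inE => /andP[AS xA]; have := BS2; rewrite inE => /andP[BS xB].
have hB : forall i, T B i = x B * (e i + y A / x A * f i) by move=> i; rewrite eAB; exact: T1.
have [eN eT] := osculates_unique l0 ef grad xA xB (T1 A AS xA) hB (osc A AS) (osc B BS) (Q0 A AS2).
exact: (same_jet_same_circle AS BS eN eT).
Qed.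
End OsculatingCircles.

Lemma msize_mderiv_le (R : realType) n (F : {mpoly R[n]}) i : (msize F^`M(i) <= msize F)%N.
Proof. by have [->|/msize_mderiv_lt/ltnW] := eqVneq F^`M(i) 0; rewrite ?msize0. Qed.

(** * Circles that are lines of curvature *)

Section Tangency.
Variables (R : realType) (o u v : 'I_3 -> R) (r : R) (G : {mpoly R[3]}).
Notation V := ('I_3 -> R).
Hypotheses (uv : onpair u v) (r0 : 0 < r).
Local Notation gam := (curve (circ_den R) (sc_poly o u v r)).
Hypothesis G0 : forall s, G.@[gam s] = 0.
Let nu := cr u v.
Let T x : V := fun i => (rotv o u v i).@[x].
Let N (x : V) : V := fun i => x i - o i.

Lemma sc_curveE s : gam s = sc_pt o u v r s.
Proof. by apply: boolp.funext; exact: sc_curve. Qed.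

(* Vanishes where the tangent of the circle is a principal direction of the zero set of [G]. *)
Definition tang (x : V) := jet1 G x (N x) * jet2 G x nu (T x) - jet1 G x nu * jet2 G x (N x) (T x).

Let sw : (size (circ_den R) <= 3)%N := size_quad _ _ _.
Let good_lin w : good (circ_den R) 2 1 (fun s => (lin o w).@[gam s]).
Proof.
apply: (good_mpoly (@circ_den_gt0 R) sw (size_sc_poly o u v r)).
rewrite /lin; apply: leq_trans (msize_sum _ _ _) _; apply/bigmax_leqP => i _.
rewrite mul_mpolyC; apply: leq_trans (msizeZ_le _ _) _.
by apply: leq_trans (msizeD_le _ _) _; rewrite geq_max msizeX mdeg1 /= -mpolyCN msizeC (leq_trans (leq_b1 _)).
Qed.
Let good_T i : good (circ_den R) 2 1 (fun s => T (gam s) i).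
Proof.
have h := good_add (good_mul (good_const sw 0 (v i)) (good_lin u)) (good_mul (good_const sw 0 (- u i)) (good_lin v)).
by apply: good_ext h => s; rewrite /T /rotv mevalB !mevalM !mevalC mulNr.
Qed.
Let good_N i : good (circ_den R) 2 1 (fun s => N (gam s) i).
Proof.
have h := good_add (good_mul (good_const sw 0 (u i)) (good_lin u)) (good_mul (good_const sw 0 (v i)) (good_lin v)).
apply: good_ext h => s; rewrite sc_curveE /N -(rad_on o r s uv) /radv mevalD !mevalM !mevalC //.
Qed.

Lemma good_tang d : (msize G <= d.+1)%N -> good (circ_den R) 2 (d.*2 + 2) (fun s => tang (gam s)).
Proof.
move=> Gd; pose gd D := good_mpoly (@circ_den_gt0 R) sw (size_sc_poly o u v r) (D := D).
have d1 i : good (circ_den R) 2 d (fun s => (G^`M(i)).@[gam s]).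
  by apply: gd; apply: leq_trans (msize_mderiv_le _ _) Gd.
have d2 i j : good (circ_den R) 2 d (fun s => (G^`M(i)^`M(j)).@[gam s]).
  by apply: gd; apply: leq_trans (msize_mderiv_le _ _) (leq_trans (msize_mderiv_le _ _) Gd).
have a1 : good (circ_den R) 2 (d + 1) (fun s => jet1 G (gam s) (N (gam s))).
  by apply: (good_sum sw) => i; exact: (good_mul (d1 i) (good_N i)).
have b1 : good (circ_den R) 2 (d + 0) (fun s => jet1 G (gam s) nu).
  by apply: (good_sum sw) => i; exact: (good_mul (d1 i) (good_const sw 0 (nu i))).
have a2 : good (circ_den R) 2 (d + (1 + 1)) (fun s => jet2 G (gam s) (N (gam s)) (T (gam s))).
  apply: (good_sum sw) => i; apply: (good_sum sw) => j.
  exact: (good_mul (d2 i j) (good_mul (good_N i) (good_T j))).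
have b2 : good (circ_den R) 2 (d + (0 + 1)) (fun s => jet2 G (gam s) nu (T (gam s))).
  apply: (good_sum sw) => i; apply: (good_sum sw) => j.
  exact: (good_mul (d2 i j) (good_mul (good_const sw 0 (nu i)) (good_T j))).
have e1 := good_mul a1 b2; have e2 := good_mul (good_const sw 0 (- 1)) (good_mul b1 a2).
have E1 : (d + 1 + (d + (0 + 1)) = d.*2 + 2)%N by rewrite -addnn; lia.
have E2 : (0 + (d + 0 + (d + (1 + 1))) = d.*2 + 2)%N by rewrite -addnn; lia.
rewrite E1 in e1; rewrite E2 in e2.
by apply: good_ext (good_add e1 e2) => s; rewrite /tang mulN1r.
Qed.

(** Let a and b be the components of grad G along N and nu. Their derivatives along the circle are
    the second differential at (N, T) and (nu, T), since grad G is orthogonal to T; so tang = 0 is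
    the vanishing of their Wronskian. This is Joachimsthal's theorem. *)
Lemma tang0_ratio : (forall s, tang (gam s) = 0) -> exists ab : R * R, ab != 0 /\
  forall s, ab.1 * jet1 G (gam s) (N (gam s)) + ab.2 * jet1 G (gam s) nu = 0.
Proof.
move=> t0; have tau0 t : 2 / (1 + t ^+ 2) != 0 :> R by rewrite mulf_neq0 ?pnatr_eq0 // invr_eq0 den_neq0.
have vel t i := sc_velocity o r t i uv.
have lG0 := lie_vanish (@circ_den_gt0 R) tau0 vel G0.
have NE s i : (radv o u v i).@[gam s] = N (gam s) i by rewrite sc_curveE rad_on.
pose a := C1 G (radv o u v); pose b := C1 G (fun i => (nu i)%:MP).
have aE s : a.@[gam s] = jet1 G (gam s) (N (gam s)).
  by rewrite /a meval_C1; apply: eq_f1 => i; rewrite NE.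
have bE s : b.@[gam s] = jet1 G (gam s) nu.
  by rewrite /b meval_C1; apply: eq_f1 => i; rewrite mevalC.
have la s : (lie (rotv o u v) a).@[gam s] = jet2 G (gam s) (N (gam s)) (T (gam s)).
  rewrite /a lie_C1 mevalD (eq_C1 _ (lie_rad o uv)) -[C1 G _]/(lie (rotv o u v) G) lG0 addr0 meval_C2.
  by apply: eq_f2 => i; rewrite ?NE.
have lb s : (lie (rotv o u v) b).@[gam s] = jet2 G (gam s) nu (T (gam s)).
  rewrite /b lie_C1 mevalD meval_C1 meval_C2.
  rewrite [X in _ + X](_ : _ = 0) ?addr0; last by rewrite /jet1 big1 // => i _; rewrite lieC meval0 mulr0.
  by apply: eq_f2 => i //; rewrite mevalC.
have [D1 [p hp]] := lie_flow (@circ_den_gt0 R) vel a.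
have [D2 [q hq]] := lie_flow (@circ_den_gt0 R) vel b.
have [p' [pf pg]] := isder_weaken D2 hp; have [q' [qf qg]] := isder_weaken D1 hq.
rewrite addnC in qf qg; set D := (D1 + D2)%N in pf pg qf qg.
have wr : p'^`() * q' = p' * q'^`().
  apply/eqP; rewrite -subr_eq0; apply/eqP; apply: poly_all0 => s.
  rewrite hornerD hornerN !hornerM.
  have w0 := circ_den_gt0 s; apply: (mulfI (lt0r_neq0 w0)); rewrite mulr0.
  transitivity (((circ_den R).[s] * p'^`().[s] - D%:R * (circ_den R)^`().[s] * p'.[s]) * q'.[s] -
    p'.[s] * ((circ_den R).[s] * q'^`().[s] - D%:R * (circ_den R)^`().[s] * q'.[s])); first by ring.
  rewrite pg qg pf qf la lb aE bE.
  transitivity (- ((circ_den R).[s] ^+ D.+1 * (circ_den R).[s] ^+ D * (2 / (1 + s ^+ 2)) * tang (gam s))).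
    by rewrite /tang; ring.
  by rewrite t0 mulr0 oppr0.
have [ab [ab0 h]] := wronskian0 wr; exists ab; split=> // s.
have w0 : (circ_den R).[s] ^+ D != 0 by rewrite expf_neq0 // lt0r_neq0 // circ_den_gt0.
apply: (mulfI w0); rewrite mulr0 -aE -bE mulrDr !(mulrCA _ ab.1, mulrCA _ ab.2) -pf -qf.
by have := congr1 (fun P => P.[s]) h; rewrite horner0 hornerD !hornerZ.
Qed.

(* The sphere (a plane if [ab.2 = 0]) through the circle whose normals satisfy [ab.1 * <n, N> + ab.2 * <n, nu> = 0] along it. *)
Definition quadric (ab : R * R) (x : V) := ab.2 * (dt (N x) (N x) - r ^+ 2) - 2 * ab.1 * r ^+ 2 * dt nu (N x).

Lemma circle_frame s (p := sc_pt o u v r s) : dt (N p) (N p) = r ^+ 2 /\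
  forall x i, x i = dt x (N p) / r ^+ 2 * N p i + dt x (T p) / r ^+ 2 * T p i + dt x nu * nu i.
Proof.
have r1 : r != 0 by rewrite lt0r_neq0.
have nrm := radius_norm uv (erefl p).
pose a := dt u (N p); pose b := dt v (N p).
have hT i : T p i = v i * a - u i * b := rotv_at p o u v i.
have hN i : N p i = u i * a + v i * b := radius_at uv (erefl p) i.
rewrite -/(N p) -/a -/b in nrm.
have [uu vv uv0] := uv.
have NN : dt (N p) (N p) = r ^+ 2.
  rewrite -nrm (eq_dt hN hN).
  transitivity (dt v v * b ^+ 2 + dt u u * a ^+ 2 + 2 * a * b * dt u v); last by rewrite uu vv uv0; ring.
  by rewrite /dt; ring.
split=> // x i.
have TT : dt (T p) (T p) = r ^+ 2.
  rewrite -nrm (eq_dt hT hT).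
  transitivity (dt v v * a ^+ 2 + dt u u * b ^+ 2 - 2 * a * b * dt u v); last by rewrite uu vv uv0; ring.
  by rewrite /dt; ring.
have NT : dt (N p) (T p) = 0.
  rewrite (eq_dt hN hT); transitivity (a * b * (dt v v - dt u u) + (a ^+ 2 - b ^+ 2) * dt u v); last by rewrite uu vv uv0; ring.
  by rewrite /dt; ring.
have ef : onpair (fun i => N p i / r) (fun i => T p i / r).
  split.
  - by transitivity (dt (N p) (N p) / r ^+ 2); [rewrite /dt; field|rewrite NN divff // expf_neq0].
  - by transitivity (dt (T p) (T p) / r ^+ 2); [rewrite /dt; field|rewrite TT divff // expf_neq0].
  - by transitivity (dt (N p) (T p) / r ^+ 2); [rewrite /dt; field|rewrite NT mul0r].
have nuE k : cr (fun i => N p i / r) (fun i => T p i / r) k = nu k.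
  transitivity ((a ^+ 2 + b ^+ 2) / r ^+ 2 * nu k); last by rewrite nrm divff ?mul1r // expf_neq0.
  by rewrite /nu; case: (ord3 k) => ->; rewrite !(cr0, cr1, cr2) !hT !hN; field.
rewrite [LHS](parseval ef x i) nuE (eq_dt (frefl x) nuE) /dt; by field.
Qed.

(** The quadric is tangent to {G = 0} at p, T is a principal direction, and lk.2 is its principal
    curvature up to normalization. So the gradient of G at p and this curvature determine the
    quadric. *)
Lemma quadric_at ab s (p := sc_pt o u v r s) : (exists i, (G^`M(i)).@[p] != 0) -> ab != 0 -> tang p = 0 ->
  ab.1 * jet1 G p (N p) + ab.2 * jet1 G p nu = 0 ->
  exists lk : R * R, [/\ lk.1 != 0,
    forall x, lk.1 * quadric ab x = lk.2 * dt (fun i => x i - p i) (fun i => x i - p i) + 2 * jet1 G p (fun i => x i - p i) &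
    forall y, jet1 G p y = 0 -> jet2 G p (T p) y = lk.2 * dt (T p) y].
Proof.
move=> Gp ab0 tp hab; have [NN px] := circle_frame s; rewrite -/p in NN px.
have r1 : r != 0 by rewrite lt0r_neq0.
have [[t1 t2 _ _] _] := circle_osculates uv r0 (erefl p) G0; rewrite -/(T p) -/(N p) in t1 t2.
have f1E y : jet1 G p y = jet1 G p (N p) * dt (N p) y / r ^+ 2 + jet1 G p nu * dt nu y.
  rewrite [LHS](eq_f1 G p (px y)) (f1D G p _ nu) f1D !f1Z t1 (dtC y) (dtC y nu); by field.
have [mu [m1 m2]] : exists mu, jet1 G p (N p) = mu * ab.2 /\ jet1 G p nu = - mu * ab.1.
  have [b0|b0] := eqVneq ab.2 0.
    have a0 : ab.1 != 0 by apply: contraNneq ab0 => a0; case: ab a0 b0 {hab} => a b /= -> ->.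
    exists (- jet1 G p nu / ab.1); split; last by field.
    by apply: (mulfI a0); move: hab; rewrite b0 mul0r !mulr0 addr0.
  exists (jet1 G p (N p) / ab.2); split; first by field.
  apply: (mulfI b0); transitivity (- (ab.1 * jet1 G p (N p))); last by field.
  by apply/eqP; rewrite -addr_eq0 addrC hab.
have mu0 : mu != 0.
  apply: contraPneq Gp => mu0 [i]; apply/negP; rewrite negbK.
  have := f1E (fun j => (i == j)%:R); rewrite m1 m2 mu0 oppr0 !mul0r addr0 => <-.
  by rewrite /jet1 (bigD1 i) //= eqxx mulr1 big1 ?addr0 // => j /negbTE ji; rewrite eq_sym ji mulr0.
exists (mu / r ^+ 2, mu / r ^+ 2 * ab.2); split=> /=; first by rewrite mulf_neq0 // invr_eq0 expf_neq0.
  move=> x; rewrite f1E m1 m2 /quadric.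
  have -> : dt (N x) (N x) - r ^+ 2 = dt (fun i => x i - p i) (fun i => x i - p i) + 2 * dt (N p) (fun i => x i - p i).
    by rewrite -NN /N /dt; ring.
  have -> : dt nu (N x) = dt nu (fun i => x i - p i).
    have : dt nu (N p) = 0.
      have hN := radius_at uv (erefl p); rewrite -/(N p) in hN.
      by rewrite (eq_dt (frefl nu) hN) /nu /dt !(cr0, cr1, cr2); ring.
    by rewrite /N /dt => h; apply/eqP; rewrite -subr_eq0 -h; apply/eqP; ring.
  by field.
move=> y y0; have nuT : ab.2 * jet2 G p nu (T p) + ab.1 * jet2 G p (N p) (T p) = 0.
  by apply: (mulfI mu0); rewrite mulr0 -tp /tang m1 m2; ring.
have hy : ab.2 * (dt y (N p) / r ^+ 2) = ab.1 * dt y nu.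
  apply: (mulfI mu0); move: y0; rewrite f1E m1 m2 (dtC y) (dtC y nu) => h.
  by apply/eqP; rewrite -subr_eq0 -h; apply/eqP; field.
rewrite f2C (eq_f2 G p (px y) (frefl _)) f2D.
have f2l a X Y : jet2 G p (fun i => a * X i) Y = a * jet2 G p X Y.
  by rewrite (eq_f2 G p (frefl _) (fun i => esym (mul1r (Y i)))) f2Z mulr1.
rewrite (f2D G p (fun i => _ * N p i)) f2l t2 m1.
set P := dt y (N p) / r ^+ 2 in hy *; set Q := dt y nu in hy *.
suff h : P * jet2 G p (N p) (T p) + Q * jet2 G p nu (T p) = 0.
  by rewrite addrAC h add0r (dtC y); ring.
have [b0|b0] := eqVneq ab.2 0.
  have a0 : ab.1 != 0 by apply: contraNneq ab0 => a0; case: ab a0 b0 {hab m1 m2 nuT hy} => a b /= -> ->.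
  have -> : Q = 0 by apply: (mulfI a0); rewrite -hy b0 mul0r mulr0.
  have -> : jet2 G p (N p) (T p) = 0 by apply: (mulfI a0); move: nuT; rewrite b0 mul0r add0r mulr0.
  by rewrite mulr0 mul0r addr0.
apply: (mulfI b0); rewrite mulr0 mulrDr mulrA hy.
by transitivity (Q * (ab.2 * jet2 G p nu (T p) + ab.1 * jet2 G p (N p) (T p))); [ring|rewrite nuT mulr0].
Qed.
End Tangency.

Section PrincipalDirections.
Variables (R : realType) (G : {mpoly R[3]}) (p : 'I_3 -> R).
Notation V := ('I_3 -> R).
Hypothesis Gp : exists i, (G^`M(i)).@[p] != 0.

(* Directions with distinct principal curvatures are orthogonal, and the tangent plane is only two-dimensional. *)
Lemma card_curvatures (I U : finType) (S : {set I}) (T : I -> V) (kap : I -> R) (lab : I -> U) :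
  (forall A, A \in S -> jet1 G p (T A) = 0) -> (forall A, A \in S -> 0 < dt (T A) (T A)) ->
  (forall A y, A \in S -> jet1 G p y = 0 -> jet2 G p (T A) y = kap A * dt (T A) y) ->
  {in S &, forall A B, kap A = kap B -> lab A = lab B} -> (#|lab @: S| <= 2)%N.
Proof.
move=> T1 Tn T2 kl; rewrite leqNgt; apply/negP => /card_gt2P[x [y [z [[xS yS zS] [xy yz zx]]]]].
have [A AS xE] := imsetP xS; have [B BS yE] := imsetP yS; have [C CS zE] := imsetP zS.
have orth X Y : X \in S -> Y \in S -> lab X != lab Y -> dt (T X) (T Y) = 0.
  move=> XS YS lXY; have kXY : kap X - kap Y != 0.
    by rewrite subr_eq0; apply: contraNneq lXY => k; rewrite (kl X Y XS YS k).
  apply: (mulfI kXY); rewrite mulr0 mulrBl -(T2 X _ XS (T1 Y YS)) [in X in _ - X]dtC -(T2 Y _ YS (T1 X XS)).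
  by rewrite f2C subrr.
have AB : dt (T A) (T B) = 0 by apply: orth; rewrite // -xE -yE.
have BC : dt (T B) (T C) = 0 by apply: orth; rewrite // -zE -yE.
have CA : dt (T C) (T A) = 0 by apply: orth; rewrite // -xE -zE.
pose n : V := fun i => (G^`M(i)).@[p].
have f1n X : jet1 G p X = dt X n by rewrite /jet1 sum3 /n /dt; ring.
pose W := cr (T A) (T B).
have WW : dt W W = dt (T A) (T A) * dt (T B) (T B).
  transitivity (dt (T A) (T A) * dt (T B) (T B) - dt (T A) (T B) ^+ 2); last by rewrite AB; ring.
  by rewrite /W /dt !(cr0, cr1, cr2); ring.
have W0 : dt W W != 0 by rewrite WW mulf_neq0 // gt_eqF // Tn.
have par X i : dt X (T A) = 0 -> dt X (T B) = 0 -> dt W W * X i = dt X W * W i.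
  move=> XA XB; have e k : cr W X k = 0.
    transitivity (T B k * dt X (T A) - T A k * dt X (T B)); last by rewrite XA XB; ring.
    by case: (ord3 k) => ->; rewrite !(cr0 W, cr1 W, cr2 W) /W !(cr0, cr1, cr2) /dt; ring.
  apply/eqP; rewrite -subr_eq0; apply/eqP.
  transitivity (cr (cr W X) W i); last by case: (ord3 i) => ->; rewrite !(cr0 (cr W X), cr1 (cr W X), cr2 (cr W X)) !e; ring.
  by case: (ord3 i) => ->; rewrite !(cr0 (cr W X), cr1 (cr W X), cr2 (cr W X)) !(cr0 W, cr1 W, cr2 W) /dt; ring.
have nW : dt n W * dt (T C) W = 0.
  apply: (mulfI W0); rewrite mulr0.
  transitivity (dt (fun i => dt W W * n i) (fun i => dt W W * T C i) / dt W W * dt W W / dt W W * dt W W).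
    have nA : dt n (T A) = 0 by rewrite dtC -f1n T1.
    have nB : dt n (T B) = 0 by rewrite dtC -f1n T1.
    have CB : dt (T C) (T B) = 0 by rewrite dtC.
    rewrite (eq_dt (fun i => par n i nA nB) (fun i => par (T C) i CA CB)).
    rewrite !(divfK W0); move: W0; rewrite /dt; set a := W j0; set b := W j1; set c := W j2 => W0; ring.
  rewrite !(divfK W0); transitivity (dt W W ^+ 2 * dt (T C) n); first by rewrite /dt; ring.
  by rewrite -f1n T1 // mulr0.
have nz X : dt X (T A) = 0 -> dt X (T B) = 0 -> dt X W = 0 -> forall i, X i = 0.
  by move=> XA XB XW i; apply: (mulfI W0); rewrite par // XW mul0r mulr0.
move/eqP: nW; rewrite mulf_eq0 => /orP[/eqP h|/eqP h].
  by have [i] := Gp; rewrite -/(n i) (nz n) ?eqxx // dtC -f1n T1.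
have CB : dt (T C) (T B) = 0 by rewrite dtC.
by have := Tn C CS; rewrite /dt !(nz (T C) CA CB h) mulr0 !addr0 ltxx.
Qed.
End PrincipalDirections.

(** * Circles in space as point sets *)

Section CircleGeometry.
Variables (R : realType) (n : nat) (o u v : 'I_n -> 'I_3 -> R) (r : 'I_n -> R).
Notation V := ('I_3 -> R).
Hypothesis uv : forall A, onpair (u A) (v A).
Hypothesis r0 : forall A, 0 < r A.
Let nu A := cr (u A) (v A).

Definition oncircle A (x : V) := (dt (fun i => x i - o A i) (fun i => x i - o A i) == r A ^+ 2) &&
  (dt (nu A) (fun i => x i - o A i) == 0).

(** The one point of the circle that the rational parametrization misses. *)
Definition antipole A (x : V) := dt (u A) (fun i => x i - o A i) == - r A.
Definition cpar A (x : V) := dt (v A) (fun i => x i - o A i) / (r A + dt (u A) (fun i => x i - o A i)).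

Lemma oncircle_frame A x (N := fun i => x i - o A i) : oncircle A x ->
  dt (u A) N ^+ 2 + dt (v A) N ^+ 2 = r A ^+ 2 /\ forall i, N i = dt (u A) N * u A i + dt (v A) N * v A i.
Proof.
move=> /andP[/eqP h1 /eqP h2]; have [uu vv uv0] := uv A.
have NE i : N i = dt (u A) N * u A i + dt (v A) N * v A i.
  by rewrite {1}(parseval (uv A) N i) (dtC N (cr _ _)) h2 mul0r addr0 (dtC N (u A)) (dtC N (v A)).
split=> //; rewrite -h1 -/N (eq_dt NE NE); set a := dt _ _; set b := dt (v A) N.
transitivity (a ^+ 2 * dt (u A) (u A) + b ^+ 2 * dt (v A) (v A) + 2 * a * b * dt (u A) (v A)); last by rewrite /dt; ring.
by rewrite uu vv uv0; ring.
Qed.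

Lemma cparP A x : oncircle A x -> ~~ antipole A x -> sc_pt (o A) (u A) (v A) (r A) (cpar A x) = x.
Proof.
move=> xA nx; have [ab NE] := oncircle_frame xA; apply: boolp.funext => i.
move: nx; rewrite /antipole -addr_eq0 addrC => nx.
set al := dt (u A) _ in ab NE nx *; set be := dt (v A) _ in ab NE *.
have sE : cpar A x = be / (r A + al) by [].
have d := den_neq0 (cpar A x).
have r1 : r A != 0 by rewrite gt_eqF.
have e1 : (1 + cpar A x ^+ 2) * (r A + al) = 2 * r A.
  apply: (mulIf nx); rewrite sE; transitivity ((r A + al) ^+ 2 + be ^+ 2); first by field.
  have -> : be ^+ 2 = r A ^+ 2 - al ^+ 2; first by rewrite -ab; ring.
  by ring.
have e2 : cpar A x * (r A + al) = be by rewrite sE divfK.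
have k1 : (r A * (1 - cpar A x ^+ 2)) / (1 + cpar A x ^+ 2) = al.
  apply: (mulIf d); rewrite divfK //; apply: (mulIf nx).
  rewrite -[RHS]mulrA e1; transitivity (r A * (2 * (r A + al) - (1 + cpar A x ^+ 2) * (r A + al))); first by ring.
  by rewrite e1; ring.
have k2 : (r A * (2 * cpar A x)) / (1 + cpar A x ^+ 2) = be.
  apply: (mulIf d); rewrite divfK //; apply: (mulIf nx).
  by rewrite -[RHS]mulrA e1 -e2; ring.
transitivity (o A i + ((r A * (1 - cpar A x ^+ 2)) / (1 + cpar A x ^+ 2) * u A i +
   (r A * (2 * cpar A x)) / (1 + cpar A x ^+ 2) * v A i)); first by rewrite /sc_pt; field.
by rewrite k1 k2 -NE addrC subrK.
Qed.

Lemma antipoleE A x : oncircle A x -> antipole A x -> x = (fun i => o A i - r A * u A i).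
Proof.
move=> xA /eqP nx; have [ab NE] := oncircle_frame xA; apply: boolp.funext => i.
have b0 : dt (v A) (fun i => x i - o A i) = 0.
  apply/eqP; rewrite -sqrf_eq0; apply/eqP; move: ab; rewrite nx; set b := dt _ _; move=> ab; lra.
by have := NE i; rewrite nx b0 mul0r addr0 => h; apply: (addrI (- o A i)); rewrite addrC h; ring.
Qed.

Hypothesis inj : forall A B, o A =1 o B -> r A = r B -> (nu A =1 nu B \/ forall i, nu A i = - nu B i) -> A = B.

(** Three points of a circle are not collinear, so W <> 0: it gives the normal up to sign, and the
    two bisector equations together with the plane give the centre. *)
Lemma three_points A B x y z : x <> y -> x <> z -> y <> z -> oncircle A x -> oncircle A y -> oncircle A z ->
  oncircle B x -> oncircle B y -> oncircle B z -> A = B.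
Proof.
move=> xy xz yz Ax Ay Az Bx By Bz.
pose d1 : V := fun i => y i - x i; pose d2 : V := fun i => z i - x i; pose W := cr d1 d2.
have basic C : oncircle C x -> oncircle C y -> oncircle C z ->
  [/\ dt (nu C) d1 = 0, dt (nu C) d2 = 0, 2 * dt (fun i => x i - o C i) d1 = - dt d1 d1 &
      2 * dt (fun i => x i - o C i) d2 = - dt d2 d2].
  move=> /andP[/eqP x1 /eqP x2] /andP[/eqP y1 /eqP y2] /andP[/eqP z1 /eqP z2]; split.
  - by apply/eqP; rewrite -(subrr 0) -{1}y2 -x2 -subr_eq0 /d1 /dt; apply/eqP; ring.
  - by apply/eqP; rewrite -(subrr 0) -{1}z2 -x2 -subr_eq0 /d2 /dt; apply/eqP; ring.
  - by apply/eqP; rewrite -subr_eq0 -(subrr (r C ^+ 2)) -{1}y1 -x1 -subr_eq0 /d1 /dt; apply/eqP; ring.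
  - by apply/eqP; rewrite -subr_eq0 -(subrr (r C ^+ 2)) -{1}z1 -x1 -subr_eq0 /d2 /dt; apply/eqP; ring.
have neq0 (f : V) g : f <> g -> exists i, g i - f i != 0.
  move=> fg; apply: boolp.contrapT => h; apply: fg; apply: boolp.funext => i.
  by apply: boolp.contrapT => /eqP hi; apply: h; exists i; rewrite subr_eq0 eq_sym.
have [a1 a2 a3 a4] := basic A Ax Ay Az; have [b1 b2 b3 b4] := basic B Bx By Bz.
have d10 : 0 < dt d1 d1 by apply: dt_gt0; exact: neq0.
have W0 : dt W W != 0.
  rewrite gt_eqF //; apply: dt_gt0; apply: boolp.contrapT => hW.
  have {}hW i : W i = 0 by apply/eqP; apply: boolp.contrapT => /negP hi; apply: hW; exists i.
  pose t := dt d1 d2 / dt d1 d1; have d1n : dt d1 d1 != 0 by rewrite gt_eqF.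
  have d2E i : d2 i = t * d1 i.
    apply: (mulfI d1n); rewrite mulrA [_ * t]mulrC /t divfK //.
    have h : cr W d1 i = dt d1 d1 * d2 i - dt d1 d2 * d1 i.
      by case: (ord3 i) => ->; rewrite !(cr0 W, cr1 W, cr2 W) /W !(cr0, cr1, cr2) /dt; ring.
    apply/eqP; rewrite -subr_eq0 -h; apply/eqP.
    by case: (ord3 i) => ->; rewrite !(cr0 W, cr1 W, cr2 W) !hW; ring.
  have t01 : t * (t - 1) = 0.
    apply: (mulfI d1n); rewrite mulr0.
    have e1 : dt (fun i => x i - o A i) d2 = t * dt (fun i => x i - o A i) d1 by rewrite (eq_dt (frefl _) d2E) /dt; ring.
    have e2 : dt d2 d2 = t ^+ 2 * dt d1 d1 by rewrite (eq_dt d2E d2E) /dt; ring.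
    move: a4; rewrite e1 e2 mulrCA a3 => h.
    transitivity (t * - dt d1 d1 - - (t ^+ 2 * dt d1 d1)); first by ring.
    by rewrite h subrr.
  move/eqP: t01; rewrite mulf_eq0 => /orP[/eqP t0|]; last rewrite subr_eq0 => /eqP t1.
    by apply: xz; apply: boolp.funext => i; have := d2E i; rewrite t0 mul0r => /eqP; rewrite subr_eq0 => /eqP.
  by apply: yz; apply: boolp.funext => i; have := d2E i; rewrite t1 mul1r => /addIr.
have par X i : dt X d1 = 0 -> dt X d2 = 0 -> X i = dt X W / dt W W * W i.
  move=> X1 X2; have e k : cr W X k = 0.
    transitivity (d2 k * dt X d1 - d1 k * dt X d2); last by rewrite X1 X2; ring.
    by case: (ord3 k) => ->; rewrite !(cr0 W, cr1 W, cr2 W) /W !(cr0, cr1, cr2) /dt; ring.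
  apply: (mulfI W0); rewrite mulrA [_ * (_ / _)]mulrC divfK //.
  apply/eqP; rewrite -subr_eq0; apply/eqP.
  transitivity (cr (cr W X) W i); last by case: (ord3 i) => ->; rewrite !(cr0 (cr W X), cr1 (cr W X), cr2 (cr W X)) !e; ring.
  by case: (ord3 i) => ->; rewrite !(cr0 (cr W X), cr1 (cr W X), cr2 (cr W X)) !(cr0 W, cr1 W, cr2 W) /dt; ring.
have nrm C : dt (nu C) (nu C) = 1 by have [] := frame_dt (uv C).
pose k C := dt (nu C) W / dt W W.
have nuA i : nu A i = k A * W i by exact: par.
have nuB i : nu B i = k B * W i by exact: par.
have kk : k A ^+ 2 = k B ^+ 2.
  have e C : (forall i, nu C i = k C * W i) -> k C ^+ 2 * dt W W = 1.
    by move=> h; rewrite -(nrm C) (eq_dt h h) /dt; ring.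
  by apply: (mulIf W0); rewrite !e.
have oo : o A =1 o B.
  pose D : V := fun i => o A i - o B i.
  have D1 : dt D d1 = 0.
    have -> : dt D d1 = dt (fun i => x i - o B i) d1 - dt (fun i => x i - o A i) d1 by rewrite /D /dt; ring.
    by move: a3 b3; set p := dt _ d1; set q := dt _ d1; lra.
  have D2 : dt D d2 = 0.
    have -> : dt D d2 = dt (fun i => x i - o B i) d2 - dt (fun i => x i - o A i) d2 by rewrite /D /dt; ring.
    by move: a4 b4; set p := dt _ d2; set q := dt _ d2; lra.
  have xW C : oncircle C x -> (forall i, nu C i = k C * W i) -> dt (fun i => x i - o C i) W = 0.
    move=> /andP[_ /eqP h] hn; have k0 : k C != 0.
      apply/eqP => k0; have := nrm C; rewrite (eq_dt hn hn) k0 /dt !mul0r !addr0 => /esym/eqP.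
      by rewrite oner_eq0.
    by apply: (mulfI k0); rewrite mulr0 -h (eq_dt hn (frefl _)) /dt; ring.
  have DW : dt D W = 0.
    transitivity (dt (fun i => x i - o B i) W - dt (fun i => x i - o A i) W); first by rewrite /D /dt; ring.
    by rewrite !xW ?subrr.
  by move=> i; apply/eqP; rewrite -subr_eq0; apply/eqP; rewrite -/(D i) (par D) // DW mul0r mul0r.
apply: inj => //.
  apply/eqP; rewrite -(eqrXn2 (isT : (0 < 2)%N)) ?ltW //; apply/eqP.
  move: Ax Bx => /andP[/eqP <- _] /andP[/eqP <- _]; apply: eq_dt => i; by rewrite oo.
have /orP[/eqP e|/eqP e] : (k A == k B) || (k A == - k B) by rewrite -eqf_sqr kk.
  by left=> i; rewrite nuA nuB e.
by right=> i; rewrite nuA nuB e mulNr.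
Qed.
End CircleGeometry.

(** * Counting incidences in space *)

Section SpaceCount.
Variables (R : realType) (m n : nat) (X : 'I_m -> 'I_3 -> R) (o u v : 'I_n -> 'I_3 -> R) (r : 'I_n -> R).
Notation V := ('I_3 -> R).
Hypothesis Xinj : injective X.
Hypothesis uv : forall A, onpair (u A) (v A).
Hypothesis r0 : forall A, 0 < r A.
Hypothesis inj : forall A B, o A =1 o B -> r A = r B ->
  (cr (u A) (v A) =1 cr (u B) (v B) \/ forall i, cr (u A) (v A) i = - cr (u B) (v B) i) -> A = B.
Let gam A := curve (circ_den R) (sc_poly (o A) (u A) (v A) (r A)).
Let par A p := cpar o u v r A (X p).
Let onA A p := oncircle o u v r A (X p).
Definition oncp A := [set p | onA A p && ~~ antipole o u r A (X p)].
Let sw : (size (circ_den R) <= 3)%N := size_quad _ _ _.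

Lemma oncpE A p : p \in oncp A -> sc_pt (o A) (u A) (v A) (r A) (par A p) = X p.
Proof. by rewrite inE => /andP[]; exact: cparP. Qed.

Lemma oncp_gam A p : p \in oncp A -> gam A (par A p) = X p.
Proof. by move=> pA; rewrite /gam sc_curveE oncpE. Qed.

Lemma oncp_inj A : {in oncp A &, injective (par A)}.
Proof. by move=> p q pA qA e; apply: Xinj; rewrite -(oncp_gam pA) -(oncp_gam qA) e. Qed.

Lemma card_antipole A : (#|[set p | onA A p && antipole o u r A (X p)]| <= 1)%N.
Proof.
apply/card_le1_eqP => p q; rewrite !inE => /andP[p1 p2] /andP[q1 q2]; apply: Xinj.
by rewrite (antipoleE uv q1 q2) (antipoleE uv p1 p2).
Qed.

Variable Fs : seq {mpoly R[3]}.
Hypothesis Fs0 : all (fun F => F != 0) Fs.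
Let D := degs Fs.
Let Z := [set p | (\prod_(F <- Fs) F).@[X p] == 0].

(** Remove twice the points that come first in their cell along A. A remaining point has two earlier
    points of its cell on A; such a triple determines A, and there are at most m t^2 triples. Pairs
    would not do, since many circles share them. *)
Lemma card_cell_incidences t : (forall x, (#|cell X Fs x| <= t.+1)%N) ->
  (\sum_A #|oncp A :\: Z| <= n * (2 * (2 * D).+1) + m * (t * t))%N.
Proof.
move=> ct; pose c x := cell X Fs x :\ x.
have ct' x : (#|c x| <= t)%N.
  have [xx|nxx] := boolP (x \in cell X Fs x).
    by have := ct x; rewrite (cardsD1 x) xx add1n ltnS.
  rewrite (_ : c x = set0) ?cards0 //; apply/setP => y; rewrite !inE; apply/negbTE/negP => /andP[_ h].
  by move: nxx; rewrite inE (same_sign_refl h).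
pose tri A (e : 'I_m * ('I_m * 'I_m)) := [&& e.2.1 \in c e.1, e.2.2 \in c e.1, e.2.1 != e.2.2,
  e.1 \in oncp A, e.2.1 \in oncp A & e.2.2 \in oncp A].
have one A : (#|oncp A :\: Z| <= 2 * (2 * D).+1 + #|[set e | tri A e]|)%N.
  pose frs (S : {set 'I_m}) := [set x in S | [forall y in S,
    (par A y < par A x)%R ==> ~~ same_sign Fs (gam A (par A y)) (gam A (par A x))]].
  have cf (S : {set 'I_m}) : S \subset oncp A :\: Z -> (#|frs S| <= (2 * D).+1)%N.
    move=> /subsetP SA; apply: (card_curve_firsts (@circ_den_gt0 R) sw (size_sc_poly _ _ _ _)).
      by move=> p q /SA/setDP[pA _] /SA/setDP[qA _]; apply: oncp_inj.
    by move=> p /SA/setDP[pA]; rewrite inE -/(gam A) (oncp_gam pA) meval_prod_neq0.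
  have nfst (S : {set 'I_m}) x : S \subset oncp A :\: Z -> x \in S -> x \notin frs S ->
      exists y, [/\ y \in S, par A y < par A x & same_sign Fs (X x) (X y)].
    move=> /subsetP SA xS; rewrite inE xS /= => /forallPn[y]; rewrite negb_imply => /andP[yS].
    have [/setDP[xA _] /setDP[yA _]] := (SA x xS, SA y yS).
    by rewrite negb_imply negbK !oncp_gam // => /andP[yx ss]; exists y; split=> //; rewrite same_sign_sym.
  set S1 := oncp A :\: Z; pose S2 := S1 :\: frs S1; pose S3 := S2 :\: frs S2.
  have s2 : S2 \subset S1 by exact: subsetDl.
  have e1 : (#|S1| <= (2 * D).+1 + #|S2|)%N.
    rewrite -(cardsID (frs S1) S1) leq_add2r; apply: leq_trans (cf S1 (subxx _)).
    by apply: subset_leq_card; exact: subsetIr.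
  have e2 : (#|S2| <= (2 * D).+1 + #|S3|)%N.
    rewrite -(cardsID (frs S2) S2) leq_add2r; apply: leq_trans (cf S2 s2).
    by apply: subset_leq_card; exact: subsetIr.
  rewrite mul2n -addnn -addnA; apply: leq_trans e1 _; rewrite leq_add2l.
  apply: leq_trans e2 _; rewrite leq_add2l.
  suff sub : S3 \subset (fun e => e.1) @: [set e | tri A e].
    by apply: leq_trans (subset_leq_card sub) (leq_imset_card _ _).
  apply/subsetP => x /setDP[xS2 xn]; have [y [yS2 yx xy]] := nfst S2 x s2 xS2 xn.
  move: (yS2) => /setDP[yS1 yn]; have [z [zS1 zy yz]] := nfst S1 y (subxx _) yS1 yn.
  have xA : x \in oncp A by move/(subsetP s2): xS2 => /setDP[].
  have yA : y \in oncp A by move: yS1 => /setDP[].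
  have zA : z \in oncp A by move: zS1 => /setDP[].
  have ne a b : par A a < par A b -> a != b by apply: contraTneq => ->; rewrite ltxx.
  have yc : y \in c x by rewrite in_setD1 inE xy ne.
  have zc : z \in c x by rewrite in_setD1 inE (same_sign_trans xy yz) ne // (lt_trans zy).
  have yz' : y != z by rewrite eq_sym ne.
  by apply/imsetP; exists (x, (y, z)); rewrite // inE /tri /= yc zc yz' xA yA zA.
apply: leq_trans (leq_sum _ (fun A _ => one A)) _; rewrite big_split /= sum_nat_const card_ord leq_add2l.
under eq_bigr => A _ do rewrite -sum_nat_pred.
rewrite exchange_big /=.
apply: (@leq_trans (\sum_(e : 'I_m * ('I_m * 'I_m)) nat_of_bool ((e.2.1 \in c e.1) && (e.2.2 \in c e.1)))).
  apply: leq_sum => -[x [y z]] _; rewrite sum_nat_pred.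
  case: (boolP (_ && _)) => h /=; last first.
    by rewrite leqn0 cards_eq0; apply/eqP/setP => A; rewrite !inE /tri /= andbA (negbTE h).
  apply/card_le1_eqP => A B; rewrite !inE /tri /= => /and4P[yc zc yz].
  rewrite !inE => /and3P[/andP[Ax _] /andP[Ay _] /andP[Az _]] /and4P[_ _ _ /and3P[/andP[Bx _] /andP[By _] /andP[Bz _]]].
  move: yc zc; rewrite !inE => /andP[yx _] /andP[zx _].
  have ne a b : a != b -> X a <> X b by move=> /eqP ab /Xinj.
  by apply: (three_points uv r0 inj (ne _ _ yx) (ne _ _ yz)); rewrite // ; apply: ne; rewrite eq_sym.
rewrite -(pair_bigA _ (fun x f => nat_of_bool ((f.1 \in c x) && (f.2 \in c x)))) /=.
rewrite -[X in (_ <= X * _)%N]card_ord -sum_nat_const; apply: leq_sum => x _.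
rewrite sum_nat_pred (_ : [set f | _] = setX (c x) (c x)); last by apply/setP => f; rewrite !inE.
by rewrite cardsX leq_mul.
Qed.

Variables (L : nat) (g : nat -> {mpoly R[3]}).
Hypothesis g0 : g 0%N = \prod_(F <- Fs) F.
Hypothesis gn : forall k, (k <= L)%N -> (g k != 0) && (msize (g k) <= msize (\prod_(F <- Fs) F)%R)%N.
Hypothesis gdv : forall k, (k < L)%N -> exists i, g k.+1 = (g k)^`M(i).
Hypothesis gL : exists2 a, a != 0 & g L = a%:MP.
Local Notation st p := (stratum gL (X p)).

Let mu_ex A : exists k, boolp.asbool (exists s, (g k).@[gam A s] != 0).
Proof. by have [a a0 e] := gL; exists L; apply/boolp.asboolP; exists 0; rewrite e mevalC. Qed.
(** If [st p] = mu A, then A lies in the zero set of [G A], which is smooth at p; this is the case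
    that needs geometry. *)
Definition mu A := ex_minn (mu_ex A).
Let mu_neq0 A : exists s, (g (mu A)).@[gam A s] != 0.
Proof. by rewrite /mu; case: ex_minnP => k /boolp.asboolP. Qed.
Let mu_vanish A k : (k < mu A)%N -> forall s, (g k).@[gam A s] = 0.
Proof.
rewrite /mu; case: ex_minnP => j _ jmin kj s; apply/eqP; apply: boolp.contrapT => /negP h.
by move: kj; rewrite ltnNge jmin //; apply/boolp.asboolP; exists s.
Qed.
Let mu_le A p : p \in oncp A -> (mu A <= st p)%N.
Proof.
move=> pA; rewrite leqNgt; apply/negP => /mu_vanish /(_ (par A p)); rewrite oncp_gam // => h.
by have := stratumP gL (X p); rewrite h eqxx.
Qed.
Let st_gt0 p : p \in Z -> (0 < st p)%N.
Proof. by rewrite inE lt0n => /eqP z; apply/eqP => e; have := stratumP gL (X p); rewrite e g0 z eqxx. Qed.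

Let G A := g (mu A).-1.
Let tg A x := tang (o A) (u A) (v A) (G A) x.
Let umb A := boolp.asbool (forall s, tg A (gam A s) = 0).
(* the incidences at which [A] is a line of curvature of the zero set of [G A] *)
Definition umbilic A := [set p in oncp A :&: Z | (st p == mu A) && umb A].

Let msG A : (0 < mu A)%N -> (mu A <= L)%N -> (msize (G A) <= D.+1)%N.
Proof.
move=> m0 mL; have [_ dP] := msize_prod_degs Fs0.
have /andP[_ h] : (G A != 0) && _ := gn (leq_trans (leq_pred _) mL).
by apply: leq_trans h _; move: dP; rewrite /D; case: (msize _).
Qed.

Let grad p : p \in Z -> exists i, ((g (st p).-1)^`M(i)).@[X p] != 0.
Proof.
move=> /st_gt0 s0; have sL : ((st p).-1 < L)%N by rewrite prednK // stratum_le.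
have [i gi] := gdv sL; exists i; rewrite -gi prednK //; exact: stratumP.
Qed.

(** Four kinds of incidences: [st p] > mu A, a root of a member of the chain along A; a root of a
    [tg A] that is not identically zero; a point with [tg A] nonzero, which has at most 11 such
    circles; and the umbilic ones. *)
Lemma card_zero_incidences :
  (\sum_A #|oncp A :&: Z| <= n * (2 * D + 2 * (D.*2 + 2)) + m * 11 + \sum_A #|umbilic A|)%N.
Proof.
pose low A := [set p in oncp A :&: Z | (mu A < st p)%N].
pose t0 A := [set p in oncp A :&: Z | [&& st p == mu A, tg A (X p) == 0 & ~~ umb A]].
pose t1 A := [set p in oncp A :&: Z | (st p == mu A) && (tg A (X p) != 0)].
have cov A : (#|oncp A :&: Z| <= #|low A| + #|t0 A| + #|t1 A| + #|umbilic A|)%N.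
  apply: (@leq_trans #|low A :|: t0 A :|: t1 A :|: umbilic A|).
    apply/subset_leq_card/subsetP => p pA; have E (Y : pred 'I_m) : (p \in [set p in oncp A :&: Z | Y p]) = Y p by rewrite inE pA.
    rewrite !in_setU /low /t0 /t1 /umbilic !E /=.
    have := mu_le (proj1 (setIP pA)); rewrite leq_eqVlt eq_sym => /orP[->|->] //=.
    by case: (tg A (X p) == 0); case: (umb A); rewrite ?orbT.
  apply: leq_trans (leq_card_setU _ _).1 _; rewrite leq_add2r.
  by apply: leq_trans (leq_card_setU _ _).1 _; rewrite leq_add2r; exact: (leq_card_setU _ _).1.
have clow A : (#|low A| <= 2 * D)%N.
  have gd k : (k <= L)%N -> ((msize (g k)).-1 <= D)%N.
    by move=> /gn/andP[_ h]; apply: leq_trans (msize_prod_degs Fs0).2; rewrite -!subn1 leq_sub2r.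
  apply: (@card_low_points R 3 L g D gL gd (circ_den R) (sc_poly (o A) (u A) (v A) (r A)) 2 (@circ_den_gt0 R) sw
    (size_sc_poly _ _ _ _) _ _ (par A) X).
  - move=> p q; rewrite inE => /andP[/setIP[pA _] _]; rewrite inE => /andP[/setIP[qA _] _]; exact: oncp_inj.
  - by move=> p; rewrite inE => /andP[/setIP[pA _] _] i; rewrite -/(gam A) oncp_gam.
  - by move=> p; rewrite inE => /andP[_ h]; exists (mu A) => //; exact: mu_neq0.
have ct0 A : (#|t0 A| <= 2 * (D.*2 + 2))%N.
  have [->|[p0]] := set_0Vmem (t0 A); first by rewrite cards0.
  rewrite inE => /andP[/setIP[_ p0Z] /and3P[/eqP e0 _ /boolp.asboolPn nu]].
  have [s0 s0P] : exists s, tg A (gam A s) != 0.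
    by apply: boolp.contrapT => h; apply: nu => s; apply/eqP; apply: boolp.contrapT => /negP hs; apply: h; exists s.
  have mu0 : (0 < mu A)%N by rewrite -e0 st_gt0.
  have muL : (mu A <= L)%N by rewrite -e0 stratum_le.
  have gt := good_tang (o A) (uv A) (r0 A) (msG mu0 muL).
  apply: (good_zeros (@circ_den_gt0 R) (t := par A) _ gt s0P).
    move=> p q; rewrite inE => /andP[/setIP[pA _] _]; rewrite inE => /andP[/setIP[qA _] _]; exact: oncp_inj.
  move=> p; rewrite inE => /andP[/setIP[pA _] /and3P[_ /eqP h _]].
  by rewrite -/(gam A) oncp_gam.
apply: leq_trans (leq_sum _ (fun A _ => cov A)) _; rewrite !big_split /= leq_add2r.
apply: leq_add.
  apply: (@leq_trans (\sum_(A < n) 2 * D + \sum_(A < n) 2 * (D.*2 + 2))).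
    by apply: leq_add; apply: leq_sum.
  by rewrite !sum_nat_const card_ord -mulnDr.
under eq_bigr => A _ do rewrite /t1 -sum_nat_pred.
rewrite exchange_big /= -[X in (_ <= X * _)%N]card_ord -sum_nat_const; apply: leq_sum => p _.
rewrite sum_nat_pred; set S := [set A | _]; have [->|[A0 A0S]] := set_0Vmem S; first by rewrite cards0.
have tP A : A \in S -> [/\ p \in oncp A, p \in Z, st p = mu A & tg A (X p) != 0].
  by rewrite inE => /andP[/setIP[pA pZ] /andP[/eqP e h]].
have pZ : p \in Z by have [] := tP A0 A0S.
apply: (card_osculating (s := fun A => par A p) (grad pZ) uv r0 inj).
- by move=> A /tP[pA _ _ _]; exact: oncpE.
- by move=> A /tP[_ _ e _]; apply: mu_vanish; rewrite -e prednK // st_gt0.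
- by move=> A /tP[_ _ e]; rewrite /tg /G -e.
Qed.

(** A surface is represented by the set [lab A] of the circles on it, so groups are indexed by a
    finite type. Equal curvatures at p give equal quadrics by [quadric_at], so [card_curvatures]
    leaves two groups per point. *)
Lemma umbilic_groups : exists (grp : {set 'I_n} -> {set 'I_n}) (pts : {set 'I_n} -> {set 'I_m}),
  [/\ forall A L M, A \in grp L -> A \in grp M -> L = M,
      forall p, (#|[set L | p \in pts L]| <= 2)%N,
      forall L A0, A0 \in grp L -> exists ab, [/\ ab != 0 :> R * R,
        forall B x, B \in grp L -> oncircle o u v r B x -> quadric (o A0) (u A0) (v A0) (r A0) ab x = 0 &
        forall p, p \in pts L -> quadric (o A0) (u A0) (v A0) (r A0) ab (X p) = 0] &
      (\sum_A #|umbilic A| <= \sum_L \sum_(A in grp L) #|[set p in pts L | onA A p]|)%N].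
Proof.
have /fin_all_exists[ab abP] : forall A, exists ab : R * R, (0 < mu A)%N && umb A -> ab != 0 /\
    forall s, ab.1 * jet1 (G A) (gam A s) (fun i => gam A s i - o A i) + ab.2 * jet1 (G A) (gam A s) (cr (u A) (v A)) = 0.
  move=> A; have [/andP[m0 /boolp.asboolP um]|] := boolP ((0 < mu A)%N && umb A); last by exists 0.
  have [|ab [ab0 h]] := @tang0_ratio R (o A) (u A) (v A) (r A) (G A) (uv A) _ um; first by apply: mu_vanish; rewrite prednK.
  by exists ab.
pose Q A := quadric (o A) (u A) (v A) (r A) (ab A).
pose lab A := [set B | boolp.asbool (forall x, oncircle o u v r B x -> Q A x = 0)].
pose grp L := [set A | [&& (0 < mu A)%N, umb A & lab A == L]].
pose pts L := \bigcup_(A in grp L) umbilic A.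
have own A x : oncircle o u v r A x -> Q A x = 0.
  by move=> /andP[/eqP h1 /eqP h2]; rewrite /Q /quadric h1 h2 subrr !mulr0 subrr.
have umbP A p : p \in umbilic A -> [/\ p \in oncp A, p \in Z, st p = mu A, umb A & A \in grp (lab A)].
  rewrite inE => /andP[/setIP[pA pZ] /andP[/eqP e um]]; split=> //.
  by rewrite inE um eqxx -e st_gt0.
exists grp, pts; split.
- by move=> A M N; rewrite !inE => /and3P[_ _ /eqP <-] /and3P[_ _ /eqP <-].
- move=> p; pose S := [set A | p \in umbilic A].
  have [e|[A0 A0S]] := set_0Vmem S.
    rewrite (_ : [set M | _] = set0) ?cards0 //; apply/eqP; rewrite -subset0; apply/subsetP => M.
    rewrite inE => /bigcupP[A _ pA]; have : A \in S; first by rewrite inE.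
    by rewrite e inE.
  have pZ : p \in Z by move: A0S; rewrite inE => /umbP[].
  apply: (@leq_trans #|lab @: S|).
    apply/subset_leq_card/subsetP => M; rewrite inE => /bigcupP[A]; rewrite inE => /and3P[_ _ /eqP <-] pA.
    by apply: imset_f; rewrite inE.
  pose H := g (st p).-1.
  have SP A : A \in S -> [/\ p \in oncp A, G A = H, umb A, (0 < mu A)%N & forall s, H.@[gam A s] = 0].
    rewrite inE => /umbP[pA _ e um]; rewrite inE => /and3P[m0 _ _]; split=> //; first by rewrite /G -e.
    by apply: mu_vanish; rewrite -e prednK // st_gt0.
  have /fin_all_exists[lk lkP] : forall A, exists lk : R * R, A \in S -> [/\ lk.1 != 0,
      forall x, lk.1 * Q A x = lk.2 * dt (fun i => x i - X p i) (fun i => x i - X p i) + 2 * jet1 H (X p) (fun i => x i - X p i) &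
      forall y, jet1 H (X p) y = 0 -> jet2 H (X p) (fun i => (rotv (o A) (u A) (v A) i).@[X p]) y =
        lk.2 * dt (fun i => (rotv (o A) (u A) (v A) i).@[X p]) y].
    move=> A; have [AS|] := boolP (A \in S); last by exists 0.
    have [pA eG um m0 H0] := SP A AS.
    have um' := um; move/boolp.asboolP: um' => um'.
    have [ab0 h] := abP A (introT andP (conj m0 um)).
    have pE := oncpE pA.
    have := @quadric_at R (o A) (u A) (v A) (r A) H (uv A) (r0 A) H0 (ab A) (par A p).
    have tg0 : tang (o A) (u A) (v A) H (X p) = 0 by have := um' (par A p); rewrite /tg eG oncp_gam.
    have rat := h (par A p); rewrite eG oncp_gam // in rat.
    by rewrite /= pE => /(_ (grad pZ) ab0 tg0 rat) [k kP]; exists k.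
  have osc A : A \in S -> osculates H (X p) (fun i => (rotv (o A) (u A) (v A) i).@[X p]) (fun i => X p i - o A i).
    by move=> AS; have [pA _ _ _ H0] := SP A AS; exact: (circle_osculates (uv A) (r0 A) (oncpE pA) H0).
  apply: (card_curvatures (grad pZ) (T := fun A i => (rotv (o A) (u A) (v A) i).@[X p]) (kap := fun A => (lk A).2)).
  + by move=> A /osc[[]].
  + by move=> A /osc[_ []].
  + by move=> A y /lkP[_ _]; apply.
  + move=> A B AS BS kk; have [a1 a2 _] := lkP A AS; have [b1 b2 _] := lkP B BS.
    have QQ x : (Q A x = 0) <-> (Q B x = 0).
      split=> h; [apply: (mulfI b1); rewrite b2 -kk -a2 h|apply: (mulfI a1); rewrite a2 kk -b2 h]; by rewrite !mulr0.
    apply/setP => C; rewrite !inE; apply/boolp.asboolP/boolp.asboolP => h x /h; by rewrite QQ.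
- move=> M A0 A0M; exists (ab A0); move: (A0M); rewrite inE => /and3P[m0 um /eqP lM].
  have c1 B x : B \in grp M -> oncircle o u v r B x -> Q A0 x = 0.
    rewrite inE => /and3P[_ _ /eqP lB]; have : B \in lab B by rewrite inE; apply/boolp.asboolP; exact: own.
    by rewrite lB -lM inE => /boolp.asboolP; apply.
  split; [by have [] := abP A0 (introT andP (conj m0 um))|exact: c1|].
  move=> p /bigcupP[B BM pB]; apply: (c1 B) => //.
  by have [] := umbP B p pB; rewrite inE => /andP[].
apply: (@leq_trans (\sum_A \sum_(M | A \in grp M) #|[set p in pts M | onA A p]|)).
  apply: leq_sum => A _; have [->|[p0 p0A]] := set_0Vmem (umbilic A); first by rewrite cards0.
  have [_ _ _ _ AM] := umbP A p0 p0A; rewrite (bigD1 (lab A)) //=; apply: leq_trans (leq_addr _ _).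
  apply/subset_leq_card/subsetP => p pA; rewrite inE; apply/andP; split.
    by apply/bigcupP; exists A.
  by have [] := umbP A p pA; rewrite inE => /andP[].
by rewrite (exchange_big_dep xpredT).
Qed.
End SpaceCount.

(** * Charts of planes and spheres *)

Section PlanarModels.
Variables (R : realType) (m n : nat) (X : 'I_m -> 'I_3 -> R) (o u v : 'I_n -> 'I_3 -> R) (r : 'I_n -> R).
Notation V := ('I_3 -> R).
Hypothesis Xinj : injective X.
Hypothesis uv : forall A, onpair (u A) (v A).
Hypothesis r0 : forall A, 0 < r A.
Hypothesis inj : forall A B, o A =1 o B -> r A = r B ->
  (cr (u A) (v A) =1 cr (u B) (v B) \/ forall i, cr (u A) (v A) i = - cr (u B) (v B) i) -> A = B.
Local Notation onA := (oncircle o u v r).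

Lemma oncircle_dir A c s : c ^+ 2 + s ^+ 2 = 1 -> onA A (fun i => o A i + r A * (c * u A i + s * v A i)).
Proof.
move=> cs; have [uu vv uv0] := uv A; apply/andP; split; apply/eqP.
  transitivity (r A ^+ 2 * (c ^+ 2 * dt (u A) (u A) + s ^+ 2 * dt (v A) (v A) + 2 * c * s * dt (u A) (v A))).
    by rewrite /dt; ring.
  by rewrite uu vv uv0 !mulr1 mulr0 addr0 cs mulr1.
by rewrite /dt !(cr0, cr1, cr2); ring.
Qed.

Variables (grp : {set 'I_n}) (pts : {set 'I_m}) (Sf : V -> Prop) (U W : V -> R) (a b w : 'I_n -> R).
Hypothesis UW_inj : forall x y, Sf x -> Sf y -> U x = U y -> W x = W y -> x = y.
Hypothesis circ_on : forall A x, A \in grp -> onA A x -> Sf x.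
Hypothesis pts_on : forall p, p \in pts -> Sf (X p).
Hypothesis onE : forall A x, A \in grp -> Sf x ->
  onA A x = (U x ^+ 2 + W x ^+ 2 - 2 * a A * U x - 2 * b A * W x + w A == 0).

(** Three points on each circle make the planar model faithful: equal coefficients give three common
    points in space, and the radius cannot vanish. *)
Let three A : exists x y z : V, [/\ x <> y, x <> z, y <> z & [/\ onA A x, onA A y & onA A z]].
Proof.
have [uu vv uv0] := uv A; have r1 : r A != 0 by rewrite gt_eqF.
exists (fun i => o A i + r A * (1 * u A i + 0 * v A i)), (fun i => o A i + r A * (0 * u A i + 1 * v A i)),
  (fun i => o A i + r A * (- 1 * u A i + 0 * v A i)).
have ne (c s c' s' : R) : (c != c') || (s != s') ->
   (fun i => o A i + r A * (c * u A i + s * v A i)) <> (fun i => o A i + r A * (c' * u A i + s' * v A i)).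
  move=> h e; have e' i : (c - c') * u A i + (s - s') * v A i = 0.
    by apply: (mulfI r1); rewrite mulr0; have := congr1 (fun f => f i) e => /= /addrI /eqP; rewrite -subr_eq0 => /eqP <-; ring.
  have c0 : c - c' = 0.
    transitivity ((c - c') * dt (u A) (u A) + (s - s') * dt (u A) (v A)); first by rewrite uu uv0; ring.
    transitivity (dt (u A) (fun i => (c - c') * u A i + (s - s') * v A i)); first by rewrite /dt; ring.
    by rewrite /dt !e'; ring.
  have s0 : s - s' = 0.
    transitivity ((c - c') * dt (u A) (v A) + (s - s') * dt (v A) (v A)); first by rewrite vv uv0; ring.
    transitivity (dt (v A) (fun i => (c - c') * u A i + (s - s') * v A i)); first by rewrite /dt; ring.
    by rewrite /dt !e'; ring.
  by move: h; rewrite -(subr_eq0 c) -(subr_eq0 s) c0 s0 eqxx.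
split.
- by apply: ne; rewrite oner_neq0.
- by apply: ne; apply/orP; left; apply/eqP => h; lra.
- by apply: ne; rewrite oner_neq0 orbT.
- by split; apply: oncircle_dir; ring.
Qed.

Lemma planar_circ_inj A B : A \in grp -> B \in grp -> a A = a B -> b A = b B -> w A = w B -> A = B.
Proof.
move=> Ag Bg ea eb ew; have [x [y [z [xy xz yz [xA yA zA]]]]] := three A.
have onB t : onA A t -> onA B t.
  by move=> tA; have St := circ_on Ag tA; rewrite (onE Bg St) -ea -eb -ew -(onE Ag St).
exact: (three_points uv r0 inj xy xz yz xA yA zA (onB _ xA) (onB _ yA) (onB _ zA)).
Qed.

Lemma planar_radius A : A \in grp -> 0 < a A ^+ 2 + b A ^+ 2 - w A.
Proof.
move=> Ag; have [x [y [z [xy _ _ [xA yA _]]]]] := three A.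
have [Sx Sy] := (circ_on Ag xA, circ_on Ag yA).
have e t : onA A t -> Sf t -> (U t - a A) ^+ 2 + (W t - b A) ^+ 2 = a A ^+ 2 + b A ^+ 2 - w A.
  by move=> tA St; move: tA; rewrite (onE Ag St) => /eqP h; apply/eqP; rewrite -subr_eq0 -h; apply/eqP; ring.
rewrite lt0r -{2}(e x) // addr_ge0 ?sqr_ge0 // andbT; apply/eqP => z0; apply: xy.
have zero t : onA A t -> Sf t -> U t = a A /\ W t = b A.
  move=> tA St; have := e t tA St; rewrite z0 => /eqP; rewrite paddr_eq0 ?sqr_ge0 // !sqrf_eq0 !subr_eq0.
  by move=> /andP[/eqP -> /eqP ->].
have [x1 x2] := zero x xA Sx; have [y1 y2] := zero y yA Sy.
by apply: UW_inj; rewrite // ?x1 ?x2.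
Qed.

Lemma group_bound C : (forall m n (U V : 'I_m -> R) (a b w : 'I_n -> R),
  (forall i j, U i = U j -> V i = V j -> i = j) ->
  (forall i j, a i = a j -> b i = b j -> w i = w j -> i = j) ->
  (forall i, 0 < a i ^+ 2 + b i ^+ 2 - w i) ->
  forall e k h, (n <= 4 ^ h * 8 ^ k)%N ->
  (\sum_A #|[set p | pw U V a b w A p == 0%R]| <=
     C * (n * 2 ^ e + m * (m %/ 4 ^ e) * 2 ^ k + m + n * (2 ^ h * (2 * h).+1)))%N) ->
  forall e k h, (#|grp| <= 4 ^ h * 8 ^ k)%N ->
  (\sum_(A in grp) #|[set p in pts | onA A (X p)]| <=
    C * (#|grp| * 2 ^ e + #|pts| * (#|pts| %/ 4 ^ e) * 2 ^ k + #|pts| + #|grp| * (2 ^ h * (2 * h).+1)))%N.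
Proof.
move=> planar e k h gh.
have := planar #|pts| #|grp| (fun p => U (X (enum_val p))) (fun p => W (X (enum_val p)))
  (fun A => a (enum_val A)) (fun A => b (enum_val A)) (fun A => w (enum_val A)) _ _ _ e k h gh.
have step : (\sum_(A in grp) #|[set p in pts | onA A (X p)]| <= \sum_(A < #|grp|) #|[set p : 'I_#|pts| |
   pw (fun p => U (X (enum_val p))) (fun p => W (X (enum_val p))) (fun A => a (enum_val A)) (fun A => b (enum_val A))
      (fun A => w (enum_val A)) A p == 0%R]|)%N.
  rewrite big_enum_val; apply: leq_sum => A _.
  rewrite -(card_imset _ (@enum_val_inj _ (mem pts))); apply/subset_leq_card/subsetP => p.
  rewrite inE => /andP[pP pA]; apply/imsetP; exists (enum_rank_in pP p); last by rewrite enum_rankK_in.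
  have Ag := enum_valP A; have Sp := pts_on pP.
  by rewrite inE /pw /power enum_rankK_in // -(onE Ag Sp).
move=> H; apply: leq_trans step _; apply: H.
- by move=> i j e1 e2; apply: enum_val_inj; apply: Xinj; apply: UW_inj; rewrite // ; apply: pts_on; exact: enum_valP.
- by move=> i j e1 e2 e3; apply: enum_val_inj; apply: planar_circ_inj => //; exact: enum_valP.
- by move=> i; apply: planar_radius; exact: enum_valP.
Qed.
End PlanarModels.

Section Surfaces.
Variables (R : realType) (m n : nat) (X : 'I_m -> 'I_3 -> R) (o u v : 'I_n -> 'I_3 -> R) (r : 'I_n -> R).
Notation V := ('I_3 -> R).
Hypothesis Xinj : injective X.
Hypothesis uv : forall A, onpair (u A) (v A).
Hypothesis r0 : forall A, 0 < r A.
Hypothesis inj : forall A B, o A =1 o B -> r A = r B ->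
  (cr (u A) (v A) =1 cr (u B) (v B) \/ forall i, cr (u A) (v A) i = - cr (u B) (v B) i) -> A = B.
Local Notation onA := (oncircle o u v r).
Let nu A := cr (u A) (v A).

Lemma circle_in_plane A c w : (forall x, onA A x -> dt w (fun i => x i - c i) = 0) ->
  [/\ dt w (u A) = 0, dt w (v A) = 0 & dt w (fun i => o A i - c i) = 0].
Proof.
move=> h; have r1 : r A != 0 by rewrite gt_eqF.
have pt (x y : R) : x ^+ 2 + y ^+ 2 = 1 -> dt w (fun i => o A i - c i) + r A * (x * dt w (u A) + y * dt w (v A)) = 0.
  by move=> xy; rewrite -(h _ (oncircle_dir o r uv A xy)) /dt; ring.
have e1 : 1 ^+ 2 + 0 ^+ 2 = 1 :> R by ring.
have e2 : (- 1) ^+ 2 + 0 ^+ 2 = 1 :> R by ring.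
have e3 : 0 ^+ 2 + 1 ^+ 2 = 1 :> R by ring.
have p1 := pt _ _ e1; have p2 := pt _ _ e2; have p3 := pt _ _ e3.
have c0 : dt w (fun i => o A i - c i) = 0 by move: p1 p2; rewrite !mul1r !mul0r !addr0 mulN1r mulrN; lra.
rewrite c0 in p1 p3 *; split=> //; apply: (mulfI r1); rewrite mulr0; [rewrite -[RHS]p1|rewrite -[RHS]p3]; ring.
Qed.

Lemma circle_in_sphere A c k : (forall x, onA A x -> dt (fun i => x i - c i) (fun i => x i - c i) = k) ->
  [/\ dt (u A) (fun i => o A i - c i) = 0, dt (v A) (fun i => o A i - c i) = 0 &
      dt (fun i => o A i - c i) (fun i => o A i - c i) + r A ^+ 2 = k].
Proof.
move=> h; have r1 : 2 * r A != 0 by rewrite mulf_neq0 ?pnatr_eq0 // gt_eqF.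
have [uu vv uv0] := uv A.
have pt (x y : R) : x ^+ 2 + y ^+ 2 = 1 -> dt (fun i => o A i - c i) (fun i => o A i - c i) + r A ^+ 2 +
    2 * r A * (x * dt (u A) (fun i => o A i - c i) + y * dt (v A) (fun i => o A i - c i)) = k.
  move=> xy; rewrite -(h _ (oncircle_dir o r uv A xy)).
  transitivity (dt (fun i => o A i - c i) (fun i => o A i - c i) + r A ^+ 2 *
    (x ^+ 2 * dt (u A) (u A) + y ^+ 2 * dt (v A) (v A) + 2 * x * y * dt (u A) (v A)) +
    2 * r A * (x * dt (u A) (fun i => o A i - c i) + y * dt (v A) (fun i => o A i - c i))).
    by rewrite uu vv uv0 mulr0 addr0 !mulr1 xy mulr1.
  by rewrite /dt; ring.
have e1 : 1 ^+ 2 + 0 ^+ 2 = 1 :> R by ring.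
have e2 : (- 1) ^+ 2 + 0 ^+ 2 = 1 :> R by ring.
have e3 : 0 ^+ 2 + 1 ^+ 2 = 1 :> R by ring.
have p1 := pt _ _ e1; have p2 := pt _ _ e2; have p3 := pt _ _ e3.
move: p1 p2 p3; set d := dt (fun i => o A i - c i) _ + _; set a := dt (u A) _; set b := dt (v A) _ => p1 p2 p3.
have a0 : a = 0.
  apply: (mulfI r1); rewrite mulr0; move: p1 p2; rewrite !mul1r !mul0r !addr0 mulN1r mulrN; lra.
have dk : d = k by rewrite -p1 a0; ring.
split=> //; apply: (mulfI r1); rewrite mulr0; move: p3; rewrite dk a0 mulr0 add0r mul1r; lra.
Qed.

(* The curve [t |-> (2t, 2t^2, t^4 + t^2 - 1)], scaled to the unit sphere, meets every plane in finitely many points. *)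
Lemma exists_pole (I : finType) (N : I -> V) (d : I -> R) : (forall i, exists j, N i j != 0) ->
  exists w, dt w w = 1 /\ forall i, dt (N i) w != d i.
Proof.
move=> N0; pose den t : R := 1 + t ^+ 2 + t ^+ 4.
have den0 t : den t != 0 by rewrite gt_eqF // /den -addrA ltr_pwDl // addr_ge0 ?sqr_ge0 // (exprM t 2 2) sqr_ge0.
pose Pi i : {poly R} := (2 * N i j0) *: 'X + (2 * N i j1) *: 'X^2 + N i j2 *: ('X^2 + 'X^4 - 1) - d i *: (1 + 'X^2 + 'X^4).
have PE i t : (Pi i).[t] = 2 * N i j0 * t + 2 * N i j1 * t ^+ 2 + N i j2 * (t ^+ 2 + t ^+ 4 - 1) - d i * den t.
  by rewrite /Pi /den !hornerE.
have P0 i : Pi i != 0.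
  apply/eqP => e; have ek k : (Pi i)`_k = 0 by rewrite e coef0.
  have := ek 0%N; have := ek 1%N; have := ek 2%N; have := ek 4%N.
  rewrite /Pi !(coefD, coefN, coefZ, coefX, coefXn, coef1) /= => h4 h2 h1 h0.
  have [j] := N0 i; case: (ord3 j) => ->; apply/negP; rewrite negbK; apply/eqP; lra.
have : \prod_i Pi i != 0 by apply/prodf_neq0 => i _; exact: P0.
move=> prod0; have [t tP] : exists t, (\prod_i Pi i).[t] != 0.
  apply: boolp.contrapT => h; move/eqP: prod0; apply; apply: poly_all0 => t.
  by apply/eqP; apply: boolp.contrapT => /negP ht; apply: h; exists t.
have tP' i : (Pi i).[t] != 0.
  by move: tP; rewrite horner_prod => /prodf_neq0 /(_ i isT).
exists (vec3 (2 * t / den t) (2 * t ^+ 2 / den t) ((t ^+ 2 + t ^+ 4 - 1) / den t)); split.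
  rewrite /dt /vec3 /=; have := den0 t; rewrite /den => d0; by field.
move=> i; apply: contraNneq (tP' i) => e; rewrite PE -e /dt /vec3 /=; have := den0 t => d0; apply/eqP; by field.
Qed.

Variables (grp : {set 'I_n}) (pts : {set 'I_m}) (C : nat).
Hypothesis planar : forall m n (U V : 'I_m -> R) (a b w : 'I_n -> R),
  (forall i j, U i = U j -> V i = V j -> i = j) ->
  (forall i j, a i = a j -> b i = b j -> w i = w j -> i = j) ->
  (forall i, 0 < a i ^+ 2 + b i ^+ 2 - w i) ->
  forall e k h, (n <= 4 ^ h * 8 ^ k)%N ->
  (\sum_A #|[set p | pw U V a b w A p == 0%R]| <=
     C * (n * 2 ^ e + m * (m %/ 4 ^ e) * 2 ^ k + m + n * (2 ^ h * (2 * h).+1)))%N.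
Definition group_le := forall e k h, (#|grp| <= 4 ^ h * 8 ^ k)%N ->
  (\sum_(A in grp) #|[set p in pts | onA A (X p)]| <=
    C * (#|grp| * 2 ^ e + #|pts| * (#|pts| %/ 4 ^ e) * 2 ^ k + #|pts| + #|grp| * (2 ^ h * (2 * h).+1)))%N.

Lemma plane_group_le w c : dt w w = 1 ->
  (forall A x, A \in grp -> onA A x -> dt w (fun i => x i - c i) = 0) ->
  (forall p, p \in pts -> dt w (fun i => X p i - c i) = 0) -> group_le.
Proof.
move=> ww gw pw0; have [e [f [ef wE]]] := exists_frame ww.
have dtw x : dt x (cr e f) = dt w x by rewrite (eq_dt (frefl x) wE) dtC.
have par (x : V) i : dt w x = 0 -> x i = dt x e * e i + dt x f * f i.
  by move=> wx; rewrite {1}(parseval ef x i) dtw wx mul0r addr0.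
pose U (x : V) := dt e (fun i => x i - c i); pose W (x : V) := dt f (fun i => x i - c i).
have [ee ff eo] := ef.
have := @group_bound R m n X o u v r Xinj uv r0 inj grp pts (fun x => dt w (fun i => x i - c i) = 0) U W
  (fun A => U (o A)) (fun A => W (o A)) (fun A => U (o A) ^+ 2 + W (o A) ^+ 2 - r A ^+ 2) _ _ _ _ C planar.
apply => //.
- move=> x y Sx Sy eU eW; apply: boolp.funext => i; apply: (addIr (- c i)).
  by rewrite (par _ i Sx) (par _ i Sy) !(dtC _ e) !(dtC _ f) -/(U x) -/(U y) -/(W x) -/(W y) eU eW.
move=> A x Ag Sx; have [wu wv wo] := circle_in_plane (fun x => gw A x Ag).
pose y : V := fun i => x i - o A i.
have wy : dt w y = 0 by rewrite -(subrr 0) -{1}Sx -wo /dt /y; ring.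
have yy : dt y y = (U x - U (o A)) ^+ 2 + (W x - W (o A)) ^+ 2.
  rewrite (eq_dt (fun i => par y i wy) (fun i => par y i wy)).
  have -> : U x - U (o A) = dt y e by rewrite /U /y /dt; ring.
  have -> : W x - W (o A) = dt y f by rewrite /W /y /dt; ring.
  set p := dt y e; set q := dt y f.
  transitivity (p ^+ 2 * dt e e + q ^+ 2 * dt f f + 2 * p * q * dt e f); first by rewrite /dt; ring.
  by rewrite ee ff eo; ring.
have ny : dt (nu A) y = 0.
  transitivity ((dt (u A) e * dt (v A) f - dt (u A) f * dt (v A) e) * dt (cr e f) y); last by rewrite (dtC (cr e f)) dtw wy mulr0.
  have h k : nu A k = (dt (u A) e * dt (v A) f - dt (u A) f * dt (v A) e) * cr e f k.
    have hu k' := par (u A) k' wu; have hv k' := par (v A) k' wv.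
    move: hu hv; set p := dt (u A) e; set q := dt (u A) f; set p' := dt (v A) e; set q' := dt (v A) f => hu hv.
    by rewrite /nu; case: (ord3 k) => ->; rewrite !(cr0, cr1, cr2) !hu !hv; ring.
  by rewrite (eq_dt h (frefl y)) /dt; ring.
rewrite /oncircle -/(nu A) -/y ny eqxx andbT yy -subr_eq0; congr (_ == 0); ring.
Qed.

(** Stereographic projection. The pole [w] avoids the planes of all circles, so that no image is a
    line, and all the points, so that none goes to infinity. *)
Lemma sphere_group_le c rho : 0 < rho ->
  (forall A x, A \in grp -> onA A x -> dt (fun i => x i - c i) (fun i => x i - c i) = rho ^+ 2) ->
  (forall p, p \in pts -> dt (fun i => X p i - c i) (fun i => X p i - c i) = rho ^+ 2) -> group_le.
Proof.
move=> rho0 gS pS; have rn : rho != 0 by rewrite gt_eqF.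
have nu1 A : dt (nu A) (nu A) = 1 by have [] := frame_dt (uv A).
(* For the points it is enough that the first coordinates differ, which has the form that
   [exists_pole] handles. *)
have [w [ww wP]] : exists w, dt w w = 1 /\ forall i : 'I_n + 'I_m,
    dt (match i with inl A => nu A | inr _ => vec3 1 0 0 end) w !=
    match i with inl A => dt (nu A) (fun i => o A i - c i) / rho | inr p => (X p j0 - c j0) / rho end.
  apply: exists_pole => -[A|p]; last by exists j0; rewrite /vec3 /= oner_neq0.
  apply: boolp.contrapT => h; have h0 i : nu A i = 0 by apply/eqP; apply: boolp.contrapT => /negP hi; apply: h; exists i.
  by have := nu1 A; rewrite /dt !h0 mulr0 !addr0 => /esym/eqP; rewrite oner_eq0.
have [e [f [ef wE]]] := exists_frame ww; have [ee ff eo] := ef.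
have dtw x : dt x (cr e f) = dt x w by exact: eq_dt.
have par (x : V) i : x i = dt x e * e i + dt x f * f i + dt x w * w i.
  by rewrite {1}(parseval ef x i) dtw wE.
have nrm (x : V) : dt x x = dt x e ^+ 2 + dt x f ^+ 2 + dt x w ^+ 2.
  have {1}-> : dt x x = dt x (fun i => dt x e * e i + dt x f * f i + dt x w * w i) by apply: eq_dt => // i; exact: par.
  by rewrite {1}/dt; set p := dt x e; set q := dt x f; set t := dt x w; rewrite /p /q /t /dt; ring.
pose y (x : V) : V := fun i => (x i - c i) / rho.
pose h x := dt (y x) w; pose U x := dt (y x) e / (1 - h x); pose W x := dt (y x) f / (1 - h x).
pose Sf (x : V) := dt (fun i => x i - c i) (fun i => x i - c i) = rho ^+ 2 /\ x <> (fun i => c i + rho * w i).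
have yy x : dt (fun i => x i - c i) (fun i => x i - c i) = rho ^+ 2 -> dt (y x) (y x) = 1.
  move=> e1; transitivity (dt (fun i => x i - c i) (fun i => x i - c i) / rho ^+ 2); first by rewrite /dt /y; field.
  by rewrite e1 divff // expf_neq0.
have h1 x : Sf x -> 1 - h x != 0.
  move=> [/yy e1 ne]; apply/eqP => h0; apply: ne; apply: boolp.funext => i.
  have z : dt (fun i => y x i - w i) (fun i => y x i - w i) = 0.
    transitivity (dt (y x) (y x) + dt w w - 2 * h x); first by rewrite /h /dt; ring.
    by rewrite e1 ww; move: h0; lra.
  have /eqP := dt_eq0 z i; rewrite subr_eq0 => /eqP yw.
  by rewrite -yw /y mulrC divfK // addrC subrK.
have NE x : Sf x -> U x ^+ 2 + W x ^+ 2 = (1 + h x) / (1 - h x).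
  move=> Sx; have d := h1 x Sx; have := yy x Sx.1; rewrite nrm -/(h x) => e1.
  transitivity ((dt (y x) e ^+ 2 + dt (y x) f ^+ 2) / (1 - h x) ^+ 2); first by rewrite /U /W; field.
  have -> : dt (y x) e ^+ 2 + dt (y x) f ^+ 2 = (1 + h x) * (1 - h x) by move: e1; set p := _ ^+ 2; set q := _ ^+ 2; nra.
  by field.
(* The equation of the plane of A at the pole; dividing by it makes the equation of the image circle
   monic. *)
pose K A := dt (nu A) (fun i => c i + rho * w i - o A i).
have K0 A : K A != 0.
  have := wP (inl A) => /= hA; have -> : K A = rho * (dt (nu A) w - dt (nu A) (fun i => o A i - c i) / rho).
    by rewrite /K /dt; field.
  by rewrite mulf_neq0 // subr_eq0.
pose k A := dt (nu A) (fun i => c i - o A i).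
have := @group_bound R m n X o u v r Xinj uv r0 inj grp pts Sf U W
  (fun A => - rho * dt (nu A) e / K A) (fun A => - rho * dt (nu A) f / K A)
  (fun A => (k A - rho * dt (nu A) w) / K A) _ _ _ _ C planar.
apply.
- move=> x x' Sx Sx' eU eW; have [d d'] := (h1 x Sx, h1 x' Sx').
  have hh : h x = h x'.
    have := NE x Sx; rewrite eU eW (NE x' Sx') => e1.
    have e2 : (1 + h x') * (1 - h x) = (1 + h x) * (1 - h x').
      transitivity ((1 + h x') / (1 - h x') * ((1 - h x) * (1 - h x'))); first by field.
      by rewrite e1; field.
    by move: e2; lra.
  have eye : dt (y x) e = dt (y x') e by apply: (mulIf (invr_neq0 d)); rewrite [LHS]eU /U hh.
  have eyf : dt (y x) f = dt (y x') f by apply: (mulIf (invr_neq0 d)); rewrite [LHS]eW /W hh.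
  apply: boolp.funext => i; have : y x i = y x' i by rewrite (par (y x) i) (par (y x') i) eye eyf -/(h x) hh.
  by rewrite /y => /(mulIf (invr_neq0 rn)) /addIr.
- move=> A x Ag Ax; split; first exact: (gS A x).
  by move=> xE; move: Ax (K0 A); rewrite xE => /andP[_ /eqP h0]; rewrite /K h0 eqxx.
- move=> p pP; split; first exact: pS.
  move=> xE; have := wP (inr p); rewrite /= /dt /vec3 /= => /eqP; apply.
  by rewrite xE; field.
move=> A x Ag Sx; have [uo vo dr] := circle_in_sphere (fun x => gS A x Ag).
have d := h1 x Sx; have KA := K0 A.
have KE : K A = k A + rho * dt (nu A) w by rewrite /K /k /dt; ring.
have main : U x ^+ 2 + W x ^+ 2 - 2 * (- rho * dt (nu A) e / K A) * U x - 2 * (- rho * dt (nu A) f / K A) * W x +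
   (k A - rho * dt (nu A) w) / K A = 2 / ((1 - h x) * K A) * dt (nu A) (fun i => x i - o A i).
  have -> : dt (nu A) (fun i => x i - o A i) = rho * (dt (y x) e * dt (nu A) e + dt (y x) f * dt (nu A) f + h x * dt (nu A) w) + k A.
    have -> : dt (y x) e * dt (nu A) e + dt (y x) f * dt (nu A) f + h x * dt (nu A) w = dt (nu A) (y x).
      rewrite [RHS](eq_dt (frefl _) (par (y x))) -/(h x); set p := dt (y x) e; set q := dt (y x) f.
      by rewrite /dt; ring.
    by rewrite /y /k /dt; field.
  rewrite NE // /U /W; apply: (mulIf KA); rewrite [in LHS]mulrDl [in LHS]divfK //.
  transitivity ((1 + h x) / (1 - h x) * K A + 2 * rho * (dt (nu A) e * dt (y x) e + dt (nu A) f * dt (y x) f) / (1 - h x) +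
    (k A - rho * dt (nu A) w)).
    by congr (_ + _); field; rewrite KA d.
  by rewrite {1}KE; field; rewrite KA d.
rewrite main mulf_eq0 mulf_eq0 invr_eq0 mulf_eq0 (negbTE d) (negbTE KA) pnatr_eq0 /= /oncircle -/(nu A).
case: (dt (nu A) (fun i => x i - o A i) =P 0) => [ny|_]; last by rewrite andbF.
rewrite andbT; apply/eqP.
have par' : forall i, o A i - c i = dt (fun i => o A i - c i) (nu A) * nu A i.
  move=> i; rewrite {1}(parseval (uv A) (fun i => o A i - c i) i) !(dtC (fun i => o A i - c i)) uo vo.
  by rewrite !mul0r !add0r.
set z := dt (fun i => o A i - c i) (nu A) in par'.
have zz : dt (fun i => o A i - c i) (fun i => o A i - c i) = z ^+ 2.
  by rewrite (eq_dt par' par'); transitivity (z ^+ 2 * dt (nu A) (nu A)); [rewrite /dt; ring|rewrite nu1 mulr1].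
have xz : dt (fun i => x i - o A i) (fun i => o A i - c i) = 0.
  by rewrite (eq_dt (frefl _) par'); transitivity (z * dt (nu A) (fun i => x i - o A i)); [rewrite /dt; ring|rewrite ny mulr0].
have := Sx.1; rewrite -dr => h0; apply/eqP; rewrite -subr_eq0; apply/eqP.
transitivity (dt (fun i => x i - c i) (fun i => x i - c i) - (dt (fun i => o A i - c i) (fun i => o A i - c i) + r A ^+ 2) -
  2 * dt (fun i => x i - o A i) (fun i => o A i - c i)); first by rewrite /dt; ring.
by rewrite h0 xz; ring.
Qed.

(** If ab.2 = 0 the surface is the plane of the circle; otherwise completing the square gives the
    centre o + z nu with z = ab.1 r^2 / ab.2, and squared radius r^2 + z^2. *)
Lemma quadric_surface A ab : ab != 0 :> R * R ->
  (exists c, forall x, quadric (o A) (u A) (v A) (r A) ab x = 0 -> dt (nu A) (fun i => x i - c i) = 0) \/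
  (exists c rho, 0 < rho /\ forall x, quadric (o A) (u A) (v A) (r A) ab x = 0 -> dt (fun i => x i - c i) (fun i => x i - c i) = rho ^+ 2).
Proof.
move=> ab0; have r1 : r A != 0 by rewrite gt_eqF.
have [b0|b0] := eqVneq ab.2 0; [left|right].
  have a0 : ab.1 != 0 by apply: contraNneq ab0 => a0; case: ab a0 b0 => a b /= -> ->.
  exists (o A) => x; rewrite /quadric b0 mul0r sub0r => /eqP; rewrite oppr_eq0 !mulf_eq0 pnatr_eq0 (negbTE a0) /=.
  by rewrite ?mulf_eq0 (negbTE r1) /= => /eqP.
pose z := ab.1 * r A ^+ 2 / ab.2; have k0 : 0 < r A ^+ 2 + z ^+ 2 by rewrite ltr_pwDl ?exprn_gt0 ?sqr_ge0.
exists (fun i => o A i + z * nu A i), (Num.sqrt (r A ^+ 2 + z ^+ 2)); rewrite sqrtr_gt0 k0; split=> // x h.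
rewrite sqr_sqrtr ?ltW //; have nn : dt (nu A) (nu A) = 1 by have [] := frame_dt (uv A).
transitivity (dt (fun i => x i - o A i) (fun i => x i - o A i) - 2 * z * dt (nu A) (fun i => x i - o A i) + z ^+ 2 * dt (nu A) (nu A)).
  by rewrite /dt; ring.
rewrite nn mulr1; congr (_ + _); apply: (mulfI b0); apply/eqP; rewrite -subr_eq0 -h /quadric -/(nu A) /z; apply/eqP; by field.
Qed.
End Surfaces.

(** Groups are disjoint as sets of circles and share each point at most twice, hence the sums n and
    2m. The scale e may depend on the group; k and h may not. *)
Lemma space_bound (R : realType) : exists C : nat, forall m n (X : 'I_m -> 'I_3 -> R) (o u v : 'I_n -> 'I_3 -> R) (r : 'I_n -> R) q,
  injective X -> (forall A, onpair (u A) (v A)) -> (forall A, 0 < r A) ->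
  (forall A B, o A =1 o B -> r A = r B ->
    (cr (u A) (v A) =1 cr (u B) (v B) \/ forall i, cr (u A) (v A) i = - cr (u B) (v B) i) -> A = B) ->
  (forall w c (S : {set 'I_n}), dt w w = 1 ->
    (forall A x, A \in S -> oncircle o u v r A x -> dt w (fun i => x i - c i) = 0) -> (#|S| <= q)%N) ->
  (forall c rho (S : {set 'I_n}), 0 < rho ->
    (forall A x, A \in S -> oncircle o u v r A x -> dt (fun i => x i - c i) (fun i => x i - c i) = rho ^+ 2) -> (#|S| <= q)%N) ->
  forall a, exists ns ms : {set 'I_n} -> nat, [/\ (\sum_L ns L <= n)%N, (\sum_L ms L <= 2 * m)%N, forall L, (ns L <= q)%N &
    forall e k h, (forall L, ns L <= 4 ^ h * 8 ^ k)%N ->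
    (\sum_A #|[set p | oncircle o u v r A (X p)]| <= C * (n * 2 ^ a + m * (m %/ 8 ^ a * (m %/ 8 ^ a)) + m + n +
      \sum_L (ns L * 2 ^ e L + ms L * (ms L %/ 4 ^ e L) * 2 ^ k + ms L + ns L * (2 ^ h * (2 * h).+1))))%N].
Proof.
have [C1 planar] := planar_bound R.
have [C2 part] := exists_polynomial_partition R 2.
exists (C1 + 10 * C2 + 18)%N => m n X o u v r q Xinj uv r0 inj Hpl Hsp a.
have [Fs [Fs0 dFs] cF] : exists2 Fs, all (fun F => F != 0) Fs /\ (degs Fs <= C2 * 2 ^ a)%N &
    forall x, (#|cell X Fs x| <= (m %/ 8 ^ a).+1)%N.
  by apply: part; rewrite expnM ltnW // ltn_ceil // expn_gt0.
have [P0 dP] := msize_prod_degs Fs0.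
have [L [g [g0 gn gdv gL]]] := derivative_chain P0.
have b1 := card_cell_incidences Xinj uv r0 inj cF.
have b2 := card_zero_incidences Xinj uv r0 inj Fs0 g0 gn gdv gL.
have [grp [pts [gdisj p2 gq gle]]] := umbilic_groups X o uv r0 g0 gdv gL.
exists (fun M => #|grp M|), (fun M => #|pts M|).
have surf M : (#|grp M| <= q)%N /\ group_le X o u v r (grp M) (pts M) C1.
  have [e|[A0 A0M]] := set_0Vmem (grp M).
    by rewrite e cards0; split=> // e' k h _; rewrite big1 // => A; rewrite inE.
  have [ab [ab0 onG onP]] := gq M A0 A0M.
  have nn : dt (cr (u A0) (v A0)) (cr (u A0) (v A0)) = 1 by have [] := frame_dt (uv A0).
  have [[c cP]|[c [rho [rho0 cP]]]] := quadric_surface o uv r0 A0 ab0.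
    have gP A x : A \in grp M -> oncircle o u v r A x -> dt (cr (u A0) (v A0)) (fun i => x i - c i) = 0.
      by move=> AM Ax; apply: cP; exact: onG AM Ax.
    split; first exact: (Hpl _ c _ nn gP).
    by apply: (plane_group_le Xinj uv r0 inj planar nn gP) => p pM; apply: cP; exact: onP.
  have gP A x : A \in grp M -> oncircle o u v r A x -> dt (fun i => x i - c i) (fun i => x i - c i) = rho ^+ 2.
    by move=> AM Ax; apply: cP; exact: onG AM Ax.
  split; first exact: (Hsp c rho _ rho0 gP).
  by apply: (sphere_group_le Xinj uv r0 inj planar rho0 gP) => p pM; apply: cP; exact: onP.
split.
- apply: (@leq_trans (\sum_(A : 'I_n) #|[set M | A \in grp M]|)).
    under eq_bigr => M _ do rewrite -sum1_card big_mkcond /=.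
    rewrite exchange_big /=; apply: leq_sum => A _; rewrite -sum_nat_pred; apply: leq_sum => M _; by case: (A \in _).
  rewrite -[X in (_ <= X)%N]card_ord -sum1_card; apply: leq_sum => A _.
  by apply/card_le1_eqP => M N; rewrite !inE => h1 h2; apply: gdisj h2 h1.
- apply: (@leq_trans (\sum_(p : 'I_m) #|[set M | p \in pts M]|)).
    under eq_bigr => M _ do rewrite -sum1_card big_mkcond /=.
    rewrite exchange_big /=; apply: leq_sum => p _; rewrite -sum_nat_pred; apply: leq_sum => M _; by case: (p \in _).
  rewrite mulnC -[X in (_ <= X * _)%N]card_ord -sum_nat_const; apply: leq_sum => p _; exact: p2.
- by move=> M; case: (surf M).
move=> e k h qhk.
have inc A : (#|[set p | oncircle o u v r A (X p)]| <= #|oncp X o u v r A :\: [set p | (\prod_(F <- Fs) F).@[X p] == 0%R]| +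
   #|oncp X o u v r A :&: [set p | (\prod_(F <- Fs) F).@[X p] == 0%R]| + 1)%N.
  rewrite [X in (_ <= X + 1)%N]addnC cardsID.
  apply: leq_trans (leq_add (leqnn _) (card_antipole o r Xinj uv A)); apply: leq_trans (leq_card_setU _ _).1.
  by apply/subset_leq_card/subsetP => p; rewrite !inE => ->; case: (antipole _ _ _ _ _).
apply: leq_trans (leq_sum _ (fun A _ => inc A)) _.
rewrite [X in (X <= _)%N]big_split /= [X in (X + _ <= _)%N]big_split /= sum_nat_const card_ord muln1.
have b3 : (\sum_M \sum_(A in grp M) #|[set p in pts M | oncircle o u v r A (X p)]| <=
   C1 * \sum_L0 (#|grp L0| * 2 ^ e L0 + #|pts L0| * (#|pts L0| %/ 4 ^ e L0) * 2 ^ k + #|pts L0| + #|grp L0| * (2 ^ h * (2 * h).+1)))%N.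
  by rewrite big_distrr; apply: leq_sum => M _; apply: (surf M).2; exact: qhk.
have p1 : (0 < 2 ^ a)%N by rewrite expn_gt0.
apply: leq_trans (leq_add (leq_add b1 (leq_trans b2 (leq_add (leqnn _) (leq_trans gle b3)))) (leqnn n)) _.
set S := \sum_L0 _; move: dFs; set d := degs Fs; set y := (m * _)%N.
rewrite -!muln2; set z := (2 ^ a)%N in p1 * => dz.
have nz : (n * d <= C2 * (n * z))%N by rewrite mulnCA leq_mul2l dz orbT.
have nn : (n <= n * z)%N by rewrite leq_pmulr.
have -> : (n * (2 * (2 * d).+1) = 4 * (n * d) + 2 * n)%N by ring.
have -> : (n * (2 * d + 2 * (d * 2 + 2)) = 6 * (n * d) + 4 * n)%N by ring.
have -> : ((C1 + 10 * C2 + 18) * (n * z + y + m + n + S) = C1 * (n * z + y + m + n) + C1 * S + 10 * (C2 * (n * z)) + 18 * (n * z) +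
  10 * C2 * (y + m + n + S) + 18 * (y + m + n + S))%N by ring.
move: nz nn; move: (C1 * S)%N (C2 * (n * z))%N (n * z)%N (n * d)%N (C1 * _)%N (10 * C2 * _)%N => t1 t2 t3 t4 t5 t6; lia.
Qed.

(** * Summation over the surfaces *)

Lemma pow_floor (R : realType) (b : nat) (x : R) : (1 < b)%N -> 1 <= x ->
  exists a : nat, (b ^ a)%:R <= x < (b ^ a.+1)%:R.
Proof.
move=> b1 x1; have exN : exists N, x < (b ^ N)%:R.
  exists (Num.bound x); apply: lt_trans (archi_boundP (le_trans ler01 x1)) _.
  by rewrite ltr_nat ltn_expl.
have [[|a] aP amin] := ex_minnP exN; first by move: aP; rewrite expn0 ltNge x1.
exists a; rewrite aP andbT leNgt; apply/negP => /amin; by rewrite ltnn.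
Qed.

(** With 4^e about ms sg^2, ns 2^e <= ns sg sqrt ms <= om sg sqrt (ns ms), and the
    arithmetic-geometric mean with weight tau makes this linear in ns and ms. *)
Lemma group_term_le (R : realType) (ns ms q k H : nat) (om sg tau : R) : 0 < om -> 0 < sg -> 0 < tau ->
  q%:R <= om ^+ 2 -> (ns <= q)%N -> exists e : nat,
  (ns * 2 ^ e + ms * (ms %/ 4 ^ e) * 2 ^ k + ms + ns * H)%N%:R <=
  ns%:R * (1 + om * sg * tau / 2 + H%:R) + ms%:R * (om * sg / tau / 2 + 4 * 2 ^+ k / sg ^+ 2 + 1).
Proof.
move=> om0 sg0 tau0 qom nsq.
have os0 : 0 < om * sg by rewrite mulr_gt0.
have n0 : 0 <= ns%:R :> R by rewrite ler0n. have m0 : 0 <= ms%:R :> R by rewrite ler0n.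
have k0 : 0 < 2 ^+ k :> R by rewrite exprn_gt0.
have sq0 : 0 < sg ^+ 2 by rewrite exprn_gt0.
suff [e [h1 h2]] : exists e, ns%:R * (2 ^ e)%:R <= ns%:R * (1 + om * sg * tau / 2) + ms%:R * (om * sg / tau / 2) :> R /\
    (ms %/ 4 ^ e)%:R <= 4 / sg ^+ 2 :> R.
  exists e; rewrite !natrD !natrM (natrX _ 2 k).
  have : ms%:R * (ms %/ 4 ^ e)%:R * 2 ^+ k <= ms%:R * (4 / sg ^+ 2) * 2 ^+ k :> R.
    by rewrite ler_pM2r // ler_wpM2l.
  have -> : 4 * 2 ^+ k / sg ^+ 2 = 4 / sg ^+ 2 * 2 ^+ k by rewrite mulrAC.
  by move: h1; rewrite !mulrDr !mulr1 !mulrA; lra.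
have [small|big] := ltP (ms%:R * sg ^+ 2) 1.
  exists 0%N; rewrite !expn0 mulr1 divn1; split.
    have : 0 <= ns%:R * (om * sg * tau / 2) by rewrite mulr_ge0 // divr_ge0 // mulr_ge0 // ltW.
    have : 0 <= ms%:R * (om * sg / tau / 2) by rewrite mulr_ge0 // divr_ge0 // divr_ge0 // ltW.
    by rewrite mulrDr mulr1; lra.
  by rewrite ler_pdivlMr //; lra.
have [e /andP[e1 e2]] := pow_floor (isT : (1 < 4)%N) big; exists e; split; last first.
  have d0 : 0 < (4 ^ e)%:R :> R by rewrite ltr0n expn_gt0.
  apply: (@le_trans _ _ (ms%:R / (4 ^ e)%:R)).
    by rewrite ler_pdivlMr // -natrM ler_nat leq_divM.
  rewrite ler_pdivrMr // mulrAC ler_pdivlMr //; apply: le_trans (ltW e2) _.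
  by rewrite expnS natrM.
set N : R := ns%:R in n0 *; set M : R := ms%:R in m0 e1 *.
have e3 : (2 ^ e)%:R ^+ 2 <= M * sg ^+ 2.
  by apply: le_trans e1; rewrite -natrX -expnM mulnC expnM.
have Nq : N <= om ^+ 2 by apply: le_trans qom; rewrite ler_nat.
have t0 : tau != 0 by rewrite gt_eqF.
have main : N * (2 ^ e)%:R <= om * sg * ((N * tau + M / tau) / 2).
  have a0 : 0 <= N * (2 ^ e)%:R by rewrite mulr_ge0 ?ler0n.
  have b0 : 0 <= om * sg * ((N * tau + M / tau) / 2).
    apply: mulr_ge0; first exact: ltW.
    by apply: divr_ge0; rewrite ?ler0n //; apply: addr_ge0; [apply: mulr_ge0|apply: divr_ge0]; rewrite // ltW.
  rewrite -(@ler_pXn2r _ 2) ?nnegrE //.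
  apply: (@le_trans _ _ (om ^+ 2 * sg ^+ 2 * (N * M))).
    rewrite exprMn; apply: (@le_trans _ _ (N * om ^+ 2 * (M * sg ^+ 2))); last by rewrite le_eqVlt; apply/orP; left; apply/eqP; ring.
    by rewrite ler_pM ?sqr_ge0 // expr2 ler_wpM2l.
  rewrite !exprMn ler_pM2l ?mulr_gt0 ?exprn_gt0 //.
  have : 0 <= (N * tau - M / tau) ^+ 2 by exact: sqr_ge0.
  have -> : (N * tau - M / tau) ^+ 2 = (N * tau + M / tau) ^+ 2 - 4 * (N * M) by field.
  by rewrite exprVn expr2 -[X in _ -> _ <= _ * (X)^-1]natrM; lra.
apply: le_trans main _; have -> : om * sg * ((N * tau + M / tau) / 2) = N * (om * sg * tau / 2) + M * (om * sg / tau / 2) by field.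
by rewrite mulrDr mulr1; lra.
Qed.

Lemma space_bound_real (R : realType) : exists C : nat, forall m n (X : 'I_m -> 'I_3 -> R) (o u v : 'I_n -> 'I_3 -> R) (r : 'I_n -> R) q,
  injective X -> (forall A, onpair (u A) (v A)) -> (forall A, 0 < r A) ->
  (forall A B, o A =1 o B -> r A = r B ->
    (cr (u A) (v A) =1 cr (u B) (v B) \/ forall i, cr (u A) (v A) i = - cr (u B) (v B) i) -> A = B) ->
  (forall w c (S : {set 'I_n}), dt w w = 1 ->
    (forall A x, A \in S -> oncircle o u v r A x -> dt w (fun i => x i - c i) = 0) -> (#|S| <= q)%N) ->
  (forall c rho (S : {set 'I_n}), 0 < rho ->
    (forall A x, A \in S -> oncircle o u v r A x -> dt (fun i => x i - c i) (fun i => x i - c i) = rho ^+ 2) -> (#|S| <= q)%N) ->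
  forall (a k h : nat) (om sg tau : R), 0 < om -> 0 < sg -> 0 < tau ->
    (minn q n)%:R <= om ^+ 2 -> (minn q n <= 4 ^ h * 8 ^ k)%N ->
    (\sum_A #|[set p | oncircle o u v r A (X p)]|)%N%:R <=
    C%:R * (n%:R * 2 ^+ a + m%:R ^+ 3 / 64 ^+ a + 3 * m%:R + 2 * n%:R + om * sg * (n%:R * tau + 2 * m%:R / tau) / 2 +
      8 * m%:R * 2 ^+ k / sg ^+ 2 + n%:R * (2 ^+ h * (2 * h%:R + 1))).
Proof.
have [C sb] := space_bound R; exists C => m n X o u v r q Xinj uv r0 inj Hpl Hsp a k h om sg tau om0 sg0 tau0 qom qhk.
have [ns [ms [sn sm nq bd]]] := sb m n X o u v r q Xinj uv r0 inj Hpl Hsp a.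
(* A group also has at most n circles, so min(q, n) replaces q. *)
have nsq L : (ns L <= minn q n)%N.
  by rewrite leq_min nq /=; apply: leq_trans sn; rewrite (bigD1 L) //= leq_addr.
have /fin_all_exists[e eP] := fun L => group_term_le (ms L) k (2 ^ h * (2 * h).+1) om0 sg0 tau0 qom (nsq L).
have := bd e k h (fun L => leq_trans (nsq L) qhk); rewrite -(ler_nat R) natrM => /le_trans; apply.
apply: ler_wpM2l; first by rewrite ler0n.
pose y := 1 + om * sg * tau / 2 + (2 ^ h * (2 * h).+1)%:R; pose z := om * sg / tau / 2 + 4 * 2 ^+ k / sg ^+ 2 + 1.
rewrite natrD natr_sum; set S := \sum_(_ | _) _.
have hS : S <= \sum_L ((ns L)%:R * y + (ms L)%:R * z) by apply: ler_sum => L _; exact: eP.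
have hS' : S <= n%:R * y + 2 * m%:R * z.
  apply: le_trans hS _; rewrite big_split /= -!mulr_suml -!natr_sum; apply: lerD.
    by apply: ler_wpM2r; [rewrite /y !addr_ge0 ?ler0n // divr_ge0 // !mulr_ge0 ?ltW|rewrite ler_nat].
  apply: ler_wpM2r; last by rewrite -natrM ler_nat.
  by rewrite /z !addr_ge0 // ?divr_ge0 ?mulr_ge0 ?divr_ge0 ?exprn_ge0 ?mulr_ge0 // ltW.
have m8 : (m * (m %/ 8 ^ a * (m %/ 8 ^ a)))%N%:R <= m%:R ^+ 3 / 64 ^+ a :> R.
  have d0 : 0 < (8 ^ a)%:R :> R by rewrite ltr0n expn_gt0.
  have q1 : (m %/ 8 ^ a)%:R <= m%:R / (8 ^ a)%:R :> R by rewrite ler_pdivlMr // -natrM ler_nat leq_divM.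
  have -> : m%:R ^+ 3 / 64 ^+ a = m%:R * (m%:R / (8 ^ a)%:R * (m%:R / (8 ^ a)%:R)) :> R.
    have -> : 64 ^+ a = (8 ^ a)%:R * (8 ^ a)%:R :> R by rewrite -natrM -expnMn natrX.
    by have := lt0r_neq0 d0 => dn; field.
  by rewrite !natrM; apply: ler_wpM2l; rewrite ?ler0n // ler_pM ?ler0n.
rewrite !natrD natrM natrX.
apply: le_trans (lerD (lerD (lerD (lerD (lexx _) m8) (lexx _)) (lexx _)) hS') _.
rewrite /y /z natrM natrX -(natr1 (2 * h)%N) (natrM R 2 h).
have t0 : tau != 0 by rewrite gt_eqF. have s0 : sg != 0 by rewrite gt_eqF.
rewrite le_eqVlt; apply/orP; left; apply/eqP; field; by rewrite ?t0 ?s0 ?expf_neq0 ?pnatr_eq0.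
Qed.

(** * From lists of circles to indexed families *)

Section Configuration.
Local Notation R := Rdefinitions.R.
Notation V := ('I_3 -> R).

Definition tov (x : R3) : V := vec3 x.1.1 x.1.2 x.2.
Definition ofv (x : V) : R3 := (x j0, x j1, x j2).

Lemma ofvK x : tov (ofv x) = x.
Proof. by apply: boolp.funext => i; case: (ord3 i) => ->. Qed.

Lemma tov_inj : injective tov.
Proof.
move=> [[x1 x2] x3] [[y1 y2] y3] e.
have e0 := congr1 (fun f => f j0) e; have e1 := congr1 (fun f => f j1) e; have e2 := congr1 (fun f => f j2) e.
by move: e0 e1 e2; rewrite /tov /vec3 /= => -> -> ->.
Qed.

Lemma dot3E x y : dot3 x y = dt (tov x) (tov y).
Proof. by case: x => [[? ?] ?]; case: y => [[? ?] ?]. Qed.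

Lemma sub3E x c : tov (sub3 x c) = fun i => tov x i - tov c i.
Proof. by case: x => [[? ?] ?]; case: c => [[? ?] ?]; apply: boolp.funext => i; case: (ord3 i) => ->. Qed.

Lemma lengthE (T : Type) (s : list T) : length s = size s. Proof. by []. Qed.

Lemma InE (T : Type) (x0 x : T) (s : seq T) : List.In x s <-> exists2 i, (i < size s)%N & nth x0 s i = x.
Proof.
elim: s => [|y s IH] /=; first by split=> // -[].
split=> [[->|/IH[i si e]]|[[|i] si e]]; [by exists 0%N|by exists i.+1|by left|].
by right; apply/IH; exists i.
Qed.

Lemma NoDup_nthE (T : Type) (x0 : T) (s : seq T) :
  List.NoDup s <-> forall i j, (i < size s)%N -> (j < size s)%N -> nth x0 s i = nth x0 s j -> i = j.
Proof.
elim: s => [|x s IH]; first by split=> // _; constructor.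
split=> [h|h].
  inversion h as [|y t ns nd]; subst y t.
  move=> [|i] [|j] //= si sj e; last by congr _.+1; move/IH: nd; apply.
    by case: ns; apply/(InE x0); exists j.
  by case: ns; apply/(InE x0); exists i.
constructor; last by apply/IH => i j si sj e; have [] := h i.+1 j.+1 si sj e.
by move=> /(InE x0)[i si e]; have := h 0%N i.+1 isT si (esym e).
Qed.

Lemma ForallOrdPairs_nth (T : Type) (Q : T -> T -> Prop) (x0 : T) (s : seq T) i j :
  List.ForallOrdPairs Q s -> (i < j)%N -> (j < size s)%N -> Q (nth x0 s i) (nth x0 s j).
Proof.
move=> h; elim: h i j => [|x t qx _ IH] [|i] [|j] //= ij sj; last exact: IH.
by move/List.Forall_forall: qx; apply; apply/(InE x0); exists j.
Qed.

Lemma incidencesE (P : seq R3) (C : seq circle) p0 c0 : incidences P C =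
  \sum_(A < size C) #|[set p : 'I_(size P) | is_left (on_circle_dec (nth c0 C A) (nth p0 P p))]|.
Proof.
pose f c p := is_left (on_circle_dec c p).
have cnt p : length (List.filter (fun c => match on_circle_dec c p with left _ => true | right _ => false end) C) = (\sum_(c <- C) f c p)%N.
  elim: C => [|c C IH]; first by rewrite big_nil.
  by rewrite big_cons -IH /f /=; case: (on_circle_dec c p).
have -> : incidences P C = (\sum_(p <- P) \sum_(c <- C) f c p)%N.
  rewrite /incidences; elim: (P) => [|p Q IH]; first by rewrite big_nil.
  by rewrite big_cons /= IH cnt.
rewrite exchange_big /= (big_nth c0) big_mkord; apply: eq_bigr => A _.
by rewrite (big_nth p0) big_mkord sum_nat_pred.
Qed.

Variables (P : seq R3) (C : seq circle) (q : nat).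
Hypothesis ndP : List.NoDup P.
Hypothesis wfC : List.Forall wf_circle C.
Hypothesis dC : distinct_circles C.
Hypothesis Hpl : forall (a : R3) (b : R), a <> (Rdefinitions.IZR BinNums.Z0, Rdefinitions.IZR BinNums.Z0, Rdefinitions.IZR BinNums.Z0) -> at_most_in q C (in_plane a b).
Hypothesis Hsp : forall (s : R3) (r : R), Rdefinitions.Rlt (Rdefinitions.IZR BinNums.Z0) r -> at_most_in q C (in_sphere s r).
Let p0 : R3 := (0 : R, 0 : R, 0 : R).
Let c0 := mkCircle p0 p0 (0 : R).
Local Notation m := (size P).
Local Notation n := (size C).
Let X (p : 'I_m) := tov (nth p0 P p).
Let cc (A : 'I_n) := nth c0 C A.
Let o A := tov (c_center (cc A)).
Let r A : R := c_radius (cc A).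

Let wf A : wf_circle (cc A).
Proof. by move/List.Forall_forall: wfC; apply; apply/(InE c0); exists A. Qed.

Let r0 A : 0 < r A. Proof. by apply/RltP; have [] := wf A. Qed.

Let X_inj : injective X.
Proof.
move=> p p' /tov_inj e; apply: val_inj => /=.
by move/(NoDup_nthE p0): ndP; apply.
Qed.

Let frames : exists (u v : 'I_n -> V) (l : 'I_n -> R), forall A, [/\ onpair (u A) (v A), 0 < l A &
  forall i, tov (c_normal (cc A)) i = l A * cr (u A) (v A) i].
Proof.
have fr A : exists uvl : (V * V) * R, [/\ onpair uvl.1.1 uvl.1.2, 0 < uvl.2 & forall i, tov (c_normal (cc A)) i = uvl.2 * cr uvl.1.1 uvl.1.2 i].
  set x := tov (c_normal (cc A)); have xx : 0 < dt x x.
    apply: dt_gt0; apply: boolp.contrapT => h; have [_] := wf A; apply; apply: tov_inj.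
    apply: boolp.funext => i; have -> : tov (Rdefinitions.IZR BinNums.Z0, Rdefinitions.IZR BinNums.Z0, Rdefinitions.IZR BinNums.Z0) i = 0.
      by case: (ord3 i) => ->.
    by apply/eqP; apply: boolp.contrapT => /negP hi; apply: h; exists i.
  pose l := Num.sqrt (dt x x); have l0 : 0 < l by rewrite sqrtr_gt0.
  have l1 : l != 0 by rewrite gt_eqF.
  have [u [v [uv uE]]] : exists u v, onpair u v /\ cr u v =1 (fun i => x i / l).
    apply: exists_frame; transitivity (dt x x / l ^+ 2); first by rewrite /dt; field.
    by rewrite sqr_sqrtr ?ltW // divff // gt_eqF.
  by exists ((u, v), l); split=> //= i; rewrite uE mulrC divfK.
have [f fP] := fin_all_exists fr.
by exists (fun A => (f A).1.1), (fun A => (f A).1.2), (fun A => (f A).2).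
Qed.

(** Lists are reindexed by positions. Distinctness as point sets gives injectivity of centre, radius
    and normal up to sign, and [few] turns [at_most_in] into a bound on sets of indices. *)
Lemma incidence_bound_of_space (K : nat) : (forall m n (X : 'I_m -> 'I_3 -> R) (o u v : 'I_n -> 'I_3 -> R) (r : 'I_n -> R) q,
  injective X -> (forall A, onpair (u A) (v A)) -> (forall A, 0 < r A) ->
  (forall A B, o A =1 o B -> r A = r B ->
    (cr (u A) (v A) =1 cr (u B) (v B) \/ forall i, cr (u A) (v A) i = - cr (u B) (v B) i) -> A = B) ->
  (forall w c (S : {set 'I_n}), dt w w = 1 ->
    (forall A x, A \in S -> oncircle o u v r A x -> dt w (fun i => x i - c i) = 0) -> (#|S| <= q)%N) ->
  (forall c rho (S : {set 'I_n}), 0 < rho ->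
    (forall A x, A \in S -> oncircle o u v r A x -> dt (fun i => x i - c i) (fun i => x i - c i) = rho ^+ 2) -> (#|S| <= q)%N) ->
  forall (a k h : nat) (om sg tau : R), 0 < om -> 0 < sg -> 0 < tau ->
    (minn q n)%:R <= om ^+ 2 -> (minn q n <= 4 ^ h * 8 ^ k)%N ->
    (\sum_A #|[set p | oncircle o u v r A (X p)]|)%N%:R <=
    K%:R * (n%:R * 2 ^+ a + m%:R ^+ 3 / 64 ^+ a + 3 * m%:R + 2 * n%:R + om * sg * (n%:R * tau + 2 * m%:R / tau) / 2 +
      8 * m%:R * 2 ^+ k / sg ^+ 2 + n%:R * (2 ^+ h * (2 * h%:R + 1)))) ->
  forall (a k h : nat) (om sg tau : R), 0 < om -> 0 < sg -> 0 < tau ->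
    (minn q n)%:R <= om ^+ 2 -> (minn q n <= 4 ^ h * 8 ^ k)%N ->
    (incidences P C)%:R <=
    K%:R * (n%:R * 2 ^+ a + m%:R ^+ 3 / 64 ^+ a + 3 * m%:R + 2 * n%:R + om * sg * (n%:R * tau + 2 * m%:R / tau) / 2 +
      8 * m%:R * 2 ^+ k / sg ^+ 2 + n%:R * (2 ^+ h * (2 * h%:R + 1))).
Proof.
move=> space; have [u [v [l fr]]] := frames.
have uv A : onpair (u A) (v A) by have [] := fr A.
have onE A x : oncircle o u v r A (tov x) <-> on_circle (cc A) x.
  have [_ l0 nE] := fr A; rewrite /oncircle /on_circle !dot3E sub3E RpowE.
  have -> : dt (fun i => tov x i - tov (c_center (cc A)) i) (tov (c_normal (cc A))) =
     l A * dt (cr (u A) (v A)) (fun i => tov x i - o A i).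
    by rewrite (eq_dt (frefl _) nE) /dt /o; ring.
  split=> [/andP[/eqP h1 /eqP h2]|[h1 h2]]; first by split=> //; rewrite h2 mulr0.
  apply/andP; split; apply/eqP => //; apply: (mulfI (lt0r_neq0 l0)); by rewrite mulr0.
have ne A B : A <> B -> ~ (forall x, on_circle (cc A) x <-> on_circle (cc B) x).
  move=> AB; have [lt|gt|e] := ltngtP A B; last by case: AB; exact: val_inj.
    exact: (ForallOrdPairs_nth c0 dC lt (ltn_ord B)).
  by move=> h; apply: (ForallOrdPairs_nth c0 dC gt (ltn_ord A)) => x; split=> /h.
have inj A B : o A =1 o B -> r A = r B ->
    (cr (u A) (v A) =1 cr (u B) (v B) \/ forall i, cr (u A) (v A) i = - cr (u B) (v B) i) -> A = B.
  move=> oE rE nE; apply: boolp.contrapT => /ne; apply => x; rewrite -!onE /oncircle rE.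
  have -> : o A = o B by apply: boolp.funext.
  case: nE => nE; first by rewrite (eq_dt nE (frefl _)).
  have -> : dt (cr (u A) (v A)) (fun i => tov x i - o B i) = - dt (cr (u B) (v B)) (fun i => tov x i - o B i).
    by rewrite (eq_dt nE (frefl _)) /dt; ring.
  by rewrite oppr_eq0.
have few (S : {set 'I_n}) (Z : R3 -> Prop) : at_most_in q C Z ->
    (forall A x, A \in S -> on_circle (cc A) x -> Z x) -> (#|S| <= q)%N.
  move=> hZ SZ; have [->|[A0 _]] := set_0Vmem S; first by rewrite cards0.
  have := hZ [seq cc A | A <- enum S]; rewrite lengthE size_map -cardE => H.
  apply/ssrnat.leP; apply: H.
  - apply/(NoDup_nthE c0) => i j; rewrite size_map => si sj.
    rewrite !(nth_map A0) // => e; apply/eqP; rewrite -(nth_uniq A0 si sj (enum_uniq _)); apply/eqP.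
    by apply: boolp.contrapT => /ne; apply => x; rewrite e.
  - move=> c /(InE c0)[i]; rewrite size_map => si <-; apply/(InE c0).
    by rewrite (nth_map A0) //; exists (nth A0 (enum S) i).
  - move=> c /(InE c0)[i]; rewrite size_map => si <- x.
    by rewrite (nth_map A0) //; apply: SZ; rewrite -mem_enum mem_nth.
have Hpl' w c (S : {set 'I_n}) : dt w w = 1 ->
    (forall A x, A \in S -> oncircle o u v r A x -> dt w (fun i => x i - c i) = 0) -> (#|S| <= q)%N.
  move=> ww SZ; apply: (few S _ (Hpl (a := ofv w) (b := dt w c) _)).
    move=> e; have w0 i : w i = 0 by rewrite -(ofvK w) e; case: (ord3 i) => ->.
    by move: ww; rewrite /dt !w0 !mulr0 !addr0 => /esym/eqP; rewrite oner_eq0.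
  move=> A x AS /onE /(SZ A _ AS) h; rewrite /in_plane dot3E ofvK.
  by apply/eqP; rewrite -subr_eq0 -h /dt; apply/eqP; ring.
have Hsp' c rho (S : {set 'I_n}) : 0 < rho ->
    (forall A x, A \in S -> oncircle o u v r A x -> dt (fun i => x i - c i) (fun i => x i - c i) = rho ^+ 2) -> (#|S| <= q)%N.
  move=> /RltP rho0 SZ; apply: (few S _ (Hsp (s := ofv c) rho0)).
  by move=> A x AS /onE /(SZ A _ AS) h; rewrite /in_sphere dot3E sub3E ofvK RpowE.
move=> a k h om sg tau om0 sg0 tau0 h1 h2.
have := space m n X o u v r q X_inj uv r0 inj Hpl' Hsp' a k h om sg tau om0 sg0 tau0 h1 h2.
apply: le_trans; rewrite ler_nat (incidencesE P C p0 c0); apply: leq_sum => A _.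
apply/subset_leq_card/subsetP => p; rewrite !inE; case: on_circle_dec => // h3 _.
exact/onE.
Qed.
End Configuration.

Lemma incidence_bound : exists K : Rdefinitions.R, Rdefinitions.Rlt 0 K /\
  forall (P : seq R3) (C : seq circle) (q : nat), List.NoDup P -> List.Forall wf_circle C -> distinct_circles C -> (1 <= q)%coq_nat ->
  (forall (a : R3) b, a <> (Rdefinitions.IZR BinNums.Z0, Rdefinitions.IZR BinNums.Z0, Rdefinitions.IZR BinNums.Z0) ->
    at_most_in q C (in_plane a b)) ->
  (forall (s : R3) r, Rdefinitions.Rlt (Rdefinitions.IZR BinNums.Z0) r -> at_most_in q C (in_sphere s r)) ->
  Rdefinitions.Rle (Raxioms.INR (incidences P C))
    (Rdefinitions.Rmult K (IncidenceNumerics.target (Raxioms.INR (length P)) (Raxioms.INR (length C)) (Raxioms.INR q))).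
Proof.
have [K space] := space_bound_real Rdefinitions.R.
exists (195 * K%:R + 1)%R; split; first by apply/RltP; rewrite ltr_wpDl // mulr_ge0 ?ler0n.
move=> P C q ndP wfC dC q1 Hpl Hsp.
set T := IncidenceNumerics.target _ _ _.
have T0 : (0 <= T)%R.
  rewrite /T /IncidenceNumerics.target /Rpower.Rpower !RplusE !RmultE !INRE.
  have e0 x : (0 <= Rtrigo_def.exp x)%R by apply/ltW/RltP; exact: Exp_prop.exp_pos.
  by rewrite !addr_ge0 ?mulr_ge0 ?ler0n.
(* The numerical bound needs m, n >= 1. Without points or circles there are no incidences, and T >=
   0 is enough; T itself need not vanish, as [Rpower] at 0 is positive. *)
have [e0|m0] := posnP (size P).
  have -> : incidences P C = 0%N by case: (P) e0.
  by apply/RleP; rewrite INRE mulr_ge0 // addr_ge0 // mulr_ge0 ?ler0n.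
have [e0|n0] := posnP (size C).
  have -> : incidences P C = 0%N.
    by rewrite (incidencesE P C (0, 0, 0)%R (mkCircle (0, 0, 0)%R (0, 0, 0)%R 0%R)) e0 big_ord0.
  by apply/RleP; rewrite INRE mulr_ge0 // addr_ge0 // mulr_ge0 ?ler0n.
have c (p : BinNums.positive) : Rdefinitions.IZR (BinNums.Zpos p) = (BinPos.Pos.to_nat p)%:R by rewrite IZRposE INRE Pos_to_natE.
have num : Rdefinitions.Rle (Raxioms.INR (incidences P C))
    (Rdefinitions.Rmult (Rdefinitions.Rmult (Rdefinitions.IZR (BinNums.Zpos (BinPos.Pos.of_nat 195))) (Raxioms.INR K)) T).
  apply: (@IncidenceNumerics.incidence_numerics _ _ _ _ _ (Raxioms.INR (minn q (size C)))).
  - by apply/RleP; rewrite INRE ler0n.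
  - by apply/RleP; rewrite R1E INRE ler1n.
  - by apply/RleP; rewrite R1E INRE ler1n.
  - by apply/RleP; rewrite R1E INRE ler1n leq_min n0 andbT; apply/ssrnat.leP.
  - by apply/RleP; rewrite !INRE ler_nat geq_minl.
  - by apply/RleP; rewrite !INRE ler_nat geq_minr.
  move=> a k h om sg tau /RltP om0 /RltP sg0 /RltP tau0 /RleP h1 /RleP h2.
  rewrite INRE RpowE in h1.
  rewrite INRE RmultE !RpowE !c -!natrX -natrM ler_nat in h2.
  have := incidence_bound_of_space ndP wfC dC Hpl Hsp space a om0 sg0 tau0 h1 h2.
  move=> main; apply/RleP; rewrite !(RplusE, RmultE, RdivE, RpowE, INRE, R1E, c); exact: main.
apply/RleP; move/RleP: num; rewrite !RmultE !INRE c => num; apply: le_trans num _.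
by rewrite ler_wpM2r // lerDl.
Qed.

End CircleIncidences.

From Stdlib Require Import Reals List.
Open Scope R_scope.

Theorem theorem1p6 :
  exists K : R, 0 < K /\
  forall (P : list R3) (C : list circle) (q : nat),
    NoDup P ->
    Forall wf_circle C ->
    distinct_circles C ->
    (1 <= q)%nat ->
    (forall (a : R3) (b : R), a <> (0, 0, 0) -> at_most_in q C (in_plane a b)) ->
    (forall (s : R3) (r : R), 0 < r -> at_most_in q C (in_sphere s r)) ->
    let m := length P in
    let n := length C in
    INR (incidences P C) <=
      K * ( Rpower (INR m) (3 / 7) * Rpower (INR n) (6 / 7)
          + Rpower (INR m) (2 / 3) * Rpower (INR n) (1 / 3) * Rpower (INR q) (1 / 3)
          + Rpower (INR m) (6 / 11) * Rpower (INR n) (5 / 11) * Rpower (INR q) (4 / 11)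
              * log_term m q
          + INR m + INR n ).
Proof.
destruct CircleIncidences.incidence_bound as [K [K0 bound]].
exists K; split; [exact K0|].
intros P C q ndP wfC dC q1 Hpl Hsp m n.
exact (bound P C q ndP wfC dC q1 Hpl Hsp).
Qed.
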